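(* Let $n\ge1$, let $\mu$ be a Borel probability measure on $\mathbb R^n$ with $\mu(\{\mathbf 0\})<1$, and let $\kappa$ be a Borel probability measure on $\mathcal S^{n-1}$. Suppose that $$\kappa(d\gamma)=\frac{m_\gamma}{m}\,\tilde\mu_1(d\gamma),\quad m=\int_{\mathbb R^n}|z|\,\mu(dz),\qquad\text{and}\qquad\int_{\mathbb R^n}|z|^2\,\mu(dz)<+\infty .$$ Let $(Z_t)_{t\ge0}$ be a Walsh Brownian motion with spinning measure $\kappa$ started at $\mathbf 0$, and let $\tau=\lim_{l\to\infty}\tau_l$ be the limit of the successive hitting times $\tau_l$ constructed in the context. Then $\mathbb E[\tau]<+\infty$ and $Z_\tau\sim\mu$.
   Context: Notation: $\mathcal S^{n-1}$ is the unit sphere of $\mathbb R^n$, $\mathbf 0$ the origin, $\mathbb R_+=(0,\infty)$. Points are written in polar coordinates $z=(\gamma,r)$, $z=\gamma r$; all $(\gamma,0)$ are identified with $\mathbf 0$. For a function $f$ write $f_\gamma(r)=f(\gamma,r)$. Walsh Brownian motion with spinning measure $\kappa$: let $E=\{(\gamma,r):\gamma\in\mathrm{supp}(\kappa),\ r\ge 0\}$, and let $(P^+_t)$ and $(P^0_t)$ be the semigroups on $[0,\infty)$ of reflecting Brownian motion and of Brownian motion killed at $0$, respectively. For $f\in\mathcal C_0(E)$ put $\bar f(r)=\int f(\gamma,r)\,\kappa(d\gamma)$ and $$P_tf(\gamma,0)=P_t^+\bar f(0),\qquad P_tf(\gamma,r)=P_t^+\bar f(r)+P_t^0(f_\gamma-\bar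 f)(r)\quad(r>0).$$ This is a Feller semigroup; the Walsh Brownian motion $Z_t=(\Gamma_t,R_t)$ is the continuous strong Markov process on $E$ with this semigroup. Its radial part $R_t$ is a reflecting Brownian motion; by convention $\Gamma_t=(1,0,\dots,0)$ when $R_t=0$. The measure $\tilde\mu$: let $\tilde\mu$ on $\mathcal S^{n-1}\times\mathbb R_+$ be the push-forward of $\mu|_{\mathbb R^n\setminus\{\mathbf 0\}}$ under $z=\gamma r\mapsto(\gamma,r)$. With $k=\mu(\{\mathbf 0\})$, extend it to a probability measure on $\mathcal S^{n-1}\times[0,\infty)$ by $\tilde\mu(A\times\{0\})=\frac{k}{1-k}\tilde\mu(A\times\mathbb R_+)$ for Borel $A\subset\mathcal S^{n-1}$. Let $\tilde\mu_1$ be the first marginal of $\tilde\mu$, $(\tilde\mu_\gamma)_{\gamma\in\mathcal S^{n-1}}$ the disintegration of $\tilde\mu$ with respect to $\tilde\mu_1$, and $m_\gamma=\int_{[0,\infty)}r\,\tilde\mu_\gamma(dr)$; the version of the disintegration is chosen so that $0<m_\gamma<\infty$ for all $\gamma$. Construction of $\tau$: for a probability measure $\nu$ on $[0,\infty)$ with finite mean and $0\le a\le b\le+\infty$, $a<\infty$, let $m^\nu_{[a,b)}=\frac{1}{\nu([a,b))}\int_{[a,b)}r\,\nu(dr)$ if $\nu([a,b))>0$, and $m^\nu_{[a,b)}=a$ otherwise. Define inductively ordered lists (repetitions allowed) $A^\nu_l=(0=a_1\le a_2\le\dots\le a_{2^l+1}=+\infty)$: $A_0^\nu=(0,+\infty)$,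 and $A^\nu_{l+1}$ is obtained from $A_l^\nu$ by inserting, between $a_i$ and $a_{i+1}$, the barycenter $m^\nu_{[a_i,a_{i+1})}$, for each $i=1,\dots,2^l$. For $l\ge1$, let $S_l^\gamma$ be the set of points newly inserted in passing from $A_{l-1}^{\tilde\mu_\gamma}$ to $A_l^{\tilde\mu_\gamma}$ (so $S_1^\gamma=\{m_\gamma\}$), and $S_l=\{(\gamma,r):\gamma\in\mathcal S^{n-1},\ r\in S_l^\gamma\}$. Set $\tau_0=0$ and, for $l\ge1$, $\tau_l=\inf\{t\ge\tau_{l-1}:Z_t\in S_l\}$. The sequence $(\tau_l)$ is non-decreasing. *)

(* Defs.v *)
From HB Require Import structures.
From mathcomp Require Import all_boot all_order all_algebra.
From mathcomp Require Import all_classical all_reals all_analysis.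
From mathcomp Require Import measurable_realfun.

Set Implicit Arguments.
Unset Strict Implicit.
Unset Printing Implicit Defensive.

Import Order.TTheory GRing.Theory Num.Theory.
Import numFieldNormedType.Exports.

Local Open Scope classical_set_scope.
Local Open Scope ring_scope.

(* The Borel sigma-algebra of R^n. *)
HB.instance Definition _ (R : realType) (n : nat) :=
  @isMeasurable.Build (sigma_display (@open 'rV[R]_n)) 'rV[R]_n
    <<s (@open 'rV[R]_n) >> (@sigma_algebra0 _ setT _) (@sigma_algebraC _ _)
    (@sigma_algebra_bigcup _ setT _).

Section euclidean.
Context {R : realType} {n : nat}.

(* The library's norm on row vectors is the sup norm; it induces the same
   topology as [enorm]. *)
Definition enorm (z : 'rV[R]_n) : R := Num.sqrt (\sum_i z ord0 i ^+ 2).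

Definition sphere : set 'rV[R]_n := [set g | enorm g = 1].

Definition angle (z : 'rV[R]_n) : 'rV[R]_n := (enorm z)^-1 *: z.

End euclidean.
Arguments sphere R n : clear implicits.

(* Measures on the sphere are encoded as measures on R^n carried by the
   sphere, and measures on the product of the sphere and [0, +oo[ as measures
   on 'rV[R]_n * R. Pairs (g, r) of polar coordinates stand for the point
   r *: g, which identifies all the pairs (g, 0) with the origin. *)

Section walsh_semigroup.
Context {R : realType} {n : nat}.
Implicit Types (kappa : probability 'rV[R]_n R) (h : R -> R) (t r : R).

Definition msupp kappa : set 'rV[R]_n :=
  [set x | forall U, open U -> U x -> (0 < kappa U)%E].

Definition walsh_space kappa : set 'rV[R]_n :=
  [set z | exists g r, [/\ msupp kappa g, 0 <= r & z = r *: g]].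

(* Reflecting Brownian motion from r is the absolute value of a Brownian
   motion from r, whose value at time t has law N(r, t). The second argument
   of [normal_prob] is the standard deviation. *)
Definition reflecting_sg t h r : R :=
  if t == 0 then h r
  else \int[normal_prob r (Num.sqrt t)]_x h `|x|.

(* Brownian motion killed at 0: by the reflection principle, its transition
   density on the positive half-line is p_t(s - r) - p_t(s + r). *)
Definition killed_sg t h r : R :=
  if t == 0 then h r
  else \int[lebesgue_measure]_(s in `]0, +oo[)
    (h s * (normal_pdf r (Num.sqrt t) s - normal_pdf (- r) (Num.sqrt t) s)).

(* The functions of C_0(E), for E = walsh_space kappa; their values outside
   of E are irrelevant. *)
Definition C0 kappa (f : 'rV[R]_n -> R) : Prop :=
  {within walsh_space kappa, continuous f} /\
  forall e, 0 < e -> exists M, forall z, walsh_space kappa z -> M < enorm z ->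
    `|f z| < e.

Definition spin_average kappa (f : 'rV[R]_n -> R) r : R :=
  \int[kappa]_(g in msupp kappa) f (r *: g).

Definition walsh_sg kappa t (f : 'rV[R]_n -> R) (z : 'rV[R]_n) : R :=
  if z == 0 then reflecting_sg t (spin_average kappa f) 0
  else reflecting_sg t (spin_average kappa f) (enorm z) +
       killed_sg t (fun s => f (s *: angle z) - spin_average kappa f s)
         (enorm z).

End walsh_semigroup.

Section walsh_process.
Context {R : realType} {n : nat} {d : measure_display} {T : measurableType d}.
Implicit Types (Z : R -> T -> 'rV[R]_n) (sigma : T -> \bar R).

(* Processes are indexed by R, only the times t >= 0 being used. *)
Definition natural_filtration Z (t : R) : set_system T :=
  <<s \bigcup_(s in `[0, t]) preimage_set_system setT (Z s) measurable >>.

Definition stopping_time Z sigma : Prop :=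
  (forall w, (0 <= sigma w)%E) /\
  forall t, 0 <= t -> natural_filtration Z t [set w | (sigma w <= t%:E)%E].

Definition stopped_sigma_algebra Z sigma : set_system T :=
  [set A | measurable A /\ forall t, 0 <= t ->
     natural_filtration Z t (A `&` [set w | (sigma w <= t%:E)%E])].

(* E[f(Z_{sigma+t}) | F_sigma] = P_t f(Z_sigma) on {sigma < +oo} *)
Definition strong_markov (P : probability T R)
    (sg : R -> ('rV[R]_n -> R) -> 'rV[R]_n -> R)
    (tests : set ('rV[R]_n -> R)) Z : Prop :=
  forall sigma, stopping_time Z sigma ->
  forall A, stopped_sigma_algebra Z sigma A ->
  forall f, tests f -> forall t, 0 <= t ->
  \int[P]_(w in A `&` [set w | (sigma w < +oo)%E])
     f (Z (fine (sigma w) + t) w) =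
  \int[P]_(w in A `&` [set w | (sigma w < +oo)%E])
     sg t f (Z (fine (sigma w)) w).

Record walsh_brownian_motion (P : probability T R)
    (kappa : probability 'rV[R]_n R) Z : Prop := {
  wbm_measurable : forall t, 0 <= t -> measurable_fun setT (Z t) ;
  wbm_space : forall t w, 0 <= t -> walsh_space kappa (Z t w) ;
  wbm_continuous : forall w, {within `[0, +oo[, continuous (Z ^~ w)} ;
  wbm_strong_markov : strong_markov P (walsh_sg kappa) (C0 kappa) Z
}.

End walsh_process.

Section target.
Context {R : realType} {n : nat}.
Implicit Types (mu : probability 'rV[R]_n R).

(* The push-forward part is mu-tilde on S x ]0, +oo[; the second part is its
   extension to S x {0}. *)
Definition polar_measure mu (B : set ('rV[R]_n * R)) : \bar R :=
  let k := fine (mu [set 0]) in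
  (mu [set z : 'rV[R]_n | z != 0%R /\ B (angle z, enorm z)] +
   (k / (1 - k))%:E * mu [set z : 'rV[R]_n | z != 0%R /\ B (angle z, 0%R)])%E.

Definition angular_marginal mu (A : set 'rV[R]_n) : \bar R :=
  polar_measure mu (A `*` setT).

Definition mean (nu : set R -> \bar R) : \bar R :=
  (\int[nu]_(r in `[0%R, +oo[) r%:E)%E.

(* The values of the kernel outside of the sphere are irrelevant. *)
Definition disintegration mu (mug : R.-pker 'rV[R]_n ~> R) : Prop :=
  (forall g, sphere R n g -> mug g `[0, +oo[%classic = 1%E) /\
  forall A B, measurable A -> measurable B ->
    polar_measure mu (A `*` B) = (\int[angular_marginal mu]_(g in A) mug g B)%E.

End target.

Section barycenters.
Context {R : realType}.
Implicit Types (nu : set R -> \bar R) (a b : \bar R).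
Local Open Scope ereal_scope.

Definition barycenter nu a b : \bar R :=
  let I := [set r : R | a <= r%:E < b] in
  if 0 < nu I then (\int[nu]_(r in I) r%:E) / nu I else a.

(* [refine_from nu a s] refines the list a :: s, whose head is omitted. *)
Fixpoint refine_from nu a (s : seq (\bar R)) : seq (\bar R) :=
  if s is b :: s' then barycenter nu a b :: b :: refine_from nu b s' else [::].

(* [bary_tail nu l] is the list A_l without its head, which is always 0. *)
Definition bary_tail nu (l : nat) : seq (\bar R) :=
  iter l (refine_from nu 0) [:: +oo].

(* The points inserted in passing from A_l to A_{l+1}. *)
Definition inserted nu (l : nat) : seq (\bar R) :=
  pairmap (barycenter nu) 0 (bary_tail nu l).

End barycenters.

Section embedding_time.
Context {R : realType} {n : nat} {d : measure_display} {T : measurableType d}.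
Variables (mug : R.-pker 'rV[R]_n ~> R) (Z : R -> T -> 'rV[R]_n).
Local Open Scope ereal_scope.

(* The set S_l, for l >= 1. *)
Definition barrier (l : nat) : set 'rV[R]_n :=
  [set z | exists g r, [/\ sphere R n g, r%:E \in inserted (mug g) l.-1
                         & z = (r *: g)%R]].

Fixpoint tau_ (l : nat) (w : T) : \bar R :=
  if l is l'.+1 then
    ereal_inf [set t%:E | t in [set t | tau_ l' w <= t%:E /\
                                        barrier l (Z t w)]]
  else 0.

Definition tau (w : T) : \bar R := limn (fun l => tau_ l w).

End embedding_time.

(* The probability space is not assumed to be complete, so that hitting times
   of Borel sets are random variables only up to a negligible set. *)
Section ae_random_variable.
Context {R : realType} {n : nat} {d : measure_display} {T : measurableType d}.

Definition ae_measurable (P : probability T R) (f : T -> \bar R) : Prop :=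
  exists2 X : T -> \bar R, measurable_fun setT X & {ae P, forall w, f w = X w}.

Definition ae_has_law (P : probability T R) (f : T -> 'rV[R]_n)
    (mu : probability 'rV[R]_n R) : Prop :=
  exists2 X : {mfun T >-> 'rV[R]_n}, {ae P, forall w, f w = X w} &
    forall A, measurable A -> distribution P X A = mu A.

End ae_random_variable.

(* Main.v *)
(** Away from the origin, |Z| and |Z|^2 - vt are martingales, and each excursion
    from the origin takes place on a ray chosen with law kappa. Optional stopping
    at the first time when |Z| = m_(angle Z) shows that the law of the ray at
    that time is proportional to kappa(dg) / m_g, hence is the angular marginal
    of mu: Z has then the law of m_g g. Later on, tau_(l+1) is the exit time of
    |Z| from the interval between the two points of S_(l+1) next to |Z_(tau_l)|,
    and Z stays on its ray until then, so that Z_(tau_(l+1)) is a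
    mean-preserving choice between two points determined by Z_(tau_l). On the
    side of mu, the barycenter X_l of the cell of level l that contains r makes
    the same choices under the polar measure, so Z_(tau_(l+1)) has the law of
    X_l g by induction. The times converge to an integrable time because
    v E tau is controlled by E |Z|^2, and X_l converges to r in L^1 because
    E |r - X_l| = E |X_(l+1) - X_l|, the increments of X_l being orthogonal in
    L^2. *)

(* The data are a semigroup on C_0, a strong Markov property for the natural filtration and
   continuous paths; that the angle is constant during an excursion has to be derived. The Markov
   property is used between fixed times, on functions h(angle z) g(|z|) with g(0) = 0, for which the
   semigroup is explicit. The obstacle is the origin, where the angle is discontinuous and |Z| is
   only a submartingale: over a time t, the mean of |Z| grows from r by twice the expectation of the
   negative part of r + sqrt(t) X, with X standard normal. A fourth moment bounds this term by a
   multiple of t^2 / r^3, and errors of order t^2 vanish when summed over a fine mesh. This one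
   estimate gives both the constancy of the angle and the martingale property of |Z| away from 0.
   Random times are reached by rounding to a grid, which uses moment identities at fixed times;
   these carry over to a modification of Z and to a filtration enlarged by null sets. Two more
   approximations are due to the origin: the thresholds m_g have no positive lower bound, and an
   inner barrier may be 0. *)
Require Import Defs.
From HB Require Import structures.
From mathcomp Require Import all_boot all_order all_algebra.
From mathcomp Require Import all_classical all_reals all_analysis.
From mathcomp Require Import measurable_realfun.
From mathcomp Require Import ring lra.

Set Implicit Arguments.
Unset Strict Implicit.
Unset Printing Implicit Defensive.

Import Order.TTheory GRing.Theory Num.Theory.
Import numFieldNormedType.Exports.

Local Open Scope classical_set_scope.
Local Open Scope ring_scope.

(** * Expectations *)

Section expectation.
Context {d} {T : measurableType d} {R : realType} (P : probability T R).
Implicit Types (f g : T -> R) (A : set T).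

Definition L1 f := P.-integrable setT (EFin \o f).
Definition Ex f : R := \int[P]_w f w.

Lemma L1_meas f : L1 f -> measurable_fun setT f.
Proof. by move=> /integrableP[/measurable_EFinP]. Qed.

Lemma L1_le f g : measurable_fun setT f -> L1 g -> (forall x, `|f x| <= g x) ->
  L1 f.
Proof.
move=> mf ig fg; apply: le_integrable ig => //; first exact/measurable_EFinP.
move=> x _ /=; rewrite lee_fin; apply: le_trans (fg x) (ler_norm _).
Qed.

Lemma L1_cst (c : R) : L1 (cst c).
Proof. exact: finite_measure_integrable_cst. Qed.

Lemma L1_bounded f (C : R) : measurable_fun setT f -> (forall x, `|f x| <= C) -> L1 f.
Proof. move=> mf fC; exact: (L1_le mf (L1_cst C)). Qed.

Lemma L1D f g : L1 f -> L1 g -> L1 (fun x => f x + g x).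
Proof.
move=> lf lg; rewrite /L1.
rewrite [X in P.-integrable _ X](_ : _ = (EFin \o f) \+ (EFin \o g))%E; last exact/funext.
exact: integrableD.
Qed.

Lemma L1Z (c : R) f : L1 f -> L1 (fun x => c * f x).
Proof.
move=> lf; rewrite /L1.
rewrite [X in P.-integrable _ X](_ : _ = (fun x => c%:E * (EFin \o f) x))%E; last exact/funext.
exact: integrableZl.
Qed.

Lemma L1N f : L1 f -> L1 (fun x => - f x).
Proof.
move=> /(L1Z (-1)); by under eq_fun do rewrite mulN1r.
Qed.

Lemma L1B f g : L1 f -> L1 g -> L1 (fun x => f x - g x).
Proof. by move=> lf /L1N lg; exact: L1D. Qed.

Lemma L1_norm f : L1 f -> L1 (fun x => `|f x|).
Proof. exact: integrable_norm. Qed.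

Lemma L1_sum (I : Type) (s : seq I) (F : I -> T -> R) :
  (forall i, L1 (F i)) -> L1 (fun x => \sum_(i <- s) F i x).
Proof.
move=> lF; elim: s => [|i s IH].
  by under eq_fun do rewrite big_nil; exact: L1_cst.
under eq_fun do rewrite big_cons; exact: L1D.
Qed.

Lemma L1_indic A f : measurable A -> L1 f -> L1 (fun x => \1_A x * f x).
Proof.
move=> mA lf; apply: (L1_le _ (L1_norm lf)).
  by apply: measurable_funM => //; exact: L1_meas.
move=> x; rewrite normrM ler_piMl// indicE; case: (x \in A); rewrite ?normr1 ?normr0//.
Qed.

Lemma ExD f g : L1 f -> L1 g -> Ex (fun x => f x + g x) = Ex f + Ex g.
Proof. by move=> lf lg; exact: RintegralD. Qed.

Lemma ExB f g : L1 f -> L1 g -> Ex (fun x => f x - g x) = Ex f - Ex g.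
Proof. by move=> lf lg; exact: RintegralB. Qed.

Lemma ExZ c f : L1 f -> Ex (fun x => c * f x) = c * Ex f.
Proof. by move=> lf; exact: RintegralZl. Qed.

Lemma Ex_cst (c : R) : Ex (fun _ => c) = c.
Proof. by rewrite /Ex /Rintegral integral_cst//= probability_setT mule1. Qed.

Lemma Ex_sum (I : Type) (s : seq I) (F : I -> T -> R) :
  (forall i, L1 (F i)) ->
  Ex (fun x => \sum_(i <- s) F i x) = \sum_(i <- s) Ex (F i).
Proof.
move=> lF; elim: s => [|i s IH].
  by under [in LHS]eq_fun do rewrite big_nil; rewrite big_nil Ex_cst.
under [in LHS]eq_fun do rewrite big_cons.
by rewrite big_cons -IH ExD//; exact: L1_sum.
Qed.

Lemma le_Ex f g : L1 f -> L1 g -> (forall x, f x <= g x) -> Ex f <= Ex g.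
Proof. by move=> lf lg fg; apply: le_Rintegral => //. Qed.

Lemma Ex_ge0 f : (forall x, 0 <= f x) -> 0 <= Ex f.
Proof. by move=> f0; exact: Rintegral_ge0. Qed.

Lemma eq_Ex f g : f =1 g -> Ex f = Ex g.
Proof. by move=> fg; congr Ex; exact/funext. Qed.

Lemma eq_L1 f g : f =1 g -> L1 f -> L1 g.
Proof. by move=> fg; rewrite (_ : f = g)//; exact/funext. Qed.

Lemma le_norm_Ex f : L1 f -> `|Ex f| <= Ex (fun x => `|f x|).
Proof. by move=> lf; exact: le_normr_Rintegral. Qed.

Lemma Ex_int f : L1 f -> (\int[P]_w (f w)%:E)%E = (Ex f)%:E.
Proof.
by move=> lf; rewrite /Ex /Rintegral fineK//; exact: integrable_fin_num lf.
Qed.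

Lemma Ex_indic A : measurable A -> Ex (\1_A) = fine (P A).
Proof. by move=> mA; rewrite /Ex /Rintegral integral_indic// setIT. Qed.

Lemma L1_1 A : measurable A -> L1 (\1_A).
Proof.
move=> mA; apply: (@L1_bounded _ 1) => // x.
by rewrite indicE; case: (x \in A); rewrite ?normr1 ?normr0.
Qed.

Lemma Ex_ae f g : measurable_fun setT f -> measurable_fun setT g ->
  {ae P, forall x, f x = g x} -> Ex f = Ex g.
Proof.
move=> mf mg fg; rewrite /Ex /Rintegral; congr fine.
apply: ae_eq_integral => //; [exact/measurable_EFinP|exact/measurable_EFinP|].
by apply: filterS fg => x /= -> .
Qed.

Lemma L1_ae f g : measurable_fun setT f -> measurable_fun setT g ->
  {ae P, forall x, f x = g x} -> L1 f -> L1 g.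
Proof.
move=> mf mg fg /integrableP[_ lf]; apply/integrableP; split.
  exact/measurable_EFinP.
rewrite (_ : \int[P]_x _ = \int[P]_x `|(EFin \o f) x|)%E//.
apply: ae_eq_integral => //=.
- apply/measurable_EFinP; exact: measurableT_comp.
- apply/measurable_EFinP; exact: measurableT_comp.
- by apply: filterS fg => x /= -> .
Qed.

Lemma Ex_dct (F : nat -> T -> R) f g :
  (forall n, measurable_fun setT (F n)) ->
  L1 g -> (forall n x, `|F n x| <= g x) -> (forall x, F ^~ x @ \oo --> f x) ->
  L1 f /\ Ex \o F @ \oo --> Ex f.
Proof.
move=> mF lg Fg Ff.
have mf : measurable_fun setT f.
  by apply: (measurable_realfun.measurable_fun_cvg mF) => x _; exact: Ff.
have [] := @dominated_convergence _ _ _ P setT measurableT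
  (fun n => EFin \o F n) (EFin \o f) (EFin \o g).
- by move=> n; exact/measurable_EFinP.
- exact/measurable_EFinP.
- by apply: aeW => x _; apply: cvg_EFin; [exact: nearW|exact: Ff].
- exact: lg.
- by apply: aeW => x n _ /=; rewrite lee_fin.
move=> lf _ h; split=> //.
have lF n : L1 (F n) by apply: L1_le lg _ => //.
apply: fine_cvg; by rewrite -Ex_int.
Qed.

Lemma Ex_fatou (F : nat -> T -> R) f C :
  (forall n, L1 (F n)) -> (forall n x, 0 <= F n x) -> (forall n, Ex (F n) <= C) ->
  (forall x, F ^~ x @ \oo --> f x) ->
  L1 f /\ Ex f <= C.
Proof.
move=> lF F0 FC Ff.
have mF n := L1_meas (lF n).
have mf : measurable_fun setT f.
  by apply: (measurable_realfun.measurable_fun_cvg mF) => x _; exact: Ff.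
have f0 x : 0 <= f x.
  by rewrite -(cvg_lim _ (Ff x))//; apply: limr_ge; [exact: cvgP (Ff x)|exact: nearW].
have h : (\int[P]_x (f x)%:E <= C%:E)%E.
  have := @fatou _ _ _ P setT measurableT (fun n => EFin \o F n).
  rewrite (_ : (fun x => limn_einf _) = (EFin \o f)); last first.
    apply/funext => x /=.
    have /cvg_limn_einf_sup[] : (EFin \o F ^~ x) @ \oo --> (f x)%:E.
      by apply: cvg_EFin; [exact: nearW|exact: Ff].
    by [].
  move=> H.
  apply: le_trans (H _ _) _ => [n|n x _|]; first exact/measurable_EFinP.
    by rewrite /= lee_fin.
  rewrite limn_einf_lim; apply: lime_le; first exact: is_cvg_einfs.
  apply: nearW => n; apply: (@le_trans _ _ (\int[P]_x (F n x)%:E)%E).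
    by apply: ereal_inf_lbound; exists n => /=.
  by rewrite Ex_int// lee_fin.
have lf : L1 f.
  apply/integrableP; split; first exact/measurable_EFinP.
  under eq_integral => x _ do rewrite /= ger0_norm//.
  by rewrite (le_lt_trans h)// ltry.
by split=> //; rewrite -lee_fin -Ex_int.
Qed.

Lemma Ex_mct (F : nat -> T -> R) f C :
  (forall n, L1 (F n)) -> (forall n x, 0 <= F n x) -> (forall n, Ex (F n) <= C) ->
  (forall x, {homo F ^~ x : n m / (n <= m)%N >-> n <= m}) ->
  (forall x, F ^~ x @ \oo --> f x) ->
  [/\ L1 f, Ex f <= C & Ex \o F @ \oo --> Ex f].
Proof.
move=> lF F0 FC ndF Ff.
have [lf fC] := Ex_fatou lF F0 FC Ff.
split=> //.
have mF n := L1_meas (lF n).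
suff Fn n x : `|F n x| <= f x by have [] := Ex_dct mF lf Fn Ff.
rewrite ger0_norm// -(cvg_lim _ (Ff x))//.
apply: nondecreasing_cvgn_le; first by move=> a b ab; exact: ndF.
exact: cvgP (Ff x).
Qed.

Lemma L1_sqr f : measurable_fun setT f -> L1 (fun x => f x ^+ 2) -> L1 f.
Proof.
move=> mf lf; apply: (L1_le mf (L1D (L1_cst 1) lf)) => x /=.
rewrite /cst ler_norml; nra.
Qed.

(** An L2 bound makes the sequence uniformly integrable. The difference is capped at [c], where
    dominated convergence applies; above the cap it is at most its square over [c], hence at most
    2/c times the sum of the two squares, whose expectation is bounded. *)
Lemma Ex_ui (F : nat -> T -> R) f C :
  (forall n, measurable_fun setT (F n)) -> (forall n, L1 (fun x => F n x ^+ 2)) ->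
  (forall n, Ex (fun x => F n x ^+ 2) <= C) ->
  (forall x, F ^~ x @ \oo --> f x) ->
  [/\ L1 f, L1 (fun x => f x ^+ 2), Ex (fun x => f x ^+ 2) <= C & Ex \o F @ \oo --> Ex f].
Proof.
move=> mF lF2 FC Ff.
have mf : measurable_fun setT f.
  by apply: (measurable_realfun.measurable_fun_cvg mF) => x _; exact: Ff.
have [lf2 f2C] : L1 (fun x => f x ^+ 2) /\ Ex (fun x => f x ^+ 2) <= C.
  apply: (Ex_fatou lF2) => // [n x|x]; first exact: sqr_ge0.
  by under eq_fun do rewrite expr2; rewrite expr2; exact: cvgM.
have lf := L1_sqr mf lf2.
have lF n := L1_sqr (mF n) (lF2 n).
have C0 : 0 <= C by apply: le_trans f2C; apply: Ex_ge0 => x; exact: sqr_ge0.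
split => //; apply/cvgrPdist_le => e e0.
(* The part above the cap contributes at most 4C/c, which is thus at most e/2; the summand 1 keeps
   [c] positive when C = 0. *)
pose c : R := 8 * C / e + 1.
have c0 : 0 < c by rewrite /c ltr_wpDl// mulr_ge0 ?invr_ge0 ?mulr_ge0// ltW.
pose G n x : R := Num.min `|F n x - f x| c.
have mG n : measurable_fun setT (G n).
  apply: measurable_minr => //; apply: measurableT_comp => //; exact: measurable_funB.
have Gc n x : `|G n x| <= c.
  rewrite ger0_norm /G; last by rewrite le_min normr_ge0 ltW.
  by rewrite ge_min lexx orbT.
have [_ G0] : L1 (fun=> 0) /\ Ex \o G @ \oo --> Ex (fun=> 0).
  apply: (Ex_dct mG (L1_cst c)) => // x.
  apply: (@squeeze_cvgr _ _ _ _ (fun=> 0) (fun n => `|F n x - f x|)).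
  - by apply: nearW => n; rewrite /G le_min normr_ge0 ltW//= ge_min lexx.
  - exact: cvg_cst.
  - have E0 : `|f x - f x| = 0 by rewrite subrr normr0.
    rewrite -[X in _ --> X]E0; exact: (cvg_norm (cvgB (Ff x) (cvg_cst (f x)))).
rewrite Ex_cst in G0.
near=> n => /=.
have c2 : 0 <= 2 / c by rewrite divr_ge0// ltW.
have lG : L1 (G n) by exact: (L1_bounded (mG n) (Gc n)).
have H x : `|F n x - f x| <= G n x + (2 / c) * (F n x ^+ 2 + f x ^+ 2).
  have s0 : 0 <= F n x ^+ 2 + f x ^+ 2 by rewrite addr_ge0// sqr_ge0.
  rewrite /G minEle; case: ifPn => [_|]; first by rewrite lerDl mulr_ge0.
  rewrite -ltNge => cF; apply: (@le_trans _ _ ((F n x - f x) ^+ 2 / c)).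
    by rewrite ler_pdivlMr// -[leRHS]real_normK ?num_real// expr2 ler_wpM2l// ltW.
  apply: (@le_trans _ _ (2 / c * (F n x ^+ 2 + f x ^+ 2))); last by rewrite lerDr ltW.
  rewrite [leRHS]mulrAC; apply: ler_wpM2r; first by rewrite invr_ge0 ltW.
  have := sqr_ge0 (F n x + f x); nra.
rewrite distrC -ExB//.
apply: le_trans (le_norm_Ex (L1B (lF n) lf)) _.
apply: (@le_trans _ _ (Ex (G n) + 2 / c * (C + C))).
  have l2 := L1D (lF2 n) lf2.
  apply: le_trans (le_Ex _ _ H) _.
  - exact: L1_norm (L1B (lF n) lf).
  - by apply: L1D => //; exact: L1Z.
  - by rewrite ExD ?ExZ ?ExD//; [rewrite lerD2l ler_wpM2l ?lerD// divr_ge0// ltW|exact: L1Z].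
have B1 : 2 / c * (C + C) <= e / 2.
  rewrite mulrAC ler_pdivrMr//.
  have -> : e / 2 * c = 4 * C + e / 2 by rewrite /c; field; rewrite gt_eqF.
  lra.
have B2 : Ex (G n) <= e / 2.
  near: n; move/cvgr0Pnorm_le : G0 => /(_ (e / 2)); rewrite divr_gt0// => /(_ isT).
  by apply: filterS => n /=; exact: le_trans (ler_norm _).
by lra.
Unshelve. all: by end_near. Qed.

End expectation.

(** * Borel structure and test functions on R^n *)

Section continuity.
Context {R : realType} {T : topologicalType}.
Implicit Types f g : T -> R.

Lemma continuous_sum (I : Type) (s : seq I) (F : I -> T -> R) :
  (forall i, continuous (F i)) -> continuous (fun x => \sum_(i <- s) F i x).
Proof. by move=> cF x; apply: (cvg_big add_continuous) => i _; exact: cF. Qed.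

Lemma continuous_prod (I : Type) (s : seq I) (F : I -> T -> R) :
  (forall i, continuous (F i)) -> continuous (fun x => \prod_(i <- s) F i x).
Proof. by move=> cF x; apply: (cvg_big mul_continuous) => i _; exact: cF. Qed.

Lemma continuous_normB f g : continuous f -> continuous g -> continuous (fun x => `|f x - g x|).
Proof. by move=> cf cg x; apply: cvg_norm; apply: cvgB; [exact: cf|exact: cg]. Qed.

Lemma continuous_minr f g : continuous f -> continuous g ->
  continuous (fun x => Num.min (f x) (g x)).
Proof. by move=> cf cg x; apply: (@continuous_min R T f g x); [exact: cf|exact: cg]. Qed.

Lemma continuous_maxr f g : continuous f -> continuous g ->
  continuous (fun x => Num.max (f x) (g x)).
Proof. by move=> cf cg x; apply: (@continuous_max R T f g x); [exact: cf|exact: cg]. Qed.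

Lemma continuous_sub f g : continuous f -> continuous g -> continuous (fun x => f x - g x).
Proof. by move=> cf cg x; apply: cvgB; [exact: cf|exact: cg]. Qed.

Lemma continuous_mul f g : continuous f -> continuous g -> continuous (fun x => f x * g x).
Proof. by move=> cf cg x; apply: cvgM; [exact: cf|exact: cg]. Qed.

Lemma continuous_const (c : R) : continuous (fun _ : T => c).
Proof. by move=> x; exact: cvg_cst. Qed.

End continuity.

(** The continuous functions x / (x^2 + 1/(n+1)) converge pointwise to the inverse, also at 0, where
    their limit agrees with the convention 0^-1 = 0. *)
Lemma measurable_inv_R (R : realType) : measurable_fun setT (fun x : R => x^-1).
Proof.
apply: (measurable_realfun.measurable_fun_cvg
  (h := fun n (x : R) => x / (x ^+ 2 + n.+1%:R^-1))) => [n|x _].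
  apply: continuous_measurable_fun => x; apply: cvgM; first exact: cvg_id.
  apply: (@continuousV R _ (fun x : R => x ^+ 2 + n.+1%:R^-1)).
    by rewrite gt_eqF// ltr_wpDl ?sqr_ge0 ?invr_gt0.
  by apply: cvgD; [exact: exprn_continuous|exact: cvg_cst].
have [->|x0] := eqVneq x 0.
  by under eq_fun do rewrite mul0r; rewrite invr0; exact: cvg_cst.
have -> : x^-1 = x / (x ^+ 2 + 0) by rewrite addr0 expr2 invfM mulrA divff// mul1r.
apply: cvgM; first exact: cvg_cst.
apply: cvgV; first by rewrite addr0 expf_eq0.
by apply: cvgD; [exact: cvg_cst|exact: cvg_harmonic].
Qed.

Section euclidean_norm.
Context {R : realType} {n : nat}.
Implicit Types (z g x : 'rV[R]_n) (r : R).

Lemma enorm_ge0 z : 0 <= enorm z. Proof. exact: sqrtr_ge0. Qed.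

Lemma sum_sqr_ge0 z : 0 <= \sum_i z ord0 i ^+ 2.
Proof. by apply: sumr_ge0 => i _; exact: sqr_ge0. Qed.

Lemma enormZ r z : enorm (r *: z) = `|r| * enorm z.
Proof.
rewrite /enorm -sqrtr_sqr -sqrtrM ?sqr_ge0//; congr Num.sqrt.
by rewrite mulr_sumr; apply: eq_bigr => i _; rewrite mxE exprMn.
Qed.

Lemma enorm_eq0 z : (enorm z == 0) = (z == 0).
Proof.
apply/idP/eqP => [|->]; last first.
  by rewrite -[X in enorm X](scale0r (0 : 'rV[R]_n)) enormZ normr0 mul0r.
rewrite sqrtr_eq0 => h.
have : \sum_i z ord0 i ^+ 2 == 0 by rewrite eq_le h sum_sqr_ge0.
rewrite psumr_eq0; last by move=> i _; exact: sqr_ge0.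
move=> /allP h'; apply/rowP => i; rewrite mxE; apply/eqP.
by have := h' i (mem_index_enum i); rewrite sqrf_eq0.
Qed.

Lemma enorm0 : enorm (0 : 'rV[R]_n) = 0.
Proof. by apply/eqP; rewrite enorm_eq0. Qed.

Lemma enorm_gt0 z : (0 < enorm z) = (z != 0).
Proof. by rewrite lt_neqAle enorm_ge0 andbT eq_sym enorm_eq0. Qed.

Lemma angle0 : angle (0 : 'rV[R]_n) = 0. Proof. by rewrite /angle scaler0. Qed.

Lemma enorm_angle z : enorm z *: angle z = z.
Proof.
have [->|z0] := eqVneq z 0; first by rewrite angle0 scaler0.
by rewrite /angle scalerA divff ?scale1r// enorm_eq0.
Qed.

Lemma angle_sphere z : z != 0 -> sphere R n (angle z).
Proof.
move=> z0; rewrite /sphere/= /angle enormZ ger0_norm ?invr_ge0 ?enorm_ge0//.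
by rewrite mulVf// enorm_eq0.
Qed.

Lemma angleZ r g : 0 < r -> sphere R n g -> angle (r *: g) = g.
Proof.
move=> r0 g1; rewrite /angle enormZ g1 mulr1 gtr0_norm//.
by rewrite scalerA mulVf ?scale1r// gt_eqF.
Qed.

Lemma enormZ_sphere r g : 0 <= r -> sphere R n g -> enorm (r *: g) = r.
Proof. by move=> r0 g1; rewrite enormZ g1 mulr1 ger0_norm. Qed.

Lemma coord_cont (i : 'I_n) : continuous (fun x : 'rV[R]_n => x ord0 i).
Proof. exact: coord_continuous. Qed.

Lemma enorm_continuous : continuous (@enorm R n).
Proof.
move=> z; apply: (@continuous_comp _ _ _ (fun z : 'rV[R]_n => \sum_i z ord0 i ^+ 2)).
  apply: continuous_sum => i {}z.
  apply: (@continuous_comp _ _ _ (fun z : 'rV[R]_n => z ord0 i) (fun x : R => x ^+ 2)).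
    exact: coord_cont.
  exact: exprn_continuous.
exact: sqrt_continuous.
Qed.

Lemma angle_continuous z : z != 0 -> {for z, continuous (@angle R n)}.
Proof.
move=> z0; apply: (@continuousZ _ _ _ (fun z : 'rV[R]_n => (enorm z)^-1) id); last exact: cvg_id.
by apply: continuousV; [rewrite enorm_eq0|exact: enorm_continuous].
Qed.

End euclidean_norm.

(** * The Borel sets of R^n, generated by open boxes *)

Section borel_rV.
Context {R : realType} {n : nat}.
Implicit Types (U : set 'rV[R]_n).

Lemma open_measurable_rV U : open U -> measurable U.
Proof. by move=> oU; exact: sub_sigma_algebra. Qed.

Lemma closed_measurable_rV U : closed U -> measurable U.
Proof.
by rewrite -openC => oU; rewrite -(setCK U); apply: measurableC; exact: open_measurable_rV.
Qed.

Lemma measurable_set1_rV (x : 'rV[R]_n) : measurable [set x].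
Proof.
apply: closed_measurable_rV; apply: accessible_closed_set1.
apply: hausdorff_accessible; exact: norm_hausdorff.
Qed.

Definition box (a b : 'rV[R]_n) : set 'rV[R]_n :=
  [set x | forall i, a ord0 i < x ord0 i < b ord0 i].

Lemma setI_closed_box : setI_closed [set A | exists a b, A = box a b].
Proof.
move=> _ _ [a [b ->]] [a' [b' ->]].
exists (\row_i Num.max (a ord0 i) (a' ord0 i)), (\row_i Num.min (b ord0 i) (b' ord0 i)).
apply/seteqP; split => x.
  by move=> [h h'] i; rewrite !mxE gt_max lt_min; case/andP: (h i) => -> ->; case/andP: (h' i) => -> ->.
by move=> h; split => i; move: (h i); rewrite !mxE gt_max lt_min => /andP[/andP[? ?] /andP[? ?]]; apply/andP.
Qed.

(** Open cubes with a rational centre and half-side 1/(k+1): a base of the topology indexed by a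
    countable type, so that every open set is a countable union of boxes. *)
Definition rat_ball (ck : 'rV[rat]_n * nat) : set 'rV[R]_n :=
  [set x | forall i, `|x ord0 i - ratr (ck.1 ord0 i)| < ck.2.+1%:R^-1].

Lemma rat_ball_box ck : exists a b, rat_ball ck = box a b.
Proof.
exists (\row_i (ratr (ck.1 ord0 i) - ck.2.+1%:R^-1)), (\row_i (ratr (ck.1 ord0 i) + ck.2.+1%:R^-1)).
apply/seteqP; split => x h i; by have := h i; rewrite !mxE ltr_distl.
Qed.

Lemma open_rat_ball U x : open U -> U x -> exists ck, rat_ball ck x /\ rat_ball ck `<=` U.
Proof.
move=> oU Ux; have /nbhs_ballP[e /= e0 eU] : nbhs x U by exact: open_nbhs_nbhs.
have [k ke] : exists k : nat, k.+1%:R^-1 < e / 2.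
  have [k _ H] := near_infty_natSinv_lt (PosNum (divr_gt0 e0 (@ltr0Sn R 1))).
  by exists k; exact: (H k (leqnn k)).
have k0 : 0 < k.+1%:R^-1 :> R by rewrite invr_gt0.
have /choice[c cP] : forall i : 'I_n, exists q : rat, `|x ord0 i - ratr q| < k.+1%:R^-1 :> R.
  move=> i; have xk : x ord0 i - k.+1%:R^-1 < x ord0 i + k.+1%:R^-1 by rewrite ltrD2l gtrN.
  have [q /itvP qi] := rat_in_itvoo xk.
  by exists q; rewrite distrC ltr_distl !qi.
exists (\row_i c i, k); split => [i|y yc] /=; first by rewrite mxE.
apply: eU; split => // i j; rewrite ord1 /ball/=.
have := yc j; rewrite /= mxE => h1; have := cP j => h2.
rewrite (_ : _ - _ = (x ord0 j - ratr (c j)) - (y ord0 j - ratr (c j))); last by lra.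
apply: le_lt_trans (ler_normB _ _) _.
by rewrite (splitr e); apply: ltrD; [exact: lt_trans h2 ke|exact: lt_trans h1 ke].
Qed.

Lemma measurable_rat_ball ck : measurable (rat_ball ck).
Proof.
rewrite (_ : rat_ball ck = \bigcap_(i in [set: 'I_n])
   ((fun x : 'rV[R]_n => `|x ord0 i - ratr (ck.1 ord0 i)|) @^-1` `]-oo, ck.2.+1%:R^-1[)); last first.
  apply/seteqP; split => x.
    by move=> h i _; rewrite /= in_itv/=.
  by move=> h i; have := h i Logic.I; rewrite /= in_itv.
apply: fin_bigcap_measurable => // i _; apply: open_measurable_rV.
apply: open_comp; last exact: interval_open.
move=> x _; apply: (@continuous_normB _ _ _ (fun=> ratr (ck.1 ord0 i))).
  exact: coord_cont.
exact: continuous_const.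
Qed.

Lemma open_bigcup_rat_ball U : open U ->
  U = \bigcup_(ck in [set ck | rat_ball ck `<=` U]) rat_ball ck.
Proof.
move=> oU; apply/seteqP; split => x; last by move=> [ck /= h]; exact: h.
by move=> Ux; have [ck [h1 h2]] := open_rat_ball oU Ux; exists ck.
Qed.

Lemma open_bigcup_box U : open U ->
  exists F : ('rV[rat]_n * nat) -> set 'rV[R]_n,
    (forall ck, F ck = set0 \/ F ck = rat_ball ck) /\ U = \bigcup_ck F ck.
Proof.
move=> oU; exists (fun ck => if `[< rat_ball ck `<=` U >] then rat_ball ck else set0).
split=> [ck|]; first by case: ifP; [right|left].
rewrite [LHS](open_bigcup_rat_ball oU); apply/seteqP; split => x.
  by move=> [ck /= ckU ckx]; exists ck => //; rewrite ifT//; apply/asboolP.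
by move=> [ck _]; case: ifPn => // /asboolP ckU ckx; exists ck.
Qed.

(** Boxes, unlike the cubes [rat_ball], are stable under intersection, as Dynkin's theorem requires
    of a generating class. *)
Lemma measurable_rV_boxE :
  @measurable _ 'rV[R]_n = <<s [set A | exists a b, A = box a b] >>.
Proof.
apply/seteqP; split.
  apply: smallest_sub; first exact: smallest_sigma_algebra.
  move=> U oU; have [F [FE ->]] := open_bigcup_box oU.
  apply: (@countable_bigcupT_measurable _ (g_sigma_algebraType [set A | exists a b : 'rV[R]_n, A = box a b])).
    exact: countableP.
  move=> ck; have [->|->] := FE ck; first exact: measurable0.
  by apply: sub_sigma_algebra; exact: rat_ball_box.
apply: smallest_sub; first exact: smallest_sigma_algebra.
move=> _ [a [b ->]].
rewrite (_ : box a b = \bigcap_(i in [set: 'I_n])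
   ((fun x : 'rV[R]_n => x ord0 i) @^-1` `]a ord0 i, b ord0 i[)); last first.
  apply/seteqP; split => x.
    by move=> h i _; rewrite /= in_itv/=.
  by move=> h i; have := h i Logic.I; rewrite /= in_itv.
apply: fin_bigcap_measurable => // i _; apply: open_measurable_rV.
apply: open_comp; last exact: interval_open.
by move=> x _; exact: coord_cont.
Qed.

Lemma measurable_rV_coord d (T : measurableType d) (f : T -> 'rV[R]_n) :
  (forall i, measurable_fun setT (fun x => f x ord0 i)) -> measurable_fun setT f.
Proof.
move=> mf; apply: (measurability (@open 'rV[R]_n)) => // _ [U oU <-].
have [F [FE ->]] := open_bigcup_box oU.
rewrite setTI preimage_bigcup; apply: countable_bigcupT_measurable; first exact: countableP.
move=> ck; have [->|->] := FE ck; first by rewrite preimage_set0.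
have [a [b ->]] := rat_ball_box ck.
rewrite (_ : _ @^-1` _ = \bigcap_(i in [set: 'I_n])
   ((fun x => f x ord0 i) @^-1` `]a ord0 i, b ord0 i[)); last first.
  apply/seteqP; split => x.
    by move=> h i _; rewrite /= in_itv/=.
  by move=> h i; have := h i Logic.I; rewrite /= in_itv.
apply: fin_bigcap_measurable => // i _; rewrite -[X in measurable X]setTI.
exact: mf.
Qed.

Lemma continuous_measurable_rV (f : 'rV[R]_n -> R) : continuous f -> measurable_fun setT f.
Proof.
move=> cf; apply: (measurability _ (RGenOpens.measurableE R)) => _ [_ [U [oU ->]] <-].
rewrite setTI; apply: open_measurable_rV.
by apply: open_comp => // x _; exact: cf.
Qed.

Lemma measurable_coord (i : 'I_n) : measurable_fun setT (fun x : 'rV[R]_n => x ord0 i).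
Proof. by apply: continuous_measurable_rV; exact: coord_cont. Qed.

Lemma measurable_enorm : measurable_fun setT (@enorm R n).
Proof. exact: continuous_measurable_rV enorm_continuous. Qed.

Lemma measurable_angle : measurable_fun setT (@angle R n).
Proof.
apply: measurable_rV_coord => i; rewrite /angle.
under eq_fun do rewrite mxE.
apply: measurable_funM; last exact: measurable_coord.
by apply: measurableT_comp; [exact: measurable_inv_R|exact: measurable_enorm].
Qed.

Lemma measurable_scale d (T : measurableType d) (r : T -> R) (f : T -> 'rV[R]_n) :
  measurable_fun setT r -> measurable_fun setT f ->
  measurable_fun setT (fun x => r x *: f x).
Proof.
move=> mr mf; apply: measurable_rV_coord => i; under eq_fun do rewrite mxE.
apply: measurable_funM => //; exact: (measurableT_comp (measurable_coord i)).
Qed.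

Lemma measurable_sphere : measurable (sphere R n).
Proof.
rewrite (_ : sphere R n = @enorm R n @^-1` [set 1]); last by [].
by rewrite -[X in measurable X]setTI; apply: measurable_enorm.
Qed.

(** A continuous function with values in [0, 1] that tends to the indicator of the box as k grows:
    the link between continuous test functions and Borel sets. *)
Definition box_bump (a b : 'rV[R]_n) (k : nat) (x : 'rV[R]_n) : R :=
  \prod_(i < n) Num.min 1 (k%:R * Num.max 0 (Num.min (x ord0 i - a ord0 i) (b ord0 i - x ord0 i))).

Lemma box_bump01 a b k x : 0 <= box_bump a b k x <= 1.
Proof.
apply/andP; split.
  by apply: prodr_ge0 => i _; rewrite le_min ler01 mulr_ge0// le_max lexx.
rewrite -[leRHS](expr1n _ n) -[X in _ ^+ X]card_ord -prodr_const ler_prod// => i _.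
by rewrite le_min ler01 mulr_ge0 ?le_max ?lexx//= ge_min lexx.
Qed.

Lemma box_bump_cont a b k : continuous (box_bump a b k).
Proof.
apply: continuous_prod => i x.
apply: (@continuous_comp _ _ _ (fun x : 'rV[R]_n => x ord0 i)
  (fun t : R => Num.min 1 (k%:R * Num.max 0 (Num.min (t - a ord0 i) (b ord0 i - t))))).
  exact: coord_cont.
apply: continuous_minr; first exact: continuous_const.
apply: continuous_mul; first exact: continuous_const.
apply: continuous_maxr; first exact: continuous_const.
by apply: continuous_minr; apply: continuous_sub; (exact: continuous_const || move=> ?; exact: cvg_id).
Qed.

Lemma box_bump_cvg a b x : box_bump a b ^~ x @ \oo --> (\1_(box a b) x : R).
Proof.
have [xab|xab] := pselect (box a b x).
  rewrite indicE mem_set//=; apply: cvg_near_cst.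
  have /choice[e eP] : forall i : 'I_n, exists k : nat, forall m, (k <= m)%N ->
      1 <= m%:R * Num.max 0 (Num.min (x ord0 i - a ord0 i) (b ord0 i - x ord0 i)).
    move=> i; set y := Num.max _ _.
    have y0 : 0 < y by rewrite /y lt_max lt_min !subr_gt0 xab orbT.
    have [k yk] : exists k : nat, y^-1 < k%:R.
      by exists (Num.truncn y^-1).+1; exact: truncnS_gt.
    exists k => m km; rewrite -ler_pdivrMr// div1r ltW// (lt_le_trans yk)// ler_nat//.
  exists (\max_i e i) => // m /= em; rewrite /box_bump big1// => i _.
  by rewrite min_l// eP// (leq_trans _ em)// leq_bigmax.
rewrite indicE memNset//=; apply: cvg_near_cst; near=> k.
have [i /negP xi] : exists i, ~ (a ord0 i < x ord0 i < b ord0 i) by apply/existsNP.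
rewrite /box_bump (bigD1 i)//=.
suff /max_idPl -> : Num.min (x ord0 i - a ord0 i) (b ord0 i - x ord0 i) <= 0.
  by rewrite mulr0 min_r ?mul0r.
rewrite ge_min; move: xi; rewrite negb_and -!leNgt => /orP[] ?.
  by apply/orP; left; rewrite subr_le0.
by apply/orP; right; rewrite subr_le0.
Unshelve. all: by end_near. Qed.

Lemma dynkin_rV (Q : set 'rV[R]_n -> Prop) :
  Q setT -> (forall a b, Q (box a b)) ->
  (forall B, measurable B -> Q B -> Q (~` B)) ->
  (forall F : (set 'rV[R]_n)^nat, (forall n, measurable (F n)) ->
    trivIset setT F -> (forall n, Q (F n)) -> Q (\bigcup_k F k)) ->
  forall B, measurable B -> Q B.
Proof.
move=> QT Qbox QC QU B mB.
apply: (dynkin_induction measurable_rV_boxE setI_closed_box) => //.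
- by move=> _ [a [b ->]]; exact: Qbox.
- by rewrite -measurable_rV_boxE.
Qed.

End borel_rV.

(** * The support of the spinning measure *)

Section support.
Context {R : realType} {n : nat} (kappa : probability 'rV[R]_n R).

Lemma closed_msupp : closed (msupp kappa).
Proof.
rewrite -openC openE => x /existsNP[U /not_implyP[oU /not_implyP[Ux kU]]].
apply: (@filterS _ (nbhs x) _ U); last exact: open_nbhs_nbhs.
by move=> y Uy /(_ U oU Uy).
Qed.

Lemma measurable_msupp : measurable (msupp kappa).
Proof. exact: closed_measurable_rV closed_msupp. Qed.

(** The complement of the support is covered by those cubes of the countable base that are null. *)
Lemma msupp_full : kappa (~` msupp kappa) = 0%E.
Proof.
have oC : open (~` msupp kappa) by rewrite openC; exact: closed_msupp.
have [F [FE CE]] : exists F : ('rV[rat]_n * nat) -> set 'rV[R]_n,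
    (forall ck, measurable (F ck) /\ kappa (F ck) = 0%E) /\ ~` msupp kappa `<=` \bigcup_ck F ck.
  exists (fun ck => if kappa (@rat_ball R n ck) == 0%E then rat_ball ck else set0).
  split=> [ck|x /existsNP[U /not_implyP[oU /not_implyP[Ux kU]]]].
    case: ifPn => [/eqP k0|_]; split=> //; exact: measurable_rat_ball.
  have [ck [ckx ckU]] := open_rat_ball oU Ux.
  exists ck => //; rewrite ifT// eq_le measure_ge0 andbT leNgt; apply/negP => k0.
  apply: kU; apply: lt_le_trans k0 _; apply: le_measure => //; rewrite inE.
    exact: measurable_rat_ball.
  exact: open_measurable_rV.
have neg : kappa.-negligible (\bigcup_ck F ck).
  have [f _ fK] : exists2 f : nat -> option ('rV[rat]_n * nat), True & forall ck, exists m, f m = Some ck.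
    by exists unpickle => // ck; exists (pickle ck); rewrite pickleK.
  apply: (@negligibleS _ _ _ kappa (\bigcup_m (oapp F set0 (f m)))).
    by move=> x [ck _ ckx]; have [m fm] := fK ck; exists m => //; rewrite fm.
  apply: negligible_bigcup => m; case: (f m) => [ck|] /=; last exact: negligible_set0.
  by have [mF F0] := FE ck; apply/negligibleP.
by apply/negligibleP; [apply: measurableC; exact: measurable_msupp|apply: negligibleS neg].
Qed.

Lemma msupp_sphere : kappa (sphere R n) = 1%E -> msupp kappa `<=` sphere R n.
Proof.
move=> k1 x xs; apply: contrapT => nx.
have cS : closed (sphere R n).
  rewrite (_ : sphere R n = @enorm R n @^-1` [set 1]); last by [].
  by apply: closed_comp; [move=> ? _; exact: enorm_continuous|exact: closed_eq].
have := xs (~` sphere R n); rewrite openC => /(_ cS nx).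
rewrite probability_setC ?k1 ?subee ?ltxx//; exact: measurable_sphere.
Qed.

End support.

(** * Gaussian integrals *)

Section weight_ext.
Context {d1 d2 d} {T1 : measurableType d1} {T2 : measurableType d2}
  {X : measurableType d} {R : realType}.
Variables (m1 : {measure set T1 -> \bar R}) (m2 : {measure set T2 -> \bar R}).
Variables (U1 : T1 -> X) (U2 : T2 -> X) (r1 : T1 -> R) (r2 : T2 -> R).
Hypotheses (mU1 : measurable_fun setT U1) (mU2 : measurable_fun setT U2).
Hypotheses (mr1 : measurable_fun setT r1) (mr2 : measurable_fun setT r2).
Hypotheses (r10 : forall x, 0 <= r1 x) (r20 : forall x, 0 <= r2 x).
Hypothesis H : forall A, measurable A ->
  (\int[m1]_x (\1_A (U1 x) * r1 x)%:E = \int[m2]_x (\1_A (U2 x) * r2 x)%:E)%E.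

Import HBNNSimple.

Lemma weight_nnsfun d' (T : measurableType d') (m : {measure set T -> \bar R})
  (U : T -> X) (r : T -> R) (h : {nnsfun X >-> R}) :
  measurable_fun setT U -> measurable_fun setT r -> (forall x, 0 <= r x) ->
  (\int[m]_x (h (U x) * r x)%:E =
   \sum_(y \in range h) (y%:E * \int[m]_x (\1_(h @^-1` [set y]) (U x) * r x)%:E))%E.
Proof.
move=> mU mr r0.
under eq_integral => x _.
  rewrite EFinM fimfunE -fsumEFin// ge0_mule_fsuml; last first.
    by move=> y; rewrite EFinM; exact: nnfun_muleindic_ge0.
  over.
have hm y : measurable_fun setT (fun x => (\1_(h @^-1` [set y]) (U x) * r x)%:E)%E.
  apply/measurable_EFinP; apply: measurable_funM => //.
  exact: (measurableT_comp (measurable_indic _)).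
rewrite ge0_integral_fsum//; last 2 first.
- move=> y; under eq_fun do rewrite -EFinM -mulrA EFinM.
  by apply: measurable_funeM; exact: hm.
- move=> y x _; apply: mule_ge0; rewrite ?lee_fin//.
  exact: nnfun_muleindic_ge0.
apply: eq_fsbigr => y _.
under eq_integral do rewrite -EFinM -mulrA EFinM.
have [y0|y0] := leP 0 y.
  by rewrite ge0_integralZl//; move=> x _; rewrite lee_fin mulr_ge0.
rewrite preimage_nnfun0// !integral0_eq ?mule0// => x _; rewrite indic0 mul0r ?mule0//.
Qed.

(** [H] says that the measure with density [r1] and the one with density [r2] have the same image
    under [U1] and [U2]; simple functions and monotone convergence pass from sets to nonnegative
    functions. It serves for densities, for equalities of laws and for conditional means alike, and
    asks for no integrability. *)
Lemma weight_ext (f : X -> \bar R) : measurable_fun setT f -> (forall x, 0 <= f x)%E ->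
  (\int[m1]_x (f (U1 x) * (r1 x)%:E) = \int[m2]_x (f (U2 x) * (r2 x)%:E))%E.
Proof.
move=> mf f0; pose f_ := nnsfun_approx measurableT mf.
have K d' (T : measurableType d') (m : {measure set T -> \bar R})
  (U : T -> X) (r : T -> R) : measurable_fun setT U -> measurable_fun setT r -> (forall x, 0 <= r x) ->
   (\int[m]_x (f (U x) * (r x)%:E) = limn (fun n => \int[m]_x (f_ n (U x) * r x)%:E))%E.
  move=> mU mr r0; rewrite -monotone_convergence//=.
  - apply: eq_integral => x _; apply/esym/cvg_lim => //.
    under eq_fun do rewrite EFinM.
    apply: cvgeZr => //; exact: (@cvg_nnsfun_approx _ _ _ _ measurableT _ mf (fun x _ => f0 x) (U x) Logic.I).
  - move=> n; apply/measurable_EFinP; apply: measurable_funM => //.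
    exact: measurableT_comp.
  - by move=> n x _; rewrite lee_fin mulr_ge0.
  - move=> x _ a b ab; rewrite lee_fin ler_wpM2r//; exact/lefP/nd_nnsfun_approx.
rewrite !K//; congr (limn _); apply/funext => n.
rewrite !weight_nnsfun//; apply: eq_fsbigr => y _; rewrite H//.
Qed.

End weight_ext.

Section gaussian.
Context {R : realType}.
Implicit Types (f g : R -> R) (r s : R).
Notation leb := (@lebesgue_measure R).
Notation RB := (measurableTypeR R).
Definition gauss : probability RB R := [the probability RB R of normal_prob 0 1].

Let integral_normal_probB r s (f : RB -> \bar R) : measurable_fun [set: RB] f ->
  (forall x, 0 <= f x)%E ->
  (\int[normal_prob r s]_x f x = \int[leb]_x (f x * (normal_pdf r s x)%:E))%E.
Proof.
move=> mf f0.
under eq_integral => x _ do rewrite -[f x]mule1.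
apply: (@weight_ext _ _ _ RB RB RB R [the measure _ _ of normal_prob r s] leb id id (cst 1) (normal_pdf r s)) => //.
- exact: measurable_normal_pdf.
- by move=> x; rewrite normal_pdf_ge0.
move=> A mA; under eq_integral => x _ do rewrite mulr1.
rewrite integral_indic// setIT.
rewrite -[LHS]/(\int[leb]_(x in A) (normal_pdf r s x)%:E)%E [LHS]integral_mkcond.
apply: eq_integral => x _; rewrite patchE indicE; case: ifPn => _; rewrite ?mul1r ?mul0r//.
Qed.

Lemma integral_normal_prob r s (f : R -> \bar R) : measurable_fun [set: R] f ->
  (forall x, 0 <= f x)%E ->
  (\int[normal_prob r s]_x f x = \int[leb]_x (f x * (normal_pdf r s x)%:E))%E.
Proof. by move=> mf f0; apply: integral_normal_probB. Qed.

Lemma integral_gauss (f : R -> \bar R) : measurable_fun [set: R] f ->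
  (forall x, 0 <= f x)%E ->
  (\int[gauss]_x f x = \int[leb]_x (f x * (normal_pdf 0 1 x)%:E))%E.
Proof. by move=> mf f0; apply: integral_normal_prob. Qed.

Lemma affine_subst r s g : 0 < s -> continuous g -> (forall x, 0 <= g x) ->
  (\int[leb]_x (g x)%:E = \int[leb]_x (g (r + s * x) * s)%:E)%E.
Proof.
move=> s0 cg g0; pose F (x : R^o) : R^o := r + s * x.
have dF (x : R) : is_derive x (1:R) F s.
  rewrite /F; apply: is_derive_eq.
  by rewrite add0r mul1r /GRing.scale/= mulr1.
have F'E : F^`()%classic = cst s by apply/funext => x; rewrite derive1E; exact: derive_val.
rewrite (@increasing_ge0_integration_by_substitutionT _ F g)//.
- by apply: eq_integral => x _; rewrite F'E.
- by move=> x y xy; rewrite /F ltrD2l ltr_pM2l.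
- by rewrite F'E => ?; exact: cvg_cst.
- by rewrite F'E; exact: is_cvg_cst.
- by rewrite F'E; exact: is_cvg_cst.
- rewrite /F; apply/cvgrNyPle => A; near=> x.
  rewrite -lerBrDl -ler_pdivlMl//; near: x; exact: nbhs_ninfty_le.
- rewrite /F; apply/cvgryPge => A; near=> x.
  rewrite -lerBlDl -ler_pdivrMl//; near: x; exact: nbhs_pinfty_ge.
Unshelve. all: by end_near. Qed.

Lemma normal_pdf_affine r s x : 0 < s -> normal_pdf r s (r + s * x) * s = normal_pdf 0 1 x.
Proof.
move=> s0; rewrite !normal_pdfE ?gt_eqF// /normal_peak /normal_fun.
rewrite expr1n mul1r addrAC subrr add0r subr0 -!mulrnAr.
rewrite sqrtrM ?sqr_ge0// sqrtr_sqr gtr0_norm// invfM mulrAC -!mulrA mulrCA.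
rewrite mulKf ?gt_eqF//; congr (_ * expR _).
by rewrite -[s *+ 2]mulr_natr; field; rewrite gt_eqF.
Qed.

Lemma affine_continuous r s : continuous (fun x : R => r + s * x).
Proof. by move=> x; apply: cvgD; [exact: cvg_cst|apply: cvgM; [exact: cvg_cst|exact: cvg_id]]. Qed.

Lemma comp_affine_continuous r s f : continuous f -> continuous (fun x => f (r + s * x)).
Proof.
move=> cf x; apply: (@continuous_comp _ _ _ (fun x => r + s * x) f); last exact: cf.
exact: affine_continuous.
Qed.

Lemma normal_affine r s f : 0 < s -> continuous f -> (forall x, 0 <= f x) ->
  (\int[normal_prob r s]_x (f x)%:E = \int[gauss]_x (f (r + s * x))%:E)%E.
Proof.
move=> s0 cf f0; have mf := continuous_measurable_fun cf.
rewrite (@integral_normal_prob r s (EFin \o f)).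
- under eq_integral do rewrite -EFinM.
  rewrite (@affine_subst r s (fun x => f x * normal_pdf r s x))//.
  + rewrite (@integral_gauss (fun x => (f (r + s * x))%:E)).
    * by apply: eq_integral => x _; rewrite -mulrA normal_pdf_affine// EFinM.
    * by apply/measurable_EFinP; apply: continuous_measurable_fun; exact: comp_affine_continuous.
    * by move=> x; rewrite lee_fin.
  + by move=> x; apply: cvgM; [exact: cf|apply: continuous_normal_pdf; rewrite gt_eqF].
  + by move=> x; rewrite mulr_ge0// normal_pdf_ge0.
- exact/measurable_EFinP.
- by move=> x; rewrite lee_fin.
Qed.

Lemma integral_gauss_cont f : continuous f -> (forall x, 0 <= f x) ->
  (\int[gauss]_x (f x)%:E = \int[leb]_x ((f x)%:E * (normal_pdf 0 1 x)%:E))%E.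
Proof.
move=> cf f0; apply: (@integral_gauss (EFin \o f)); last by move=> x; rewrite lee_fin.
by apply/measurable_EFinP; exact: continuous_measurable_fun.
Qed.

Lemma gauss_sym f : continuous f -> (forall x, 0 <= f x) ->
  (\int[gauss]_x (f x)%:E = \int[gauss]_x (f (- x)%R)%:E)%E.
Proof.
move=> cf f0.
have cN : continuous (-%R : R -> R) by move=> x; exact: opp_continuous.
have mN : measurable_fun [set: RB] (-%R : RB -> RB) by exact: continuous_measurable_fun.
have cf' : continuous (fun x => f (- x)).
  by move=> x; apply: (@continuous_comp _ _ _ -%R f); [exact: cN|exact: cf].
rewrite (integral_gauss_cont cf f0) (integral_gauss_cont cf')//.
transitivity (\int[pushforward leb (-%R : RB -> RB)]_x ((f x)%:E * (normal_pdf 0 1 x)%:E))%E.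
  by apply: eq_measure_integral => //= A mA AS; exact/esym/lebesgue_measureN.
rewrite ge0_integral_pushforward.
- apply: eq_integral => x _; congr (_ * _%:E)%E.
  by rewrite !normal_pdfE ?oner_eq0// /normal_fun !subr0 sqrrN.
- exact: mN.
- exact: measurableT.
- apply: emeasurable_funM.
    by apply/measurable_EFinP; exact: continuous_measurable_fun.
  by apply/measurable_EFinP; exact: measurable_normal_pdf.
- by move=> x _; apply: mule_ge0; rewrite lee_fin; [exact: f0|exact: normal_pdf_ge0].
Qed.

(** The density of N(0, 1) is compared with that of N(0, 2), which leaves a factor exp(-x^2/4).
    Since exp(x^2/8) >= 1 + x^2/8, squaring gives x^4 exp(-x^2/4) <= 64, whence the constant. *)
Lemma gauss_pow4 : L1 gauss (fun x => x ^+ 4).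
Proof.
have m4 : measurable_fun [set: RB] (fun x : R => x ^+ 4).
  by apply: continuous_measurable_fun; exact: exprn_continuous.
apply/integrableP; split; first exact/measurable_EFinP.
under eq_integral => x _ do rewrite /= ger0_norm ?exprn_even_ge0//.
rewrite (@integral_gauss (fun x => (x ^+ 4)%:E)); last 2 first.
- exact/measurable_EFinP.
- by move=> x; rewrite lee_fin exprn_even_ge0.
have s2 : 0 < Num.sqrt 2 :> R by rewrite sqrtr_gt0.
pose c : R := 64 * (normal_peak 1 / normal_peak (Num.sqrt 2)).
have c0 : 0 <= c by rewrite mulr_ge0// divr_ge0// normal_peak_ge0.
apply: (@le_lt_trans _ _ (\int[leb]_x (c%:E * (normal_pdf 0 (Num.sqrt 2) x)%:E))%E).
  apply: ge0_le_integral => //.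
  - by move=> x _; rewrite -EFinM lee_fin mulr_ge0 ?exprn_even_ge0 ?normal_pdf_ge0.
  - by apply/measurable_EFinP; apply: measurable_funM => //; exact: measurable_normal_pdf.
  - by apply/measurable_EFinP; apply: measurable_funM => //; exact: measurable_normal_pdf.
  move=> x _; rewrite -!EFinM lee_fin /c !normal_pdfE ?gt_eqF// /normal_fun !subr0.
  have -> : 64 * (normal_peak 1 / normal_peak (Num.sqrt 2)) * (normal_peak (Num.sqrt 2) *
      expR (- x ^+ 2 / (Num.sqrt 2 ^+ 2 *+ 2))) =
      64 * (normal_peak 1 * expR (- x ^+ 2 / (Num.sqrt 2 ^+ 2 *+ 2))) :> R.
    by rewrite -!mulrA mulKf// gt_eqF// normal_peak_gt0// gt_eqF.
  rewrite mulrCA [leRHS]mulrCA ler_wpM2l ?normal_peak_ge0//.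
  rewrite sqr_sqrtr// expr1n.
  have -> : - x ^+ 2 / (1 *+ 2) = - x ^+ 2 / (2 *+ 2) + - (x ^+ 2 / 4) by field.
  rewrite expRD mulrCA -[leRHS]mulrC ler_wpM2l ?expR_ge0// expRN.
  rewrite -ler_pdivlMr ?invr_gt0 ?expR_gt0// invrK.
  have -> : x ^+ 2 / 4 = x ^+ 2 / 8 + x ^+ 2 / 8 by field.
  rewrite expRD; have := expR_ge1Dx (x ^+ 2 / 8); have := sqr_ge0 x.
  set y := x ^+ 2; set E := expR _; move=> y0 yE.
  have -> : x ^+ 4 = y ^+ 2 by rewrite -exprM.
  have : (1 + y / 8) * (1 + y / 8) <= E * E by apply: ler_pM => //; lra.
  nra.
rewrite integralZl//; last exact: integrable_normal_pdf.
by rewrite integral_normal_pdf mule1 ltry.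
Qed.

Lemma L1_gauss_le f g : continuous f -> L1 gauss g -> (forall x, `|f x| <= g x) -> L1 gauss f.
Proof.
by move=> cf lg fg; apply: L1_le lg fg; exact: continuous_measurable_fun.
Qed.

Lemma L1_gauss f (C : R) : continuous f -> (forall x, `|f x| <= C * (1 + x ^+ 4)) -> L1 gauss f.
Proof.
move=> cf fC; apply: L1_gauss_le cf _ fC.
by apply: L1Z; apply: L1D; [exact: L1_cst|exact: gauss_pow4].
Qed.

Lemma le_pow4 (x : R) : `|x| <= 1 + x ^+ 4 /\ x ^+ 2 <= 1 + x ^+ 4 /\ `|x ^+ 3| <= 1 + x ^+ 4.
Proof.
have -> : x ^+ 4 = (x ^+ 2) ^+ 2 by rewrite -exprM.
have -> : x ^+ 3 = x * x ^+ 2 by rewrite exprS.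
have y0 := sqr_ge0 x; set y := x ^+ 2 in y0 *.
have yE : y = x * x by rewrite /y expr2.
split; [|split].
- have := sqr_ge0 (x - 1); have := sqr_ge0 (x + 1); have := sqr_ge0 (y - 1).
  rewrite ler_norml !expr2; nra.
- have := sqr_ge0 (y - 1); nra.
- have := sqr_ge0 (x - y); have := sqr_ge0 (x + y); have := sqr_ge0 (y - 1).
  rewrite ler_norml !expr2; nra.
Qed.

Lemma Ex_gauss_sym f : continuous f -> L1 gauss f -> Ex gauss f = Ex gauss (fun x => f (- x)).
Proof.
move=> cf lf.
have cN : continuous (-%R : R -> R) by move=> x; exact: opp_continuous.
have cf' : continuous (fun x => f (- x)).
  by move=> x; apply: (@continuous_comp _ _ _ -%R f); [exact: cN|exact: cf].
pose p x := Num.max (f x) 0; pose m x := Num.max (- f x) 0.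
have cp : continuous p by apply: continuous_maxr => //; exact: continuous_const.
have cNf : continuous (fun x => - f x) by move=> x; apply: cvgN; exact: cf.
have cm : continuous m by apply: continuous_maxr => //; exact: continuous_const.
have p0 x : 0 <= p x by rewrite le_max lexx orbT.
have m0 x : 0 <= m x by rewrite le_max lexx orbT.
have fE x : f x = p x - m x.
  rewrite /p /m; case: (leP (f x) 0) => h; case: (leP (- f x) 0) => h'; lra.
have S (q : R -> R) : continuous q -> (forall x, 0 <= q x) -> (forall x, q x <= `|f x|) ->
    [/\ L1 gauss q, L1 gauss (fun x => q (- x)) & Ex gauss q = Ex gauss (fun x => q (- x))].
  move=> cq q0 qf.
  have lq : L1 gauss q.
    by apply: L1_gauss_le cq (L1_norm lf) _ => x; rewrite ger0_norm.
  have E := gauss_sym cq q0.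
  split=> //; last by rewrite /Ex /Rintegral E.
  apply/integrableP; split.
    apply/measurable_EFinP; apply: continuous_measurable_fun => x.
    by apply: (@continuous_comp _ _ _ -%R q); [exact: cN|exact: cq].
  under eq_integral do rewrite /= ger0_norm//.
  by rewrite -E Ex_int// ltry.
have [lp lp' pE] := S p cp p0 (fun x => ltac:(by rewrite /p ge_max normr_ge0 ler_norm)).
have [lm lm' mE] := S m cm m0 (fun x => ltac:(by rewrite /m ge_max normr_ge0 -normrN ler_norm)).
rewrite (eq_Ex gauss fE) (eq_Ex gauss (fun x => fE (- x))).
by rewrite (ExB lp lm) (ExB lp' lm') pE mE.
Qed.

Lemma Ex_gauss_odd f : continuous f -> L1 gauss f -> (forall x, f (- x) = - f x) ->
  Ex gauss f = 0.
Proof.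
move=> cf lf fN; have := Ex_gauss_sym cf lf.
rewrite (eq_Ex gauss fN).
have -> : Ex gauss (fun x => - f x) = - Ex gauss f.
  by rewrite -[RHS]mulN1r -ExZ//; apply: eq_Ex => x; rewrite mulN1r.
lra.
Qed.

(** The constant v of the martingale |Z|^2 - vt; its positivity is what lets second moments control
    times. *)
Definition gauss_var : R := Ex gauss (fun x => x ^+ 2).
Definition gauss_m4 : R := Ex gauss (fun x => x ^+ 4).

Lemma L1_gauss_exp k : (k <= 4)%N -> L1 gauss (fun x => x ^+ k).
Proof.
move=> k4; apply: (@L1_gauss _ 1); first exact: exprn_continuous.
move=> x; rewrite mul1r; have [h1 [h2 h3]] := le_pow4 x.
move: k k4; do 5? [case=> [_|]]; rewrite ?expr0 ?expr1 ?normr1//.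
- by rewrite lerDl exprn_even_ge0.
- by rewrite ger0_norm// sqr_ge0.
- by rewrite ger0_norm ?exprn_even_ge0// lerDr.
Qed.

Lemma gauss_var_ge0 : 0 <= gauss_var.
Proof. by apply: Ex_ge0 => x; exact: sqr_ge0. Qed.

Lemma gauss_m4_ge0 : 0 <= gauss_m4.
Proof. by apply: Ex_ge0 => x; exact: exprn_even_ge0. Qed.

(** A zero second moment would concentrate the law at the point 0, which is null because the law has
    a density. *)
Lemma gauss_var_gt0 : 0 < gauss_var.
Proof.
rewrite lt_neqAle gauss_var_ge0 andbT eq_sym; apply/eqP => v0.
have l2 := @L1_gauss_exp 2 isT.
have : ae_eq gauss [set: RB] (EFin \o (fun x : R => x ^+ 2)) (cst 0%E).
  apply/(ae_eq_integral_abs _ measurableT); first by case/integrableP : l2.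
  under eq_integral => x _ do rewrite /= ger0_norm ?sqr_ge0//.
  by rewrite Ex_int// -/gauss_var v0.
move=> [N [mN N0 NS]].
have N1 : gauss [set (0%R : RB)] = 0%E.
  by rewrite -[LHS]/(\int[leb]_(x in [set (0%R : RB)]) (normal_pdf 0 1 x)%:E)%E integral_set1.
have m1 : measurable [set (0%R : RB)] by exact: measurable_set1.
have : (gauss [set: RB] <= gauss N + gauss [set (0%R : RB)])%E.
  apply: le_trans (measureU2 _ mN m1); apply: le_measure; rewrite ?inE//.
    exact: measurableU.
  move=> x _; have [->|x0] := eqVneq x 0; first by right.
  left; apply: NS => /= /(_ Logic.I)[] /eqP; rewrite sqrf_eq0; exact/negP.
by rewrite N0 N1 add0e probability_setT lee_fin ler10.
Qed.

End gaussian.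

(** * One-dimensional semigroups *)

Lemma continuous_compR (R : realType) (T : topologicalType) (f : T -> R) (g : R -> R) :
  continuous f -> continuous g -> continuous (fun x => g (f x)).
Proof. by move=> cf cg x; apply: (@continuous_comp _ _ _ f g); [exact: cf|exact: cg]. Qed.

Lemma continuous_abs (R : realType) : continuous (fun x : R => `|x|).
Proof. by move=> x; exact: norm_continuous. Qed.

Lemma continuous_exprn (R : realType) k : continuous (fun x : R => x ^+ k).
Proof. exact: exprn_continuous. Qed.

Lemma continuous_idR (R : realType) : continuous (fun x : R => x).
Proof. by move=> x; exact: cvg_id. Qed.

Section half_line.
Context {R : realType}.
Implicit Types (g : R -> R) (r s t c : R).
Notation leb := (@lebesgue_measure R).
Notation RB := (measurableTypeR R).
Notation gauss := (@gauss R).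

(* With g 0 = 0, the semigroup of reflecting Brownian motion maps g to
   up s g r + up s g (- r), and the killed one to up s g r - up s g (- r). *)
Definition up s g r : R := Ex gauss (fun x => g (Num.max 0 (r + s * x))).

(** The value 0 at the origin lets the reflecting and killed semigroups be written with [up], and
    makes h(angle z) g(|z|) continuous at the origin. The growth bound is that of the highest moment
    in use. *)
Definition quartic g : Prop :=
  [/\ continuous g, g 0 = 0 & forall x, 0 <= g x <= 1 + x ^+ 4].

Lemma pos_affine_continuous r s g : continuous g -> continuous (fun x => g (Num.max 0 (r + s * x))).
Proof.
move=> cg x; apply: (@continuous_comp _ _ _ (fun x => Num.max 0 (r + s * x)) g); last exact: cg.
by apply: continuous_maxr; [exact: continuous_const|exact: affine_continuous].
Qed.

Lemma pow4_max (y : R) : (Num.max 0 y) ^+ 4 <= y ^+ 4.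
Proof. by rewrite maxEle; case: ifP => // _; rewrite expr0n/= exprn_even_ge0. Qed.

Lemma pow4_affine r s (x : R) : (r + s * x) ^+ 4 <= 8 * r ^+ 4 + 8 * s ^+ 4 * x ^+ 4.
Proof.
rewrite -[8 * s ^+ 4 * _]mulrA -exprMn; set y := s * x.
have P (a : R) : a ^+ 4 = (a ^+ 2) ^+ 2 by rewrite -exprM.
rewrite !P; have h1 : (r + y) ^+ 2 <= 2 * (r ^+ 2 + y ^+ 2).
  have := sqr_ge0 (r - y); rewrite !expr2; nra.
have := sqr_ge0 (r ^+ 2 - y ^+ 2); have := sqr_ge0 (r + y).
set a := (r + y) ^+ 2 in h1 *; set b := r ^+ 2 in h1 *; set e := y ^+ 2 in h1 *.
rewrite !expr2 => a0 be.
have : a * a <= (2 * (b + e)) * (2 * (b + e)) by apply: ler_pM.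
nra.
Qed.

Lemma quartic_up g r s x : quartic g ->
  0 <= g (Num.max 0 (r + s * x)) <= (1 + 8 * r ^+ 4 + 8 * s ^+ 4) * (1 + x ^+ 4).
Proof.
move=> [_ _ gb]; have /andP[-> /= h] := gb (Num.max 0 (r + s * x)).
apply: le_trans h _; have h1 := pow4_max (r + s * x); have h2 := pow4_affine r s x.
have r0 : 0 <= r ^+ 4 by rewrite exprn_even_ge0.
have s0 : 0 <= s ^+ 4 by rewrite exprn_even_ge0.
have x0 : 0 <= x ^+ 4 by rewrite exprn_even_ge0.
have := mulr_ge0 r0 x0.
lra.
Qed.

Lemma L1_up g r s : quartic g -> L1 gauss (fun x => g (Num.max 0 (r + s * x))).
Proof.
move=> qg; have [cg _ _] := qg.
apply: (@L1_gauss _ _ (1 + 8 * r ^+ 4 + 8 * s ^+ 4)); first exact: pos_affine_continuous.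
by move=> x; have /andP[h1 h2] := quartic_up r s x qg; rewrite ger0_norm.
Qed.

Lemma up_ge0 g r s : quartic g -> 0 <= up s g r.
Proof. by move=> qg; apply: Ex_ge0 => x; have /andP[] := quartic_up r s x qg. Qed.

Lemma up_le g r s : quartic g -> up s g r <= (1 + 8 * r ^+ 4 + 8 * s ^+ 4) * (1 + gauss_m4).
Proof.
move=> qg; have l4 := @gauss_pow4 R.
have l14 : L1 gauss (fun x => 1 + x ^+ 4) by apply: L1D; [exact: L1_cst|].
apply: le_trans (le_Ex (L1_up r s qg) (L1Z (1 + 8 * r ^+ 4 + 8 * s ^+ 4) l14) _) _.
  by move=> x; have /andP[] := quartic_up r s x qg.
by rewrite ExZ// ExD// ?Ex_cst//; exact: L1_cst.
Qed.

Lemma measurable_up s g : quartic g -> measurable_fun [set: R] (up s g).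
Proof.
move=> qg; have [cg _ _] := qg.
pose f (z : RB * RB) : \bar R := (g (Num.max 0 (z.1 + s * z.2)))%:E.
have mf : measurable_fun setT f.
  apply/measurable_EFinP; apply: (@measurableT_comp _ _ _ _ _ _ g).
    exact: continuous_measurable_fun.
  apply: measurable_maxr => //; apply: measurable_funD => //.
  by apply: measurable_funM => //; exact: measurable_snd.
have := @measurable_fun_fubini_tonelli_F _ _ RB RB R gauss f.
have f0 z : (0 <= f z)%E by have /andP[] := quartic_up z.1 s z.2 qg; rewrite lee_fin.
move=> /(_ mf f0) H.
have : measurable_fun setT (fine \o fubini_F gauss f) by apply: measurableT_comp.
by [].
Qed.

Lemma norm_max_sum g (y : R) : g 0 = 0 -> g `|y| = g (Num.max 0 y) + g (Num.max 0 (- y)).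
Proof.
move=> g0; have [y0|y0] := leP 0 y.
  by rewrite ger0_norm// [Num.max 0 (- y)]max_l ?oppr_le0// g0 addr0.
by rewrite ltr0_norm// [Num.max 0 (- y)]max_r ?g0 ?add0r// oppr_ge0 ltW.
Qed.

(** Since g(0) = 0, g(|y|) is the sum of g at the positive and at the negative part of y; the
    symmetry of the Gaussian law turns the negative part of r + sX into the positive part of -r +
    sX. *)
Lemma Ex_norm_up g r s : quartic g ->
  Ex gauss (fun x => g `|r + s * x|) = up s g r + up s g (- r).
Proof.
move=> qg; have [cg g0 _] := qg.
have -> : up s g (- r) = Ex gauss (fun x => g (Num.max 0 (- (r + s * x)))).
  rewrite /up (Ex_gauss_sym (@pos_affine_continuous (- r) s _ cg) (L1_up _ _ qg)).
  by apply: eq_Ex => x; rewrite opprD mulrN.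
rewrite -ExD//; first by apply: eq_Ex => x; exact: norm_max_sum.
  exact: L1_up.
by apply: eq_L1 (L1_up (- r) (- s) qg) => x /=; rewrite opprD mulNr.
Qed.

Lemma reflecting_sgE t g r : 0 < t -> quartic g ->
  reflecting_sg t g r = up (Num.sqrt t) g r + up (Num.sqrt t) g (- r).
Proof.
move=> t0 qg; have [cg g0 gb] := qg.
have s0 : 0 < Num.sqrt t by rewrite sqrtr_gt0.
rewrite -(Ex_norm_up _ _ qg) /reflecting_sg (gt_eqF t0) /Ex /Rintegral.
have cgn : continuous (fun x : R => g `|x|).
  by apply: continuous_compR cg; exact: continuous_abs.
have gn0 (x : R) : 0 <= g `|x| by have /andP[] := gb `|x|.
exact (congr1 fine (@normal_affine R r (Num.sqrt t) (fun x => g `|x|) s0 cgn gn0)).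
Qed.

Lemma killed_halfE s g r : 0 < s -> quartic g ->
  leb.-integrable `]0, +oo[%classic (fun x => (g x * normal_pdf r s x)%:E) /\
  \int[leb]_(x in `]0, +oo[) (g x * normal_pdf r s x) = up s g r.
Proof.
move=> s0 qg; have [cg g0 gb] := qg.
pose gp (x : R) := g (Num.max 0 x).
have cgp : continuous gp.
  apply: continuous_compR cg; apply: continuous_maxr; first exact: continuous_const.
  exact: continuous_idR.
have gp0 x : 0 <= gp x by have /andP[] := gb (Num.max 0 x).
have mgp : measurable_fun [set: R] gp by exact: continuous_measurable_fun.
have E : (\int[leb]_(x in `]0%R, +oo[) (g x * normal_pdf r s x)%:E = (up s g r)%:E)%E.
  rewrite -Ex_int; last exact: L1_up.
  have -> := esym (@normal_affine R r s gp s0 cgp gp0).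
  rewrite (@integral_normal_prob R r s (EFin \o gp)).
  - rewrite integral_mkcond; apply: eq_integral => x _; rewrite patchE.
    case: ifPn; rewrite ?in_setE ?notin_setE/= in_itv/= andbT.
      by move=> x0; rewrite /gp max_r// ltW.
    by move=> /negP; rewrite -leNgt => x0; rewrite /gp max_l// g0 mul0e.
  - exact/measurable_EFinP.
  - by move=> x; rewrite lee_fin.
split; last by rewrite /Rintegral E.
apply/integrableP; split.
  apply/measurable_EFinP; apply: measurable_funTS; apply: measurable_funM.
    exact: continuous_measurable_fun.
  exact: measurable_normal_pdf.
under eq_integral => x _.
  rewrite /= ger0_norm; last by rewrite mulr_ge0 ?normal_pdf_ge0//; have /andP[] := gb x.
  over.
by rewrite E ltry.
Qed.

Lemma killed_sgE t g c r : 0 < t -> quartic g ->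
  killed_sg t (fun x => c * g x) r = c * (up (Num.sqrt t) g r - up (Num.sqrt t) g (- r)).
Proof.
move=> t0 qg; have s0 : 0 < Num.sqrt t by rewrite sqrtr_gt0.
have [i1 <-] := killed_halfE r s0 qg; have [i2 <-] := killed_halfE (- r) s0 qg.
have mI : measurable (`]0%R, +oo[%classic : set RB) by exact: measurable_itv.
rewrite -(RintegralB mI i1 i2) -(RintegralZl _ mI).
  rewrite /killed_sg (gt_eqF t0).
  by apply: eq_Rintegral => x _; rewrite -mulrBr mulrA.
rewrite [X in leb.-integrable _ X](_ : _ = (fun x => (g x * normal_pdf r (Num.sqrt t) x)%:E) \-
   (fun x => (g x * normal_pdf (- r) (Num.sqrt t) x)%:E))%E; last exact/funext.
exact: integrableB.
Qed.

Lemma eq_killed_sg t (f h : R -> R) r : 0 < t -> (forall x, 0 < x -> f x = h x) ->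
  killed_sg t f r = killed_sg t h r.
Proof.
move=> t0 fh; rewrite /killed_sg (gt_eqF t0); apply: eq_Rintegral => x.
by rewrite inE/= in_itv/= andbT => x0; rewrite fh.
Qed.

Lemma eq_reflecting_sg t (f h : R -> R) r : 0 < t -> (forall x, 0 <= x -> f x = h x) ->
  reflecting_sg t f r = reflecting_sg t h r.
Proof.
by move=> t0 fh; rewrite /reflecting_sg (gt_eqF t0); apply: eq_Rintegral => x _; rewrite fh.
Qed.

Definition powabs (k : nat) (x : R) : R := `|x| ^+ k.

Lemma quartic_powabs k : (0 < k <= 4)%N -> quartic (powabs k).
Proof.
move=> /andP[k0 k4]; split.
- by apply: (@continuous_compR _ _ _ (fun x : R => x ^+ k)); [exact: continuous_abs|exact: continuous_exprn].
- by rewrite /powabs normr0 expr0n gtn_eqF.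
- move=> x; rewrite /powabs exprn_ge0//=; have [h1 [h2 h3]] := le_pow4 x.
  move: k k0 k4 => [//|[|[|[|[|//]]]]] _ _; rewrite ?expr1//.
  + by rewrite real_normK ?num_real.
  + by rewrite -normrX.
  + by rewrite -normrX ger0_norm ?exprn_even_ge0// lerDr.
Qed.

(** Vanishes beyond radius j, so that it leads to functions of C_0; it increases with j and equals
    [g] at a given point as soon as j is large. *)
Definition cutoff g (j : nat) (x : R) : R := Num.max 0 (Num.min (g x) (j%:R - `|x|)).

Lemma cutoff_le g j x : 0 <= g x -> 0 <= cutoff g j x <= g x.
Proof. by move=> g0; rewrite /cutoff le_max lexx/= ge_max g0/= ge_min lexx. Qed.

Lemma quartic_cutoff g j : quartic g -> quartic (cutoff g j).
Proof.
move=> [cg g0 gb]; split.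
- apply: continuous_maxr; first exact: continuous_const.
  apply: continuous_minr => //; apply: continuous_sub; first exact: continuous_const.
  by move=> ?; exact: norm_continuous.
- by rewrite /cutoff g0 normr0 subr0 min_l ?maxxx.
- move=> x; have /andP[h1 h2] := gb x.
  by have /andP[-> h] := cutoff_le j h1; exact: le_trans h2.
Qed.

Lemma cutoff_bound g j x : cutoff g j x <= j%:R.
Proof. by rewrite /cutoff ge_max ler0n/= ge_min gerBl normr_ge0 orbT. Qed.

Lemma cutoff_eq0 g j x : 0 <= g x -> j%:R <= `|x| -> cutoff g j x = 0.
Proof. by move=> g0 jx; apply/max_idPl; rewrite ge_min subr_le0 jx orbT. Qed.

Lemma cutoff_nd g x : 0 <= g x -> {homo (cutoff g) ^~ x : n m / (n <= m)%N >-> n <= m}.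
Proof.
move=> g0 n m nm; rewrite /cutoff ge_max le_max lexx/= le_max; apply/orP; right.
rewrite le_min !ge_min lexx/=; apply/orP; right; by rewrite lerD2r ler_nat.
Qed.

Lemma cutoff_cvg g x : 0 <= g x -> cutoff g ^~ x @ \oo --> g x.
Proof.
move=> g0; apply: cvg_near_cst; near=> j.
rewrite /cutoff min_l ?max_r// lerBrDr; near: j; exact: nbhs_infty_ger.
Unshelve. all: by end_near. Qed.

Lemma up_cutoff_le g r s j : quartic g -> up s (cutoff g j) r <= up s g r.
Proof.
move=> qg; have [cg g0 gb] := qg.
apply: le_Ex; [exact: L1_up (quartic_cutoff j qg)|exact: L1_up|].
by move=> x; have /andP[h _] := gb (Num.max 0 (r + s * x)); have /andP[] := cutoff_le j h.
Qed.

Lemma up_cutoff_cvg g r s : quartic g -> (fun j => up s (cutoff g j) r) @ \oo --> up s g r.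
Proof.
move=> qg; have [cg g0 gb] := qg.
apply: (@Ex_dct _ RB R gauss (fun j x => cutoff g j (Num.max 0 (r + s * x)))
  (fun x => g (Num.max 0 (r + s * x))) (fun x => g (Num.max 0 (r + s * x))) _ _ _ _).2.
- move=> j; apply: continuous_measurable_fun; apply: pos_affine_continuous.
  by have [] := quartic_cutoff j qg.
- exact: L1_up.
- move=> j x; have /andP[h _] := gb (Num.max 0 (r + s * x)).
  by have /andP[h1 h2] := cutoff_le j h; rewrite ger0_norm.
- by move=> x; apply: cutoff_cvg; have /andP[] := gb (Num.max 0 (r + s * x)).
Qed.

(** The expectation of the negative part of r + sX, with X standard normal. Reflection at 0 raises
    the mean of r + sX by twice this amount. *)
Definition excess s r : R := up s (powabs 1) (- r).

Lemma excess_ge0 s r : 0 <= excess s r.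
Proof. by apply: up_ge0; exact: quartic_powabs. Qed.

Lemma up1E s r : up s (powabs 1) r = r + excess s r.
Proof.
have q1 : quartic (powabs 1) by exact: quartic_powabs.
have [cg _ _] := q1.
have -> : excess s r = Ex gauss (fun x => powabs 1 (Num.max 0 (- (r + s * x)))).
  rewrite /excess /up (Ex_gauss_sym (@pos_affine_continuous (- r) s _ cg) (L1_up _ _ q1)).
  by apply: eq_Ex => x; rewrite opprD mulrN.
have lr : L1 gauss (fun x => r + s * x).
  apply: L1D; first exact: L1_cst.
  by apply: L1Z; exact: (@L1_gauss_exp R 1).
have rE : r = Ex gauss (fun x => r + s * x).
  rewrite ExD; [|exact: L1_cst|by apply: L1Z; exact: (@L1_gauss_exp R 1)].
  rewrite Ex_cst ExZ; last exact: (@L1_gauss_exp R 1).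
  rewrite (@Ex_gauss_odd _ (fun x => x)) ?mulr0 ?addr0//; first by move=> ?; exact: cvg_id.
  exact: (@L1_gauss_exp R 1).
rewrite [X in X + _]rE -ExD//; last first.
  by apply: eq_L1 (L1_up (- r) (- s) q1) => x /=; rewrite opprD mulNr.
apply: eq_Ex => x; rewrite /powabs !expr1 !ger0_norm ?le_max ?lexx//.
by case: (leP 0 (r + s * x)) => h; case: (leP 0 (- (r + s * x))) => h'; lra.
Qed.

(** Where y = sX exceeds r, one has y - r <= y <= y^4 / r^3. The fourth power is chosen because s^4
    = t^2 when s is the square root of the time t: such errors sum to 0 along a mesh. *)
Lemma excess_le s r : 0 < r -> excess s r <= s ^+ 4 * gauss_m4 / r ^+ 3.
Proof.
move=> r0; rewrite mulrAC -ExZ; last exact: gauss_pow4.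
apply: le_Ex; [by apply: L1_up; exact: quartic_powabs|by apply: L1Z; exact: gauss_pow4|].
move=> x; rewrite /powabs expr1 mulrAC -exprMn ler_pdivlMr ?exprn_gt0//.
set y := s * x; have [h|h] := leP 0 (- r + y); last first.
  by rewrite normr0 mul0r exprn_even_ge0.
have ry : r <= y by lra.
rewrite ger0_norm// (@le_trans _ _ (y * y ^+ 3))// -?exprS//.
by apply: ler_pM; rewrite ?exprn_ge0 ?lerXn2r ?nnegrE//; lra.
Qed.

Lemma excess_bound s r : 0 <= r -> excess s r <= 1 + s ^+ 2 * gauss_var.
Proof.
move=> r0; have l2 : L1 gauss (fun x => x ^+ 2) by exact: (@L1_gauss_exp R 2).
rewrite -ExZ// -[1](@Ex_cst _ _ _ gauss) -ExD; [|exact: L1_cst|exact: L1Z].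
apply: le_Ex; [by apply: L1_up; exact: quartic_powabs|by apply: L1D; [exact: L1_cst|exact: L1Z]|].
move=> x; rewrite /powabs expr1 -exprMn; set y := s * x.
have := sqr_ge0 (y - 1); have := sqr_ge0 y; rewrite !expr2.
case: (leP 0 (- r + y)) => h; first by rewrite ger0_norm//; nra.
by rewrite normr0; nra.
Qed.

Lemma up2E s r : up s (powabs 2) r + up s (powabs 2) (- r) = r ^+ 2 + s ^+ 2 * gauss_var.
Proof.
have l1 : L1 gauss (fun x => x) by exact: (@L1_gauss_exp R 1).
have l2 : L1 gauss (fun x => x ^+ 2) by exact: (@L1_gauss_exp R 2).
rewrite -Ex_norm_up; last exact: quartic_powabs.
rewrite (eq_Ex gauss (g := fun x => r ^+ 2 + (2 * r * s * x + s ^+ 2 * x ^+ 2))); last first.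
  by move=> x; rewrite /powabs normr_id real_normK ?num_real//; ring.
rewrite ExD; [|exact: L1_cst|by apply: L1D; exact: L1Z].
rewrite ExD; [|exact: L1Z|exact: L1Z].
rewrite Ex_cst !ExZ// (@Ex_gauss_odd _ (fun x => x))//; first by rewrite mulr0 add0r.
by move=> ?; exact: cvg_id.
Qed.

Lemma up4E s r : up s (powabs 4) r + up s (powabs 4) (- r) =
  r ^+ 4 + 6 * r ^+ 2 * s ^+ 2 * gauss_var + s ^+ 4 * gauss_m4.
Proof.
have l1 : L1 gauss (fun x => x) by exact: (@L1_gauss_exp R 1).
have l2 : L1 gauss (fun x => x ^+ 2) by exact: (@L1_gauss_exp R 2).
have l3 : L1 gauss (fun x => x ^+ 3) by exact: (@L1_gauss_exp R 3).
have l4 : L1 gauss (fun x => x ^+ 4) by exact: (@L1_gauss_exp R 4).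
rewrite -Ex_norm_up; last exact: quartic_powabs.
rewrite (eq_Ex gauss (g := fun x => r ^+ 4 + (4 * r ^+ 3 * s * x + (6 * r ^+ 2 * s ^+ 2 * x ^+ 2 +
   (4 * r * s ^+ 3 * x ^+ 3 + s ^+ 4 * x ^+ 4))))); last first.
  by move=> x; rewrite /powabs normr_id -normrX ger0_norm ?exprn_even_ge0//; ring.
rewrite ExD; [|exact: L1_cst|by do 3 (apply: L1D; first exact: L1Z); exact: L1Z].
rewrite ExD; [|exact: L1Z|by do 2 (apply: L1D; first exact: L1Z); exact: L1Z].
rewrite ExD; [|exact: L1Z|by do 1 (apply: L1D; first exact: L1Z); exact: L1Z].
rewrite ExD; [|exact: L1Z|exact: L1Z].
rewrite Ex_cst !ExZ// (@Ex_gauss_odd _ (fun x => x))//; last by move=> ?; exact: cvg_id.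
rewrite (@Ex_gauss_odd _ (fun x => x ^+ 3))//; last 2 first.
- exact: exprn_continuous.
- by move=> x; ring.
by rewrite !mulr0 !add0r addrA.
Qed.

End half_line.

(** * Moment identities for Walsh Brownian motion *)

Lemma measurable_neg {d} {T : measurableType d} {R : realType} (f : T -> R) :
  measurable_fun setT f -> measurable_fun setT (fun w => - f w).
Proof. by move=> mf; under eq_fun do rewrite -sub0r; exact: measurable_funB. Qed.

Lemma measurable_excess {R : realType} (s : R) : measurable_fun setT (excess s).
Proof.
apply: (measurableT_comp (@measurable_up R s (powabs 1) (@quartic_powabs R 1 isT))).
exact: measurable_neg.
Qed.

Section test_functions.
Context {R : realType} {n : nat} (kappa : probability 'rV[R]_n R).
Hypothesis kappaS : kappa (sphere R n) = 1%E.
Implicit Types (h : 'rV[R]_n -> R) (g : R -> R).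

(** For these products the average over the rays factorizes, which makes the semigroup explicit. *)
Definition polar_test h g (z : 'rV[R]_n) : R := h (angle z) * g (enorm z).

(** The angle jumps at the origin, but [h] takes values in [0, 1] and g(0) = 0, so that the product
    is squeezed there between 0 and g(|z|). *)
Lemma polar_test_continuous h g : continuous h -> (forall x, 0 <= h x <= 1) ->
  quartic g -> continuous (polar_test h g).
Proof.
move=> ch h01 [cg g0 gb] z.
have cgn : continuous (fun z : 'rV[R]_n => g (enorm z)).
  by apply: continuous_compR cg; exact: enorm_continuous.
have [->|z0] := eqVneq z 0; last first.
  apply: (@cvgM _ _ (nbhs z) _ (fun z => h (angle z)) (fun z => g (enorm z))); last exact: cgn.
  apply: (@continuous_comp _ _ _ (@angle R n) h); last exact: ch.
  exact: angle_continuous.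
have E0 : polar_test h g 0 = 0 by rewrite /polar_test enorm0 g0 mulr0.
apply: (@squeeze_cvgr _ (nbhs (0 : 'rV[R]_n)) _ _ (fun=> 0) (fun z => g (enorm z))).
- apply: nearW => x; rewrite /polar_test.
  have /andP[h0 h1] := h01 (angle x); have /andP[gx _] := gb (enorm x).
  by rewrite mulr_ge0//= ler_piMl.
- by rewrite E0; exact: cvg_cst.
- by have := cgn 0; rewrite /continuous_at E0 enorm0 g0.
Qed.

Lemma polar_test_C0 h g j : continuous h -> (forall x, 0 <= h x <= 1) ->
  quartic g -> C0 kappa (polar_test h (cutoff g j)).
Proof.
move=> ch h01 qg; have [cg g0 gb] := qg; split.
  apply: continuous_subspaceT; apply: polar_test_continuous => //.
  exact: quartic_cutoff.
move=> e e0; exists j%:R => z _ zj; rewrite /polar_test cutoff_eq0 ?mulr0 ?normr0//.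
  by have /andP[] := gb (enorm z).
by rewrite ger0_norm ?enorm_ge0// ltW.
Qed.

Definition avg h : R := \int[kappa]_(x in msupp kappa) h x.

Lemma kappa_integrable h : measurable_fun setT h -> (forall x, 0 <= h x <= 1) ->
  kappa.-integrable (msupp kappa) (EFin \o h).
Proof.
move=> mh h01; apply: (@integrableS _ _ _ kappa setT) => //.
  exact: measurable_msupp.
by apply: (@L1_bounded _ _ _ kappa h 1) => // x; have /andP[h0 h1] := h01 x; rewrite ger0_norm.
Qed.

Lemma avg_Ex h : measurable_fun setT h -> (forall x, 0 <= h x <= 1) -> avg h = Ex kappa h.
Proof.
move=> mh h01; rewrite /avg /Ex /Rintegral; congr fine.
rewrite -(@setUv _ (msupp kappa)) ge0_integral_setU//.
- rewrite [X in (_ + X)%E]null_set_integral ?adde0//.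
  + exact: measurableC (measurable_msupp kappa).
  + by apply/measurable_EFinP; exact: measurable_funTS.
  + exact: msupp_full.
- exact: measurable_msupp.
- exact: measurableC (measurable_msupp kappa).
- by apply/measurable_EFinP; exact: measurable_funTS.
- by move=> x _; have /andP[h0 h1] := h01 x; rewrite lee_fin.
- by rewrite disj_set2E setICr.
Qed.

Lemma avg01 h : measurable_fun setT h -> (forall x, 0 <= h x <= 1) -> 0 <= avg h <= 1.
Proof.
move=> mh h01; rewrite avg_Ex//; apply/andP; split.
  by apply: Ex_ge0 => x; have /andP[] := h01 x.
rewrite -[leRHS](@Ex_cst _ _ _ kappa); apply: le_Ex; last by move=> x; have /andP[] := h01 x.
  by apply: (@L1_bounded _ _ _ kappa h 1) => // x; have /andP[h0 h1] := h01 x; rewrite ger0_norm.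
exact: L1_cst.
Qed.

Lemma spin_average_polar h g r : continuous h -> (forall x, 0 <= h x <= 1) -> g 0 = 0 -> 0 <= r ->
  spin_average kappa (polar_test h g) r = avg h * g r.
Proof.
move=> ch h01 g0 r0; rewrite /spin_average /avg mulrC -RintegralZl.
- apply: eq_Rintegral => x; rewrite inE => /(msupp_sphere kappaS) xS.
  rewrite /polar_test enormZ_sphere// mulrC.
  move: r0; rewrite le_eqVlt => /predU1P[<-|r0]; first by rewrite g0 !mul0r.
  by rewrite angleZ.
- exact: measurable_msupp.
- by apply: kappa_integrable => //; exact: continuous_measurable_rV.
Qed.

Lemma up_scale s c g r : quartic g -> up s (fun x => c * g x) r = c * up s g r.
Proof. by move=> qg; rewrite /up ExZ//; exact: L1_up. Qed.

(** [c] stands for the average of the angular factor under kappa and [a] for its value at the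
    starting angle. Paths that have touched 0 contribute 2 [up s g (- r)], on a fresh ray; the
    others contribute [up s g r - up s g (- r)], on the old ray. *)
Definition two_part (c a : R) s g r : R := c * (2 * up s g (- r)) + a * (up s g r - up s g (- r)).

Lemma walsh_sg_polar t h g z : 0 < t -> continuous h -> (forall x, 0 <= h x <= 1) -> quartic g ->
  walsh_sg kappa t (polar_test h g) z =
  two_part (avg h) (h (angle z)) (Num.sqrt t) g (enorm z).
Proof.
move=> t0 ch h01 qg; have [cg g0 gb] := qg.
have mh := continuous_measurable_rV ch; have /andP[a0 a1] := avg01 mh h01.
have qag : quartic (fun x => avg h * g x).
  split.
  - by apply: continuous_mul => //; exact: continuous_const.
  - by rewrite g0 mulr0.
  - move=> x; have /andP[gx0 gx1] := gb x; rewrite mulr_ge0//=.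
    by apply: le_trans gx1; rewrite ler_piMl.
have rE r : reflecting_sg t (spin_average kappa (polar_test h g)) r =
    avg h * (up (Num.sqrt t) g r + up (Num.sqrt t) g (- r)).
  rewrite (@eq_reflecting_sg _ _ _ (fun x => avg h * g x))//; last first.
    by move=> x x0; exact: spin_average_polar.
  by rewrite (reflecting_sgE _ t0 qag) !up_scale// mulrDr.
(* At the origin r = - r = 0, so the part on the old ray vanishes whatever value [angle] takes
   there. *)
rewrite /walsh_sg; have [->|z0] := eqVneq z 0.
  by rewrite rE enorm0 /two_part oppr0 subrr mulr0 addr0 mulr2n mulrDl mul1r.
rewrite rE (@eq_killed_sg _ _ _ (fun x => (h (angle z) - avg h) * g x))//; last first.
  move=> x x0; rewrite spin_average_polar ?ltW// /polar_test angleZ//; last exact: angle_sphere.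
  by rewrite enormZ_sphere ?ltW//; [rewrite mulrBl|exact: angle_sphere].
by rewrite (killed_sgE _ _ t0 qg) /two_part; ring.
Qed.

End test_functions.

(** * The Markov property between fixed times, extended to unbounded functions *)

Section markov.
Context {R : realType} {n : nat} {d : measure_display} {T : measurableType d}.
Variables (P : probability T R) (kappa : probability 'rV[R]_n R) (Z : R -> T -> 'rV[R]_n).
Hypothesis kappaS : kappa (sphere R n) = 1%E.
Hypothesis wbmZ : walsh_brownian_motion P kappa Z.
Hypothesis Z0 : {ae P, forall w, Z 0 w = 0}.
Implicit Types (h : 'rV[R]_n -> R) (g : R -> R) (s t : R).

Lemma natural_filtration_measurable s A : natural_filtration Z s A -> measurable A.
Proof.
apply: smallest_sub; first exact: sigma_algebra_measurable.
move=> B [u /=]; rewrite in_itv/= => /andP[u0 us] [C mC <-].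
exact: (wbm_measurable wbmZ u0).
Qed.

Lemma natural_filtration_le s t : s <= t -> natural_filtration Z s `<=` natural_filtration Z t.
Proof.
move=> st; apply: sub_smallest2r; first exact: smallest_sigma_algebra.
move=> B [u /=]; rewrite in_itv/= => /andP[u0 us] uB.
by exists u => //=; rewrite in_itv/= u0 (le_trans us).
Qed.

Lemma natural_filtration_T s : natural_filtration Z s setT.
Proof. exact: (@measurableT _ (g_sigma_algebraType _)). Qed.

(** A constant time is a stopping time. The dynamics of the process enters through this identity;
    random times are reached later by optional stopping. *)
Lemma markov_deterministic s t A f : 0 <= s -> 0 <= t -> natural_filtration Z s A ->
  C0 kappa f ->
  \int[P]_(w in A) f (Z (s + t) w) = \int[P]_(w in A) walsh_sg kappa t f (Z s w).
Proof.
move=> s0 t0 FA f0; have := wbm_strong_markov wbmZ.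
have st : stopping_time Z (fun=> s%:E).
  split=> [w|u u0]; first by rewrite lee_fin.
  have [su|su] := leP s u.
    rewrite (_ : [set _ | _] = setT); first exact: natural_filtration_T.
    by apply/seteqP; split => // w _ /=; rewrite lee_fin.
  rewrite (_ : [set _ | _] = set0); first exact: (@measurable0 _ (g_sigma_algebraType _)).
  by apply/seteqP; split => // w /=; rewrite lee_fin leNgt su.
move=> /(_ _ st A) H; have := H _ _ f0 _ t0.
rewrite (_ : A `&` [set _ | _] = A).
  apply; split; first exact: natural_filtration_measurable FA.
  move=> u u0; have [su|su] := leP s u.
    rewrite (_ : _ `&` _ = A); first exact: natural_filtration_le FA.
    by apply/seteqP; split => [w []//|w Aw]; split => //=; rewrite lee_fin.
  rewrite (_ : _ `&` _ = set0); first exact: (@measurable0 _ (g_sigma_algebraType _)).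
  by apply/seteqP; split => // w [_ /=]; rewrite lee_fin leNgt su.
by apply/seteqP; split => [w []//|w Aw]; split => //=; rewrite ltry.
Qed.

Lemma Rintegral_indic (A : set T) (f : T -> R) : \int[P]_(w in A) f w = Ex P (fun w => \1_A w * f w).
Proof.
rewrite Rintegral_mkcond /Ex; congr (Rintegral _ _ _); apply/funext => w.
by rewrite patchE indicE; case: ifP => _; rewrite ?mul1r ?mul0r.
Qed.

Notation rad t w := (enorm (Z t w)).
Notation ang t w := (angle (Z t w)).

Lemma mZ t : 0 <= t -> measurable_fun setT (Z t).
Proof. exact: (wbm_measurable wbmZ). Qed.

Lemma mrad t : 0 <= t -> measurable_fun setT (fun w => rad t w).
Proof. by move=> t0; apply: measurableT_comp; [exact: measurable_enorm|exact: mZ]. Qed.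

Lemma mang t : 0 <= t -> measurable_fun setT (fun w => ang t w).
Proof. by move=> t0; apply: measurableT_comp; [exact: measurable_angle|exact: mZ]. Qed.

Lemma mh_ang t h : 0 <= t -> measurable_fun setT h -> measurable_fun setT (fun w => h (ang t w)).
Proof. by move=> t0 mh; apply: measurableT_comp => //; exact: mang. Qed.

Lemma mg_rad t g : 0 <= t -> measurable_fun setT g -> measurable_fun setT (fun w => g (rad t w)).
Proof. by move=> t0 mg; apply: measurableT_comp => //; exact: mrad. Qed.

Lemma mgq t g : 0 <= t -> quartic g -> measurable_fun setT (fun w => g (rad t w)).
Proof. by move=> t0 [cg _ _]; apply: mg_rad => //; exact: continuous_measurable_fun. Qed.

Lemma markov_cutoff s t A h g j : 0 <= s -> 0 < t -> natural_filtration Z s A ->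
  continuous h -> (forall x, 0 <= h x <= 1) -> quartic g ->
  Ex P (fun w => \1_A w * (h (ang (s + t) w) * cutoff g j (rad (s + t) w))) =
  Ex P (fun w => \1_A w * two_part (avg kappa h) (h (ang s w)) (Num.sqrt t) (cutoff g j) (rad s w)).
Proof.
move=> s0 t0 FA ch h01 qg.
have := markov_deterministic s0 (ltW t0) FA (polar_test_C0 kappa j ch h01 qg).
rewrite !Rintegral_indic => ->; apply: eq_Ex => w.
by rewrite walsh_sg_polar//; exact: quartic_cutoff.
Qed.

Lemma avg_cst1 : avg kappa (fun=> 1) = 1.
Proof. by rewrite avg_Ex// ?Ex_cst// => x; rewrite ler01 lexx. Qed.

Lemma Ex_cutoff_le g j t : 0 < t -> quartic g ->
  Ex P (fun w => cutoff g j (rad t w)) <= 2 * up (Num.sqrt t) g 0.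
Proof.
move=> t0 qg.
have h1 (x : 'rV[R]_n) : 0 <= (1 : R) <= 1 by rewrite ler01 lexx.
have c1 : continuous (fun _ : 'rV[R]_n => 1 : R) by exact: continuous_const.
have := markov_cutoff j (lexx 0) t0 (@natural_filtration_T 0) c1 h1 qg.
rewrite add0r => E.
have -> : Ex P (fun w => cutoff g j (rad t w)) = 2 * up (Num.sqrt t) (cutoff g j) 0.
  transitivity (Ex P (fun w => \1_setT w * (1 * cutoff g j (rad t w)))).
    by apply: eq_Ex => w; rewrite indicT mul1r mul1r.
  rewrite E -[RHS](@Ex_cst _ _ _ P); apply: Ex_ae => //.
    apply: measurable_funM; first exact: measurable_indic.
    rewrite /two_part; have qc := quartic_cutoff j qg.
    have mu := measurable_up (Num.sqrt t) qc.
    apply: measurable_funD.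
      apply: measurable_funM => //; apply: measurable_funM => //.
      apply: (@measurableT_comp _ _ _ _ _ _ (up (Num.sqrt t) (cutoff g j)) _ (fun w => - rad 0 w)) => //.
      by apply: measurable_neg; exact: mrad.
    apply: measurable_funM => //; apply: measurable_funB.
      by apply: (measurableT_comp mu); exact: mrad.
    by apply: (measurableT_comp mu); apply: measurable_neg; exact: mrad.
  apply: filterS Z0 => w ->; rewrite indicT enorm0 /two_part avg_cst1 oppr0 subrr mulr0 addr0 !mul1r//.
by rewrite ler_pM2l// up_cutoff_le.
Qed.

(** As the process starts at 0, every cutoff has expectation at most twice [up] at 0, uniformly in
    the cutoff, and monotone convergence applies. *)
Lemma L1_quartic g t : 0 <= t -> quartic g -> L1 P (fun w => g (rad t w)).
Proof.
rewrite le_eqVlt => /predU1P[<-|t0] qg; have [cg g0 gb] := qg.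
  apply: (@L1_ae _ _ _ _ (fun=> 0)) => //; [exact: mgq| |exact: L1_cst].
  by apply: filterS Z0 => w ->; rewrite enorm0 g0.
have t0' := ltW t0.
have gn w : 0 <= g (rad t w) by have /andP[] := gb (rad t w).
have [] := @Ex_mct _ _ _ P (fun j w => cutoff g j (rad t w)) (fun w => g (rad t w))
   (2 * up (Num.sqrt t) g 0) _ _ _ _ _ => //.
- move=> j; apply: (@L1_bounded _ _ _ _ _ j%:R); first by apply: mgq => //; exact: quartic_cutoff.
  by move=> w; have /andP[c0 _] := cutoff_le j (gn w); rewrite ger0_norm// cutoff_bound.
- by move=> j w; have /andP[] := cutoff_le j (gn w).
- by move=> j; exact: Ex_cutoff_le.
- by move=> w; exact: cutoff_nd.
- by move=> w; exact: cutoff_cvg.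
Qed.

Lemma L1_rad t : 0 <= t -> L1 P (fun w => rad t w).
Proof.
move=> t0; apply: eq_L1 (@L1_quartic (powabs 1) t t0 _); last exact: quartic_powabs.
by move=> w /=; rewrite /powabs expr1 ger0_norm ?enorm_ge0.
Qed.

Lemma L1_rad2 t : 0 <= t -> L1 P (fun w => rad t w ^+ 2).
Proof.
move=> t0; apply: eq_L1 (@L1_quartic (powabs 2) t t0 _); last exact: quartic_powabs.
by move=> w /=; rewrite /powabs ger0_norm ?enorm_ge0.
Qed.

Lemma L1_rad4 t : 0 <= t -> L1 P (fun w => rad t w ^+ 4).
Proof.
move=> t0; apply: eq_L1 (@L1_quartic (powabs 4) t t0 _); last exact: quartic_powabs.
by move=> w /=; rewrite /powabs ger0_norm ?enorm_ge0.
Qed.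

Lemma indic01 (A : set T) w : 0 <= (\1_A w : R) <= 1.
Proof. by rewrite indicE; case: (w \in A); rewrite /= ?lexx ?ler01. Qed.

Lemma measurable_two_part s g (c : T -> R) (r : T -> R) c0 : quartic g ->
  measurable_fun setT c -> measurable_fun setT r ->
  measurable_fun setT (fun w => two_part c0 (c w) s g (r w)).
Proof.
move=> qg mc mr; have mu := measurable_up s qg.
have m1 : measurable_fun setT (fun w => up s g (- r w)).
  by apply: (measurableT_comp mu); exact: measurable_neg.
have m2 : measurable_fun setT (fun w => up s g (r w)) by exact: (measurableT_comp mu).
apply: measurable_funD; first by apply: measurable_funM => //; apply: measurable_funM.
by apply: measurable_funM => //; exact: measurable_funB.
Qed.

Lemma two_part_bound s g c a r : quartic g -> 0 <= c <= 1 -> 0 <= a <= 1 ->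
  `|two_part c a s g r| <= 4 * (1 + 8 * r ^+ 4 + 8 * s ^+ 4) * (1 + gauss_m4).
Proof.
move=> qg /andP[c0 c1] /andP[a0 a1].
have u1 := up_ge0 r s qg; have u2 := up_ge0 (- r) s qg.
have b1 := up_le r s qg; have b2 := up_le (- r) s qg.
have e4 : (- r) ^+ 4 = r ^+ 4 by ring.
rewrite {}e4 in b2; rewrite /two_part; set B := _ * (1 + gauss_m4) in b1 b2.
rewrite -mulrA -/B; move: (up s g r) (up s g (- r)) u1 u2 b1 b2 => x y x0 y0 xB yB.
rewrite ler_norml; apply/andP; split; nra.
Qed.

(** The identity holds for the cutoffs, which belong to C_0. Dominated convergence removes them: the
    left side is dominated by g(|Z_(s+t)|), the right side by a multiple of a constant plus
    |Z_s|^4. *)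
Lemma markov_quartic s t A h g : 0 <= s -> 0 < t -> natural_filtration Z s A ->
  continuous h -> (forall x, 0 <= h x <= 1) -> quartic g ->
  Ex P (fun w => \1_A w * (h (ang (s + t) w) * g (rad (s + t) w))) =
  Ex P (fun w => \1_A w * two_part (avg kappa h) (h (ang s w)) (Num.sqrt t) g (rad s w)).
Proof.
move=> s0 t0 FA ch h01 qg; have [cg g0 gb] := qg.
have mA := natural_filtration_measurable FA.
have st0 : 0 <= s + t by rewrite addr_ge0// ltW.
have mh := continuous_measurable_rV ch.
have a01 := avg01 kappa mh h01.
have m1A : measurable_fun setT (\1_A : T -> R) by exact: measurable_indic.
pose F1 j w := \1_A w * (h (ang (s + t) w) * cutoff g j (rad (s + t) w)).
pose F2 j w := \1_A w * two_part (avg kappa h) (h (ang s w)) (Num.sqrt t) (cutoff g j) (rad s w).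
have L : Ex P \o F1 @ \oo --> Ex P (fun w => \1_A w * (h (ang (s + t) w) * g (rad (s + t) w))).
  apply: (@Ex_dct _ _ _ P F1 _ (fun w => g (rad (s + t) w)) _ _ _ _).2.
  - move=> j; apply: measurable_funM => //; apply: measurable_funM; first exact: mh_ang.
    by apply: mgq => //; exact: quartic_cutoff.
  - exact: L1_quartic.
  - move=> j w; have /andP[gn _] := gb (rad (s + t) w); have /andP[c0 c1] := cutoff_le j gn.
    have /andP[i0 i1] := indic01 A w; have /andP[h0 h1] := h01 (ang (s + t) w).
    by rewrite /F1 ger0_norm ?mulr_ge0// mulrA; apply: le_trans c1; rewrite ler_piMl// mulr_ile1.
  - move=> w; apply: cvgM; first exact: cvg_cst.
    apply: cvgM; first exact: cvg_cst.
    by apply: cutoff_cvg; have /andP[] := gb (rad (s + t) w).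
have L' : Ex P \o F2 @ \oo -->
    Ex P (fun w => \1_A w * two_part (avg kappa h) (h (ang s w)) (Num.sqrt t) g (rad s w)).
  apply: (@Ex_dct _ _ _ P F2 _
    (fun w => 4 * (1 + 8 * rad s w ^+ 4 + 8 * Num.sqrt t ^+ 4) * (1 + gauss_m4)) _ _ _ _).2.
  - move=> j; apply: measurable_funM => //; apply: measurable_two_part; [exact: quartic_cutoff|exact: mh_ang|exact: mrad].
  - apply: (@eq_L1 _ _ _ _ (fun w => (4 * (1 + gauss_m4)) * ((1 + 8 * Num.sqrt t ^+ 4) + 8 * rad s w ^+ 4))).
      by move=> w /=; ring.
    by apply: L1Z; apply: L1D; [exact: L1_cst|apply: L1Z; exact: L1_rad4].
  - move=> j w; have /andP[i0 i1] := indic01 A w.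
    rewrite normrM; apply: le_trans (two_part_bound (Num.sqrt t) (rad s w) (quartic_cutoff j qg) a01 (h01 (ang s w))).
    by rewrite ler_piMl// ger0_norm.
  - move=> w; apply: cvgM; first exact: cvg_cst.
    apply: cvgD; apply: cvgM; try exact: cvg_cst.
      by apply: cvgM; [exact: cvg_cst|exact: up_cutoff_cvg].
    by apply: cvgB; exact: up_cutoff_cvg.
have EF : Ex P \o F1 = Ex P \o F2 by apply/funext => j /=; exact: markov_cutoff.
by rewrite EF in L; exact: (cvg_unique _ L L').
Qed.

Lemma markov_rad2 s t A : 0 <= s -> 0 <= t -> natural_filtration Z s A ->
  Ex P (fun w => \1_A w * rad (s + t) w ^+ 2) =
  Ex P (fun w => \1_A w * (rad s w ^+ 2 + t * gauss_var)).
Proof.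
move=> s0; rewrite le_eqVlt => /predU1P[<-|t0] FA.
  by rewrite addr0; apply: eq_Ex => w; rewrite mul0r addr0.
have h1 (x : 'rV[R]_n) : 0 <= (1 : R) <= 1 by rewrite ler01 lexx.
have c1 : continuous (fun _ : 'rV[R]_n => 1 : R) by exact: continuous_const.
have q2 : quartic (powabs 2 : R -> R) by exact: quartic_powabs.
have := markov_quartic s0 t0 FA c1 h1 q2.
rewrite avg_cst1 => E; transitivity (Ex P (fun w => \1_A w * (1 * powabs 2 (rad (s + t) w)))).
  by apply: eq_Ex => w; rewrite /powabs ger0_norm ?enorm_ge0// mul1r.
rewrite E; apply: eq_Ex => w; congr (_ * _).
have := up2E (Num.sqrt t) (rad s w); rewrite (sqr_sqrtr (ltW t0)) => <-.
by rewrite /two_part; ring.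
Qed.

Lemma markov_rad4 s t A : 0 <= s -> 0 <= t -> natural_filtration Z s A ->
  Ex P (fun w => \1_A w * rad (s + t) w ^+ 4) =
  Ex P (fun w => \1_A w * (rad s w ^+ 4 + 6 * rad s w ^+ 2 * t * gauss_var + t ^+ 2 * gauss_m4)).
Proof.
move=> s0; rewrite le_eqVlt => /predU1P[<-|t0] FA.
  by rewrite addr0; apply: eq_Ex => w; rewrite expr0n/= mulr0 !mul0r !addr0.
have h1 (x : 'rV[R]_n) : 0 <= (1 : R) <= 1 by rewrite ler01 lexx.
have c1 : continuous (fun _ : 'rV[R]_n => 1 : R) by exact: continuous_const.
have q2 : quartic (powabs 4 : R -> R) by exact: quartic_powabs.
have := markov_quartic s0 t0 FA c1 h1 q2.
rewrite avg_cst1 => E; transitivity (Ex P (fun w => \1_A w * (1 * powabs 4 (rad (s + t) w)))).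
  by apply: eq_Ex => w; rewrite /powabs ger0_norm ?enorm_ge0// mul1r.
rewrite E; apply: eq_Ex => w; congr (_ * _).
have := up4E (Num.sqrt t) (rad s w).
have -> : Num.sqrt t ^+ 4 = t ^+ 2 by rewrite -[in RHS](sqr_sqrtr (ltW t0)) -exprM.
rewrite (sqr_sqrtr (ltW t0)) => <-.
by rewrite /two_part; ring.
Qed.

(** For g(r) = r, [up1E] separates the starting radius, which keeps its angle, from the excess,
    which is carried by a fresh ray of law kappa. *)
Lemma markov_excess_cont s t A h : 0 <= s -> 0 < t -> natural_filtration Z s A ->
  continuous h -> (forall x, 0 <= h x <= 1) ->
  Ex P (fun w => \1_A w * (h (ang (s + t) w) * rad (s + t) w)) =
  Ex P (fun w => \1_A w * (Ex kappa h * (2 * excess (Num.sqrt t) (rad s w)) + h (ang s w) * rad s w)).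
Proof.
move=> s0 t0 FA ch h01.
have q2 : quartic (powabs 1 : R -> R) by exact: quartic_powabs.
have := markov_quartic s0 t0 FA ch h01 q2.
rewrite avg_Ex//; last exact: continuous_measurable_rV.
move=> E; transitivity (Ex P (fun w => \1_A w * (h (ang (s + t) w) * powabs 1 (rad (s + t) w)))).
  by apply: eq_Ex => w; rewrite /powabs expr1 ger0_norm ?enorm_ge0.
rewrite E; apply: eq_Ex => w; congr (_ * _).
by rewrite /two_part (up1E _ (rad s w)) /excess; ring.
Qed.

Section excess_borel.
Variables (s t : R) (A : set T).
Hypotheses (s0 : 0 <= s) (t0 : 0 < t) (FA : natural_filtration Z s A).

Let st0 : 0 <= s + t. Proof. by rewrite addr_ge0// ltW. Qed.
Let mA : measurable A. Proof. exact: natural_filtration_measurable FA. Qed.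
Let m1A : measurable_fun setT (\1_A : T -> R). Proof. exact: measurable_indic. Qed.

Let lhs h w := \1_A w * (h (ang (s + t) w) * rad (s + t) w).
Let rhs h w := \1_A w * (Ex kappa h * (2 * excess (Num.sqrt t) (rad s w)) + h (ang s w) * rad s w).
Let good h := Ex P (lhs h) = Ex P (rhs h).
Let mb h := measurable_fun setT h /\ forall x, `|h x| <= 1.

Let mexc : measurable_fun setT (fun w => excess (Num.sqrt t) (rad s w)).
Proof.
have mu := @measurable_up R (Num.sqrt t) (powabs 1) (@quartic_powabs R 1 isT).
by apply: (measurableT_comp mu); apply: measurable_neg; exact: mrad.
Qed.

Let dom w := 2 * (1 + Num.sqrt t ^+ 2 * gauss_var) + rad s w.

Let L1dom : L1 P dom.
Proof. by apply: L1D; [exact: L1_cst|exact: L1_rad]. Qed.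

Let mlhs h : mb h -> measurable_fun setT (lhs h).
Proof.
move=> [mh _]; apply: measurable_funM => //; apply: measurable_funM; [exact: mh_ang|exact: mrad].
Qed.

Let mrhs h : mb h -> measurable_fun setT (rhs h).
Proof.
move=> [mh _]; apply: measurable_funM => //; apply: measurable_funD.
  by apply: measurable_funM => //; apply: measurable_funM.
by apply: measurable_funM; [exact: mh_ang|exact: mrad].
Qed.

Let lhs_le h w : mb h -> `|lhs h w| <= rad (s + t) w.
Proof.
move=> [_ hb]; have /andP[i0 i1] := indic01 A w.
rewrite /lhs !normrM (ger0_norm i0) (ger0_norm (enorm_ge0 _)) mulrA.
by rewrite ler_piMl ?enorm_ge0// mulr_ile1.
Qed.

Let L1h h : mb h -> L1 kappa h.
Proof. by move=> [mh hb]; exact: (@L1_bounded _ _ _ kappa h 1 mh hb). Qed.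

Let Exh h : mb h -> `|Ex kappa h| <= 1.
Proof.
move=> hb; apply: le_trans (le_norm_Ex (L1h hb)) _.
rewrite -[leRHS](@Ex_cst _ _ _ kappa); apply: le_Ex; [exact: L1_norm (L1h hb)|exact: L1_cst|exact: hb.2].
Qed.

Let rhs_le h w : mb h -> `|rhs h w| <= dom w.
Proof.
move=> hb; have /andP[i0 i1] := indic01 A w.
rewrite /rhs normrM (ger0_norm i0).
apply: (@le_trans _ _ (`|Ex kappa h * (2 * excess (Num.sqrt t) (rad s w)) + h (ang s w) * rad s w|)).
  by rewrite ler_piMl.
apply: le_trans (ler_normD _ _) _; rewrite /dom; apply: lerD.
  rewrite normrM -[leRHS]mul1r; apply: ler_pM => //; first exact: Exh.
  rewrite ger0_norm ?mulr_ge0 ?excess_ge0// ler_pM2l//.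
  by apply: excess_bound; exact: enorm_ge0.
rewrite normrM (ger0_norm (enorm_ge0 _)) ler_piMl ?enorm_ge0//; exact: hb.2.
Qed.

Let L1l h : mb h -> L1 P (lhs h).
Proof. by move=> hb; apply: (L1_le (mlhs hb) (L1_rad st0)) => w; exact: lhs_le. Qed.

Let L1r h : mb h -> L1 P (rhs h).
Proof. by move=> hb; apply: (L1_le (mrhs hb) L1dom) => w; exact: rhs_le. Qed.

Let good_lim (h : nat -> 'rV[R]_n -> R) h' : (forall k, mb (h k)) -> mb h' ->
  (forall x, h ^~ x @ \oo --> h' x) -> (forall k, good (h k)) -> good h'.
Proof.
move=> hb hb' hh gh.
have L : Ex P \o (fun k => lhs (h k)) @ \oo --> Ex P (lhs h').
  apply: (@Ex_dct _ _ _ P (fun k => lhs (h k)) _ (fun w => rad (s + t) w) _ _ _ _).2 => //.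
  - by move=> k; exact: mlhs.
  - exact: L1_rad.
  - by move=> k w; exact: lhs_le.
  - by move=> w; apply: cvgM; [exact: cvg_cst|apply: cvgM; [exact: hh|exact: cvg_cst]].
have Lk : Ex kappa \o h @ \oo --> Ex kappa h'.
  apply: (@Ex_dct _ _ _ kappa h _ (fun=> 1) _ _ _ _).2 => //.
  - by move=> k; exact: (hb k).1.
  - exact: L1_cst.
  - by move=> k x; exact: (hb k).2.
have L' : Ex P \o (fun k => rhs (h k)) @ \oo --> Ex P (rhs h').
  apply: (@Ex_dct _ _ _ P (fun k => rhs (h k)) _ dom _ _ _ _).2 => //.
  - by move=> k; exact: mrhs.
  - by move=> k w; exact: rhs_le.
  - move=> w; apply: cvgM; first exact: cvg_cst.
    by apply: cvgD; apply: cvgM; (exact: cvg_cst || exact: Lk || exact: hh).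
have E : Ex P \o (fun k => lhs (h k)) = Ex P \o (fun k => rhs (h k)) by apply/funext.
by rewrite E in L; exact: (cvg_unique _ L L').
Qed.

Let good_lin h1 h2 (c : R) : mb h1 -> mb h2 -> good h1 -> good h2 -> good (fun x => h1 x + c * h2 x).
Proof.
move=> b1 b2 g1 g2; rewrite /good.
transitivity (Ex P (lhs h1) + c * Ex P (lhs h2)).
  rewrite -ExZ; last exact: L1l.
  rewrite -ExD; [|exact: L1l|by apply: L1Z; exact: L1l].
  by apply: eq_Ex => w; rewrite /lhs; ring.
rewrite g1 g2 -ExZ; last exact: L1r.
rewrite -ExD; [|exact: L1r|by apply: L1Z; exact: L1r].
apply: eq_Ex => w; rewrite /rhs.
rewrite ExD; [|exact: L1h|by apply: L1Z; exact: L1h].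
by rewrite ExZ; [ring|exact: L1h].
Qed.

Let mb_indic B : measurable B -> mb (\1_B).
Proof.
move=> mB; split => // x; rewrite indicE; case: (x \in B); rewrite ?normr1 ?normr0//.
Qed.

Let good_cont h : continuous h -> (forall x, 0 <= h x <= 1) -> good h.
Proof. by move=> ch h01; exact: markov_excess_cont. Qed.

Let good1 : good (fun=> 1).
Proof.
by apply: good_cont; [exact: continuous_const|move=> x; rewrite ler01 lexx].
Qed.

(** The identity is linear in [h] and stable under bounded pointwise limits. Continuous functions
    give it for boxes through [box_bump], and Dynkin's theorem extends it to all Borel sets. *)
Lemma markov_excess_Ex B : measurable B -> good (\1_B).
Proof.
have mb1 : mb (fun=> 1) by split => // x; rewrite normr1.
move: B; apply: (@dynkin_rV _ _ (fun B => good (\1_B))).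
- by rewrite (_ : \1_setT = (fun=> 1))//; apply/funext => x; rewrite indicT.
- move=> a b; have mab : measurable (box a b).
    by rewrite measurable_rV_boxE; apply: sub_sigma_algebra; exists a, b.
  apply: (@good_lim (box_bump a b)) => //.
  + move=> k; split; first by apply: continuous_measurable_rV; exact: box_bump_cont.
    by move=> x; have /andP[h0 h1] := box_bump01 a b k x; rewrite ger0_norm.
  + exact: mb_indic.
  + exact: box_bump_cvg.
  + by move=> k; apply: good_cont; [exact: box_bump_cont|exact: box_bump01].
- move=> B mB gB; rewrite (_ : \1_(~` B) = (fun x => 1 + (-1) * \1_B x)).
    by apply: good_lin => //; exact: mb_indic.
  apply/funext => x; rewrite !indicE in_setC; case: (x \in B) => /=; lra.
- move=> F mF tF gF.
  have SE m x : (\sum_(k < m) \1_(F k) x : R) = \1_(\big[setU/set0]_(k < m) F k) x.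
    elim: m => [|m IH]; first by rewrite !big_ord0 indic0.
    rewrite !big_ord_recr/= IH !indicE in_setU.
    case: (boolP (x \in F m)) => xm; last by rewrite orbF addr0.
    rewrite orbT [x \in _](_ : _ = false) ?add0r//.
    apply/negbTE/negP; rewrite inE -bigcup_mkord => -[k /= km Fkx].
    move/trivIsetP : tF => /(_ k m Logic.I Logic.I); rewrite neq_ltn km => /(_ isT) /seteqP[+ _].
    by move=> /(_ x); apply; split => //; rewrite inE in xm.
  apply: (@good_lim (fun m x => \1_(\big[setU/set0]_(k < m) F k) x)).
  + by move=> m; apply: mb_indic; exact: bigsetU_measurable.
  + by apply: mb_indic; exact: bigcupT_measurable.
  + move=> x; apply: cvg_near_cst; have [[k _ Fkx]|nF] := pselect ((\bigcup_k F k) x).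
      exists k.+1 => // m /= km; rewrite !indicE mem_set ?mem_set//; first by exists k.
      by rewrite -bigcup_mkord; exists k.
    apply: nearW => m; rewrite !indicE !memNset//.
    by rewrite -bigcup_mkord => -[k _ Fkx]; apply: nF; exists k.
  + move=> m; elim: m => [|m IH].
      rewrite (_ : (fun x => _) = (fun x : 'rV[R]_n => (1 : R) + (-1) * 1)); first exact: good_lin.
      by apply/funext => x; rewrite big_ord0 indic0 mulr1 subrr.
    rewrite (_ : (fun x => _) = (fun x => \1_(\big[setU/set0]_(k < m) F k) x + 1 * \1_(F m) x)).
      by apply: good_lin => //; apply: mb_indic => //; exact: bigsetU_measurable.
    by apply/funext => x; rewrite mul1r -!SE big_ord_recr.
Qed.

End excess_borel.

Lemma markov_excess s t A B : 0 <= s -> 0 < t -> natural_filtration Z s A -> measurable B ->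
  Ex P (fun w => \1_A w * (\1_B (ang (s + t) w) * rad (s + t) w)) =
  Ex P (fun w => \1_A w * (fine (kappa B) * (2 * excess (Num.sqrt t) (rad s w)) +
                           \1_B (ang s w) * rad s w)).
Proof. by move=> s0 t0 FA mB; rewrite (markov_excess_Ex s0 t0 FA mB) Ex_indic. Qed.

End markov.

(** * Excursions stay on one ray *)

Lemma indic_norm_le1 (R : realType) (X : Type) (A : set X) x : `|\1_A x : R| <= 1.
Proof. by rewrite indicE; case: (x \in A); rewrite ?normr1 ?normr0. Qed.

Lemma negligible_bigcup_countable (R : realType) d (T : measurableType d) (P : probability T R)
  (X : countType) (bad : X -> set T) :
  (forall x, P.-negligible (bad x)) -> P.-negligible (\bigcup_x bad x).
Proof.
move=> nb; apply: (@negligibleS _ _ _ P (\bigcup_m (oapp bad set0 (unpickle m)))); last first.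
  apply: negligible_bigcup => m; case: unpickle => [x|] /=; [exact: nb|exact: negligible_set0].
by move=> w [x _ bx]; exists (pickle x) => //; rewrite pickleK.
Qed.

Section rays.
Context {R : realType} {n : nat}.
Implicit Types (z : R -> 'rV[R]_n).

Definition ray_path z : Prop := forall s t, 0 <= s -> s <= t ->
  (forall u, s <= u <= t -> z u != 0) -> angle (z s) = angle (z t).

Lemma rad_continuous z : continuous z -> continuous (fun t => enorm (z t)).
Proof.
by move=> cz t; apply: (@continuous_comp _ _ _ z (@enorm R n)); [exact: cz|exact: enorm_continuous].
Qed.

Lemma ang_continuous z t (i : 'I_n) : continuous z -> z t != 0 ->
  {for t, continuous (fun t => angle (z t) ord0 i)}.
Proof.
move=> cz zt; apply: (@continuous_comp _ _ _ (fun t => angle (z t)) (fun x : 'rV[R]_n => x ord0 i)).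
  apply: (@continuous_comp _ _ _ z (@angle R n)); [exact: cz|exact: angle_continuous].
exact: coord_cont.
Qed.

Lemma rad_lower_bound z s t : continuous z -> s <= t -> (forall u, s <= u <= t -> z u != 0) ->
  exists j : nat, forall u, s <= u <= t -> j.+1%:R^-1 <= enorm (z u).
Proof.
move=> cz st zn0; have [c cst cm] := @EVT_min R (fun u => enorm (z u)) s t st
  (continuous_subspaceT (rad_continuous cz)).
have c0 : 0 < enorm (z c) by rewrite enorm_gt0; apply: zn0; move: cst; rewrite in_itv.
have [j _ H] := near_infty_natSinv_lt (PosNum c0).
exists j => u ut; apply: le_trans (ltW (H j (leqnn j))) (cm u _); by rewrite in_itv.
Qed.

(* A path violates [ray_path] only if some coordinate of its angle crosses a
   rational level between two rational times while the radius stays away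
   from zero. *)
Lemma ray_path_rat z : continuous z ->
  (forall (s t : rat) (i : 'I_n) (q : rat) (j : nat), 0 <= s -> s < t ->
    (forall u : R, ratr s <= u <= ratr t -> j.+1%:R^-1 <= enorm (z u)) ->
    (angle (z (ratr s)) ord0 i < ratr q) = (angle (z (ratr t)) ord0 i < ratr q)) ->
  ray_path z.
Proof.
move=> cz H s t s0; rewrite le_eqVlt => /predU1P[->//|st] zn0.
have K (x y : R) (i : 'I_n) (f : R -> R) : x < y ->
    {for s, continuous f} -> {for t, continuous f} ->
    (f s = x /\ f t = y) \/ (f s = y /\ f t = x) ->
  exists q s' t' : rat, [/\ s < ratr s' :> R, ratr s' < ratr t' :> R, ratr t' < t :> R &
    (f (ratr s') < ratr q) != (f (ratr t') < ratr q)].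
  move=> xy cs ct E; have [q /itvP qi] := rat_in_itvoo xy.
  have qx : x < ratr q by rewrite qi.
  have qy : ratr q < y by rewrite qi.
  have N (v : R) : {for v, continuous f} -> f v != ratr q ->
      exists2 e : R, 0 < e & forall u, `|v - u| < e -> (f u < ratr q) = (f v < ratr q).
    move=> cv fv; have : \forall u \near v, (f u < ratr q) = (f v < ratr q).
      have q0 : 0 < `|f v - ratr q| by rewrite normr_gt0 subr_eq0.
      move/cvgrPdist_lt : cv => /(_ _ q0); apply: filterS => u /=.
      rewrite ltr_distl => /andP[]; have [fq|fq] := ltP (f v) (ratr q).
        by rewrite ltr0_norm ?subr_lt0// => h1 h2; apply/idP; lra.
      by rewrite ger0_norm ?subr_ge0// => h1 h2; apply/negbTE; rewrite -leNgt; lra.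
    by move=> /nbhs_ballP[e /= e0 he]; exists e => // u vu; apply: he.
  have fsq : f s != ratr q.
    by case: E => -[-> _]; [rewrite lt_eqF|rewrite gt_eqF].
  have ftq : f t != ratr q.
    by case: E => -[_ ->]; [rewrite gt_eqF|rewrite lt_eqF].
  have [e1 e10 h1] := N s cs fsq; have [e2 e20 h2] := N t ct ftq.
  (* The midpoint separates the two rational times, one near s and the other near t. *)
  pose m := (s + t) / 2; have sm : s < m by rewrite /m; lra.
  have mt : m < t by rewrite /m; lra.
  have [s' /itvP si] : exists s' : rat, ratr s' \in `]s, Num.min m (s + e1)[.
    by apply: rat_in_itvoo; rewrite lt_min sm ltrDl.
  have [t' /itvP ti] : exists t' : rat, ratr t' \in `]Num.max m (t - e2), t[.
    by apply: rat_in_itvoo; rewrite gt_max mt gtrBl.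
  have s1 : s < ratr s' by rewrite si.
  have : ratr s' < Num.min m (s + e1) by rewrite si.
  rewrite lt_min => /andP[s2 s3].
  have t1 : ratr t' < t by rewrite ti.
  have : Num.max m (t - e2) < ratr t' by rewrite ti.
  rewrite gt_max => /andP[t2 t3].
  exists q, s', t'; split => //; first exact: lt_trans t2.
  rewrite (h1 (ratr s')) ?(h2 (ratr t')).
  - by case: E => -[-> ->]; rewrite qx [y < _]ltNge ltW.
  - by rewrite ltr_distl; apply/andP; split; lra.
  - by rewrite ltr_distl; apply/andP; split; lra.
apply/rowP => i; apply/eqP/negP => /negP neq.
pose f u := angle (z u) ord0 i.
have cs : {for s, continuous f} by apply: ang_continuous => //; apply: zn0; rewrite lexx ltW.
have ct : {for t, continuous f} by apply: ang_continuous => //; apply: zn0; rewrite lexx ltW.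
have [q [s' [t' [ss' s't' t't nq]]]] : exists q s' t' : rat,
    [/\ s < ratr s' :> R, ratr s' < ratr t' :> R, ratr t' < t :> R &
    (f (ratr s') < ratr q) != (f (ratr t') < ratr q)].
  move: neq; rewrite neq_lt => /orP[lt1|lt1].
    by apply: (K _ _ i f lt1 cs ct); left.
  by apply: (K _ _ i f lt1 cs ct); right.
have [j jP] := @rad_lower_bound z (ratr s') (ratr t') cz (ltW s't')
  (fun u => ltac:(move=> /andP[u1 u2]; apply: zn0; apply/andP; split; lra)).
move: nq; rewrite /f (H s' t' i q j) ?eqxx//.
  by rewrite -(ler0q R); lra.
by rewrite -(ltr_rat R).
Qed.

End rays.

Section ray_constancy.
Context {R : realType} {n : nat} {d : measure_display} {T : measurableType d}.
Variables (P : probability T R) (kappa : probability 'rV[R]_n R) (Z : R -> T -> 'rV[R]_n).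
Hypothesis kappaS : kappa (sphere R n) = 1%E.
Hypothesis wbmZ : walsh_brownian_motion P kappa Z.
Hypothesis Z0 : {ae P, forall w, Z 0 w = 0}.
Notation rad t w := (enorm (Z t w)).
Notation ang t w := (angle (Z t w)).

Definition far (B : set 'rV[R]_n) (e s : R) : set T := [set w | B (ang s w) /\ e <= rad s w].

Lemma far_filtration B e s : 0 <= s -> measurable B -> natural_filtration Z s (far B e s).
Proof.
move=> s0 mB; apply: sub_sigma_algebra; exists s; first by rewrite /= in_itv/= s0 lexx.
exists ([set z | B (angle z)] `&` [set z | e <= enorm z]); last by rewrite setTI.
apply: measurableI.
  by rewrite -[X in measurable X]setTI; apply: measurable_angle.
rewrite (_ : [set z | _] = @enorm R n @^-1` `[e, +oo[).
  by rewrite -[X in measurable X]setTI; apply: measurable_enorm.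
by apply/seteqP; split => z /=; rewrite in_itv/= andbT.
Qed.

Lemma far_measurable B e s : 0 <= s -> measurable B -> measurable (far B e s).
Proof.
by move=> s0 mB; apply: (natural_filtration_measurable wbmZ (far_filtration _ s0 mB)).
Qed.

(** Changing sides of B requires a passage through 0. On the event [D] the term 1_B' (angle) |Z| of
    the complement B' vanishes at time s, so by [markov_excess] its mean at time s + t is at most
    twice the excess from radius e, of order t^2 / e^3; Markov's inequality at level e costs one
    more factor 1/e. *)
Lemma switch_prob B e s t : 0 <= s -> 0 < t -> 0 < e -> measurable B ->
  fine (P (far B e s `&` far (~` B) e (s + t))) <= 2 * gauss_m4 * t ^+ 2 / e ^+ 4.
Proof.
move=> s0 t0 e0 mB; have mC : measurable (~` B) by exact: measurableC.
have st0 : 0 <= s + t by rewrite addr_ge0// ltW.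
have mD := far_measurable e s0 mB; have mD' := far_measurable e st0 mC.
have mI := measurableI _ _ mD mD'.
set D := far B e s in mD mI *; set D' := far _ e (s + t) in mD' mI *.
rewrite -Ex_indic// ler_pdivlMr ?exprn_gt0//.
have lr := L1_rad kappaS wbmZ Z0.
pose Y w := \1_D w * (\1_(~` B) (ang (s + t) w) * rad (s + t) w).
have lY : L1 P Y.
  apply: L1_indic => //; apply: (@L1_le _ _ _ _ _ (fun w => rad (s + t) w)).
  - apply: measurable_funM; last exact: (mrad wbmZ).
    apply: (measurableT_comp (measurable_indic mC)); exact: (mang wbmZ).
  - exact: lr.
  - move=> w; rewrite normrM (ger0_norm (enorm_ge0 _)) ler_piMl ?enorm_ge0//.
    exact: indic_norm_le1.
have XY w : e * \1_(D `&` D') w <= Y w.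
  rewrite indicI/= /Y !indicE.
  case: (boolP (w \in D)) => [wB|_]; last by rewrite mul0r mulr0 mul0r.
  rewrite !mul1r; case: (boolP (w \in D')) => [|_]; last first.
    by rewrite mulr0 mulr_ge0 ?enorm_ge0.
  by rewrite inE => -[wC ew]; rewrite mem_set// mul1r mulr1.
pose c := 2 * gauss_m4 * t ^+ 2 / e ^+ 3.
have Yc : Ex P Y <= c.
  rewrite /Y (markov_excess kappaS wbmZ Z0 s0 t0 (far_filtration e s0 mB) mC).
  rewrite -[leRHS](@Ex_cst _ _ _ P); apply: le_Ex; last 2 first.
  - exact: L1_cst.
  - have c0 : 0 <= c by rewrite divr_ge0 ?exprn_ge0 ?mulr_ge0 ?gauss_m4_ge0 ?sqr_ge0// ltW.
    move=> w; rewrite -/D !indicE; case: (boolP (w \in D)) => [|_]; last by rewrite mul0r.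
    rewrite inE => -[Bw ew]; rewrite mul1r memNset// mul0r addr0.
    have ex0 := excess_ge0 (Num.sqrt t) (rad s w).
    have r0 : 0 < rad s w by exact: lt_le_trans ew.
    have k0 : 0 <= fine (kappa (~` B)) by rewrite fine_ge0.
    have k1 : fine (kappa (~` B)) <= 1.
      by rewrite -lee_fin fineK ?fin_num_measure//; exact: probability_le1.
    apply: (@le_trans _ _ (2 * excess (Num.sqrt t) (rad s w))); first by rewrite ler_piMl ?mulr_ge0.
    rewrite /c -!mulrA ler_pM2l//; apply: le_trans (excess_le _ r0) _.
    have -> : Num.sqrt t ^+ 4 = t ^+ 2 by rewrite -[in RHS](sqr_sqrtr (ltW t0)) -exprM.
    have -> : gauss_m4 * (t * (t / e ^+ 3)) = t ^+ 2 * gauss_m4 * (e ^+ 3)^-1 :> R by ring.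
    apply: ler_wpM2l; first by rewrite mulr_ge0 ?gauss_m4_ge0 ?sqr_ge0.
    rewrite lef_pV2 ?posrE ?exprn_gt0//.
    by apply: lerXn2r => //; rewrite nnegrE ltW.
  - have mW : measurable_fun setT (fun w => fine (kappa (~` B)) * (2 * excess (Num.sqrt t) (rad s w)) +
        \1_(~` B) (ang s w) * rad s w).
      apply: measurable_funD.
        apply: measurable_funM => //; apply: measurable_funM => //.
        by apply: (measurableT_comp (measurable_excess _)); exact: (mrad wbmZ).
      apply: measurable_funM; last exact: (mrad wbmZ).
      by apply: (measurableT_comp (measurable_indic mC)); exact: (mang wbmZ).
    apply: L1_indic => //; apply: (@L1_le _ _ _ _ _ (fun w =>
       fine (kappa (~` B)) * (2 * (1 + Num.sqrt t ^+ 2 * gauss_var)) + rad s w)) => //.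
      by apply: L1D; [exact: L1_cst|exact: lr].
    move=> w; apply: le_trans (ler_normD _ _) _; apply: lerD.
      have k0 : 0 <= fine (kappa (~` B)) by rewrite fine_ge0.
      have ex0 := excess_ge0 (Num.sqrt t) (rad s w).
      rewrite ger0_norm; last by rewrite mulr_ge0// mulr_ge0.
      rewrite ler_wpM2l// ler_pM2l//; apply: excess_bound; exact: enorm_ge0.
    rewrite normrM (ger0_norm (enorm_ge0 _)) ler_piMl ?enorm_ge0//.
    exact: indic_norm_le1.
have := le_trans (le_Ex (L1Z e (L1_1 P mI)) lY XY) Yc.
rewrite ExZ; last exact: L1_1.
rewrite /c ler_pdivlMr ?exprn_gt0//; congr (_ <= _).
by rewrite [e ^+ 4]exprS; ring.
Qed.

(** Along a mesh of N + 1 steps, some step must change sides while the radius is at least e. Each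
    step has probability of order 1/(N+1)^2, so that the union [M N] has probability of order
    1/(N+1), and the event lies in every [M N]. *)
Lemma switch_negligible B e s t : 0 <= s -> s < t -> 0 < e -> measurable B ->
  P.-negligible [set w | [/\ B (ang s w), ~ B (ang t w) & forall u, s <= u <= t -> e <= rad u w]].
Proof.
move=> s0 st e0 mB; have mC : measurable (~` B) by exact: measurableC.
pose dt N : R := (t - s) / N.+1%:R.
pose u N k : R := s + k%:R * dt N.
have dt0 N : 0 < dt N by rewrite divr_gt0// subr_gt0.
have u0 N k : 0 <= u N k by rewrite addr_ge0// mulr_ge0// ltW.
have uS N k : u N k + dt N = u N k.+1 by rewrite /u -addrA -[in RHS]natr1 mulrDl mul1r.
pose F N k := far B e (u N k) `&` far (~` B) e (u N k + dt N).
pose M N := \big[setU/set0]_(k < N.+1) F N k.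
have mM N : measurable (M N).
  by apply: bigsetU_measurable => k _; apply: measurableI; apply: far_measurable => //; rewrite uS.
have PM N : fine (P (M N)) <= 2 * gauss_m4 * (t - s) ^+ 2 / e ^+ 4 / N.+1%:R.
  apply: (@le_trans _ _ (\sum_(k < N.+1) fine (P (far B e (u N k) `&` far (~` B) e (u N k + dt N))))).
    rewrite -lee_fin -sumEFin fineK ?fin_num_measure//.
    apply: le_trans (@Boole_inequality _ _ _ P (F N) N.+1 _) _.
      by move=> k _; apply: measurableI; apply: far_measurable => //; rewrite uS.
    apply: lee_sum => k _; rewrite fineK// fin_num_measure//.
    by apply: measurableI; apply: far_measurable => //; rewrite uS.
  apply: (@le_trans _ _ (\sum_(k < N.+1) (2 * gauss_m4 * dt N ^+ 2 / e ^+ 4))).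
    by apply: ler_sum => k _; exact: switch_prob.
  rewrite sumr_const card_ord /dt -[X in X <= _]mulr_natl le_eqVlt; apply/orP; left; apply/eqP.
  have N0 : N.+1%:R != 0 :> R by rewrite pnatr_eq0.
  by move: N.+1%:R N0 => x x0; rewrite -[x * _]/(x * _); field; rewrite x0 gt_eqF.
apply: (@negligibleS _ _ _ P (\bigcap_N M N)).
  move=> w [Bs nBt H] N _; rewrite /M -(bigcup_mkord _ (F N)).
  have [k [kN Bk nBk]] : exists k, [/\ (k < N.+1)%N, B (ang (u N k) w) & ~ B (ang (u N k.+1) w)].
    apply: contrapT => /forallNP K.
    have all k : (k <= N.+1)%N -> B (ang (u N k) w).
      elim: k => [_|k IH kN]; first by rewrite /u mul0r addr0.
      apply: contrapT => nB; apply: (K k); split => //; exact: IH (ltnW kN).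
    apply: nBt; have := all N.+1 (leqnn _).
    by rewrite /u /dt mulrC divfK ?pnatr_eq0// addrC subrK.
  have ust m : (m <= N.+1)%N -> s <= u N m <= t.
    move=> mN; have d0 := ltW (dt0 N).
    have dE : N.+1%:R * dt N = t - s by rewrite mulrC divfK ?pnatr_eq0.
    have : m%:R * dt N <= N.+1%:R * dt N by rewrite ler_wpM2r// ler_nat.
    by rewrite dE; have := mulr_ge0 (ler0n R m) d0; rewrite /u => ? ?; apply/andP; split; lra.
  exists k => //; rewrite /F uS; split; split => //; apply: H; apply: ust => //; exact: ltnW.
apply/negligibleP; first exact: bigcapT_measurable.
apply/eqP; rewrite eq_le measure_ge0 andbT; apply/lee_addgt0Pr => x x0; rewrite add0e.
have [N NP] : exists N : nat, 2 * gauss_m4 * (t - s) ^+ 2 / e ^+ 4 / N.+1%:R <= x.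
  set c := _ / e ^+ 4; exists (Num.truncn (c / x)).
  rewrite ler_pdivrMr// mulrC -ler_pdivrMr//; apply: ltW; exact: truncnS_gt.
apply: (@le_trans _ _ (P (M N))).
  by apply: le_measure; rewrite ?inE//; [exact: bigcapT_measurable|move=> w; apply].
rewrite -[P (M N)]fineK ?fin_num_measure// lee_fin; exact: le_trans (PM N) NP.
Qed.

(** Paths are controlled on [0, +oo[ alone; freezing them at negative times gives continuity on the
    whole line, without domains to carry along. *)
Lemma max0_continuous w : continuous (fun t : R => Z (Num.max 0 t) w).
Proof.
move=> t B ZB.
have cm : continuous (fun t : R => Num.max 0 t).
  by apply: continuous_maxr; [exact: continuous_const|exact: continuous_idR].
have m0 (u : R) : Num.max 0 u \in `[0, +oo[ by rewrite in_itv/= andbT le_max lexx.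
have /subspace_continuousP/(_ _ (m0 t) B ZB) := @wbm_continuous _ _ _ _ P kappa Z wbmZ w.
rewrite /= !nbhs_simpl /within/= => /cm; rewrite nbhs_simpl/=.
by apply: filterS => u /(_ (m0 u)).
Qed.

(** By [ray_path_rat] a violation is witnessed by two rational times, a coordinate, a rational
    level, a distance 1/(j+1) from the origin and a direction of crossing, recorded by the boolean:
    countably many null events. *)
Lemma rays_ae : {ae P, forall w, ray_path (fun t => Z (Num.max 0 t) w)}.
Proof.
have cZ := max0_continuous.
pose X := (rat * rat * 'I_n * rat * bool * nat)%type.
pose bad (x : X) : set T := let: (s, t, i, q, b, j) := x in
  let B : set 'rV[R]_n := [set x | x ord0 i < ratr q] in
  let B' := if b then B else ~` B in
  if (0 <= s) && (s < t) then
    [set w | [/\ B' (ang (ratr s) w), ~ B' (ang (ratr t) w) &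
      forall u, ratr s <= u <= ratr t -> j.+1%:R^-1 <= rad u w]]
  else set0.
have nbad x : P.-negligible (bad x).
  case: x => [[[[[s t] i] q] b] j]; rewrite /bad; case: ifP => [/andP[s0 st]|_]; last exact: negligible_set0.
  have mB : measurable [set x : 'rV[R]_n | x ord0 i < ratr q].
    rewrite (_ : [set _ | _] = (fun x : 'rV[R]_n => x ord0 i) @^-1` `]-oo, ratr q[).
      by rewrite -[X in measurable X]setTI; apply: measurable_coord.
    by apply/seteqP; split => x /=; rewrite in_itv.
  apply: switch_negligible => //.
  - by rewrite ler0q.
  - by rewrite ltr_rat.
  - by case: b => //; exact: measurableC.
apply: (negligibleS _ (negligible_bigcup_countable nbad)).
move=> w /= nr; apply: contrapT => nb; apply: nr; apply: ray_path_rat => //.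
move=> s t i q j s0 st H.
have K (b : bool) : ~ bad (s, t, i, q, b, j) w.
  by move=> bw; apply: nb; exists (s, t, i, q, b, j).
have s0' : 0 <= ratr s :> R by rewrite ler0q.
have st' : ratr s < ratr t :> R by rewrite ltr_rat.
have t0' : 0 <= ratr t :> R by lra.
rewrite !max_r//.
have H' u : ratr s <= u <= ratr t -> j.+1%:R^-1 <= rad u w.
  by move=> us; have := H u us; rewrite max_r//; lra.
have := K true; have := K false; rewrite /bad s0 st /= => k1 k2.
apply/idP/idP => h; apply: contrapT => nh.
  by apply: k2; split.
by apply: k1; split => //; apply.
Unshelve. all: by end_near. Qed.

End ray_constancy.

(** * Regular modifications *)

Section spider.
Context {R : realType} {n : nat} {d : measure_display} {T : measurableType d}.

(* A modification of a Walsh Brownian motion from 0, with a filtration that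
   contains the null sets. Of the strong Markov property only the moment
   identities for |Z|^2, |Z|^4 and 1_B(angle Z) |Z| are retained. *)
Record spider (P : probability T R) (kappa : probability 'rV[R]_n R)
    (F : R -> set_system T) (Z : R -> T -> 'rV[R]_n) : Prop := {
  sp_sigma : forall s, sigma_algebra setT (F s) ;
  sp_meas : forall s A, F s A -> measurable A ;
  sp_null : forall s A, measurable A -> P A = 0%E -> F s A ;
  sp_mono : forall s t, s <= t -> F s `<=` F t ;
  sp_adapt : forall s B, measurable B -> F s (Z s @^-1` B) ;
  sp_cont : forall w, continuous (Z ^~ w) ;
  sp_zero : forall t w, t <= 0 -> Z t w = 0 ;
  sp_ray : forall w, ray_path (Z ^~ w) ;
  sp_L4 : forall s, L1 P (fun w => enorm (Z s w) ^+ 4) ;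
  sp_rad2 : forall s t A, 0 <= s -> 0 <= t -> F s A ->
    Ex P (fun w => \1_A w * enorm (Z (s + t) w) ^+ 2) =
    Ex P (fun w => \1_A w * (enorm (Z s w) ^+ 2 + t * gauss_var)) ;
  sp_rad4 : forall s t A, 0 <= s -> 0 <= t -> F s A ->
    Ex P (fun w => \1_A w * enorm (Z s w) ^+ 4) <=
    Ex P (fun w => \1_A w * enorm (Z (s + t) w) ^+ 4) ;
  sp_excess : forall s t A B, 0 <= s -> 0 < t -> F s A -> measurable B ->
    Ex P (fun w => \1_A w * (\1_B (angle (Z (s + t) w)) * enorm (Z (s + t) w))) =
    Ex P (fun w => \1_A w *
      (fine (kappa B) * (2 * excess (Num.sqrt t) (enorm (Z s w))) +
       \1_B (angle (Z s w)) * enorm (Z s w)))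
}.

End spider.

Section regularization.
Context {R : realType} {n : nat} {d : measure_display} {T : measurableType d}.
Variables (P : probability T R) (kappa : probability 'rV[R]_n R) (Z : R -> T -> 'rV[R]_n).
Hypothesis kappaS : kappa (sphere R n) = 1%E.
Hypothesis wbmZ : walsh_brownian_motion P kappa Z.
Hypothesis Z0 : {ae P, forall w, Z 0 w = 0}.

(** The natural filtration enlarged by the measurable null sets: an event is kept when it is
    measurable and almost surely equal to an event of the natural filtration. At negative times the
    filtration is that of time 0. *)
Definition ae_filtration (s : R) : set_system T :=
  [set A | measurable A /\ exists2 B, natural_filtration Z (Num.max 0 s) B &
    {ae P, forall w, A w <-> B w}].

(** On the exceptional set [N] the path becomes the constant path at 0, which is continuous and
    satisfies [ray_path] vacuously. *)
Definition regularize (N : set T) (s : R) (w : T) : 'rV[R]_n :=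
  if w \in N then 0 else Z (Num.max 0 s) w.

Lemma ae_filtration_sigma s : sigma_algebra setT (ae_filtration s).
Proof.
split.
- split; [exact: measurable0|exists set0 => //].
    exact: (@measurable0 _ (g_sigma_algebraType _)).
  exact: aeW.
- move=> A [mA [B FB AB]]; split; first exact: measurableD.
  exists (setT `\` B); last by apply: filterS AB => w AB; split=> -[_ h]; split => // /AB.
  by have := @measurableC _ (g_sigma_algebraType _) _ FB; rewrite setTD.
- move=> A FA; split; first by apply: bigcup_measurable => k _; have [] := FA k.
  have /choice[B BP] k : exists B, natural_filtration Z (Num.max 0 s) B /\ {ae P, forall w, A k w <-> B w}.
    by have [_ [B FB AB]] := FA k; exists B.
  exists (\bigcup_k B k).
    by apply: (@bigcup_measurable _ (g_sigma_algebraType _)) => k _; have [] := BP k.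
  have : {ae P, forall w, forall k, A k w <-> B k w} by apply: ae_foralln => k; have [] := BP k.
  by apply: filterS => w AB; split=> -[k _ /AB h]; exists k.
Qed.

(** Continuity, the start at 0 and [ray_path] are wanted at every sample point, whence the
    replacement of the bad paths; the moment identities are insensitive to null sets and carry over
    both to the new process and to the larger filtration. *)
Lemma regular_spider : exists F Z', [/\ spider P kappa F Z' &
  {ae P, forall w, forall s, 0 <= s -> Z' s w = Z s w}].
Proof.
have good : {ae P, forall w, ray_path (fun t => Z (Num.max 0 t) w) /\ Z 0 w = 0}.
  have h1 := rays_ae kappaS wbmZ Z0.
  by apply: filterS2 h1 Z0 => w.
have [N [mN PN NP]] := good.
have aeN : {ae P, forall w, ~ N w}.
  by exists N; split => // w /= /contrapT.
pose Z' := regularize N.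
have ZE s : {ae P, forall w, Z' s w = Z (Num.max 0 s) w}.
  by apply: filterS aeN => w Nw; rewrite /Z' /regularize memNset.
have goodN w : ~ N w -> ray_path (fun t => Z (Num.max 0 t) w) /\ Z 0 w = 0.
  by move=> Nw; apply: contrapT => nw; apply: Nw; exact: NP.
have max_ge0 (s : R) : 0 <= Num.max 0 s by rewrite le_max lexx.
have mZ' s : measurable_fun setT (Z' s).
  apply: measurable_fun_ifT; [|exact: measurable_cst|exact: (mZ wbmZ)].
  apply: (@measurable_fun_bool _ _ _ _ true); rewrite setTI.
  by rewrite (_ : _ @^-1` _ = N)//; apply/seteqP; split => w /=; [move=> /set_mem|move=> /mem_set].
have F0 s A : 0 <= s -> ae_filtration s A -> exists2 B, natural_filtration Z s B & [/\ measurable A, measurable B & {ae P, forall w, A w <-> B w}].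
  move=> s0 [mA [B]]; rewrite max_r// => FB AB; exists B => //; split => //.
  exact: (natural_filtration_measurable wbmZ FB).
(* The transfer principle of the proof: expectations do not see a change of the event and of the
   function on null sets. *)
have tr A B (f g : T -> R) : measurable A -> measurable B -> {ae P, forall w, A w <-> B w} ->
    measurable_fun setT f -> measurable_fun setT g -> {ae P, forall w, f w = g w} ->
    Ex P (fun w => \1_A w * f w) = Ex P (fun w => \1_B w * g w).
  move=> mA mB AB mf mg fg; apply: Ex_ae.
  - exact: measurable_funM.
  - exact: measurable_funM.
  - apply: filterS2 AB fg => w AB ->; congr (_ * _); rewrite !indicE; congr (_%:R).
    by congr nat_of_bool; apply/idP/idP => /set_mem/AB h; exact: mem_set.
have mr s : measurable_fun setT (fun w => enorm (Z' s w)).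
  by apply: measurableT_comp; [exact: measurable_enorm|exact: mZ'].
have ma s : measurable_fun setT (fun w => angle (Z' s w)).
  by apply: measurableT_comp; [exact: measurable_angle|exact: mZ'].
have Z'E w : Z' ^~ w = if w \in N then fun=> 0 else fun s => Z (Num.max 0 s) w.
  by apply/funext => s; rewrite /Z' /regularize; case: ifP.
have ZE0 s : 0 <= s -> {ae P, forall w, Z' s w = Z s w}.
  by move=> s0; have := ZE s; rewrite max_r.
exists ae_filtration, Z'; split; last first.
  by apply: filterS aeN => w Nw s s0; rewrite /Z' /regularize memNset// max_r.
split.
- exact: ae_filtration_sigma.
- by move=> s A [].
- move=> s A mA PA; split => //; exists set0; first exact: (@measurable0 _ (g_sigma_algebraType _)).
  by exists A; split => // w /= h; apply: contrapT => nA; apply: h; split => //.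
- move=> s t st A [mA [B FB AB]]; split => //; exists B => //.
  apply: natural_filtration_le FB; by rewrite ge_max !le_max lexx/= st orbT.
- move=> s B mB; split; first by rewrite -[X in measurable X]setTI; exact: mZ'.
  exists (Z (Num.max 0 s) @^-1` B); last by apply: filterS (ZE s) => w /= ->.
  apply: sub_sigma_algebra; exists (Num.max 0 s); first by rewrite /= in_itv/= max_ge0 lexx.
  by exists B => //; rewrite setTI.
- move=> w; rewrite Z'E; case: ifPn => _; first by move=> x; exact: cvg_cst.
  exact: (max0_continuous wbmZ).
- move=> t w t0; rewrite /Z' /regularize; case: ifPn => //; rewrite notin_setE (max_l t0) => Nw.
  by have [] := goodN w Nw.
- move=> w; rewrite Z'E; case: ifPn => [_ //|]; rewrite notin_setE => Nw.
  by have [] := goodN w Nw.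
- move=> s; apply: (@L1_ae _ _ _ P (fun w => enorm (Z (Num.max 0 s) w) ^+ 4)).
  + by apply: measurable_funX; exact: (mrad wbmZ).
  + exact: measurable_funX.
  + by apply: filterS (ZE s) => w -> .
  + exact: (L1_rad4 kappaS wbmZ Z0).
- move=> s t A s0 t0 /(F0 _ _ s0)[B FB [mA mB AB]].
  have st0 : 0 <= s + t by rewrite addr_ge0.
  rewrite (tr A B _ (fun w => enorm (Z (s + t) w) ^+ 2))//; last 3 first.
  + exact: measurable_funX.
  + by apply: measurable_funX; exact: (mrad wbmZ).
  + by apply: filterS (ZE0 _ st0) => w -> .
  rewrite (markov_rad2 kappaS wbmZ Z0 s0 t0 FB); apply/esym; apply: tr => //.
  + by apply: measurable_funD => //; exact: measurable_funX.
  + by apply: measurable_funD => //; apply: measurable_funX; exact: (mrad wbmZ).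
  + by apply: filterS (ZE0 _ s0) => w -> .
- move=> s t A s0 t0 /(F0 _ _ s0)[B FB [mA mB AB]].
  have st0 : 0 <= s + t by rewrite addr_ge0.
  rewrite [leRHS](tr A B _ (fun w => enorm (Z (s + t) w) ^+ 4))//; last 3 first.
  + exact: measurable_funX.
  + by apply: measurable_funX; exact: (mrad wbmZ).
  + by apply: filterS (ZE0 _ st0) => w -> .
  rewrite [leLHS](tr A B _ (fun w => enorm (Z s w) ^+ 4))//; last 3 first.
  + exact: measurable_funX.
  + by apply: measurable_funX; exact: (mrad wbmZ).
  + by apply: filterS (ZE0 _ s0) => w -> .
  have l2 := L1_rad2 kappaS wbmZ Z0 s0; have l4 := L1_rad4 kappaS wbmZ Z0 s0.
  rewrite (markov_rad4 kappaS wbmZ Z0 s0 t0 FB); apply: le_Ex.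
  + exact: L1_indic.
  + apply: L1_indic => //; apply: L1D; last exact: L1_cst.
    apply: L1D => //; apply: (eq_L1 _ (L1Z (6 * t * gauss_var) l2)) => w /=; ring.
  + move=> w; apply: ler_wpM2l; first by have /andP[] := indic01 (R := R) B w.
    have := mulr_ge0 (sqr_ge0 t) (@gauss_m4_ge0 R).
    have : 0 <= 6 * enorm (Z s w) ^+ 2 * t * gauss_var.
      by rewrite mulr_ge0 ?(ltW (@gauss_var_gt0 R))// mulr_ge0// mulr_ge0// sqr_ge0.
    lra.
- move=> s t A B s0 t0 /(F0 _ _ s0)[A' FA' [mA mA' AA']] mB.
  have st0 : 0 <= s + t by rewrite addr_ge0// ltW.
  have m1 : measurable_fun setT (\1_B : _ -> R) by exact: measurable_indic.
  rewrite (tr A A' _ (fun w => \1_B (angle (Z (s + t) w)) * enorm (Z (s + t) w)))//; last 3 first.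
  + by apply: measurable_funM => //; apply: measurableT_comp.
  + by apply: measurable_funM; [apply: (mh_ang wbmZ)|exact: (mrad wbmZ)].
  + by apply: filterS (ZE0 _ st0) => w -> .
  rewrite (markov_excess kappaS wbmZ Z0 s0 t0 FA' mB); apply/esym; apply: tr => //.
  + apply: measurable_funD; last by apply: measurable_funM => //; apply: measurableT_comp.
    apply: measurable_funM => //; apply: measurable_funM => //.
    by apply: measurableT_comp => //; exact: measurable_excess.
  + apply: measurable_funD; last by apply: measurable_funM; [apply: (mh_ang wbmZ)|exact: (mrad wbmZ)].
    apply: measurable_funM => //; apply: measurable_funM => //.
    by apply: (mg_rad wbmZ) => //; exact: measurable_excess.
  + by apply: filterS (ZE0 _ s0) => w -> .
Qed.

End regularization.

(** * Stopping times *)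

Lemma continuous_eps (R : realType) (f : R -> R) (x e : R) : continuous f -> 0 < e ->
  exists2 r, 0 < r & forall u, x - r < u < x + r -> f x - e < f u < f x + e.
Proof.
move=> cf e0; have /cvgrPdist_lt/(_ _ e0)/nbhs_ballP[r /= r0 h] := cf x.
by exists r => // u ur; rewrite -ltr_distlC; apply: h; rewrite /ball/= ltr_distlC.
Qed.

Lemma eps_continuous (R : realType) (f : R -> R) :
  (forall x e, 0 < e -> exists2 r, 0 < r & forall u, x - r < u < x + r -> `|f x - f u| < e) ->
  continuous f.
Proof.
move=> h x; apply/cvgrPdist_lt => e /h-/(_ x)[r r0 hr].
by apply/nbhs_ballP; exists r => // u; rewrite /ball/= ltr_distlC => /hr.
Qed.

Section stopping.
Context {R : realType} {n : nat} {d : measure_display} {T : measurableType d}.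
Variable F : R -> set_system T.
Hypothesis Fsigma : forall s, sigma_algebra setT (F s).
Hypothesis Fmono : forall s t, s <= t -> F s `<=` F t.
Hypothesis Fmeas : forall s A, F s A -> measurable A.
Implicit Types (alpha beta : T -> R) (A B : set T) (s t : R).
(* [g_sigma_algebraType (F s)] makes the library's measurable functions
   available for F s. *)
Notation gF s := (g_sigma_algebraType (F s)).

Lemma measurable_gF s : @measurable _ (gF s) = F s.
Proof. exact: sigma_algebra_id. Qed.

Lemma filtT s : F s setT.
Proof. rewrite -measurable_gF; exact: measurableT. Qed.

Lemma filt0 s : F s set0.
Proof. rewrite -measurable_gF; exact: measurable0. Qed.

Lemma filtI s A B : F s A -> F s B -> F s (A `&` B).
Proof. rewrite -measurable_gF; exact: measurableI. Qed.

Lemma filtU s A B : F s A -> F s B -> F s (A `|` B).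
Proof. rewrite -measurable_gF; exact: measurableU. Qed.

Lemma filtC s A : F s A -> F s (~` A).
Proof. rewrite -measurable_gF; exact: measurableC. Qed.

Lemma filt_bigcup s (G : nat -> set T) : (forall k, F s (G k)) -> F s (\bigcup_k G k).
Proof. rewrite -measurable_gF => h; apply: bigcupT_measurable => k; exact: h. Qed.

Lemma filt_bigcap s (G : nat -> set T) : (forall k, F s (G k)) -> F s (\bigcap_k G k).
Proof. rewrite -measurable_gF => h; apply: bigcapT_measurable => k; exact: h. Qed.

Lemma filt_bigcup_rat s (G : rat -> set T) : (forall k, F s (G k)) -> F s (\bigcup_k G k).
Proof. rewrite -measurable_gF => h; apply: bigcupT_measurable_rat => k; exact: h. Qed.

(** Times are real-valued. Hitting times that could be infinite are capped ([hit_or]) or given a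
    default value on a null set ([hit_fin]). *)
Definition stop alpha : Prop :=
  (forall w, 0 <= alpha w) /\ forall s, F s [set w | alpha w <= s].

(** The sigma-algebra of the past of [alpha], usually written F_alpha. *)
Definition past alpha A : Prop :=
  measurable A /\ forall s, F s (A `&` [set w | alpha w <= s]).

Lemma stop0 : stop (fun=> 0).
Proof.
split=> // s; have [s0|s0] := leP 0 s.
  rewrite (_ : [set _ | _] = setT); first exact: filtT.
  by apply/seteqP; split.
by rewrite (_ : [set _ | _] = set0); [exact: filt0|apply/seteqP; split].
Qed.

Lemma stop_gt alpha s : stop alpha -> F s [set w | s < alpha w].
Proof.
move=> [_ sa]; rewrite (_ : [set _ | _] = ~` [set w | alpha w <= s]); first exact: filtC.
by apply/seteqP; split => w /=; [rewrite ltNge => /negP|move/negP; rewrite -ltNge].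
Qed.

Lemma stop_min alpha c : 0 <= c -> stop alpha -> stop (fun w => Num.min (alpha w) c).
Proof.
move=> c0 [a0 sa]; split=> [w|s]; first by rewrite le_min a0 c0.
have [cs|cs] := leP c s.
  rewrite (_ : [set _ | _] = setT); first exact: filtT.
  by apply/seteqP; split => // w _ /=; rewrite ge_min cs orbT.
rewrite (_ : [set _ | _] = [set w | alpha w <= s])//.
by apply/seteqP; split => w /=; rewrite ge_min [c <= s]leNgt cs orbF.
Qed.

Lemma stop_measurable alpha : stop alpha -> measurable_fun setT alpha.
Proof.
move=> sa; apply: (measurability (@RGenOInfty.G R)); first exact: RGenOInfty.measurableE.
move=> _ [_ [x ->] <-]; rewrite setTI; apply: (@Fmeas x).
rewrite (_ : _ @^-1` _ = [set w | x < alpha w]); first exact: stop_gt.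
by apply/seteqP; split => w /=; rewrite in_itv/= andbT.
Qed.

Lemma pastT alpha : stop alpha -> past alpha setT.
Proof. by move=> [_ sa]; split=> // s; rewrite setTI. Qed.

Lemma past_min_le alpha c : 0 <= c -> stop alpha ->
  forall A, past alpha A -> past (fun w => Num.min (alpha w) c) (A `&` [set w | alpha w <= c]).
Proof.
move=> c0 sa A [mA pA]; split; first exact: (Fmeas (pA c)).
move=> s; have [cs|cs] := leP c s.
  rewrite (_ : _ `&` _ = A `&` [set w | alpha w <= c]); first exact: Fmono (pA c).
  by apply/seteqP; split => [w [] //|w h]; split => //=; rewrite ge_min cs orbT.
rewrite (_ : _ `&` _ = A `&` [set w | alpha w <= s])//.
apply/seteqP; split => w /=; rewrite ge_min [c <= s]leNgt cs orbF.
  by move=> [[]].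
by move=> [Aw aw]; split=> //; split=> //; lra.
Qed.

Section hitting.
Variables (alpha : T -> R) (Y : R -> T -> R).
Hypothesis sa : stop alpha.
Hypothesis cY : forall w, continuous (Y ^~ w).
Hypothesis aY : forall t x, F t ([set w | alpha w <= t] `&` [set w | x < Y t w]).

(** The target is the closed condition Y >= 0, after the time [alpha]. Adaptedness is asked of [Y]
    only once [alpha] has passed, because the barriers used later depend on the position at that
    time. *)
Definition hit_by s : set T := [set w | exists t, [/\ alpha w <= t, t <= s & 0 <= Y t w]].

Definition hit_time w : R := inf [set t | alpha w <= t /\ 0 <= Y t w].

(** By continuity, the target is met within [alpha, s] exactly when, for every k, Y exceeds -1/(k+1)
    at s or at some rational time of the interval: the maximum over this compact interval is then
    nonnegative. Only times up to s are inspected, so the event belongs to F s itself. *)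
Lemma hit_by_filt s : F s (hit_by s).
Proof.
pose G k := ([set w | alpha w <= s] `&` [set w | - k.+1%:R^-1 < Y s w]) `|`
  \bigcup_(q : rat) (if ratr q <= s then
     [set w | alpha w <= ratr q] `&` [set w | - k.+1%:R^-1 < Y (ratr q) w] else set0).
rewrite (_ : hit_by s = \bigcap_k G k); last first.
  apply/seteqP; split => w.
    move=> [t [at_ ts Yt]] k _.
    have k0 : 0 < k.+1%:R^-1 :> R by rewrite invr_gt0.
    move: ts; rewrite le_eqVlt => /predU1P[ts|ts].
      by left; rewrite -ts; split => //=; apply: lt_le_trans Yt; rewrite oppr_lt0.
    right; have [e e0 he] := continuous_eps t (@cY w) k0.
    have [q /itvP qi] : exists q : rat, ratr q \in `]t, Num.min s (t + e)[.
      by apply: rat_in_itvoo; rewrite lt_min ts ltrDl.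
    have q1 : t < ratr q by rewrite qi.
    have : ratr q < Num.min s (t + e) by rewrite qi.
    rewrite lt_min => /andP[q2 q3].
    exists q => //; rewrite (ltW q2); split => /=; first by lra.
    have /he/andP[] : t - e < ratr q < t + e by apply/andP; split; lra.
    by move=> h _; apply: le_lt_trans h; rewrite -[leLHS]add0r lerD2r.
  move=> Gw; have as_ : alpha w <= s.
    have [[]//|[q _]] := Gw 0 I; case: ifP => // qs [/= aq _]; exact: le_trans qs.
  have [c cst cm] := @EVT_max R (Y ^~ w) (alpha w) s as_ (continuous_subspaceT (@cY w)).
  exists c; move: cst; rewrite in_itv/= => /andP[-> ->]; split => //.
  have K k : - k.+1%:R^-1 < Y c w.
    have [[_ /= h]|[q _]] := Gw k I.
      by apply: lt_le_trans h (cm s _); rewrite in_itv/= as_ lexx.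
    case: ifP => // qs [/= aq h]; apply: lt_le_trans h (cm _ _).
    by rewrite in_itv/= aq qs.
  rewrite leNgt; apply/negP => Y0.
  have Y0' : 0 < - Y c w by lra.
  have [j _ H] := near_infty_natSinv_lt (PosNum Y0').
  by have := K j; rewrite ltrNl => /(lt_trans (H j (leqnn j))); rewrite ltxx.
apply: filt_bigcap => k; apply: filtU; first exact: aY.
apply: filt_bigcup_rat => q; case: ifP => [qs|_]; last exact: filt0.
by apply: (Fmono qs); exact: aY.
Qed.

Lemma hit_timeP w s : hit_by s w ->
  [/\ alpha w <= hit_time w, hit_time w <= s, 0 <= Y (hit_time w) w &
    forall t, alpha w <= t -> t < hit_time w -> Y t w < 0].
Proof.
move=> [t [at_ ts Yt]]; set S := [set t | alpha w <= t /\ 0 <= Y t w].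
have lbS : lbound S (alpha w) by move=> u [].
have hS : has_inf S by split; [exists t|exists (alpha w)].
have St : S t by [].
have b1 : alpha w <= inf S by apply: lb_le_inf => //; exists t.
have b2 : inf S <= t by apply: ge_inf => //; exists (alpha w).
have b4 u : alpha w <= u -> u < inf S -> Y u w < 0.
  move=> au ub; rewrite ltNge; apply/negP => Yu.
  have : inf S <= u by apply: ge_inf => //; exists (alpha w).
  by rewrite leNgt ub.
split => //; first exact: le_trans ts.
rewrite leNgt; apply/negP => Yb; have Yb' : 0 < - Y (inf S) w by lra.
have [e e0 he] := continuous_eps (inf S) (@cY w) Yb'.
have [u [au Yu] ub] := inf_adherent e0 hS.
have iu : inf S <= u by apply: ge_inf => //; exists (alpha w).
have /he/andP[] : inf S - e < u < inf S + e by apply/andP; split; lra.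
by lra.
Qed.

Lemma hit_time_le w s t : hit_by t w -> (hit_time w <= s) <-> hit_by s w.
Proof.
move=> hw; split=> [bs|]; last by move/hit_timeP => [].
by have [h1 h2 h3 h4] := hit_timeP hw; exists (hit_time w).
Qed.

Lemma hit_by_le s t : s <= t -> hit_by s `<=` hit_by t.
Proof. by move=> st w [u [au us Yu]]; exists u; split => //; exact: le_trans st. Qed.

Lemma hit_start w s t : Y (alpha w) w <= 0 -> hit_by s w -> t = hit_time w -> Y t w = 0.
Proof.
move=> Ya hw ->; have [h1 h2 h3 h4] := hit_timeP hw.
apply/eqP; rewrite eq_le h3 andbT; move: h1; rewrite [alpha w <= _]le_eqVlt => /orP[/eqP<- //|h1].
rewrite leNgt; apply/negP => Yb.
have [e e0 he] := continuous_eps (hit_time w) (@cY w) Yb.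
pose u := Num.max (alpha w) (hit_time w - e / 2).
have ub : u < hit_time w by rewrite gt_max h1/=; lra.
have ue : hit_time w - e / 2 <= u by rewrite le_max lexx orbT.
have au : alpha w <= u by rewrite le_max lexx.
have /he/andP[] : hit_time w - e < u < hit_time w + e by apply/andP; split; lra.
by have := h4 u au ub; lra.
Qed.

(** The hitting time capped at c, to which optional stopping applies. Its value is also c when
    [alpha] exceeds c, whence the minimum in [hit_or_ge]. *)
Definition hit_or c w : R := if w \in hit_by c then hit_time w else c.

Lemma hit_or_stop c : 0 <= c -> stop (hit_or c).
Proof.
move=> c0; have [a0 _] := sa; split=> [w|s].
  rewrite /hit_or; case: ifP => // /set_mem/hit_timeP[h _ _ _]; exact: le_trans h.
have [cs|cs] := leP c s.
  rewrite (_ : [set _ | _] = setT); first exact: filtT.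
  apply/seteqP; split => // w _ /=; rewrite /hit_or; case: ifP => // /set_mem/hit_timeP[_ h _ _].
  exact: le_trans cs.
rewrite (_ : [set _ | _] = hit_by s); first exact: hit_by_filt.
apply/seteqP; split => w /=; rewrite /hit_or.
  by case: ifP => [/set_mem h /(hit_time_le s h)//|_]; rewrite leNgt cs.
move=> h; rewrite mem_set; last exact: hit_by_le (ltW cs) _ h.
by have [] := hit_timeP h.
Qed.

Lemma hit_or_le c w : hit_or c w <= c.
Proof. by rewrite /hit_or; case: ifP => // /set_mem/hit_timeP[]. Qed.

Lemma hit_or_ge c w : Num.min (alpha w) c <= hit_or c w.
Proof.
by rewrite /hit_or; case: ifP => [/set_mem/hit_timeP[h _ _ _]|_]; rewrite ge_min ?h// lexx orbT.
Qed.

Lemma hit_or_before c w t : alpha w <= t -> t < hit_or c w -> Y t w < 0.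
Proof.
move=> at_; rewrite /hit_or; case: ifPn => [/set_mem/hit_timeP[_ _ _ h] tb|]; first exact: h.
rewrite notin_setE => nh tc; rewrite ltNge; apply/negP => Yt; apply: nh.
by exists t; split => //; exact: ltW.
Qed.

Lemma hit_or_val c w : alpha w <= c -> Y (alpha w) w <= 0 -> Y (hit_or c w) w <= 0.
Proof.
move=> ac Ya; rewrite /hit_or; case: ifPn => [/set_mem h|].
  by rewrite (hit_start Ya h erefl).
rewrite notin_setE => nh; apply: ltW; rewrite ltNge; apply/negP => Yc; apply: nh.
by exists c.
Qed.

Lemma hit_or_eq c w s : hit_by s w -> s <= c -> hit_or c w = hit_time w.
Proof. by move=> h sc; rewrite /hit_or mem_set//; exact: hit_by_le sc _ h. Qed.

End hitting.

End stopping.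

(** * Optional stopping *)

Section mesh.
Context {R : realType}.
Implicit Types (x : R) (N k : nat).

(** [rnd] rounds up to the grid of step 1/(N+1), so that the event that a rounded stopping time
    takes a given value is known at that time. The preceding grid point, of index [(ridx N x).-1],
    does not exceed x and is used where only the past of x is available. *)
Definition ridx N x : nat := `|Num.ceil (x * N.+1%:R)|%N.
Definition rnd N x : R := (ridx N x)%:R / N.+1%:R.

Lemma ridx_le N x k : 0 <= x -> (ridx N x <= k)%N = (x <= k%:R / N.+1%:R).
Proof.
move=> x0; have c0 : 0 <= Num.ceil (x * N.+1%:R).
  by have := ceil_le (mulr_ge0 x0 (ler0n R N.+1)); rewrite ceil0.
rewrite /ridx -lez_nat gez0_abs// ceil_le_int ler_pdivlMr//.
Qed.

Lemma rnd_ge N x : 0 <= x -> x <= rnd N x.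
Proof. by move=> x0; rewrite /rnd -ridx_le. Qed.

Lemma ridx_pred N x : 0 <= x -> (ridx N x).-1%:R / N.+1%:R <= x.
Proof.
move=> x0; case E : (ridx N x) => [|k] /=; first by rewrite mul0r.
by apply: ltW; rewrite ltNge -ridx_le// E ltnn.
Qed.

Lemma rnd_le N x : 0 <= x -> rnd N x <= x + N.+1%:R^-1.
Proof.
move=> x0; rewrite -lerBlDr; apply: le_trans (ridx_pred N x0).
rewrite /rnd -[X in _ - X]mul1r -mulrBl ler_wpM2r ?invr_ge0//.
by case: ridx => [|k] /=; rewrite ?sub0r ?lerN10// -[k.+1%:R]natr1 addrK.
Qed.

Lemma ridx_pred_ge N x : 0 <= x -> x - N.+1%:R^-1 <= (ridx N x).-1%:R / N.+1%:R.
Proof.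
move=> x0; rewrite lerBlDr; apply: le_trans (rnd_ge N x0) _.
rewrite /rnd -[X in _ + X]mul1r -mulrDl ler_wpM2r ?invr_ge0//.
by case: ridx => [|k] /=; rewrite ?addr_ge0// natr1.
Qed.

Lemma inv_cvg0 : (fun N => N.+1%:R^-1 : R) @ \oo --> 0.
Proof. exact: cvg_harmonic. Qed.

Lemma rnd_cvg x : 0 <= x -> (fun N => rnd N x) @ \oo --> x.
Proof.
move=> x0; apply: (@squeeze_cvgr _ _ _ _ (fun=> x) (fun N => x + N.+1%:R^-1)).
- by apply: nearW => N; rewrite rnd_ge//= rnd_le.
- exact: cvg_cst.
- rewrite -[X in _ --> X]addr0; apply: cvgD; [exact: cvg_cst|exact: inv_cvg0].
Qed.

Lemma ridx_pred_cvg x : 0 <= x -> (fun N => (ridx N x).-1%:R / N.+1%:R) @ \oo --> x.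
Proof.
move=> x0; apply: (@squeeze_cvgr _ _ _ _ (fun N => x - N.+1%:R^-1) (fun=> x)).
- by apply: nearW => N; rewrite ridx_pred_ge//= ridx_pred.
- rewrite -[X in _ --> X]subr0; apply: cvgB; [exact: cvg_cst|exact: inv_cvg0].
- exact: cvg_cst.
Qed.

Lemma sum_idx (L i : nat) (f : nat -> R) : (i < L)%N ->
  \sum_(k < L) (i == k :> nat)%:R * f k = f i.
Proof.
move=> iL; rewrite (bigD1 (Ordinal iL))//= eqxx mul1r big1 ?addr0// => k ki.
rewrite (_ : (i == k) = false) ?mul0r//; apply/negbTE; apply: contra ki => /eqP ik.
by apply/eqP/val_inj.
Qed.

End mesh.

Section stopped.
Context {R : realType} {n : nat} {d : measure_display} {T : measurableType d}.
Variables (P : probability T R) (kappa : probability 'rV[R]_n R).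
Variables (F : R -> set_system T) (Z : R -> T -> 'rV[R]_n).
Hypothesis sp : spider P kappa F Z.
Implicit Types (alpha beta rho : T -> R) (A D : set T) (s t : R).
Notation rad t w := (enorm (Z t w)).
Notation ang t w := (angle (Z t w)).
Notation gF s := (g_sigma_algebraType (F s)).
Let Fsigma := sp_sigma sp.
Let Fmono := sp_mono sp.
Let Fmeas := sp_meas sp.

Lemma sp_mZ t : measurable_fun setT (Z t).
Proof. by move=> _ B mB; rewrite setTI; apply: (Fmeas (sp_adapt sp t mB)). Qed.

Lemma sp_mrad t : measurable_fun setT (fun w => rad t w).
Proof. by apply: measurableT_comp; [exact: measurable_enorm|exact: sp_mZ]. Qed.

Lemma sp_mang t : measurable_fun setT (fun w => ang t w).
Proof. by apply: measurableT_comp; [exact: measurable_angle|exact: sp_mZ]. Qed.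

Lemma sp_gZ t : @measurable_fun _ _ (gF t) _ setT (Z t).
Proof. by move=> _ B mB; rewrite setTI measurable_gF//; exact: (sp_adapt sp). Qed.

Lemma ridx_filt N rho k : stop F rho -> F (k%:R / N.+1%:R) [set w | ridx N (rho w) = k].
Proof.
move=> [r0 sr]; have E j : [set w | (ridx N (rho w) <= j)%N] = [set w | rho w <= j%:R / N.+1%:R].
  by apply/seteqP; split => w /=; rewrite ridx_le.
case: k => [|k].
  rewrite (_ : [set _ | _] = [set w | rho w <= 0%:R / N.+1%:R]); first exact: sr.
  by rewrite -E; apply/seteqP; split => w /=; rewrite leqn0 => /eqP.
rewrite (_ : [set _ | _] = [set w | rho w <= k.+1%:R / N.+1%:R] `&` ~` [set w | rho w <= k%:R / N.+1%:R]).
  apply: filtI => //; apply: filtC => //; apply: (Fmono _ (sr _)).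
  by rewrite ler_wpM2r ?invr_ge0// ler_nat.
rewrite -!E; apply/seteqP; split => w /=; first by move=> ->; split=> //; rewrite ltnn.
by move=> [h1 /negP]; rewrite -ltnNge => h2; apply/eqP; rewrite eqn_leq h1.
Qed.

(** Progressive measurability. The time min(rho, s) is approximated from below by grid points, at
    which the process is known by time s, and continuity of the paths gives the limit. *)
Lemma stopped_measurable (X : R -> T -> R) rho s : 0 <= s -> stop F rho ->
  (forall w, continuous (X ^~ w)) -> (forall t, @measurable_fun _ _ (gF t) _ setT (X t)) ->
  @measurable_fun _ _ (gF s) _ setT (fun w => X (Num.min (rho w) s) w).
Proof.
move=> s0 sr cX aX; have sm := stop_min Fsigma s0 sr; have [m0 _] := sm.
pose f N w := X ((ridx N (Num.min (rho w) s)).-1%:R / N.+1%:R) w.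
have : forall N, @measurable_fun _ _ (gF s) _ setT (f N).
  move=> N; pose L := (ridx N s).+1.
  pose G k : set T := [set w | ridx N (Num.min (rho w) s) = k].
  have rL w : (ridx N (Num.min (rho w) s) < L)%N.
    rewrite ltnS ridx_le//; apply: le_trans (rnd_ge N s0); by rewrite ge_min lexx orbT.
  (* Capping the grid times at s changes nothing where the indicator is nonzero, and makes every
     summand measurable for F s. *)
  rewrite (_ : f N = fun w => \sum_(k < L) \1_(G k) w * X (Num.min (k.-1%:R / N.+1%:R) s) w); last first.
    apply/funext => w; rewrite /f -(sum_idx (fun k => X (k.-1%:R / N.+1%:R) w) (rL w)).
    apply: eq_bigr => k _; rewrite indicE; case: (boolP (w \in G k)) => [/set_mem <-|]; last first.
      by rewrite notin_setE /G/= => /eqP/negbTE ->; rewrite !mul0r.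
    rewrite eqxx; congr (_ * X _ w); apply/esym/min_idPl; apply: le_trans (ridx_pred N (m0 w)) _.
    by rewrite ge_min lexx orbT.
  apply: measurable_sum => k; apply: measurable_funM.
    apply: measurable_indic; rewrite measurable_gF//.
    have E j : F s [set w | (ridx N (Num.min (rho w) s) <= j)%N].
      rewrite (_ : [set _ | _] = [set w | Num.min (rho w) s <= j%:R / N.+1%:R]); last first.
        by apply/seteqP; split => w /=; rewrite ridx_le.
      have [js|js] := leP s (j%:R / N.+1%:R).
        rewrite (_ : [set _ | _] = setT); first exact: filtT.
        by apply/seteqP; split => // w _ /=; rewrite ge_min js orbT.
      by apply: (Fmono (ltW js)); have [_] := sm; apply.
    case: (k : nat) => [|j].
      rewrite (_ : G 0 = [set w | (ridx N (Num.min (rho w) s) <= 0)%N]) //.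
      by apply/seteqP; split => w /=; rewrite /G/= leqn0 => /eqP.
    rewrite (_ : G _ = [set w | (ridx N (Num.min (rho w) s) <= j.+1)%N] `&`
      ~` [set w | (ridx N (Num.min (rho w) s) <= j)%N]).
      by apply: filtI => //; apply: filtC.
    apply/seteqP; split => w /=; rewrite /G/=; first by move=> ->; split=> //; rewrite ltnn.
    by move=> [h1 /negP]; rewrite -ltnNge => h2; apply/eqP; rewrite eqn_leq h1.
  move=> _ B mB; rewrite setTI measurable_gF//.
  apply: (Fmono (_ : Num.min (k.-1%:R / N.+1%:R) s <= s)); first by rewrite ge_min lexx orbT.
  by rewrite -(measurable_gF Fsigma) -[X in measurable X]setTI; apply: aX.
move=> mf; apply: (@measurable_realfun.measurable_fun_cvg _ (gF s) R setT f) => // w _.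
apply: (@cvg_comp _ _ _ (fun N => (ridx N (Num.min (rho w) s)).-1%:R / N.+1%:R) (X ^~ w)).
  exact: ridx_pred_cvg.
exact: cX.
Qed.

Lemma stopped_Z rho s : 0 <= s -> stop F rho ->
  @measurable_fun _ _ (gF s) _ setT (fun w => Z (Num.min (rho w) s) w).
Proof.
move=> s0 sr; apply: measurable_rV_coord => i.
apply: (@stopped_measurable (fun t w => Z t w ord0 i)) => //.
  move=> w t; apply: (@continuous_comp _ _ _ (Z ^~ w) (fun x : 'rV[R]_n => x ord0 i)).
    apply: (sp_cont sp).
  exact: coord_cont.
by move=> t; apply: (measurableT_comp (measurable_coord i)); exact: sp_gZ.
Qed.

Lemma stop_Z_measurable rho : stop F rho -> measurable_fun setT (fun w => Z (rho w) w).
Proof.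
move=> sr; have [r0 _] := sr; apply: measurable_rV_coord => i.
pose f k w := Z (Num.min (rho w) k%:R) w ord0 i.
apply: (@measurable_realfun.measurable_fun_cvg _ T R setT f).
  move=> k; apply: (measurableT_comp (measurable_coord i)) => _ B mB.
  rewrite setTI; apply: (@Fmeas k%:R); rewrite -(measurable_gF Fsigma) -[X in measurable X]setTI.
  by apply: (stopped_Z _ sr).
move=> w _; apply: cvg_near_cst; near=> k; rewrite /f min_l//.
near: k; exact: nbhs_infty_ger.
Unshelve. all: by end_near. Qed.

Lemma past_Z rho B : stop F rho -> measurable B -> past F rho [set w | B (Z (rho w) w)].
Proof.
move=> sr mB; have [r0 sr'] := sr; split.
  by rewrite -[X in measurable X]setTI; apply: stop_Z_measurable.
move=> s; have [s0|s0] := leP 0 s; last first.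
  rewrite (_ : _ `&` _ = set0); first exact: filt0.
  by apply/seteqP; split => // w [_ /=]; have := r0 w; lra.
rewrite (_ : _ `&` _ = [set w | B (Z (Num.min (rho w) s) w)] `&` [set w | rho w <= s]).
  apply: filtI => //; rewrite -(measurable_gF Fsigma) -[X in measurable X]setTI.
  by apply: (stopped_Z s0 sr).
by apply/seteqP; split => w /= [h1 h2]; split => //; move: h1; rewrite min_l.
Qed.

Lemma rad4_le s t D : 0 <= s -> s <= t -> F s D ->
  Ex P (fun w => \1_D w * rad s w ^+ 4) <= Ex P (fun w => \1_D w * rad t w ^+ 4).
Proof.
by move=> s0 st FD; have := sp_rad4 sp s0 (_ : 0 <= t - s) FD; rewrite [s + _]addrC subrK; apply; rewrite subr_ge0.
Qed.

Section process.
Variables (K : nat) (M : R -> T -> R) (C : R).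
Hypothesis C0 : 0 <= C.
Hypothesis cM : forall w, continuous (M ^~ w).
Hypothesis mM : forall s, measurable_fun setT (M s).
Hypothesis bM : forall s w, 0 <= s -> s <= K%:R -> M s w ^+ 2 <= C * (1 + rad s w ^+ 4).

Lemma L1_M2 s : 0 <= s -> s <= K%:R -> L1 P (fun w => M s w ^+ 2).
Proof.
move=> s0 sK; apply: (@L1_le _ _ _ _ _ (fun w => C * (1 + rad s w ^+ 4))).
- exact: measurable_funX.
- by apply: L1Z; apply: L1D; [exact: L1_cst|exact: sp_L4 sp s].
- by move=> w; rewrite ger0_norm ?sqr_ge0// bM.
Qed.

Lemma L1_M s : 0 <= s -> s <= K%:R -> L1 P (M s).
Proof. by move=> s0 sK; apply: L1_sqr => //; exact: L1_M2. Qed.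

Lemma grid_le N k : (k <= K * N.+1)%N -> k%:R / N.+1%:R <= K%:R :> R.
Proof. by move=> kK; rewrite ler_pdivrMr// -natrM ler_nat. Qed.

Lemma grid_ge0 N k : 0 <= k%:R / N.+1%:R :> R.
Proof. by rewrite divr_ge0. Qed.

Section round.
Variable rho : T -> R.
Hypothesis sr : stop F rho.
Hypothesis rK : forall w, rho w <= K%:R.
Let r0 := sr.1.

Lemma ridx_lt N w : (ridx N (rho w) < (K * N.+1).+1)%N.
Proof. by rewrite ltnS ridx_le// natrM mulfK ?pnatr_eq0. Qed.

Lemma round_sum N (f : R -> T -> R) w : f (rnd N (rho w)) w =
  \sum_(k < (K * N.+1).+1) \1_[set w | ridx N (rho w) = k] w * f (k%:R / N.+1%:R) w.
Proof.
rewrite /rnd -(sum_idx (fun k => f (k%:R / N.+1%:R) w) (ridx_lt N w)).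
apply: eq_bigr => k _; congr (_ * _); rewrite indicE; congr (_%:R); congr nat_of_bool.
by apply/eqP/idP => [h|/set_mem //]; exact: mem_set.
Qed.

Lemma ridx_meas N k : measurable [set w | ridx N (rho w) = k].
Proof. by apply: (Fmeas (ridx_filt N k sr)). Qed.

(** On the event that the rounded time is k/(N+1), known at that time, the fourth moment of the
    radius grows until time K by [sp_rad4]. Summing over the partition gives a bound that is uniform
    in N. *)
Lemma round_sqr N : L1 P (fun w => M (rnd N (rho w)) w ^+ 2) /\
  Ex P (fun w => M (rnd N (rho w)) w ^+ 2) <= C * (1 + Ex P (fun w => rad K%:R w ^+ 4)).
Proof.
pose L := (K * N.+1).+1; pose t k : R := k%:R / N.+1%:R.
pose G k : set T := [set w | ridx N (rho w) = k].
have mG k : measurable (G k) by exact: ridx_meas.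
have tK (k : 'I_L) : t k <= K%:R by apply: grid_le; rewrite -ltnS.
have l4 s : L1 P (fun w => 1 + rad s w ^+ 4) by apply: L1D; [exact: L1_cst|exact: sp_L4 sp s].
have lM (k : 'I_L) : L1 P (fun w => \1_(G k) w * M (t k) w ^+ 2).
  by apply: L1_indic => //; apply: L1_M2 => //; exact: grid_ge0.
have E w : M (rnd N (rho w)) w ^+ 2 = \sum_(k < L) \1_(G k) w * M (t k) w ^+ 2.
  by rewrite (round_sum N (fun s w => M s w ^+ 2)).
split; first by apply: (eq_L1 (fun w => esym (E w))); apply: L1_sum.
rewrite (eq_Ex P E) Ex_sum//.
apply: (@le_trans _ _ (\sum_(k < L) C * Ex P (fun w => \1_(G k) w * (1 + rad K%:R w ^+ 4)))).
  apply: ler_sum => k _; rewrite -ExZ; last exact: L1_indic.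
  apply: (@le_trans _ _ (Ex P (fun w => C * (\1_(G k) w * (1 + rad (t k) w ^+ 4))))).
    apply: le_Ex => //; first by apply: L1Z; exact: L1_indic.
    move=> w; rewrite [leRHS]mulrCA; apply: ler_wpM2l; first by have /andP[] := indic01 (R := R) (G k) w.
    by apply: bM => //; exact: grid_ge0.
  rewrite !ExZ; [|exact: L1_indic..]; apply: ler_wpM2l => //.
  have D s : Ex P (fun w => \1_(G k) w * (1 + rad s w ^+ 4)) =
      Ex P (\1_(G k)) + Ex P (fun w => \1_(G k) w * rad s w ^+ 4).
    rewrite -ExD; [|exact: L1_1|by apply: L1_indic => //; exact: sp_L4 sp s].
    by apply: eq_Ex => w; rewrite mulrDr mulr1.
  rewrite !D lerD2l; apply: rad4_le => //; first exact: grid_ge0.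
  exact: ridx_filt.
rewrite -mulr_sumr -Ex_sum; last by move=> k; exact: L1_indic.
rewrite -[X in C * (X + _)](Ex_cst P) -ExD; [|exact: L1_cst|exact: sp_L4 sp _].
apply: ler_wpM2l => //; rewrite le_eqVlt; apply/orP; left; apply/eqP; apply: eq_Ex => w.
by rewrite -(round_sum N (fun _ w => 1 + rad K%:R w ^+ 4)).
Qed.

Lemma round_meas N : measurable_fun setT (fun w => M (rnd N (rho w)) w).
Proof.
under eq_fun do rewrite (round_sum N M).
apply: measurable_sum => k; apply: measurable_funM => //; exact: measurable_indic (ridx_meas N k).
Qed.

(** The bound of [round_sqr] does not depend on N, so the values at the rounded times are uniformly
    integrable, and they converge by continuity of the paths. *)
Lemma stopped_L2 A : measurable A ->
  [/\ L1 P (fun w => M (rho w) w), L1 P (fun w => M (rho w) w ^+ 2),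
    Ex P (fun w => M (rho w) w ^+ 2) <= C * (1 + Ex P (fun w => rad K%:R w ^+ 4)) &
    Ex P \o (fun N w => \1_A w * M (rnd N (rho w)) w) @ \oo --> Ex P (fun w => \1_A w * M (rho w) w)].
Proof.
move=> mA; have cv w : (fun N => M (rnd N (rho w)) w) @ \oo --> M (rho w) w.
  apply: (@cvg_comp _ _ _ (fun N => rnd N (rho w)) (M ^~ w)); last exact: cM.
  exact: rnd_cvg.
have [h1 h2 h3 _] := Ex_ui round_meas (fun N => (round_sqr N).1) (fun N => (round_sqr N).2) cv.
split => //.
have I2 N w : (\1_A w * M (rnd N (rho w)) w) ^+ 2 = \1_A w * M (rnd N (rho w)) w ^+ 2.
  by rewrite exprMn indicE; case: (w \in A); rewrite ?expr1n ?expr0n.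
have lI N : L1 P (fun w => (\1_A w * M (rnd N (rho w)) w) ^+ 2).
  by apply: (eq_L1 (fun w => esym (I2 N w))); apply: L1_indic => //; exact: (round_sqr N).1.
have [] // := @Ex_ui _ _ _ P (fun N w => \1_A w * M (rnd N (rho w)) w)
  (fun w => \1_A w * M (rho w) w) (C * (1 + Ex P (fun w => rad K%:R w ^+ 4))) _ lI.
- by move=> N; apply: measurable_funM; [exact: measurable_indic|exact: round_meas].
- move=> N; apply: le_trans (round_sqr N).2; apply: le_Ex => //; first exact: (round_sqr N).1.
  move=> w; rewrite I2 ler_piMl ?sqr_ge0//; by have /andP[] := indic01 (R := R) A w.
- by move=> w; apply: cvgM; [exact: cvg_cst|exact: cv].
Qed.

End round.

(** The increments of M over a step h need only be centred up to c h^2, and only on events of [A]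
    that lie between [alpha] and [beta]. Along the grid there are K (N+1) steps with error c /
    (N+1)^2 each, so the total error is cK / (N+1). This covers |Z|, which is a martingale only
    while it stays away from 0. *)
Lemma optional_stopping alpha beta A (c : R) : stop F alpha -> stop F beta ->
  (forall w, alpha w <= beta w) -> (forall w, beta w <= K%:R) -> past F alpha A ->
  (forall s h D, 0 <= s -> 0 < h -> s + h <= K%:R -> F s D ->
     (forall w, D w -> [/\ A w, alpha w <= s & s < beta w]) ->
     `|Ex P (fun w => \1_D w * (M (s + h) w - M s w))| <= c * h ^+ 2) ->
  Ex P (fun w => \1_A w * M (beta w) w) = Ex P (fun w => \1_A w * M (alpha w) w).
Proof.
move=> sa sb ab bK pA H; have [mA pA'] := pA.
have aK w : alpha w <= K%:R by exact: le_trans (bK w).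
have [a0 _] := sa; have [b0 _] := sb.
have [_ _ _ ca] := stopped_L2 sa aK mA; have [_ _ _ cb] := stopped_L2 sb bK mA.
have step N : `|Ex P (fun w => \1_A w * M (rnd N (beta w)) w) -
    Ex P (fun w => \1_A w * M (rnd N (alpha w)) w)| <= c * K%:R * N.+1%:R^-1.
  pose L := (K * N.+1)%N; pose t k : R := k%:R / N.+1%:R.
  have tS k : t k.+1 = t k + N.+1%:R^-1 by rewrite /t -natr1 mulrDl mul1r.
  pose D k := A `&` [set w | alpha w <= t k] `&` [set w | t k < beta w].
  have FD k : F (t k) (D k) by apply: filtI => //; exact: stop_gt.
  have mD k : measurable (D k) by exact: Fmeas (FD k).
  have tK k : (k < L)%N -> t k.+1 <= K%:R by move=> kL; exact: grid_le.
  have tK' k : (k < L)%N -> t k <= K%:R by move=> kL; apply: grid_le; exact: ltnW.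
  have lD (k : 'I_L) : L1 P (fun w => \1_(D k) w * (M (t k.+1) w - M (t k) w)).
    apply: L1_indic => //; apply: L1B; apply: L1_M.
    + exact: grid_ge0.
    + exact: tK.
    + exact: grid_ge0.
    + exact: tK'.
  have lr rho : stop F rho -> (forall w, rho w <= K%:R) -> L1 P (fun w => \1_A w * M (rnd N (rho w)) w).
    move=> sr rK; apply: L1_indic => //; apply: L1_sqr; first exact: round_meas.
    by have [] := round_sqr sr rK N.
  rewrite -ExB; [|exact: lr..].
  (* A grid step contributes only if [alpha] has passed and [beta] has not: the sum over the whole
     grid is the telescoping sum between the two rounded times. *)
  have E w : \1_A w * M (rnd N (beta w)) w - \1_A w * M (rnd N (alpha w)) w =
      \sum_(k < L) \1_(D k) w * (M (t k.+1) w - M (t k) w).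
    rewrite -mulrBr; have [Aw|nA] := pselect (A w); last first.
      rewrite [\1_A w]indicE memNset// mul0r big1// => k _.
      by rewrite indicE memNset ?mul0r// => -[[]].
    rewrite [\1_A w]indicE mem_set// mul1r /rnd.
    have iab : (ridx N (alpha w) <= ridx N (beta w))%N.
      by rewrite ridx_le//; apply: le_trans (ab w) _; exact: rnd_ge.
    have ibL : (ridx N (beta w) <= L)%N by rewrite -ltnS; exact: ridx_lt.
    have := telescope_sumr (fun k => M (t k) w) iab; rewrite -/(t _) -/(t _) => <-.
    rewrite -(big_mkord xpredT (fun k => \1_(D k) w * (M (t k.+1) w - M (t k) w))).
    rewrite [RHS](big_cat_nat (leq0n (ridx N (alpha w))) (leq_trans iab ibL))/=.
    rewrite [X in _ = _ + X](big_cat_nat iab ibL)/=.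
    have -> : \sum_(0 <= k < ridx N (alpha w)) \1_(D k) w * (M (t k.+1) w - M (t k) w) = 0.
      rewrite big_nat_cond big1// => k /andP[/andP[_ ka] _].
      rewrite indicE memNset ?mul0r// => -[[_ /=]]; rewrite -ridx_le// => h _.
      by move: ka; rewrite ltnNge h.
    have -> : \sum_(ridx N (beta w) <= k < L) \1_(D k) w * (M (t k.+1) w - M (t k) w) = 0.
      rewrite big_nat_cond big1// => k /andP[/andP[kb _] _].
      by rewrite indicE memNset ?mul0r// => -[_ /=]; rewrite ltNge -ridx_le// kb.
    rewrite add0r addr0.
    apply: eq_big_nat => k /andP[ka kb]; rewrite indicE mem_set ?mul1r//.
    split; first by split => //=; rewrite -ridx_le.
    by rewrite /= ltNge -ridx_le// -ltnNge.
  rewrite (eq_Ex P E) Ex_sum//; apply: le_trans (ler_norm_sum _ _ _) _.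
  apply: (@le_trans _ _ (\sum_(k < L) c * N.+1%:R^-1 ^+ 2)).
    apply: ler_sum => k _; rewrite tS; apply: H => //.
    + exact: grid_ge0.
    + by rewrite -tS tK.
    + by move=> w [[Aw aw] bw].
  rewrite sumr_const card_ord -[_ *+ L]mulr_natl /L natrM le_eqVlt; apply/orP; left; apply/eqP.
  have N0 : N.+1%:R != 0 :> R by rewrite pnatr_eq0.
  by move: N.+1%:R N0 => x x0; field.
have c0 : (fun N => Ex P (fun w => \1_A w * M (rnd N (beta w)) w) -
    Ex P (fun w => \1_A w * M (rnd N (alpha w)) w)) @ \oo --> 0.
  apply/cvgr0Pnorm_le => e e0.
  have h : (fun N => c * K%:R * N.+1%:R^-1 : R) @ \oo --> 0.
    by rewrite -[X in _ --> X](mulr0 (c * K%:R)); apply: cvgMr; exact: inv_cvg0.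
  move/cvgr0Pnorm_le : h => /(_ _ e0); apply: filterS => N hN.
  apply: le_trans (step N) _; exact: le_trans (ler_norm _) hN.
apply/eqP; rewrite -subr_eq0; apply/eqP.
by apply: (cvg_unique _ (cvgB cb ca) c0).
Qed.

End process.
End stopped.

(** * The martingales of the process, stopped at bounded times *)

Section martingales.
Context {R : realType} {n : nat} {d : measure_display} {T : measurableType d}.
Variables (P : probability T R) (kappa : probability 'rV[R]_n R).
Variables (F : R -> set_system T) (Z : R -> T -> 'rV[R]_n).
Hypothesis sp : spider P kappa F Z.
Implicit Types (alpha beta rho : T -> R) (A D : set T) (s t : R).
Notation rad t w := (enorm (Z t w)).
Notation ang t w := (angle (Z t w)).
Let Fsigma := sp_sigma sp.
Let Fmono := sp_mono sp.
Let Fmeas := sp_meas sp.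

Lemma sp_crad w : continuous (fun t => rad t w).
Proof. by apply: (@rad_continuous _ _ (Z ^~ w)); apply: (sp_cont sp). Qed.

Lemma sp_pos_time t w : Z t w != 0 -> 0 < t.
Proof. by apply: contraNT; rewrite -leNgt => t0; rewrite (sp_zero sp). Qed.

Lemma sp_ang_eq w s t : s <= t -> (forall u, s <= u <= t -> Z u w != 0) -> ang s w = ang t w.
Proof.
move=> st h; apply: (sp_ray sp) => //; apply: ltW; apply: (@sp_pos_time _ w).
by apply: h; rewrite lexx.
Qed.

Lemma sp_ang_near w t : Z t w != 0 -> exists2 e : R, 0 < e &
  forall s, t - e < s < t + e -> Z s w != 0 /\ ang s w = ang t w.
Proof.
move=> Zt; have rt : 0 < rad t w by rewrite enorm_gt0.
have [e e0 he] := continuous_eps t (@sp_crad w) rt.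
have nz s : t - e < s < t + e -> Z s w != 0.
  by move=> /he/andP[h _]; rewrite -enorm_gt0; move: h; rewrite subrr.
exists e => // s se; split; first exact: nz.
have [st|ts] := leP s t.
  apply: sp_ang_eq => // u /andP[su ut]; apply: nz; move: se => /andP[? ?]; apply/andP; split; lra.
apply/esym/sp_ang_eq; first exact: ltW.
by move=> u /andP[su ut]; apply: nz; move: se => /andP[? ?]; apply/andP; split; lra.
Qed.

(** Away from 0 the angle is locally constant, and near 0 the factor |Z| wins over the bounded
    factor: continuity holds for every bounded [g], however irregular. *)
Lemma ang_rad_continuous (g : 'rV[R]_n -> R) C w : (forall x, `|g x| <= C) ->
  continuous (fun t => g (ang t w) * rad t w).
Proof.
move=> gC; have C0 : 0 <= C by exact: le_trans (gC 0).
have D0 : 0 < C + 1 by lra.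
apply: eps_continuous => t e e0.
have [q q0 hq] := continuous_eps t (@sp_crad w) (divr_gt0 e0 D0).
have [Zt|Zt] := eqVneq (Z t w) 0.
  exists q => // s /hq/andP[_].
  rewrite Zt enorm0 mulr0 add0r ltr_pdivlMr// sub0r normrN normrM (ger0_norm (enorm_ge0 _)) => h.
  apply: le_lt_trans h; rewrite mulrC ler_wpM2l ?enorm_ge0//; have := gC (ang s w); lra.
have [r r0 hr] := sp_ang_near Zt.
exists (Num.min q r); first by rewrite lt_min q0 r0.
move=> s /andP[s1 s2].
have m1 : Num.min q r <= q by rewrite ge_min lexx.
have m2 : Num.min q r <= r by rewrite ge_min lexx orbT.
have /hr[_ ->] : t - r < s < t + r by apply/andP; split; lra.
have /hq : t - q < s < t + q by apply/andP; split; lra.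
rewrite -ltr_distlC => h.
rewrite -mulrBr normrM; apply: (@le_lt_trans _ _ (C * `|rad t w - rad s w|)).
  by rewrite ler_wpM2r.
move: h; rewrite ltr_pdivlMr// => h; apply: le_lt_trans h; rewrite mulrC ler_wpM2l//; lra.
Qed.

Lemma pow4_ge (x : R) : x ^+ 2 <= 1 + x ^+ 4.
Proof.
have -> : x ^+ 4 = (x ^+ 2) ^+ 2 by rewrite -exprM.
have := sqr_ge0 (x ^+ 2 - 1); have := sqr_ge0 x; set y := x ^+ 2; rewrite !expr2; nra.
Qed.

Section bounded.
Variable K : nat.

Lemma stop_rad_L1 rho : stop F rho -> (forall w, rho w <= K%:R) ->
  [/\ L1 P (fun w => rad (rho w) w), L1 P (fun w => rad (rho w) w ^+ 2) & L1 P rho].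
Proof.
move=> sr rK.
have mr := measurableT_comp (@measurable_enorm R n) (stop_Z_measurable sp sr).
have [h1 _ _ _] := @stopped_L2 _ _ _ _ _ _ _ _ sp K (fun t w => rad t w ^+ 2) 1 ler01
  (fun w => @continuous_compR _ _ _ _ (@sp_crad w) (@continuous_exprn R 2))
  (fun s => measurable_funX 2 (sp_mrad sp s))
  (fun s w _ _ => ltac:(rewrite -exprM mul1r lerDr; exact: ler01)) rho sr rK setT measurableT.
split => //; first exact: L1_sqr.
apply: (@L1_bounded _ _ _ _ _ K%:R); first exact: (stop_measurable Fsigma Fmeas).
by move=> w; rewrite ger0_norm ?rK//; have [] := sr.
Qed.

Variables (alpha beta : T -> R) (A : set T).
Hypotheses (sa : stop F alpha) (sb : stop F beta) (ab : forall w, alpha w <= beta w).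
Hypotheses (bK : forall w, beta w <= K%:R) (pA : past F alpha A).

Let aK w : alpha w <= K%:R. Proof. exact: le_trans (bK w). Qed.
Let mA : measurable A. Proof. by case: pA. Qed.

Lemma opt_rad2 : Ex P (fun w => \1_A w * rad (beta w) w ^+ 2) =
  Ex P (fun w => \1_A w * rad (alpha w) w ^+ 2) +
  gauss_var * (Ex P (fun w => \1_A w * beta w) - Ex P (fun w => \1_A w * alpha w)).
Proof.
pose M t w := rad t w ^+ 2 - gauss_var * t.
have v0 := ltW (@gauss_var_gt0 R).
have [_ la2 la] := stop_rad_L1 sa aK; have [_ lb2 lb] := stop_rad_L1 sb bK.
have E rho : L1 P (fun w => rad (rho w) w ^+ 2) -> L1 P rho ->
    Ex P (fun w => \1_A w * M (rho w) w) =
    Ex P (fun w => \1_A w * rad (rho w) w ^+ 2) - gauss_var * Ex P (fun w => \1_A w * rho w).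
  move=> l2 l1; rewrite -ExZ; last exact: L1_indic.
  rewrite -ExB; [|exact: L1_indic|by apply: L1Z; exact: L1_indic].
  by apply: eq_Ex => w; rewrite /M; ring.
suff : Ex P (fun w => \1_A w * M (beta w) w) = Ex P (fun w => \1_A w * M (alpha w) w).
  by rewrite !E//; lra.
(* The constant comes from (a - b)^2 <= 2 a^2 + 2 b^2 with b = vs at most vK. The increments are
   exactly centred, hence the error constant 0. *)
apply: (@optional_stopping _ _ _ _ _ _ _ _ sp K M (2 + 2 * (gauss_var * K%:R) ^+ 2) _ _ _ _ _ _ _ 0 sa sb ab bK pA).
- by have := sqr_ge0 (gauss_var * K%:R : R); lra.
- move=> w; have c1 := @continuous_compR _ _ _ _ (@sp_crad w) (@continuous_exprn R 2).
  move=> t; apply: cvgB; first exact: c1.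
  by apply: cvgMr; exact: cvg_id.
- move=> s; apply: measurable_funB => //; exact: measurable_funX (sp_mrad sp s).
- move=> s w s0 sK; rewrite /M.
  have : (gauss_var * s) ^+ 2 <= (gauss_var * K%:R) ^+ 2.
    by apply: lerXn2r; rewrite ?nnegrE ?mulr_ge0// ler_wpM2l.
  have -> : rad s w ^+ 4 = (rad s w ^+ 2) ^+ 2 by rewrite -exprM.
  set a := rad s w ^+ 2; set b := gauss_var * s; set c := (gauss_var * K%:R) ^+ 2 => bc.
  have := sqr_ge0 (a + b); have := sqr_ge0 a; have : 0 <= c by exact: sqr_ge0.
  rewrite !expr2 in bc *; nra.
- move=> s h D s0 h0 _ FD _; rewrite mul0r normr_le0; apply/eqP.
  have mD : measurable D by exact: Fmeas FD.
  have sh0 : 0 <= s + h by rewrite addr_ge0// ltW.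
  have l2 u : L1 P (fun w => rad u w ^+ 2).
    apply: (@L1_le _ _ _ _ _ (fun w => 1 + rad u w ^+ 4)).
    - exact: measurable_funX (sp_mrad sp u).
    - by apply: L1D; [exact: L1_cst|exact: (sp_L4 sp)].
    - by move=> w; rewrite ger0_norm ?sqr_ge0// pow4_ge.
  have := sp_rad2 sp s0 (ltW h0) FD.
  have -> : Ex P (fun w => \1_D w * (rad s w ^+ 2 + h * gauss_var)) =
    Ex P (fun w => \1_D w * rad s w ^+ 2) + Ex P (fun w => \1_D w * (h * gauss_var)).
    rewrite -ExD; [|by apply: L1_indic => //; exact: l2|by apply: L1_indic => //; exact: L1_cst].
    by apply: eq_Ex => w; rewrite mulrDr.
  move=> H.
  have -> : Ex P (fun w => \1_D w * (M (s + h) w - M s w)) =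
    Ex P (fun w => \1_D w * rad (s + h) w ^+ 2) -
    (Ex P (fun w => \1_D w * rad s w ^+ 2) + Ex P (fun w => \1_D w * (h * gauss_var))).
    rewrite -ExD; [|by apply: L1_indic => //; exact: l2|by apply: L1_indic => //; exact: L1_cst].
    rewrite -ExB; [|by apply: L1_indic => //; exact: l2|].
      by apply: eq_Ex => w; rewrite /M; ring.
    by apply: L1D; [by apply: L1_indic => //; exact: l2|by apply: L1_indic => //; exact: L1_cst].
  by rewrite H subrr.
Qed.

Lemma opt_rad (e : R) : 0 < e -> (forall w t, A w -> alpha w <= t -> t < beta w -> e <= rad t w) ->
  Ex P (fun w => \1_A w * rad (beta w) w) = Ex P (fun w => \1_A w * rad (alpha w) w).
Proof.
move=> e0 He.
apply: (@optional_stopping _ _ _ _ _ _ _ _ sp K (fun t w => rad t w) 1 _ _ _ _ _ _ _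
  (2 * gauss_m4 / e ^+ 3) sa sb ab bK pA).
- exact: ler01.
- exact: sp_crad.
- exact: (sp_mrad sp).
- by move=> s w _ _; rewrite mul1r pow4_ge.
- move=> s h D s0 h0 _ FD DP; have mD : measurable D by exact: Fmeas FD.
  have l1 u : L1 P (fun w => rad u w).
    apply: L1_sqr; first exact: (sp_mrad sp).
    apply: (@L1_le _ _ _ _ _ (fun w => 1 + rad u w ^+ 4)).
    - exact: measurable_funX (sp_mrad sp u).
    - by apply: L1D; [exact: L1_cst|exact: (sp_L4 sp)].
    - by move=> w; rewrite ger0_norm ?sqr_ge0// pow4_ge.
  have iT (x : 'rV[R]_n) : \1_(setT : set 'rV[R]_n) x = 1 :> R by rewrite indicE in_setT.
  have := sp_excess sp s0 h0 FD measurableT.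
  rewrite probability_setT /=.
  under eq_fun do rewrite iT mul1r.
  under [X in _ = Ex _ X]eq_fun do rewrite iT !mul1r mulrDr.
  pose c := 2 * (Num.sqrt h ^+ 4 * gauss_m4 / e ^+ 3).
  have lx : L1 P (fun w => \1_D w * (2 * excess (Num.sqrt h) (rad s w))).
    apply: (@L1_bounded _ _ _ _ _ c).
      apply: measurable_funM; first exact: measurable_indic.
      apply: measurable_funM => //; apply: measurableT_comp; [exact: measurable_excess|exact: (sp_mrad sp)].
    have c0 : 0 <= c by rewrite /c !mulr_ge0 ?exprn_ge0 ?sqrtr_ge0 ?gauss_m4_ge0 ?invr_ge0 ?exprn_ge0// ltW.
    move=> w; rewrite indicE; case: (boolP (w \in D)) => [/set_mem/DP[Aw aw wb]|_]; last by rewrite mul0r normr0.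
    have es := He w s Aw aw wb; have s1 : 0 < rad s w by exact: lt_le_trans es.
    rewrite mul1r ger0_norm; last by rewrite mulr_ge0// excess_ge0.
    rewrite /c ler_pM2l//; apply: le_trans (excess_le _ s1) _.
    apply: ler_wpM2l; first by rewrite mulr_ge0 ?gauss_m4_ge0// exprn_ge0// sqrtr_ge0.
    rewrite lef_pV2 ?posrE ?exprn_gt0//.
    by apply: lerXn2r => //; rewrite nnegrE ltW.
  rewrite ExD; [|exact: lx|by apply: L1_indic => //; exact: l1].
  move=> H.
  have -> : Ex P (fun w => \1_D w * (rad (s + h) w - rad s w)) =
    Ex P (fun w => \1_D w * (2 * excess (Num.sqrt h) (rad s w))).
    transitivity (Ex P (fun w => \1_D w * rad (s + h) w) - Ex P (fun w => \1_D w * rad s w)).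
      rewrite -ExB; [|by apply: L1_indic => //; exact: l1..].
      by apply: eq_Ex => w; rewrite mulrBr.
    by rewrite H addrK.
  apply: le_trans (le_norm_Ex lx) _; rewrite -[leRHS](Ex_cst P); apply: le_Ex.
  + exact: L1_norm.
  + exact: L1_cst.
  + have E4 : Num.sqrt h ^+ 4 = h ^+ 2 by rewrite -[in RHS](sqr_sqrtr (ltW h0)) -exprM.
    have c0 : 0 <= 2 * gauss_m4 / e ^+ 3 * h ^+ 2.
      by rewrite !mulr_ge0 ?gauss_m4_ge0 ?invr_ge0 ?exprn_ge0 ?ltW.
    move=> w; rewrite indicE; case: (boolP (w \in D)) => [/set_mem/DP[Aw aw wb]|_]; last by rewrite mul0r normr0.
    have es := He w s Aw aw wb; have s1 : 0 < rad s w by exact: lt_le_trans es.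
    rewrite mul1r ger0_norm; last by rewrite mulr_ge0// excess_ge0.
    have -> : 2 * gauss_m4 / e ^+ 3 * h ^+ 2 = 2 * (Num.sqrt h ^+ 4 * gauss_m4 / e ^+ 3).
      by rewrite E4; ring.
    rewrite ler_pM2l//; apply: le_trans (excess_le _ s1) _.
    apply: ler_wpM2l; first by rewrite mulr_ge0 ?gauss_m4_ge0// exprn_ge0// sqrtr_ge0.
    rewrite lef_pV2 ?posrE ?exprn_gt0//.
    by apply: lerXn2r => //; rewrite nnegrE ltW.
Qed.

End bounded.

(* An excursion from 0 takes place on a ray of law kappa, independent of |Z|. *)
Lemma opt_ray (K : nat) beta B : stop F beta -> (forall w, beta w <= K%:R) -> measurable B ->
  Ex P (fun w => \1_B (ang (beta w) w) * rad (beta w) w) =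
  fine (kappa B) * Ex P (fun w => rad (beta w) w).
Proof.
move=> sb bK mB; pose k := fine (kappa B).
have k0 : 0 <= k by rewrite fine_ge0.
have k1 : k <= 1 by rewrite -lee_fin fineK ?fin_num_measure//; exact: probability_le1.
(* The excess enters the mean of 1_B(angle) |Z| with the factor kappa(B), so that subtracting
   kappa(B) |Z| cancels it: this combination is a martingale even through the origin. *)
pose M t w := (\1_B (ang t w) - k) * rad t w.
have mi : measurable_fun setT (\1_B : _ -> R) by exact: measurable_indic.
have gb (x : 'rV[R]_n) : `|\1_B x - k| <= 1.
  by rewrite indicE; case: (x \in B); rewrite ler_norml /=; apply/andP; split; lra.
have mM s : measurable_fun setT (M s).
  apply: measurable_funM; last exact: (sp_mrad sp).
  by apply: measurable_funB => //; apply: measurableT_comp => //; exact: (sp_mang sp).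
have K0 : forall w, (0 : R) <= K%:R by [].
have b0 w : 0 <= beta w by have [] := sb.
have : Ex P (fun w => \1_setT w * M (beta w) w) = Ex P (fun w => \1_setT w * M 0 w).
  apply: (@optional_stopping _ _ _ _ _ _ _ _ sp K M 1 _ _ _ _ (fun=> 0) _ _ 0
    (stop0 Fsigma) sb b0 bK (pastT (stop0 Fsigma))).
  - exact: ler01.
  - by move=> w; apply: ang_rad_continuous gb.
  - exact: mM.
  - move=> s w _ _; rewrite mul1r; apply: le_trans (pow4_ge (rad s w)).
    rewrite exprMn ler_piMl ?sqr_ge0// -[leLHS]real_normK ?num_real// expr_le1//.
  - move=> s h D s0 h0 _ FD _; rewrite mul0r normr_le0; apply/eqP.
    have mD : measurable D by exact: Fmeas FD.
    have l1 u : L1 P (fun w => rad u w).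
      apply: L1_sqr; first exact: (sp_mrad sp).
      apply: (@L1_le _ _ _ _ _ (fun w => 1 + rad u w ^+ 4)).
      - exact: measurable_funX (sp_mrad sp u).
      - by apply: L1D; [exact: L1_cst|exact: (sp_L4 sp)].
      - by move=> w; rewrite ger0_norm ?sqr_ge0// pow4_ge.
    have lB u : L1 P (fun w => \1_B (ang u w) * rad u w).
      apply: L1_le (l1 u) _.
        apply: measurable_funM; last exact: (sp_mrad sp).
        by apply: measurableT_comp => //; exact: (sp_mang sp).
      move=> w; rewrite normrM (ger0_norm (enorm_ge0 _)) ler_piMl ?enorm_ge0//.
      exact: indic_norm_le1.
    have iT (x : 'rV[R]_n) : \1_(setT : set 'rV[R]_n) x = 1 :> R by rewrite indicE in_setT.
    pose X w := \1_D w * (2 * excess (Num.sqrt h) (rad s w)).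
    have lX : L1 P X.
      apply: L1_indic => //; apply: (@L1_bounded _ _ _ _ _ (2 * (1 + Num.sqrt h ^+ 2 * gauss_var))).
        apply: measurable_funM => //; apply: measurableT_comp; [exact: measurable_excess|exact: (sp_mrad sp)].
      move=> w; rewrite ger0_norm; last by rewrite mulr_ge0// excess_ge0.
      by rewrite ler_pM2l//; apply: excess_bound; exact: enorm_ge0.
    have H1 : Ex P (fun w => \1_D w * rad (s + h) w) = Ex P X + Ex P (fun w => \1_D w * rad s w).
      rewrite -ExD//; last by apply: L1_indic => //; exact: l1.
      have := sp_excess sp s0 h0 FD measurableT; rewrite probability_setT /=.
      under eq_fun do rewrite iT mul1r.
      by under [X in _ = Ex _ X]eq_fun do rewrite iT !mul1r mulrDr.
    have H2 : Ex P (fun w => \1_D w * (\1_B (ang (s + h) w) * rad (s + h) w)) =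
        k * Ex P X + Ex P (fun w => \1_D w * (\1_B (ang s w) * rad s w)).
      rewrite (sp_excess sp s0 h0 FD mB) -ExZ// -ExD//.
      - by apply: eq_Ex => w; rewrite /X mulrDr mulrCA.
      - exact: L1Z.
      - by apply: L1_indic => //; exact: lB.
    have E u : Ex P (fun w => \1_D w * M u w) =
        Ex P (fun w => \1_D w * (\1_B (ang u w) * rad u w)) - k * Ex P (fun w => \1_D w * rad u w).
      rewrite -ExZ; last by apply: L1_indic => //; exact: l1.
      rewrite -ExB; [|by apply: L1_indic => //; exact: lB|by apply: L1Z; apply: L1_indic => //; exact: l1].
      by apply: eq_Ex => w; rewrite /M mulrBl mulrBr; congr (_ - _); rewrite mulrCA.
    have lM u : L1 P (fun w => \1_D w * M u w).
      apply: L1_indic => //; apply: L1_le (l1 u) _; first exact: mM.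
      by move=> w; rewrite normrM (ger0_norm (enorm_ge0 _)) ler_piMl ?enorm_ge0.
    transitivity (Ex P (fun w => \1_D w * M (s + h) w) - Ex P (fun w => \1_D w * M s w)).
      by rewrite -ExB//; apply: eq_Ex => w; rewrite mulrBr.
    by rewrite !E H1 H2; ring.
have iT w : \1_(setT : set T) w = 1 :> R by rewrite indicE in_setT.
have -> : Ex P (fun w => \1_setT w * M 0 w) = 0.
  rewrite -[RHS](Ex_cst P); apply: eq_Ex => w.
  by rewrite /M (sp_zero sp)// enorm0 !mulr0.
have [lb _ _] := stop_rad_L1 sb bK.
have lB : L1 P (fun w => \1_B (ang (beta w) w) * rad (beta w) w).
  apply: (L1_le _ lb).
    apply: measurable_funM; last exact: L1_meas lb.
    apply: measurableT_comp => //; apply: measurableT_comp; first exact: measurable_angle.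
    exact: (stop_Z_measurable sp).
  move=> w; rewrite normrM (ger0_norm (enorm_ge0 _)) ler_piMl ?enorm_ge0//.
  exact: indic_norm_le1.
under eq_fun do rewrite iT mul1r /M mulrBl.
rewrite ExB ?ExZ//; last exact: L1Z.
by move/eqP; rewrite subr_eq0 => /eqP.
Qed.

End martingales.

(** * The first stage *)

Section full_sets.
Context {R : realType} {d : measure_display} {T : measurableType d} (P : probability T R).

Lemma Ex_full (H : set T) (f : T -> R) : measurable H -> {ae P, forall w, H w} ->
  measurable_fun setT f -> Ex P (fun w => \1_H w * f w) = Ex P f.
Proof.
move=> mH aH mf; apply: Ex_ae => //; first exact: measurable_funM.
by apply: filterS aH => w Hw; rewrite indicE mem_set// mul1r.
Qed.

(** Applied with [B] the event that a barrier is never met: there the time capped at k is equal to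
    k, while its expectation stays bounded. *)
Lemma null_of_bound (B : set T) (f : nat -> T -> R) (a C : R) : measurable B ->
  (forall k, L1 P (f k)) -> (forall k, Ex P (f k) <= C) ->
  (forall k w, (k%:R - a) * \1_B w <= f k w) -> P B = 0%E.
Proof.
move=> mB lf fC Bf.
have H k : (k%:R - a) * Ex P (\1_B) <= C.
  rewrite -ExZ; last exact: L1_1.
  by apply: le_trans (fC k); apply: le_Ex => //; apply: L1Z; exact: L1_1.
have b0 : 0 <= Ex P (\1_B) by apply: Ex_ge0 => w; rewrite indicE.
rewrite -[LHS]fineK ?fin_num_measure// -Ex_indic//; congr (_%:E).
apply/eqP; rewrite eq_le b0 andbT leNgt; apply/negP => b1.
pose k := Num.truncn (Num.max 0 (C / Ex P (\1_B) + a)).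
have kk : C / Ex P (\1_B) + a < k.+1%:R.
  by apply: le_lt_trans (truncnS_gt _); rewrite le_max lexx orbT.
have := H k.+1; rewrite -ler_pdivlMr//; lra.
Qed.

Lemma ae_of_null (B : set T) : measurable B -> P (~` B) = 0%E -> {ae P, forall w, B w}.
Proof.
by move=> mB PB; exists (~` B); split => //; exact: measurableC.
Qed.

End full_sets.

Section first_stage.
Context {R : realType} {n : nat} {d : measure_display} {T : measurableType d}.
Variables (P : probability T R) (kappa : probability 'rV[R]_n R).
Variables (F : R -> set_system T) (Z : R -> T -> 'rV[R]_n).
Hypothesis sp : spider P kappa F Z.
Implicit Types (alpha beta rho : T -> R) (A D : set T) (s t : R).
Notation rad t w := (enorm (Z t w)).
Notation ang t w := (angle (Z t w)).
Let Fsigma := sp_sigma sp.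
Let Fmono := sp_mono sp.
Let Fmeas := sp_meas sp.

Lemma filt_ae s A A' : F s A -> measurable A' -> {ae P, forall w, A w <-> A' w} -> F s A'.
Proof.
move=> FA mA' AA'; have mA := Fmeas FA.
pose N := (A `\` A') `|` (A' `\` A).
have mN : measurable N by apply: measurableU; exact: measurableD.
have PN : P N = 0%E.
  apply/negligibleP => //; apply: negligibleS AA' => w /= [] [h1 h2] h; apply: h2; exact/h.
rewrite (_ : A' = (A `&` ~` N) `|` (A' `&` N)); last first.
  apply/seteqP; split => w.
    move=> A'w; have [Nw|Nw] := pselect (N w); first by right.
    left; split => //; apply: contrapT => nA; apply: Nw; by right.
  move=> [[Aw Nw]|[]//]; apply: contrapT => nA; apply: Nw; by left.
apply: filtU => //.
  by apply: filtI => //; apply: filtC => //; exact: (sp_null sp).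
apply: (sp_null sp); first exact: measurableI.
apply/eqP; rewrite eq_le measure_ge0 andbT -PN; apply: le_measure; rewrite ?inE//.
by apply: measurableI.
Qed.

Section finite_hitting.
Variables (alpha : T -> R) (Y : R -> T -> R).
Hypothesis sa : stop F alpha.
Hypothesis cY : forall w, continuous (Y ^~ w).
Hypothesis aY : forall t x, F t ([set w | alpha w <= t] `&` [set w | x < Y t w]).

Definition hits : set T := \bigcup_k hit_by alpha Y k%:R.

(** The default value [alpha] is taken on an event that will be null, which keeps the time finite
    everywhere; it is a stopping time because the filtration contains the null sets. *)
Definition hit_fin w : R := if w \in hits then hit_time alpha Y w else alpha w.

Lemma hit_by_hits s w : hit_by alpha Y s w -> hits w.
Proof.
move=> h; exists (Num.truncn s).+1 => //; apply: hit_by_le h; apply: ltW; exact: truncnS_gt.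
Qed.

Lemma hits_measurable : measurable hits.
Proof. apply: bigcupT_measurable => k; apply: (Fmeas (hit_by_filt Fsigma Fmono cY aY k%:R)). Qed.

Lemma hit_finP w : hits w ->
  [/\ alpha w <= hit_fin w, 0 <= Y (hit_fin w) w,
     forall t, alpha w <= t -> t < hit_fin w -> Y t w < 0,
     Y (alpha w) w <= 0 -> Y (hit_fin w) w = 0 &
     \forall k \near \oo, hit_or alpha Y k%:R w = hit_fin w].
Proof.
move=> h; rewrite /hit_fin mem_set//; have [k _ hk] := h.
have [h1 h2 h3 h4] := hit_timeP cY hk; split => //.
- by move=> Ya; apply: (hit_start cY Ya hk).
- exists k => // m /= km; apply: hit_or_eq hk _; by rewrite ler_nat.
Qed.

Lemma hit_fin_ge w : alpha w <= hit_fin w.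
Proof. by have [/hit_finP[]//|h] := pselect (hits w); rewrite /hit_fin memNset. Qed.

Lemma hit_fin_stop : {ae P, forall w, hits w} -> stop F hit_fin.
Proof.
move=> ah; have [a0 sa'] := sa; split => [w|s]; first exact: le_trans (hit_fin_ge w).
rewrite (_ : [set _ | _] = hit_by alpha Y s `|` (~` hits `&` [set w | alpha w <= s])).
  apply: filtU => //; first exact: hit_by_filt.
  have mC : measurable (~` hits `&` [set w | alpha w <= s]).
    by apply: measurableI; [apply: measurableC; exact: hits_measurable|exact: Fmeas (sa' s)].
  apply: (sp_null sp) => //; apply/negligibleP => //; apply: negligibleS ah => w [h _]; exact.
apply/seteqP; split => w /=.
  rewrite /hit_fin; case: ifPn => [/set_mem[k _ hk]|]; first by move=> /(hit_time_le cY s hk); left.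
  by rewrite notin_setE; right.
move=> [h|[h1 h2]]; last by rewrite /hit_fin memNset.
rewrite /hit_fin mem_set; last exact: hit_by_hits h.
by have [] := hit_timeP cY h.
Qed.

End finite_hitting.

(** * The first time that |Z| reaches a threshold bounded below *)

Section truncated_threshold.
Variables (c : 'rV[R]_n -> R) (e : R).
Hypothesis e0 : 0 < e.
Hypothesis ec : forall x, e <= c x.
Hypothesis mc : measurable_fun setT c.
Hypothesis lc : L1 kappa c.

Let c0 x : 0 < c x. Proof. exact: lt_le_trans (ec x). Qed.
(** This is continuous in t although [c] is merely measurable, by [ang_rad_continuous]: 1/c is
    bounded. *)
Let Y t w := (c (ang t w))^-1 * rad t w - 1.
Let zero : T -> R := fun=> 0.

Let cY w : continuous (Y ^~ w).
Proof.
have h : forall x, `|(c x)^-1| <= e^-1.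
  by move=> x; rewrite ger0_norm ?invr_ge0 ?(ltW (c0 x))// lef_pV2 ?posrE ?c0.
move=> t; apply: cvgB; last exact: cvg_cst.
exact: (@ang_rad_continuous _ _ _ _ _ _ _ _ sp (fun x => (c x)^-1) e^-1 w h t).
Qed.

Let aY t x : F t ([set w | zero w <= t] `&` [set w | x < Y t w]).
Proof.
apply: filtI => //; first by have [_] := stop0 Fsigma; apply.
rewrite (_ : [set _ | _] = Z t @^-1` [set z | x < (c (angle z))^-1 * enorm z - 1])//.
apply: (sp_adapt sp).
pose f (z : 'rV[R]_n) := (c (angle z))^-1 * enorm z - 1.
have mf : measurable_fun setT f.
  apply: measurable_funB => //; apply: measurable_funM; last exact: measurable_enorm.
  apply: measurableT_comp; first exact: measurable_inv_R.
  by apply: measurableT_comp => //; exact: measurable_angle.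
rewrite (_ : [set _ | _] = f @^-1` `]x, +oo[).
  by rewrite -[X in measurable X]setTI; apply: mf.
by apply/seteqP; split => z /=; rewrite in_itv/= andbT.
Qed.

Let b (K : nat) := hit_or zero Y K%:R.
Let sb K : stop F (b K). Proof. by apply: hit_or_stop => //; exact: stop0. Qed.
Let bK K w : b K w <= K%:R. Proof. exact: hit_or_le. Qed.

Let Ya w : Y (zero w) w <= 0.
Proof. by rewrite /Y /zero (sp_zero sp)// enorm0 mulr0 sub0r lerN10. Qed.

Let below K w : rad (b K w) w <= c (ang (b K w) w).
Proof.
have : Y (b K w) w <= 0 by apply: hit_or_val => //; rewrite /zero.
by rewrite /Y subr_le0 mulrC ler_pdivrMr// mul1r.
Qed.

Let mradb rho : stop F rho -> measurable_fun setT (fun w => rad (rho w) w).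
Proof. by move=> sr; apply: measurableT_comp; [exact: measurable_enorm|exact: (stop_Z_measurable sp)]. Qed.

Let mangb rho : stop F rho -> measurable_fun setT (fun w => ang (rho w) w).
Proof. by move=> sr; apply: measurableT_comp; [exact: measurable_angle|exact: (stop_Z_measurable sp)]. Qed.

(** Under the weight |Z_rho| the angle has the law kappa times D; the identity passes from sets to
    nonnegative functions. *)
Let ray_weight rho (D : R) (f : 'rV[R]_n -> R) : stop F rho -> L1 P (fun w => rad (rho w) w) -> 0 <= D ->
  (forall B, measurable B -> Ex P (fun w => \1_B (ang (rho w) w) * rad (rho w) w) = fine (kappa B) * D) ->
  measurable_fun setT f -> (forall x, 0 <= f x) ->
  (\int[P]_w (f (ang (rho w) w) * rad (rho w) w)%:E = \int[kappa]_x (f x * D)%:E)%E.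
Proof.
move=> sr lr D0 H mf f0.
have := @weight_ext _ _ _ _ _ _ R P kappa (fun w => ang (rho w) w) id (fun w => rad (rho w) w) (fun=> D)
  (mangb sr) (@measurable_id _ _ _) (mradb sr) (@measurable_cst _ _ _ _ _ _)
  (fun w => enorm_ge0 _) (fun=> D0) _ (EFin \o f).
apply; last by move=> x; rewrite lee_fin.
  move=> A mA; rewrite Ex_int; last first.
    apply: (L1_le _ lr).
      apply: measurable_funM; last exact: mradb.
      by apply: measurableT_comp; [exact: measurable_indic|exact: mangb].
    move=> w; rewrite normrM (ger0_norm (enorm_ge0 _)) ler_piMl ?enorm_ge0//.
    exact: indic_norm_le1.
  rewrite H// Ex_int; last by apply: L1_indic => //; exact: L1_cst.
  congr (_%:E); rewrite -Ex_indic// mulrC -ExZ; last exact: L1_1.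
  by apply: eq_Ex => x; rewrite mulrC.
exact/measurable_EFinP.
Qed.

(** A self-improving bound. Let x and y be the second and first moments of |Z| at the capped time,
    and m the mean of [c] under kappa. Since |Z| <= c(angle Z), [ray_weight] gives x <= y m, and y^2
    <= x then forces y <= m, hence x <= m^2. *)
Let radb2 K : Ex P (fun w => rad (b K w) w ^+ 2) <= Ex kappa c ^+ 2.
Proof.
have [l1 l2 _] := stop_rad_L1 sp (sb K) (bK K).
set m := Ex kappa c; pose x := Ex P (fun w => rad (b K w) w ^+ 2).
pose y := Ex P (fun w => rad (b K w) w).
have y0 : 0 <= y by apply: Ex_ge0 => w; exact: enorm_ge0.
have m0 : 0 <= m by apply: Ex_ge0 => z; exact: ltW.
have h1 : x <= y * m.
  rewrite -lee_fin -Ex_int//.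
  apply: (@le_trans _ _ (\int[P]_w (c (ang (b K w) w) * rad (b K w) w)%:E)%E).
    apply: ge0_le_integral => //.
    - by move=> w _; rewrite lee_fin sqr_ge0.
    - by apply/measurable_EFinP; apply: measurable_funX; exact: (mradb (sb K)).
    - by apply/measurable_EFinP; apply: measurable_funM; [apply: measurableT_comp => //; exact: (mangb (sb K))|exact: (mradb (sb K))].
    - by move=> w _; rewrite lee_fin expr2 ler_wpM2r ?enorm_ge0.
  rewrite (@ray_weight (b K) y)//; last 2 first.
  - by move=> B mB; exact: (opt_ray sp (sb K) (bK K) mB).
  - by move=> z; exact: ltW.
  have lcy : L1 kappa (fun z => c z * y) by apply: (eq_L1 (fun z => mulrC y (c z))); exact: L1Z.
  rewrite Ex_int// lee_fin le_eqVlt; apply/orP; left; apply/eqP.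
  by rewrite -ExZ//; apply: eq_Ex => z; rewrite mulrC.
have h2 : y ^+ 2 <= x.
  have : 0 <= Ex P (fun w => (rad (b K w) w - y) ^+ 2) by apply: Ex_ge0 => w; exact: sqr_ge0.
  have -> : Ex P (fun w => (rad (b K w) w - y) ^+ 2) = x - 2 * y * y + y ^+ 2.
    have -> : Ex P (fun w => (rad (b K w) w - y) ^+ 2) =
        Ex P (fun w => (rad (b K w) w ^+ 2 - 2 * y * rad (b K w) w) + y ^+ 2).
      by apply: eq_Ex => w; ring.
    rewrite ExD; [|by apply: L1B => //; exact: L1Z|exact: L1_cst].
    by rewrite ExB//; [rewrite ExZ// Ex_cst|exact: L1Z].
  by lra.
have [y1|y1] := leP y 0; first by apply: le_trans h1 _; rewrite (_ : y = 0) ?mul0r ?sqr_ge0//; apply/eqP; rewrite eq_le y1.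
have ym : y <= m by rewrite -(ler_pM2l y1) -expr2; exact: le_trans h1.
by apply: le_trans h1 _; rewrite expr2; apply: ler_wpM2r.
Qed.

Let Exb K : Ex P (b K) <= Ex kappa c ^+ 2 / gauss_var.
Proof.
have v0 := @gauss_var_gt0 R.
have b0 : forall w, zero w <= b K w by have [] := sb K.
have := opt_rad2 sp (stop0 Fsigma) (sb K) b0 (bK K) (pastT (stop0 Fsigma)).
have iT w : \1_(setT : set T) w = 1 :> R by rewrite indicE in_setT.
under eq_fun do rewrite iT mul1r.
under [X in _ = Ex _ X + _]eq_fun do rewrite iT mul1r (sp_zero sp)// enorm0 expr0n/=.
under [X in _ = _ + _ * (Ex _ X - _)]eq_fun do rewrite iT mul1r.
under [X in _ = _ + _ * (_ - Ex _ X)]eq_fun do rewrite mulr0.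
rewrite !Ex_cst add0r subr0 => E; rewrite ler_pdivlMr// mulrC -E; exact: radb2.
Qed.

Let H := hits zero Y.
Let mH : measurable H. Proof. exact: hits_measurable. Qed.

Let aH : {ae P, forall w, H w}.
Proof.
apply: ae_of_null => //.
apply: (@null_of_bound _ _ _ P (~` H) b 0 (Ex kappa c ^+ 2 / gauss_var)) => //.
- exact: measurableC.
- by move=> k; have [] := stop_rad_L1 sp (sb k) (bK k).
- move=> k w; rewrite subr0 indicE; case: (boolP (w \in ~` H)) => [/set_mem nH|_].
    rewrite mulr1 /b /hit_or memNset//; move=> h; apply: nH; exact: hit_by_hits h.
  by rewrite mulr0; have [] := sb k.
Qed.

Let beta := hit_fin zero Y.
Let sbeta : stop F beta. Proof. exact: (hit_fin_stop (stop0 Fsigma)). Qed.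

Let near_beta w : H w -> \forall k \near \oo, b k w = beta w.
Proof. by case/(hit_finP cY). Qed.

Let cvgb (f : R -> T -> R) w : (fun k => \1_H w * f (b k w) w) @ \oo --> \1_H w * f (beta w) w.
Proof.
rewrite indicE; case: (boolP (w \in H)) => [/set_mem/near_beta h|_].
  apply: cvg_near_cst; by apply: filterS h => k ->.
by under eq_fun do rewrite mul0r; rewrite mul0r; exact: cvg_cst.
Qed.

(** At the threshold |Z| = c(angle Z), so the probability that the angle is in B is the expectation
    of 1_B(angle) / c(angle) weighted by |Z|, which [ray_weight] evaluates as D times the integral
    of 1_B / c under kappa. Here D is the mean of |Z| at that time; it is reached from the capped
    times by uniform integrability, thanks to [radb2]. *)
Lemma threshold_time : exists beta, [/\ stop F beta, L1 P beta,
  Ex P beta <= Ex kappa c ^+ 2 / gauss_var,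
  {ae P, forall w, rad (beta w) w = c (ang (beta w) w) /\
     forall t, 0 <= t -> t < beta w -> rad t w < c (ang t w)} &
  exists2 D, 0 <= D & forall B, measurable B ->
    fine (P [set w | B (ang (beta w) w)]) = D * Ex kappa (fun x => \1_B x / c x)].
Proof.
exists beta; have mb := stop_measurable Fsigma Fmeas sbeta.
have Hb : {ae P, forall w, rad (beta w) w = c (ang (beta w) w) /\
     forall t, 0 <= t -> t < beta w -> rad t w < c (ang t w)}.
  apply: filterS aH => w Hw; have [_ _ h1 h2 _] := hit_finP cY Hw; split.
    have := h2 (Ya w); rewrite -/(beta w) /Y => /eqP; rewrite subr_eq0 => /eqP h.
    by rewrite -[RHS]mulr1 -h mulrA divff ?mul1r// gt_eqF.
  by move=> t t0 tb; have := h1 t t0 tb; rewrite /Y subr_lt0 mulrC ltr_pdivrMr// mul1r.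
have lb k : L1 P (b k) by have [] := stop_rad_L1 sp (sb k) (bK k).
have lr k : L1 P (fun w => rad (b k w) w) by have [] := stop_rad_L1 sp (sb k) (bK k).
have lr2 k : L1 P (fun w => rad (b k w) w ^+ 2) by have [] := stop_rad_L1 sp (sb k) (bK k).
have [lB ExB'] : L1 P (fun w => \1_H w * beta w) /\ Ex P (fun w => \1_H w * beta w) <= Ex kappa c ^+ 2 / gauss_var.
  apply: (@Ex_fatou _ _ _ P (fun k w => \1_H w * b k w)).
  - by move=> k; apply: L1_indic.
  - by move=> k w; rewrite mulr_ge0//; have [] := sb k.
  - move=> k; rewrite (Ex_full mH aH) ?Exb//; exact: L1_meas.
  - by move=> w; exact: (@cvgb (fun t w => t)).
have iE w : H w -> \1_H w = 1 :> R by move=> Hw; rewrite indicE mem_set.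
have lbeta : L1 P beta.
  apply: (L1_ae _ _ _ lB) => //; first exact: measurable_funM.
  by apply: filterS aH => w Hw; rewrite iE// mul1r.
split => //; first by rewrite -(Ex_full mH aH).
pose D := Ex P (fun w => rad (beta w) w).
have D0 : 0 <= D by apply: Ex_ge0 => w; exact: enorm_ge0.
have UI B : measurable B -> L1 P (fun w => \1_H w * (\1_B (ang (beta w) w) * rad (beta w) w)) /\
   Ex P (fun w => \1_B (ang (b k w) w) * rad (b k w) w) @[k --> \oo] -->
   Ex P (fun w => \1_B (ang (beta w) w) * rad (beta w) w).
  move=> mB; have miB rho : stop F rho -> measurable_fun setT (fun w => \1_B (ang (rho w) w) * rad (rho w) w : R).
    move=> sr; apply: measurable_funM; last exact: mradb.
    by apply: measurableT_comp; [exact: measurable_indic|exact: mangb].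
  have le2 k w : (\1_H w * (\1_B (ang (b k w) w) * rad (b k w) w)) ^+ 2 <= rad (b k w) w ^+ 2.
    rewrite !indicE; case: (_ \in H); case: (_ \in B);
      by rewrite ?mul1r ?mul0r ?mulr0 ?expr0n/= ?sqr_ge0.
  have mk k : measurable_fun setT (fun w => \1_H w * (\1_B (ang (b k w) w) * rad (b k w) w)).
    by apply: measurable_funM => //; exact: miB.
  have l2 k : L1 P (fun w => (\1_H w * (\1_B (ang (b k w) w) * rad (b k w) w)) ^+ 2).
    apply: (L1_le _ (lr2 k)); first exact: measurable_funX.
    by move=> w; rewrite ger0_norm ?sqr_ge0.
  have [//|g1 _ _ g2] := @Ex_ui _ _ _ P (fun k w => \1_H w * (\1_B (ang (b k w) w) * rad (b k w) w))
    (fun w => \1_H w * (\1_B (ang (beta w) w) * rad (beta w) w)) (Ex kappa c ^+ 2) mk l2 _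
    (@cvgb (fun t w => \1_B (ang t w) * rad t w)).
    by move=> k; apply: le_trans (radb2 k); apply: le_Ex.
  split => //; rewrite (Ex_full mH aH) in g2; last exact: miB.
  apply: cvg_trans g2; apply: near_eq_cvg; apply: nearW => k /=.
  by rewrite (Ex_full mH aH)//; exact: miB.
have UT : Ex P (fun w => rad (b k w) w) @[k --> \oo] --> D.
  have [_] := UI setT measurableT.
  have E rho : Ex P (fun w => \1_[set: 'rV[R]_n] (ang (rho w) w) * rad (rho w) w) = Ex P (fun w => rad (rho w) w).
    by apply: eq_Ex => w; rewrite indicE in_setT mul1r.
  by rewrite E; under eq_fun do rewrite E.
have lR : L1 P (fun w => rad (beta w) w).
  have [l _] := UI setT measurableT; apply: (L1_ae _ _ _ l).
  - by apply: (L1_meas l).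
  - exact: mradb.
  - by apply: filterS aH => w Hw; rewrite iE// indicE in_setT !mul1r.
have HD B : measurable B -> Ex P (fun w => \1_B (ang (beta w) w) * rad (beta w) w) = fine (kappa B) * D.
  move=> mB; have [_ U] := UI B mB; apply: (cvg_unique _ U) => //.
  have : (fun k => fine (kappa B) * Ex P (fun w => rad (b k w) w)) @ \oo --> fine (kappa B) * D by exact: cvgMr UT.
  by under eq_fun => k do rewrite -(opt_ray sp (sb k) (bK k) mB).
exists D => // B mB.
have mcV : measurable_fun setT (fun x => (c x)^-1).
  by apply: measurableT_comp; [exact: measurable_inv_R|].
have mf : measurable_fun setT (fun x => \1_B x / c x) by apply: measurable_funM.
have f0 x : 0 <= \1_B x / c x by rewrite divr_ge0 ?(ltW (c0 x)).
have lf : L1 kappa (fun x => \1_B x / c x).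
  apply: (@L1_bounded _ _ _ _ _ e^-1) => // x; rewrite normrM [X in _ * X]ger0_norm ?invr_ge0 ?(ltW (c0 x))//.
  rewrite -[leRHS]mul1r; apply: ler_pM => //; first by rewrite invr_ge0 ltW.
    exact: indic_norm_le1.
  by rewrite lef_pV2 ?posrE ?c0.
have := @ray_weight beta D (fun x => \1_B x / c x) sbeta lR D0 HD mf f0.
have mA : measurable [set w | B (ang (beta w) w)].
  by rewrite -[X in measurable X]setTI; apply: (mangb sbeta).
rewrite [RHS](_ : _ = (D * Ex kappa (fun x => \1_B x / c x))%:E); last first.
  rewrite -ExZ// -Ex_int; last exact: L1Z.
  by apply: eq_integral => x _; rewrite mulrC.
rewrite [LHS](_ : _ = P [set w | B (ang (beta w) w)]); first by move=> ->.
rewrite -[P _]fineK ?fin_num_measure// -Ex_indic// -Ex_int; last exact: L1_1.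
apply: ae_eq_integral => //.
- apply/measurable_EFinP; apply: measurable_funM; last exact: mradb.
  by apply: (measurableT_comp mf); exact: mangb.
- by apply/measurable_EFinP; exact: measurable_indic.
- apply: filterS Hb => w [Rc _] _; congr (_%:E); rewrite Rc divfK ?gt_eqF//.
Qed.

End truncated_threshold.

(** * Removing the lower bound on the threshold *)

Section barycentric_threshold.
Variables (lam : probability 'rV[R]_n R) (mm : 'rV[R]_n -> R) (mbar : R).
Hypothesis mm0 : forall x, 0 < mm x.
Hypothesis mmm : measurable_fun setT mm.
Hypothesis lmm : L1 kappa mm.
Hypothesis lmml : L1 lam mm.
Hypothesis mbar0 : 0 < mbar.
Hypothesis kappaE : forall B, measurable B ->
  fine (kappa B) * mbar = Ex lam (fun x => \1_B x * mm x).

(** Nothing bounds [mm] away from 0, so it is raised to at least 1/(j+1). The thresholds decrease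
    with j and are eventually equal to [mm] at each angle. *)
Let c (j : nat) x : R := Num.max (mm x) j.+1%:R^-1.

Let cmm j x : mm x <= c j x. Proof. by rewrite le_max lexx. Qed.
Let c0 j x : 0 < c j x. Proof. exact: lt_le_trans (cmm j x). Qed.

Let mc j : measurable_fun setT (c j).
Proof. by apply: measurable_maxr. Qed.

Let c_near x : \forall j \near \oo, c j x = mm x.
Proof.
have [j0 _ h] := near_infty_natSinv_lt (PosNum (mm0 x)).
exists j0 => // j /= jj; rewrite /c max_l//; apply: ltW; exact: (h j).
Qed.

Let c_le j k x : (j <= k)%N -> c k x <= c j x.
Proof.
move=> jk; rewrite ge_max !le_max lexx/=; apply/orP; right.
by rewrite lef_pV2 ?posrE// ler_nat.
Qed.

Let lc j : L1 kappa (c j).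
Proof.
apply: (@L1_le _ _ _ _ _ (fun x => mm x + 1)) => //; first by apply: L1D => //; exact: L1_cst.
move=> x; rewrite ger0_norm ?(ltW (c0 j x))// ge_max lerDl ler01/=.
apply: (@le_trans _ _ 1); last by rewrite lerDr ltW.
by rewrite invf_le1// ler1n.
Qed.

(** As kappa has density mm / mbar with respect to [lam], the measure kappa / c_j has density mm /
    c_j up to the factor mbar. This density increases to 1, so that [lam] appears in the limit. *)
Let q j B := Ex lam (fun x => \1_B x * (mm x / c j x)).

Let ratio01 j x : 0 <= mm x / c j x <= 1.
Proof. by rewrite divr_ge0 ?(ltW (mm0 x)) ?(ltW (c0 j x))//= ler_pdivrMr// mul1r. Qed.

Let mratio j : measurable_fun setT (fun x => mm x / c j x).
Proof.
apply: measurable_funM => //; apply: measurableT_comp => //; exact: measurable_inv_R.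
Qed.

Let qE j B : measurable B -> Ex kappa (fun x => \1_B x / c j x) * mbar = q j B.
Proof.
move=> mB; have mcV : measurable_fun setT (fun x => (c j x)^-1).
  by apply: measurableT_comp => //; exact: measurable_inv_R.
have j0 : 0 < j.+1%:R^-1 :> R by rewrite invr_gt0.
have mf : measurable_fun setT (fun x => \1_B x / c j x) by apply: measurable_funM.
have f0 x : 0 <= \1_B x / c j x by rewrite divr_ge0 ?(ltW (c0 j x)).
have lf : L1 kappa (fun x => \1_B x / c j x).
  apply: (@L1_bounded _ _ _ _ _ (j.+1%:R^-1)^-1) => // x; rewrite normrM [X in _ * X]ger0_norm ?invr_ge0 ?(ltW (c0 j x))//.
  rewrite -[leRHS]mul1r; apply: ler_pM => //; first by rewrite invr_ge0 ltW.
    exact: indic_norm_le1.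
  by rewrite lef_pV2 ?posrE ?c0// le_max lexx orbT.
have lq : L1 lam (fun x => \1_B x * (mm x / c j x)).
  apply: L1_indic => //; apply: (@L1_bounded _ _ _ _ _ 1) => // x.
  by have /andP[h1 h2] := ratio01 j x; rewrite ger0_norm.
have := @weight_ext _ _ _ _ _ _ R kappa lam id id (fun=> mbar) mm
  (@measurable_id _ _ _) (@measurable_id _ _ _) (@measurable_cst _ _ _ _ _ _) mmm
  (fun=> ltW mbar0) (fun x => ltW (mm0 x)) _ (EFin \o (fun x => \1_B x / c j x)).
move=> H; have {H} : (\int[kappa]_x ((\1_B x / c j x)%:E * mbar%:E) =
    \int[lam]_x ((\1_B x / c j x)%:E * (mm x)%:E))%E.
  apply: H; last by move=> x; rewrite lee_fin.
    move=> A mA; rewrite !Ex_int; [|by apply: L1_indic|by apply: L1_indic => //; exact: L1_cst].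
    rewrite -kappaE// -Ex_indic// [in RHS]mulrC -ExZ; last exact: L1_1.
    by congr (_%:E); apply: eq_Ex => x; rewrite mulrC.
  exact/measurable_EFinP.
rewrite [LHS](_ : _ = (Ex kappa (fun x => \1_B x / c j x) * mbar)%:E); last first.
  rewrite mulrC -ExZ// -Ex_int; last exact: L1Z.
  by apply: eq_integral => x _; rewrite -EFinM mulrC.
rewrite [RHS](_ : _ = (q j B)%:E); first by case.
rewrite -Ex_int//; apply: eq_integral => x _; rewrite -EFinM; congr (_%:E).
by rewrite -mulrA [_^-1 * _]mulrC.
Qed.

Let q_cvg B : measurable B -> (fun j => q j B) @ \oo --> fine (lam B).
Proof.
move=> mB; rewrite -Ex_indic//.
apply: (@Ex_dct _ _ _ lam (fun j x => \1_B x * (mm x / c j x)) (\1_B) (fun=> 1) _ _ _ _).2.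
- by move=> j; exact: measurable_funM.
- exact: L1_cst.
- move=> j x; have /andP[h1 h2] := ratio01 j x; rewrite normrM -[leRHS]mul1r; apply: ler_pM => //.
    exact: indic_norm_le1.
  by rewrite ger0_norm.
- move=> x; apply: cvg_near_cst; apply: filterS (c_near x) => j ->.
  by rewrite divff ?mulr1// gt_eqF.
Qed.

(** The hitting times of the thresholds c_j decrease to [tau1], and the laws of the angles at these
    times converge to [lam]. The danger is that Z vanishes at the limit time; this would require
    angles with arbitrarily small [mm], to which [lam] gives no mass in the limit. Elsewhere the
    sequence of times is eventually constant. *)
Lemma first_time : exists tau1, [/\ stop F tau1, L1 P tau1,
  {ae P, forall w, rad (tau1 w) w = mm (ang (tau1 w) w) /\
     forall t, 0 <= t -> t < tau1 w -> rad t w != mm (ang t w)} &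
  forall B, measurable B -> P [set w | B (ang (tau1 w) w)] = lam B].
Proof.
have j0 (j : nat) : 0 < j.+1%:R^-1 :> R by rewrite invr_gt0.
have jc j x : j.+1%:R^-1 <= c j x by rewrite le_max lexx orbT.
have /choice[b bP] := fun j => threshold_time (j0 j) (jc j) (@mc j) (lc j).
have sb j : stop F (b j) by have [] := bP j.
have b0 j w : 0 <= b j w by have [] := sb j.
have mZb j : measurable_fun setT (fun w => Z (b j w) w) by exact: (stop_Z_measurable sp).
have mrb j : measurable_fun setT (fun w => rad (b j w) w).
  by apply: measurableT_comp => //; exact: measurable_enorm.
have mab j : measurable_fun setT (fun w => ang (b j w) w).
  by apply: measurableT_comp => //; exact: measurable_angle.
have mAb j B : measurable B -> measurable [set w | B (ang (b j w) w)].
  by move=> mB; rewrite -[X in measurable X]setTI; apply: mab.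
pose p j B := fine (P [set w | B (ang (b j w) w)]).
have p_cvg B : measurable B -> (fun j => p j B) @ \oo --> fine (lam B).
  (* The unknown factor D of [threshold_time] is eliminated by dividing by the same identity for the
     whole space. *)
  move=> mB; have E j : p j B = q j B / q j setT.
    have [_ _ _ _ [D D0 HD]] := bP j.
    have := HD _ mB; rewrite -/(p j B) => ->; have := HD _ measurableT.
    rewrite (_ : [set w | _] = setT); last by apply/seteqP.
    rewrite probability_setT/= => h1.
    rewrite -(qE j mB) -(qE j measurableT).
    have K0 : Ex kappa (fun x => \1_setT x / c j x) != 0.
      by apply: contra_eq_neq h1 => ->; rewrite mulr0 oner_eq0.
    set x := Ex kappa _ in h1 K0 *; set y := Ex kappa _.
    have -> : D = x^-1 by apply: (mulIf K0); rewrite mulVf.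
    by field; rewrite K0 gt_eqF.
  under eq_fun do rewrite E.
  have -> : fine (lam B) = fine (lam B) / fine (lam setT) by rewrite probability_setT divr1.
  apply: cvgM; first exact: q_cvg.
  apply: cvgV; last exact: q_cvg.
  by rewrite probability_setT oner_eq0.
have good : {ae P, forall w, forall j, rad (b j w) w = c j (ang (b j w) w) /\
     forall t, 0 <= t -> t < b j w -> rad t w < c j (ang t w)}.
  by apply: ae_foralln => j; have [] := bP j.
have [N [mN PN NP]] := good.
have gN w : ~ N w -> forall j, rad (b j w) w = c j (ang (b j w) w) /\
     forall t, 0 <= t -> t < b j w -> rad t w < c j (ang t w).
  by move=> Nw; apply: contrapT => h; apply: Nw; exact: NP.
pose b' j w := if w \in N then 0 else b j w.
pose tau1 w := limn (fun j => b' j w).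
have b'_le w : {homo (fun j => b' j w) : j k / (j <= k)%N >-> k <= j}.
  move=> j k jk; rewrite /b'; case: ifPn => //; rewrite notin_setE => Nw.
  have [Rj hj] := gN w Nw j; have [Rk hk] := gN w Nw k.
  rewrite leNgt; apply/negP => jk'.
  have := hk _ (b0 j w) jk'; rewrite Rj ltNge; apply/negP; rewrite negbK; exact: c_le.
have b'0 j w : 0 <= b' j w by rewrite /b'; case: ifP.
have b'_cvg w : (fun j => b' j w) @ \oo --> tau1 w.
  apply: nonincreasing_is_cvgn; first by move=> j k; exact: b'_le.
  by exists 0 => _ [j _ <-].
have tau1_le w j : tau1 w <= b' j w.
  by apply: nonincreasing_cvgn_ge; [move=> x y; exact: b'_le|apply: cvgP (b'_cvg w)].
have tau10 w : 0 <= tau1 w.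
  by apply: limr_ge; [apply: cvgP (b'_cvg w)|exact: nearW].
have mN' : measurable_fun setT (fun w => w \in N).
  apply: (@measurable_fun_bool _ _ _ _ true); rewrite setTI.
  by rewrite (_ : _ @^-1` _ = N)//; apply/seteqP; split => w /=; [move=> /set_mem|move=> /mem_set].
have mb' j : measurable_fun setT (b' j).
  by apply: measurable_fun_ifT => //; exact: (stop_measurable Fsigma Fmeas (sb j)).
have mtau1 : measurable_fun setT tau1.
  by apply: (measurable_realfun.measurable_fun_cvg mb') => w _; exact: b'_cvg.
have rb'E j w : rad (b' j w) w = if w \in N then 0 else rad (b j w) w.
  by rewrite /b'; case: ifP => // _; rewrite (sp_zero sp)// enorm0.
have mrb' j : measurable_fun setT (fun w => rad (b' j w) w).
  by under eq_fun do rewrite rb'E; exact: measurable_fun_ifT.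
have rb'_cvg w : (fun j => rad (b' j w) w) @ \oo --> rad (tau1 w) w.
  apply: (@cvg_comp _ _ _ (fun j => b' j w) (fun t => rad t w)); first exact: b'_cvg.
  exact: (sp_crad sp).
have mrt : measurable_fun setT (fun w => rad (tau1 w) w).
  by apply: (measurable_realfun.measurable_fun_cvg mrb') => w _; exact: rb'_cvg.
(* no mass escapes to the origin *)
pose O := [set w | rad (tau1 w) w = 0].
have mO : measurable O by have := mrt measurableT _ (measurable_set1 (0 : R)); rewrite setTI.
have PO : P (O `\` N) = 0%E.
  pose Bk (k : nat) : set 'rV[R]_n := [set x | mm x < k.+1%:R^-1].
  have mBk k : measurable (Bk k).
    rewrite (_ : Bk k = mm @^-1` `]-oo, k.+1%:R^-1[).
      by rewrite -[X in measurable X]setTI; apply: mmm.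
    by apply/seteqP; split => x /=; rewrite in_itv.
  have Bk0 : (fun k => fine (lam (Bk k))) @ \oo --> 0.
    have -> : (fun k => fine (lam (Bk k))) = (fun k => Ex lam (\1_(Bk k))).
      by apply/funext => k; rewrite Ex_indic.
    rewrite -[X in _ --> X](Ex_cst lam 0).
    apply: (@Ex_dct _ _ _ lam (fun k => \1_(Bk k)) (fun=> 0) (fun=> 1) _ _ _ _).2.
    - by move=> k; exact: measurable_indic.
    - exact: L1_cst.
    - by move=> k x; exact: indic_norm_le1.
    - move=> x; apply: cvg_near_cst.
      have [k0 _ h] := near_infty_natSinv_lt (PosNum (mm0 x)).
      exists k0 => // k /= kk; rewrite indicE memNset//= /Bk/= => h'.
      by have := lt_trans h' (h k kk); rewrite ltxx.
  (* The continuous function [f] is 1 at 0 and vanishes beyond 1/(k+1). If it is positive at the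
     radius c_j(angle), which is at least mm(angle), then the angle is in [Bk k]; taking the limit
     in j bounds the probability of ending at 0. *)
  have POk k : fine (P (O `\` N)) <= fine (lam (Bk k)).
    pose f (r : R) : R := Num.max 0 (1 - r * k.+1%:R).
    have cf : continuous f.
      apply: continuous_maxr; first exact: continuous_const.
      by move=> x; apply: cvgB; [exact: cvg_cst|apply: cvgMl; exact: cvg_id].
    have mf : measurable_fun setT f by exact: continuous_measurable_fun.
    have f01 r : 0 <= r -> 0 <= f r <= 1.
      move=> r0; rewrite le_max lexx ge_max ler01/=.
      by have := mulr_ge0 r0 (ler0n R k.+1); lra.
    pose g j w := \1_(~` N) w * f (rad (b' j w) w).
    have mg j : measurable_fun setT (g j).
      apply: measurable_funM; first exact: measurable_indic (measurableC mN).
      exact: measurableT_comp.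
    have gb j w : `|g j w| <= 1.
      have /andP[h1 h2] := f01 _ (enorm_ge0 (Z (b' j w) w)).
      rewrite normrM -[leRHS]mul1r; apply: ler_pM => //; first exact: indic_norm_le1.
      by rewrite ger0_norm.
    have [lg cg] : L1 P (fun w => \1_(~` N) w * f (rad (tau1 w) w)) /\
        Ex P \o g @ \oo --> Ex P (fun w => \1_(~` N) w * f (rad (tau1 w) w)).
      apply: (@Ex_dct _ _ _ P g _ (fun=> 1)) => //; first exact: L1_cst.
      move=> w; apply: cvgMr; apply: (@cvg_comp _ _ _ (fun j => rad (b' j w) w) f); first exact: rb'_cvg.
      exact: cf.
    apply: (@le_trans _ _ (Ex P (fun w => \1_(~` N) w * f (rad (tau1 w) w)))).
      rewrite -Ex_indic; last exact: measurableD.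
      apply: le_Ex => //; first by apply: L1_1; exact: measurableD.
      move=> w; have /andP[h1 h2] := f01 _ (enorm_ge0 (Z (tau1 w) w)).
      rewrite [leLHS]indicE; case: (boolP (w \in O `\` N)) => [/set_mem[/= Ow Nw]|_].
        by rewrite indicE mem_set// mul1r /f Ow mul0r subr0 le_max lexx orbT.
      by rewrite mulr_ge0.
    apply: (ler_cvg_to cg (p_cvg _ (mBk k))); apply: nearW => j /=.
    rewrite /p -Ex_indic; last exact: mAb.
    apply: le_Ex; [exact: (@L1_bounded _ _ _ P (g j) 1 (mg j) (gb j))|by apply: L1_1; exact: mAb|].
    move=> w; rewrite /g rb'E indicE; case: (boolP (w \in ~` N)) => [/set_mem Nw|_]; last by rewrite mul0r.
    rewrite memNset// mul1r; have [Rj _] := gN w Nw j.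
    have /andP[h1 h2] := f01 _ (enorm_ge0 (Z (b j w) w)).
    rewrite indicE; case: (boolP (w \in [set w | _])) => [//|]; rewrite notin_setE /= => h.
    rewrite /f ge_max lexx/= subr_le0.
    have : k.+1%:R^-1 <= mm (ang (b j w) w) by rewrite leNgt; apply/negP.
    move=> /le_trans/(_ (cmm j _)); rewrite -Rj -ler_pdivrMr ?invr_gt0//.
    by rewrite div1r.
  rewrite -[LHS]fineK ?fin_num_measure//; last exact: measurableD.
  congr (_%:E); apply/eqP; rewrite eq_le fine_ge0// andbT.
  by apply: (ler_cvg_to (cvg_cst _) Bk0); apply: nearW.
pose N2 := N `|` O.
have mN2 : measurable N2 by exact: measurableU.
have PN2 : P N2 = 0%E.
  rewrite (_ : N2 = N `|` (O `\` N)).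
    rewrite (measureU P mN (measurableD mO mN)); last by apply/seteqP; split => // w [Nw [_]].
    by rewrite -[RHS]adde0; congr (_ + _)%E; [exact: PN|exact: PO].
  apply/seteqP; split => w [h|h]; [by left| |by left|by right; have [] := h].
  by have [Nw|Nw] := pselect (N w); [left|right].
have aN2 : {ae P, forall w, ~ N2 w}.
  by exists N2; split => // w /= /contrapT.
have main w : ~ N2 w -> [/\ rad (tau1 w) w = mm (ang (tau1 w) w),
    forall t, 0 <= t -> t < tau1 w -> rad t w != mm (ang t w) &
    \forall j \near \oo, b j w = tau1 w].
  move=> N2w; have Nw : ~ N w by move=> h; apply: N2w; left.
  have b'E j : b' j w = b j w by rewrite /b' memNset.
  have Zt : Z (tau1 w) w != 0.
    by rewrite -enorm_eq0; apply/eqP => h; apply: N2w; right.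
  have [e e0 he] := sp_ang_near sp Zt.
  set g := ang (tau1 w) w in he *.
  (* Off the origin the angle is constant near [tau1], so that a single value of the threshold
     matters, and it is eventually that of [mm]. *)
  have near_b : \forall j \near \oo, rad (b j w) w = mm g /\ ang (b j w) w = g.
    have /cvgrPdist_lt/(_ _ e0) := b'_cvg w.
    apply: filterS2 (c_near g) => j cj; rewrite ltr_distlC b'E => /he[_ aj].
    by rewrite aj; split => //; have [-> _] := gN w Nw j; rewrite aj.
  have Rt : rad (tau1 w) w = mm g.
    apply: (cvg_unique _ (rb'_cvg w)) => //; apply: cvg_near_cst.
    by apply: filterS near_b => j; rewrite b'E => -[].
  split => //.
  - move=> t t0 tt; apply/eqP => h.
    have [j _ /(_ j (leqnn j)) cj] := c_near (ang t w).
    have [_ hj] := gN w Nw j; have := hj t t0; rewrite cj h ltxx => hh.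
    have : t < b j w by rewrite -b'E; exact: lt_le_trans (tau1_le w j).
    by move=> /hh.
  - apply: filterS (c_near g) => j cj; apply/eqP; rewrite eq_le -{2}b'E tau1_le andbT.
    rewrite leNgt; apply/negP => h; have [_ hj] := gN w Nw j.
    by have := hj _ (tau10 w) h; rewrite -/g cj Rt ltxx.
have st : stop F tau1.
  (* The times decrease to [tau1] but are eventually equal to it almost surely, hence the union over
     j; otherwise only events slightly after s would be known. *)
  split => // s; apply: (@filt_ae s (\bigcup_j [set w | b j w <= s])).
  - by apply: filt_bigcup => // j; have [_] := sb j; apply.
  - rewrite (_ : [set w | _] = tau1 @^-1` `]-oo, s]).
      by rewrite -[X in measurable X]setTI; apply: mtau1.
    by apply/seteqP; split => w /=; rewrite in_itv.
  - apply: filterS aN2 => w N2w; have [_ _ [j _ /(_ j (leqnn j)) bj]] := main w N2w.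
    split => [[k _ /= bk]|/= h]; last by exists j => //=; rewrite bj.
    apply: le_trans bk; apply: le_trans (tau1_le w k) _.
    by rewrite /b'; case: ifP => // _; exact: b0.
exists tau1; split => //.
- have [_ lb0 _ _ _] := bP 0; apply: (L1_le mtau1 lb0) => w.
  rewrite ger0_norm//; apply: le_trans (tau1_le w 0) _.
  by rewrite /b'; case: ifP => // _; exact: b0.
- by apply: filterS aN2 => w /main[].
- move=> B mB; have mat : measurable_fun setT (fun w => ang (tau1 w) w).
    by apply: measurableT_comp; [exact: measurable_angle|exact: (stop_Z_measurable sp)].
  have mBt : measurable [set w | B (ang (tau1 w) w)].
    by rewrite -[X in measurable X]setTI; apply: mat.
  have mi : measurable_fun setT (\1_B : _ -> R) by exact: measurable_indic.
  pose g j w : R := \1_(~` N2) w * \1_B (ang (b j w) w).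
  have C : (fun j => Ex P (g j)) @ \oo --> Ex P (fun w => \1_(~` N2) w * \1_B (ang (tau1 w) w)).
    apply: (@Ex_dct _ _ _ P g _ (fun=> 1) _ _ _ _).2.
    + move=> j; apply: measurable_funM; first exact: measurable_indic (measurableC mN2).
      exact: measurableT_comp.
    + exact: L1_cst.
    + by move=> j w; rewrite normrM -[leRHS]mul1r; apply: ler_pM => //; exact: indic_norm_le1.
    + move=> w; apply: cvg_near_cst; rewrite /g indicE.
      case: (boolP (w \in ~` N2)) => [/set_mem/main[_ _ h]|_].
        by apply: filterS h => j ->.
      by apply: nearW => j; rewrite !mul0r.
  have E j : Ex P (g j) = p j B.
    rewrite /g (Ex_full (measurableC mN2) aN2); last exact: measurableT_comp.
    rewrite /p -Ex_indic; last exact: mAb.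
    by apply: eq_Ex => w; rewrite !indicE; congr (_%:R); congr nat_of_bool; apply/idP/idP => /set_mem h; exact: mem_set.
  have C2 : (fun j => Ex P (g j)) @ \oo --> fine (lam B).
    by under eq_fun do rewrite E; exact: p_cvg.
  have := cvg_unique _ C C2; move=> /(_ (@Rhausdorff R)).
  rewrite (Ex_full (measurableC mN2) aN2); last exact: measurableT_comp.
  move=> h; rewrite -[LHS]fineK ?fin_num_measure// -[RHS]fineK ?fin_num_measure//.
  by congr (_%:E); rewrite -h -Ex_indic.
Qed.

End barycentric_threshold.

End first_stage.

(** * Exit times from intervals of a ray *)

Section expectation_limits.
Context {R : realType} {d : measure_display} {T : measurableType d} (P : probability T R).

Lemma Ex_fatou_cvg (f : nat -> T -> R) g (u : nat -> R) (l : R) :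
  (forall k, L1 P (f k)) -> (forall k w, 0 <= f k w) -> (forall k, Ex P (f k) <= u k) ->
  u @ \oo --> l -> (forall w, f ^~ w @ \oo --> g w) -> L1 P g /\ Ex P g <= l.
Proof.
move=> lf f0 fu ul fg.
have H e : 0 < e -> L1 P g /\ Ex P g <= l + e.
  move=> e0; have /cvgrPdist_le/(_ _ e0)[N _ hN] := ul.
  apply: (@Ex_fatou _ _ _ P (fun k => f (k + N)%N)) => //.
    move=> k; apply: le_trans (fu _) _; have := hN (k + N)%N (leq_addl _ _).
    by rewrite /= ler_distlC => /andP[].
  by move=> w; rewrite (cvg_shiftn N (f ^~ w)).
split; first by have [] := H 1 ltr01.
by apply/ler_addgt0Pr => e /H[].
Qed.

End expectation_limits.

Lemma indic_mul_le (R : realType) (T : Type) (H : set T) w (x C : R) : `|x| <= C -> `|\1_H w * x| <= C.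
Proof. by apply: le_trans; rewrite normrM ler_piMl// indic_norm_le1. Qed.

Section exit.
Context {R : realType} {n : nat} {d : measure_display} {T : measurableType d}.
Variables (P : probability T R) (kappa : probability 'rV[R]_n R).
Variables (F : R -> set_system T) (Z : R -> T -> 'rV[R]_n).
Hypothesis sp : spider P kappa F Z.
Variable alpha : T -> R.
Hypothesis sa : stop F alpha.
Hypothesis la : L1 P alpha.
Hypothesis lr2a : L1 P (fun w => enorm (Z (alpha w) w) ^+ 2).
Variable q : 'rV[R]_n -> R.
Hypothesis mq : measurable_fun setT q.
Hypothesis qz : forall z, enorm z <= q z.
Hypothesis q0 : q 0 = 0.
Implicit Types (p : 'rV[R]_n -> R) (B : set 'rV[R]_n) (s t : R).
Notation rad t w := (enorm (Z t w)).
Notation ang t w := (angle (Z t w)).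
Notation U w := (Z (alpha w) w).
Let Fsigma := sp_sigma sp.
Let Fmono := sp_mono sp.
Let Fmeas := sp_meas sp.
Let a0 w : 0 <= alpha w. Proof. by have [] := sa. Qed.
Let mU : measurable_fun setT (fun w => U w). Proof. exact: (stop_Z_measurable sp). Qed.
Let mRa : measurable_fun setT (fun w => rad (alpha w) w).
Proof. by apply: measurableT_comp => //; exact: measurable_enorm. Qed.
Let lRa : L1 P (fun w => rad (alpha w) w). Proof. exact: L1_sqr. Qed.

(** Negative exactly when |Z_t| lies strictly between the barriers p and q, which are evaluated at
    the position U at time [alpha]; the exit is thus the hitting of the nonnegative half-line. *)
Definition strip p t w : R := Num.max (p (U w) - rad t w) (rad t w - q (U w)).

Lemma strip_continuous p w : continuous (strip p ^~ w).
Proof.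
apply: (@continuous_maxr _ _ (fun t => p (U w) - rad t w) (fun t => rad t w - q (U w))).
  by move=> t; apply: cvgB; [exact: cvg_cst|exact: (sp_crad sp)].
by move=> t; apply: cvgB; [exact: (sp_crad sp)|exact: cvg_cst].
Qed.

(** Once [alpha] has passed, its position is that at the time min(alpha, t), which is known at time
    t. *)
Lemma strip_adapted p t x : measurable_fun setT p ->
  F t ([set w | alpha w <= t] `&` [set w | x < strip p t w]).
Proof.
move=> mp; have [t0|t0] := leP 0 t; last first.
  rewrite (_ : _ `&` _ = set0); first exact: filt0.
  by apply/seteqP; split => // w [/=]; have := a0 w; lra.
pose f w := Num.max (p (Z (Num.min (alpha w) t) w) - rad t w) (rad t w - q (Z (Num.min (alpha w) t) w)).
have mf : @measurable_fun _ _ (g_sigma_algebraType (F t)) _ setT f.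
  have mZ := stopped_Z sp t0 sa.
  have mr : @measurable_fun _ _ (g_sigma_algebraType (F t)) _ setT (fun w => rad t w).
    by apply: (measurableT_comp (@measurable_enorm R n)); exact: (sp_gZ sp).
  apply: measurable_maxr; apply: measurable_funB => //; exact: measurableT_comp.
rewrite (_ : _ `&` _ = [set w | alpha w <= t] `&` f @^-1` `]x, +oo[); last first.
  apply/seteqP; split => w /= [h1]; rewrite in_itv/= andbT /f /strip; rewrite (min_l h1).
    by [].
  by [].
apply: filtI => //; first by have [_] := sa; apply.
by rewrite -(measurable_gF Fsigma) -[X in measurable X]setTI; apply: mf.
Qed.

Lemma strip_start p w : p (U w) <= enorm (U w) -> strip p (alpha w) w <= 0.
Proof. by move=> pz; rewrite /strip ge_max !subr_le0 pz qz. Qed.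

Lemma strip_le p t w : strip p t w <= 0 -> p (U w) <= rad t w <= q (U w).
Proof. by rewrite /strip ge_max !subr_le0. Qed.

Lemma strip_lt p t w : strip p t w < 0 -> p (U w) < rad t w < q (U w).
Proof. by rewrite /strip gt_max !subr_lt0. Qed.

Lemma strip_ge p t w : 0 <= strip p t w -> rad t w <= p (U w) \/ q (U w) <= rad t w.
Proof. by rewrite /strip le_max !subr_ge0 => /orP[]; [left|right]. Qed.

Section one_barrier.
Variable p : 'rV[R]_n -> R.
Hypothesis mp : measurable_fun setT p.
Hypothesis pz : forall z, p z <= enorm z.

Let cY : forall w, continuous (strip p ^~ w) := @strip_continuous p.
Let aY t x := strip_adapted t x mp.
Let b (K : nat) := hit_or alpha (strip p) K%:R.
Let aK (K : nat) w := Num.min (alpha w) K%:R.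
Let sb K : stop F (b K). Proof. exact: (hit_or_stop Fsigma Fmono sa cY aY). Qed.
Let saK K : stop F (aK K). Proof. exact: stop_min. Qed.
Let bK K w : b K w <= K%:R. Proof. exact: hit_or_le. Qed.
Let ab K w : aK K w <= b K w. Proof. exact: hit_or_ge. Qed.

(* The event that the starting point lies in B and the outer barrier is at
   most C, on which everything is bounded. *)
Let A B (C : R) := [set w | B (U w) /\ q (U w) <= C].
Let AK B C (K : nat) := A B C `&` [set w | alpha w <= K%:R].

Let pastA B C : measurable B -> past F alpha (A B C).
Proof.
move=> mB; apply: (past_Z sp sa (B := B `&` [set z | q z <= C])).
apply: measurableI => //; rewrite (_ : [set z | _] = q @^-1` `]-oo, C]).
  by rewrite -[X in measurable X]setTI; apply: mq.
by apply/seteqP; split => z /=; rewrite in_itv.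
Qed.

Let pastAK B C K : measurable B -> past F (aK K) (AK B C K).
Proof. by move=> mB; apply: past_min_le => //; exact: pastA. Qed.

Let mA B C : measurable B -> measurable (A B C). Proof. by move=> mB; have [] := @pastA B C mB. Qed.
Let mAK B C K : measurable B -> measurable (AK B C K). Proof. by move=> mB; have [] := @pastAK B C K mB. Qed.

Let b_val K w : alpha w <= K%:R -> p (U w) <= rad (b K w) w <= q (U w).
Proof.
by move=> aKw; apply: strip_le; apply: hit_or_val => //; exact: strip_start.
Qed.

Let time_bound B C K : measurable B -> 
  gauss_var * Ex P (fun w => \1_(AK B C K) w * (b K w - aK K w)) =
  Ex P (fun w => \1_(AK B C K) w * (rad (b K w) w ^+ 2 - rad (aK K w) w ^+ 2)).
Proof.
move=> mB; have E := opt_rad2 sp (saK K) (sb K) (@ab K) (bK K) (@pastAK B C K mB).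
have [_ l1 l2] := stop_rad_L1 sp (saK K) (fun w => le_trans (ab K w) (bK K w)).
have [_ l3 l4] := stop_rad_L1 sp (sb K) (bK K).
have mm := @mAK B C K mB.
have -> : Ex P (fun w => \1_(AK B C K) w * (b K w - aK K w)) =
    Ex P (fun w => \1_(AK B C K) w * b K w) - Ex P (fun w => \1_(AK B C K) w * aK K w).
  by rewrite -ExB; [apply: eq_Ex => w; rewrite mulrBr|exact: L1_indic..].
have -> : Ex P (fun w => \1_(AK B C K) w * (rad (b K w) w ^+ 2 - rad (aK K w) w ^+ 2)) =
    Ex P (fun w => \1_(AK B C K) w * rad (b K w) w ^+ 2) -
    Ex P (fun w => \1_(AK B C K) w * rad (aK K w) w ^+ 2).
  by rewrite -ExB; [apply: eq_Ex => w; rewrite mulrBr|exact: L1_indic..].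
by rewrite E addrAC subrr add0r.
Qed.

Let sqr_bound B C K w : `|\1_(AK B C K) w * (rad (b K w) w ^+ 2 - rad (aK K w) w ^+ 2)| <= C ^+ 2.
Proof.
rewrite indicE; case: (boolP (w \in _)) => [/set_mem[[_ qC] aw]|_]; last by rewrite mul0r normr0 sqr_ge0.
have /andP[_ h] := b_val aw; have r0 := enorm_ge0 (Z (b K w) w).
have r1 := enorm_ge0 (Z (aK K w) w).
have h2 : rad (aK K w) w <= C by rewrite /aK (min_l aw); exact: le_trans (qz _) qC.
have hC : rad (b K w) w <= C by exact: le_trans qC.
rewrite mul1r ler_norml; set x := rad (b K w) w in r0 hC *; set y := rad (aK K w) w in r1 h2 *.
rewrite !expr2; apply/andP; split; nra.
Qed.

Let H := hits alpha (strip p).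
Let mH : measurable H. Proof. exact: (hits_measurable sp cY aY). Qed.

(** On the event q(U) <= C the radius at the capped exit is at most C, so that the second moment
    bounds the expected capped durations uniformly in the cap. Staying in the strip forever would
    make them unbounded. *)
Let aH : {ae P, forall w, H w}.
Proof.
apply: ae_of_null => //.
pose G (C : nat) := ~` H `&` A setT C%:R `&` [set w | alpha w <= C%:R].
have mG C : measurable (G C).
  apply: measurableI; first by apply: measurableI; [exact: measurableC|exact: mA].
  by have [_ h] := sa; exact: Fmeas (h _).
have v0 := @gauss_var_gt0 R.
have PG C : P (G C) = 0%E.
  apply: (@null_of_bound _ _ _ P (G C) (fun K w => \1_(AK setT C%:R K) w * (b K w - aK K w)) C%:R
     (C%:R ^+ 2 / gauss_var)) => //.
  - move=> K; have [_ _ l2] := stop_rad_L1 sp (saK K) (fun w => le_trans (ab K w) (bK K w)).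
    have [_ _ l4] := stop_rad_L1 sp (sb K) (bK K).
    by apply: L1_indic; [exact: mAK|exact: L1B].
  - move=> K; rewrite ler_pdivlMr// mulrC time_bound//.
    apply: le_trans (ler_norm _) _; apply: le_trans (le_norm_Ex _) _.
      have [_ l1 _] := stop_rad_L1 sp (saK K) (fun w => le_trans (ab K w) (bK K w)).
      have [_ l3 _] := stop_rad_L1 sp (sb K) (bK K).
      by apply: L1_indic; [exact: mAK|exact: L1B].
    rewrite -[leRHS](Ex_cst P); apply: le_Ex; last by move=> w; exact: sqr_bound.
      have [_ l1 _] := stop_rad_L1 sp (saK K) (fun w => le_trans (ab K w) (bK K w)).
      have [_ l3 _] := stop_rad_L1 sp (sb K) (bK K).
      by apply: L1_norm; apply: L1_indic; [exact: mAK|exact: L1B].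
    exact: L1_cst.
  - move=> K w; have d0 : 0 <= b K w - aK K w by rewrite subr_ge0.
    have i0 : (0 : R) <= \1_(AK setT C%:R K) w by [].
    rewrite [\1_(G C) w]indicE; case: (boolP (w \in G C)) => [/set_mem[[nH Aw] aw]|_]; last first.
      by rewrite mulr0 mulr_ge0.
    rewrite mulr1; have [CK|KC] := leP C%:R (K%:R : R); last first.
      by apply: (@le_trans _ _ 0); [rewrite subr_le0 ltW|rewrite mulr_ge0].
    rewrite indicE mem_set; last by split => //=; exact: le_trans aw CK.
    rewrite mul1r; apply: lerB.
      rewrite /b /hit_or memNset//; move=> h; apply: nH; exact: hit_by_hits h.
    by rewrite ge_min aw.
apply/negligibleP; first exact: measurableC.
apply: (@negligibleS _ _ _ P (\bigcup_C G C)); last first.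
  by apply: negligible_bigcup => C; apply/(negligibleP P (mG C)); exact: PG.
move=> w nH; pose x := Num.max (q (U w)) (alpha w).
exists (Num.truncn x).+1 => //.
have hx : x <= (Num.truncn x).+1%:R by apply: ltW; exact: truncnS_gt.
have x1 : q (U w) <= x by rewrite le_max lexx.
have x2 : alpha w <= x by rewrite le_max lexx orbT.
by split; [split => //; split => //|] => /=; apply: le_trans hx.
Qed.

Definition exit_of := hit_fin alpha (strip p).

Lemma exit_stop : stop F exit_of. Proof. exact: (hit_fin_stop sp sa cY aY aH). Qed.

Lemma exit_ge w : alpha w <= exit_of w. Proof. by apply: hit_fin_ge. Qed.

Lemma exit_ae : {ae P, forall w, [/\ 0 <= strip p (exit_of w) w, strip p (exit_of w) w = 0 &
  forall t, alpha w <= t -> t < exit_of w -> strip p t w < 0]}.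
Proof.
apply: filterS aH => w Hw; have [_ h1 h2 h3 _] := hit_finP cY Hw; split => //.
by apply: h3; exact: strip_start.
Qed.

Let b_near w : H w -> \forall K \near \oo, b K w = exit_of w.
Proof. by case/(hit_finP cY). Qed.

Let a_near w : \forall K \near \oo, alpha w <= K%:R.
Proof. exact: nbhs_infty_ger. Qed.

Let AK_near B C w : \forall K \near \oo, aK K w = alpha w /\ \1_(AK B C K) w = \1_(A B C) w :> R.
Proof.
apply: filterS (a_near w) => K h; split; first by rewrite /aK min_l.
rewrite !indicE; congr (_%:R); congr nat_of_bool; apply/idP/idP => /set_mem.
  by move=> [h1 _]; exact: mem_set.
by move=> h1; apply: mem_set; split.
Qed.

Let cvgK (B : set 'rV[R]_n) C (f g : R -> T -> R) w :
  (fun K => \1_H w * (\1_(AK B C K) w * (f (b K w) w - g (aK K w) w))) @ \oo -->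
  \1_H w * (\1_(A B C) w * (f (exit_of w) w - g (alpha w) w)).
Proof.
rewrite [\1_H w]indicE; case: (boolP (w \in H)) => [/set_mem/b_near h|_]; last first.
  by under eq_fun do rewrite mul0r; rewrite mul0r; exact: cvg_cst.
apply: cvg_near_cst; apply: filterS2 h (AK_near B C w) => K -> [-> ->]; by [].
Qed.

Let mexit : measurable_fun setT exit_of. Proof. exact: (stop_measurable Fsigma Fmeas exit_stop). Qed.

Lemma exit_rad_measurable : measurable_fun setT (fun w => rad (exit_of w) w).
Proof. by apply: measurableT_comp; [exact: measurable_enorm|exact: (stop_Z_measurable sp exit_stop)]. Qed.

Let exit_time_bound C :
  L1 P (fun w => \1_(A setT C) w * (exit_of w - alpha w)) /\
  gauss_var * Ex P (fun w => \1_(A setT C) w * (exit_of w - alpha w)) <=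
  Ex P (fun w => \1_(A setT C) w * (rad (exit_of w) w ^+ 2 - rad (alpha w) w ^+ 2)).
Proof.
have mHA K : measurable (AK setT C K) by exact: mAK.
have v0 := @gauss_var_gt0 R.
have mX : measurable_fun setT (fun w => \1_(A setT C) w * (exit_of w - alpha w)).
  apply: measurable_funM; first by apply: measurable_indic; exact: mA.
  apply: measurable_funB => //; exact: L1_meas la.
have mS : measurable_fun setT (fun w => \1_(A setT C) w * (rad (exit_of w) w ^+ 2 - rad (alpha w) w ^+ 2)).
  apply: measurable_funM; first by apply: measurable_indic; exact: mA.
  apply: measurable_funB; first exact: measurable_funX exit_rad_measurable.
  exact: measurable_funX.
have mb K : measurable_fun setT (b K) by exact: (stop_measurable Fsigma Fmeas (sb K)).
have maK K : measurable_fun setT (aK K) by exact: (stop_measurable Fsigma Fmeas (saK K)).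
have lK K : L1 P (fun w => \1_(AK setT C K) w * (b K w - aK K w)).
  have [_ _ l2] := stop_rad_L1 sp (saK K) (fun w => le_trans (ab K w) (bK K w)).
  have [_ _ l4] := stop_rad_L1 sp (sb K) (bK K).
  by apply: L1_indic => //; exact: L1B.
have lS K : L1 P (fun w => \1_(AK setT C K) w * (rad (b K w) w ^+ 2 - rad (aK K w) w ^+ 2)).
  have [_ l1 _] := stop_rad_L1 sp (saK K) (fun w => le_trans (ab K w) (bK K w)).
  have [_ l3 _] := stop_rad_L1 sp (sb K) (bK K).
  by apply: L1_indic => //; exact: L1B.
have [_ D] := @Ex_dct _ _ _ P (fun K w => \1_H w * (\1_(AK setT C K) w * (rad (b K w) w ^+ 2 - rad (aK K w) w ^+ 2)))
  (fun w => \1_H w * (\1_(A setT C) w * (rad (exit_of w) w ^+ 2 - rad (alpha w) w ^+ 2))) (fun=> C ^+ 2)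
  (fun K => L1_meas (L1_indic mH (lS K))) (L1_cst P (C ^+ 2))
  (fun K w => indic_mul_le H w (sqr_bound setT C K w))
  (@cvgK setT C (fun t w => rad t w ^+ 2) (fun t w => rad t w ^+ 2)).
rewrite (Ex_full mH aH) in D; last by [].
have EH K : Ex P (fun w => \1_H w * (\1_(AK setT C K) w * (b K w - aK K w))) <=
    gauss_var^-1 * Ex P (fun w => \1_H w * (\1_(AK setT C K) w * (rad (b K w) w ^+ 2 - rad (aK K w) w ^+ 2))).
  rewrite (Ex_full mH aH (L1_meas (lK K))) (Ex_full mH aH (L1_meas (lS K))).
  by rewrite -time_bound// mulKf// gt_eqF.
have [l e] := @Ex_fatou_cvg _ _ _ P (fun K w => \1_H w * (\1_(AK setT C K) w * (b K w - aK K w)))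
  (fun w => \1_H w * (\1_(A setT C) w * (exit_of w - alpha w)))
  (fun K => gauss_var^-1 * Ex P (fun w => \1_H w * (\1_(AK setT C K) w * (rad (b K w) w ^+ 2 - rad (aK K w) w ^+ 2))))
  (gauss_var^-1 * Ex P (fun w => \1_(A setT C) w * (rad (exit_of w) w ^+ 2 - rad (alpha w) w ^+ 2)))
  (fun K => L1_indic mH (lK K))
  (fun K w => ltac:(by rewrite !mulr_ge0// subr_ge0))
  EH
  (cvgMr D) (@cvgK setT C (fun t w => t) (fun t w => t)).
rewrite (Ex_full mH aH) in e; last by [].
split.
  apply: (L1_ae _ mX _ l); first by apply: measurable_funM => //; exact: measurable_indic.
  by apply: filterS aH => w Hw; rewrite indicE mem_set// mul1r.
by rewrite mulrC -ler_pdivlMr// mulrC.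
Qed.

Let A_near B w : \forall C \near \oo, \1_(A B C%:R) w = \1_B (U w) :> R.
Proof.
apply: filterS (nbhs_infty_ger (q (U w))) => C h.
rewrite !indicE; congr (_%:R); congr nat_of_bool; apply/idP/idP => /set_mem.
  by move=> [h1 _]; exact: mem_set.
by move=> h1; apply: mem_set; split.
Qed.

(** Square integrability at the exit is a premise: it will come from the law of the exit point,
    which is itself determined by first moments. *)
Lemma exit_expectation : L1 P (fun w => rad (exit_of w) w ^+ 2) ->
  L1 P exit_of /\ gauss_var * Ex P exit_of <=
    gauss_var * Ex P alpha + (Ex P (fun w => rad (exit_of w) w ^+ 2) - Ex P (fun w => rad (alpha w) w ^+ 2)).
Proof.
move=> l2; have v0 := @gauss_var_gt0 R.
have lD : L1 P (fun w => rad (exit_of w) w ^+ 2 - rad (alpha w) w ^+ 2) by exact: L1B.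
have iT w : \1_(setT : set 'rV[R]_n) (U w) = 1 :> R by rewrite indicE in_setT.
have [_ D] := @Ex_dct _ _ _ P (fun C w => \1_(A setT C%:R) w * (rad (exit_of w) w ^+ 2 - rad (alpha w) w ^+ 2))
  (fun w => rad (exit_of w) w ^+ 2 - rad (alpha w) w ^+ 2) _
  (fun C => L1_meas (L1_indic (mA C%:R measurableT) lD)) (L1_norm lD)
  (fun C w => ltac:(by rewrite normrM ler_piMl// indic_norm_le1))
  (fun w => ltac:(by apply: cvg_near_cst; apply: filterS (A_near setT w) => C ->; rewrite iT mul1r)).
have [l e] := @Ex_fatou_cvg _ _ _ P (fun C w => \1_(A setT C%:R) w * (exit_of w - alpha w))
  (fun w => exit_of w - alpha w)
  (fun C => gauss_var^-1 * Ex P (fun w => \1_(A setT C%:R) w * (rad (exit_of w) w ^+ 2 - rad (alpha w) w ^+ 2)))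
  (gauss_var^-1 * Ex P (fun w => rad (exit_of w) w ^+ 2 - rad (alpha w) w ^+ 2))
  (fun C => (exit_time_bound C%:R).1)
  (fun C w => ltac:(by rewrite mulr_ge0// subr_ge0 exit_ge))
  (fun C => ltac:(by rewrite -(ler_pM2l v0) mulVKf ?gt_eqF//; exact: (exit_time_bound C%:R).2))
  (cvgMr D)
  (fun w => ltac:(by apply: cvg_near_cst; apply: filterS (A_near setT w) => C ->; rewrite iT mul1r)).
have le : L1 P exit_of by apply: (eq_L1 _ (L1D l la)) => w; rewrite subrK.
split => //; have := e; rewrite -(ler_pM2l v0) mulVKf ?gt_eqF//.
by rewrite !ExB// mulrBr; lra.
Qed.

(** Inside the strip |Z| >= e, so that [opt_rad] applies at the capped times; the caps are removed
    by dominated convergence, all the radii being at most C. *)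
Lemma exit_mart B C (e : R) : 0 < e -> measurable B -> 0 <= C ->
  (forall w t, q (U w) <= C -> strip p (alpha w) w < 0 -> alpha w <= t -> strip p t w < 0 -> e <= rad t w) ->
  Ex P (fun w => \1_(A B C) w * rad (exit_of w) w) = Ex P (fun w => \1_(A B C) w * rad (alpha w) w).
Proof.
move=> e0 mB C0 He.
have E K : Ex P (fun w => \1_(AK B C K) w * rad (b K w) w) = Ex P (fun w => \1_(AK B C K) w * rad (aK K w) w).
  apply: (@opt_rad _ _ _ _ _ _ _ _ sp K (aK K) (b K) (AK B C K) (saK K) (sb K) (@ab K) (bK K) (@pastAK B C K mB) e e0).
  move=> w t [[_ qC] aw] at_ tb.
  have at' : alpha w <= t by apply: le_trans at_; rewrite /aK min_l.
  apply: He => //; last exact: (hit_or_before cY at' tb).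
  apply: (hit_or_before cY _ (le_lt_trans at' tb)); exact: lexx.
have bd K w : `|\1_(AK B C K) w * (rad (b K w) w - rad (aK K w) w)| <= C.
  rewrite indicE; case: (boolP (w \in _)) => [/set_mem[[_ qC] aw]|_]; last by rewrite mul0r normr0.
  have /andP[_ h] := b_val aw; have r0 := enorm_ge0 (Z (b K w) w).
  have r1 := enorm_ge0 (Z (aK K w) w).
  have h2 : rad (aK K w) w <= C by rewrite /aK (min_l aw); exact: le_trans (qz _) qC.
  have hC : rad (b K w) w <= C by exact: le_trans qC.
  by rewrite mul1r ler_norml; apply/andP; split; lra.
have lK K : L1 P (fun w => \1_(AK B C K) w * (rad (b K w) w - rad (aK K w) w)).
  have [l1 _ _] := stop_rad_L1 sp (saK K) (fun w => le_trans (ab K w) (bK K w)).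
  have [l3 _ _] := stop_rad_L1 sp (sb K) (bK K).
  by apply: L1_indic; [exact: mAK|exact: L1B].
have [l D] := @Ex_dct _ _ _ P (fun K w => \1_H w * (\1_(AK B C K) w * (rad (b K w) w - rad (aK K w) w)))
  (fun w => \1_H w * (\1_(A B C) w * (rad (exit_of w) w - rad (alpha w) w))) (fun=> C)
  (fun K => L1_meas (L1_indic mH (lK K))) (L1_cst P C)
  (fun K w => ltac:(by rewrite normrM; apply: le_trans (bd K w); rewrite ler_piMl// indic_norm_le1))
  (@cvgK B C (fun t w => rad t w) (fun t w => rad t w)).
have mX : measurable_fun setT (fun w => \1_(A B C) w * (rad (exit_of w) w - rad (alpha w) w)).
  apply: measurable_funM; first by apply: measurable_indic; exact: mA.
  by apply: measurable_funB => //; exact: exit_rad_measurable.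
rewrite (Ex_full mH aH) in D; last by [].
have D0 : Ex P (fun w => \1_(A B C) w * (rad (exit_of w) w - rad (alpha w) w)) = 0.
  apply: (cvg_unique _ D) => //; apply: cvg_near_cst; apply: nearW => K /=.
  rewrite (Ex_full mH aH); last exact: L1_meas (lK K).
  have [l1 _ _] := stop_rad_L1 sp (saK K) (fun w => le_trans (ab K w) (bK K w)).
  have [l3 _ _] := stop_rad_L1 sp (sb K) (bK K).
  have mm := @mAK B C K mB.
  transitivity (Ex P (fun w => \1_(AK B C K) w * rad (b K w) w) - Ex P (fun w => \1_(AK B C K) w * rad (aK K w) w)).
    by rewrite -ExB; [apply: eq_Ex => w; rewrite mulrBr|exact: L1_indic..].
  by rewrite E subrr.
have lX : L1 P (fun w => \1_(A B C) w * (rad (exit_of w) w - rad (alpha w) w)).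
  apply: (L1_ae _ mX _ l); first by apply: measurable_funM => //; exact: measurable_indic.
  by apply: filterS aH => w Hw; rewrite indicE mem_set// mul1r.
have lA : L1 P (fun w => \1_(A B C) w * rad (alpha w) w) by apply: L1_indic => //; exact: mA.
have -> : Ex P (fun w => \1_(A B C) w * rad (exit_of w) w) =
   Ex P (fun w => \1_(A B C) w * (rad (exit_of w) w - rad (alpha w) w) + \1_(A B C) w * rad (alpha w) w).
  by apply: eq_Ex => w; rewrite -mulrDr subrK.
by rewrite ExD// D0 add0r.
Qed.

End one_barrier.
Section inner_barrier.
Variable p : 'rV[R]_n -> R.
Hypothesis mp : measurable_fun setT p.
Hypothesis p0 : forall z, 0 <= p z.
Hypothesis pz : forall z, p z <= enorm z.

(* The inner barrier is approximated by barriers away from the origin. *)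
Let pi (i : nat) z := Num.max (p z) (Num.min (enorm z) i.+1%:R^-1).

Let mpi i : measurable_fun setT (pi i).
Proof.
apply: measurable_maxr => //; apply: measurable_minr => //; exact: measurable_enorm.
Qed.

Let piz i z : pi i z <= enorm z.
Proof. by rewrite /pi ge_max pz ge_min lexx. Qed.

Let p_le i z : p z <= pi i z. Proof. by rewrite /pi le_max lexx. Qed.

Let pi_le i j z : (i <= j)%N -> pi j z <= pi i z.
Proof.
move=> ij; rewrite /pi ge_max p_le/= le_max; apply/orP; right.
rewrite le_min !ge_min lexx/=; apply/orP; right.
by rewrite lef_pV2 ?posrE// ler_nat.
Qed.

Let beta := exit_of p.
Let bi i := exit_of (pi i).

Let good w := [/\ 0 <= strip p (beta w) w, strip p (beta w) w = 0 &
  forall t, alpha w <= t -> t < beta w -> strip p t w < 0] /\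
  forall i, [/\ 0 <= strip (pi i) (bi i w) w, strip (pi i) (bi i w) w = 0 &
  forall t, alpha w <= t -> t < bi i w -> strip (pi i) t w < 0].

Let ae_good : {ae P, forall w, good w}.
Proof.
have h1 := exit_ae mp pz; have h2 : {ae P, forall w, forall i, [/\ 0 <= strip (pi i) (bi i w) w, strip (pi i) (bi i w) w = 0 &
  forall t, alpha w <= t -> t < bi i w -> strip (pi i) t w < 0]}.
  by apply: ae_foralln => i; exact: exit_ae (mpi i) (piz i).
by apply: filterS2 h1 h2 => w g1 g2; split.
Qed.

Let strip_mono i t w : strip p t w <= strip (pi i) t w.
Proof.
rewrite /strip ge_max !le_max lexx orbT andbT; apply/orP; left.
by rewrite lerD2r.
Qed.

(** The exit times [bi i] increase and are at most [beta]. If none is equal to [beta], each of these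
    exits is through the raised inner barrier, at a radius at most 1/(i+1). The minimum of the
    radius over [alpha, beta] is then 0, and since the radius exceeds p >= 0 before [beta], it is
    attained at [beta]: both radii tend to 0. *)
Let bi_cvg w : good w -> (fun i => rad (bi i w) w) @ \oo --> rad (beta w) w.
Proof.
move=> [[h1 h2 h3] h4].
have bb i : bi i w <= beta w.
  have [_ _ h] := h4 i; rewrite leNgt; apply/negP => bb.
  have := h _ (exit_ge p w) bb; rewrite ltNge; apply/negP; rewrite negbK.
  exact: le_trans h1 (strip_mono i _ _).
have bmono i j : (i <= j)%N -> bi i w <= bi j w.
  move=> ij; have [g1 _ _] := h4 j; have [_ _ g3] := h4 i.
  rewrite leNgt; apply/negP => bb'; have := g3 _ (exit_ge (pi j) w) bb'.
  rewrite ltNge; apply/negP; rewrite negbK; apply: le_trans g1 _.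
  rewrite /strip ge_max !le_max lexx orbT andbT; apply/orP; left.
  by rewrite lerD2r; exact: pi_le.
have [[i0 e0]|ne] := pselect (exists i, bi i w = beta w).
  apply: cvg_near_cst; exists i0 => // i /= ii; congr (enorm (Z _ w)).
  by apply/eqP; rewrite eq_le bb -e0 bmono.
have lt i : bi i w < beta w by rewrite lt_neqAle bb andbT; apply/eqP => e; apply: ne; exists i.
have small i : rad (bi i w) w <= i.+1%:R^-1.
  have [g1 _ _] := h4 i.
  have /andP[g2 g3] := strip_lt (h3 _ (exit_ge (pi i) w) (lt i)).
  have [|] := strip_ge g1; last by rewrite leNgt g3.
  rewrite /pi le_max => /orP[|]; first by rewrite leNgt g2.
  by rewrite le_min => /andP[].
have cr := @continuous_subspaceT _ _ `[alpha w, beta w] _ (@sp_crad _ _ _ _ _ _ _ _ sp w).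
have [t0 t0i t0m] := @EVT_min R (fun t => rad t w) (alpha w) (beta w) (exit_ge p w) cr.
move: t0i; rewrite in_itv/= => /andP[at0 t0b].
have r0 : rad t0 w = 0.
  apply/eqP; rewrite eq_le enorm_ge0 andbT; apply: (ler_cvg_to (cvg_cst _) (@inv_cvg0 R)).
  apply: nearW => i; apply: le_trans (small i); apply: t0m.
  by rewrite in_itv/= (exit_ge (pi i) w) bb.
have tb : t0 = beta w.
  apply/eqP; rewrite eq_le t0b leNgt; apply/negP => /(h3 _ at0)/strip_lt/andP[+ _].
  by rewrite r0 ltNge p0.
rewrite -tb r0; apply: (@squeeze_cvgr _ _ _ _ (fun=> 0) (fun i => i.+1%:R^-1)).
- by apply: nearW => i; rewrite enorm_ge0 small.
- exact: cvg_cst.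
- exact: inv_cvg0.
Qed.

Let mgr i : measurable_fun setT (fun w => rad (bi i w) w).
Proof. exact: exit_rad_measurable (mpi i) (piz i). Qed.

Let bi_mart i B C : measurable B -> 0 <= C ->
  Ex P (fun w => \1_[set w | B (U w) /\ q (U w) <= C] w * rad (bi i w) w) =
  Ex P (fun w => \1_[set w | B (U w) /\ q (U w) <= C] w * rad (alpha w) w).
Proof.
move=> mB C0; apply: (exit_mart (mpi i) (piz i) (e := i.+1%:R^-1)) => //.
move=> w t _ /strip_lt/andP[h1 _] at_ /strip_lt/andP[h _].
(* A start within 1/(i+1) of the origin lies on the raised barrier itself and exits at once; from
   any other start the strip stays at distance 1/(i+1). *)
have [h0|h0] := leP (enorm (U w)) i.+1%:R^-1.
  by move: h1; rewrite ltNge /pi le_max le_min lexx h0 orbT.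
apply: ltW; apply: le_lt_trans h; rewrite /pi le_max; apply/orP; right.
by rewrite le_min lexx andbT ltW.
Qed.

Let mbr : measurable_fun setT (fun w => rad (beta w) w). Proof. exact: exit_rad_measurable. Qed.

Let mA B (C : R) : measurable B -> measurable [set w | B (U w) /\ q (U w) <= C].
Proof.
move=> mB; have mq' : measurable [set z | q z <= C].
  rewrite (_ : [set z | _] = q @^-1` `]-oo, C]).
    by rewrite -[X in measurable X]setTI; apply: mq.
  by apply/seteqP; split => z /=; rewrite in_itv.
by rewrite -[X in measurable X]setTI; apply: (mU measurableT (measurableI _ _ mB mq')).
Qed.

Let beta_mart_bounded B C : measurable B -> 0 <= C ->
  L1 P (fun w => \1_[set w | B (U w) /\ q (U w) <= C] w * rad (beta w) w) /\
  Ex P (fun w => \1_[set w | B (U w) /\ q (U w) <= C] w * rad (beta w) w) =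
  Ex P (fun w => \1_[set w | B (U w) /\ q (U w) <= C] w * rad (alpha w) w).
Proof.
move=> mB C0; set A := [set w | _]; have mAB : measurable A by exact: mA.
have [N [mN PN NP]] := ae_good.
have aN : {ae P, forall w, (~` N) w} by exists N; split => // w /= /contrapT.
have mN' := measurableC mN.
have gN w : (~` N) w -> good w by move=> Nw; apply: contrapT => h; apply: Nw; exact: NP.
have bd i w : `|\1_(~` N) w * (\1_A w * rad (bi i w) w)| <= C.
  rewrite [\1_(~` N) w]indicE; case: (boolP (w \in ~` N)) => [/set_mem/gN[_ h]|_]; last by rewrite mul0r normr0.
  rewrite mul1r indicE; case: (boolP (w \in A)) => [/set_mem[_ qC]|_]; last by rewrite mul0r normr0.
  rewrite mul1r ger0_norm ?enorm_ge0//; have [_ h0 _] := h i.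
  have /strip_le/andP[_] : strip (pi i) (bi i w) w <= 0 by rewrite h0.
  by move=> /le_trans; apply.
have mf i : measurable_fun setT (fun w => \1_A w * rad (bi i w) w) by apply: measurable_funM.
have mg : measurable_fun setT (fun w => \1_A w * rad (beta w) w) by apply: measurable_funM.
have cv w : (fun i => \1_(~` N) w * (\1_A w * rad (bi i w) w)) @ \oo --> \1_(~` N) w * (\1_A w * rad (beta w) w).
  rewrite [\1_(~` N) w]indicE; case: (boolP (w \in ~` N)) => [/set_mem/gN h|_].
    by apply: cvgMr; apply: cvgMr; exact: bi_cvg.
  by under eq_fun do rewrite mul0r; rewrite mul0r; exact: cvg_cst.
have [l D] := @Ex_dct _ _ _ P (fun i w => \1_(~` N) w * (\1_A w * rad (bi i w) w))
  (fun w => \1_(~` N) w * (\1_A w * rad (beta w) w)) (fun=> C)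
  (fun i => measurable_funM (measurable_indic mN') (mf i)) (L1_cst P C) bd cv.
split.
  apply: (L1_ae _ mg _ l); first by apply: measurable_funM => //; exact: measurable_indic.
  by apply: filterS aN => w Nw; rewrite indicE mem_set// mul1r.
rewrite (Ex_full mN' aN mg) in D.
apply: (cvg_unique _ D) => //; apply: cvg_near_cst; apply: nearW => i /=.
by rewrite (Ex_full mN' aN (mf i)) bi_mart.
Qed.

(** The bound on q(U) is lifted by monotone convergence; the limit is integrable because all the
    expectations are at most that of |Z_alpha|. *)
Lemma beta_mart B : measurable B -> L1 P (fun w => \1_B (U w) * rad (beta w) w) /\
  Ex P (fun w => \1_B (U w) * rad (beta w) w) = Ex P (fun w => \1_B (U w) * rad (alpha w) w).
Proof.
move=> mB; pose A (C : nat) := [set w | B (U w) /\ q (U w) <= C%:R].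
have mAC C : measurable (A C) by exact: mA.
have A_near w : \forall C \near \oo, \1_(A C) w = \1_B (U w) :> R.
  apply: filterS (nbhs_infty_ger (q (U w))) => C h.
  rewrite !indicE; congr (_%:R); congr nat_of_bool; apply/idP/idP => /set_mem.
    by move=> [h1 _]; exact: mem_set.
  by move=> h1; apply: mem_set; split.
have AB C w : \1_(A C) w <= \1_B (U w) :> R.
  rewrite !indicE; case: (boolP (w \in A C)) => // /set_mem[h _].
  by rewrite mem_set.
have mono w C D : (C <= D)%N -> \1_(A C) w <= \1_(A D) w :> R.
  move=> CD; rewrite !indicE; case: (boolP (w \in A C)) => // /set_mem[h1 h2].
  by rewrite mem_set//; split => //; apply: le_trans h2 _; rewrite ler_nat.
have lC C := (beta_mart_bounded mB (ler0n R C)).1.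
have eC C := (beta_mart_bounded mB (ler0n R C)).2.
have lB : L1 P (fun w => \1_B (U w) * rad (alpha w) w).
  apply: (L1_le _ lRa).
    by apply: measurable_funM => //; apply: measurableT_comp => //; exact: measurable_indic.
  by move=> w; apply: le_trans (indic_mul_le B (U w) (lexx _)) _; rewrite ger0_norm ?enorm_ge0.
have EC C : Ex P (fun w => \1_(A C) w * rad (beta w) w) <= Ex P (fun w => rad (alpha w) w).
  rewrite eC; apply: le_Ex => //; first exact: (L1_indic (mAC C) lRa).
  by move=> w; apply: le_trans (ler_norm _) _; rewrite normrM (ger0_norm (enorm_ge0 _)) ler_piMl ?enorm_ge0// indic_norm_le1.
have mC w : {homo (fun C => \1_(A C) w * rad (beta w) w) : C D / (C <= D)%N >-> C <= D}.
  by move=> C D CD; apply: ler_wpM2r; [exact: enorm_ge0|exact: mono].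
have [l _ D] := @Ex_mct _ _ _ P (fun C w => \1_(A C) w * rad (beta w) w)
  (fun w => \1_B (U w) * rad (beta w) w) (Ex P (fun w => rad (alpha w) w)) lC
  (fun C w => mulr_ge0 (ler0n _ _) (enorm_ge0 _))
  EC mC
  (fun w => ltac:(by apply: cvg_near_cst; apply: filterS (A_near w) => C ->)).
split => //; have [_ D2] := @Ex_dct _ _ _ P (fun C w => \1_(A C) w * rad (alpha w) w)
  (fun w => \1_B (U w) * rad (alpha w) w) _ (fun C => L1_meas (L1_indic (mAC C) lRa)) lRa
  (fun C w => ltac:(rewrite -[leRHS]ger0_norm ?enorm_ge0//; exact: indic_mul_le))
  (fun w => ltac:(by apply: cvg_near_cst; apply: filterS (A_near w) => C ->)).
apply: (cvg_unique _ D) => //; apply: cvg_trans D2; apply: near_eq_cvg; apply: nearW => C /=.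
by rewrite -eC.
Qed.

Lemma exit_stage : exists beta, [/\ stop F beta, forall w, alpha w <= beta w,
  {ae P, forall w, [/\ rad (beta w) w = p (U w) \/ rad (beta w) w = q (U w),
     Z (beta w) w = rad (beta w) w *: ang (alpha w) w &
     forall t, alpha w <= t -> t < beta w -> p (U w) < rad t w < q (U w)]},
  forall B, measurable B -> L1 P (fun w => \1_B (U w) * rad (beta w) w) /\
    Ex P (fun w => \1_B (U w) * rad (beta w) w) = Ex P (fun w => \1_B (U w) * rad (alpha w) w) &
  L1 P (fun w => rad (beta w) w ^+ 2) -> L1 P beta /\
    gauss_var * Ex P beta <= gauss_var * Ex P alpha +
      (Ex P (fun w => rad (beta w) w ^+ 2) - Ex P (fun w => rad (alpha w) w ^+ 2))].
Proof.
exists beta; split.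
- exact: exit_stop.
- by move=> w; exact: exit_ge.
- apply: filterS (exit_ae mp pz) => w [h1 h2 h3]; split.
  + have /strip_le/andP[g1 g2] : strip p (beta w) w <= 0 by rewrite h2.
    have [g|g] := strip_ge h1; [left|right]; apply/eqP; rewrite eq_le.
      by rewrite g g1.
    by rewrite g g2.
  + have [Zb|Zb] := eqVneq (Z (beta w) w) 0; first by rewrite Zb enorm0 scale0r.
    rewrite -[LHS]enorm_angle; congr (_ *: _); apply/esym; apply: (sp_ang_eq sp (exit_ge p w)).
    move=> u /andP[au]; rewrite le_eqVlt => /orP[/eqP -> //|ub].
    have /strip_lt/andP[h _] := h3 _ au ub.
    by rewrite -enorm_gt0; exact: le_lt_trans h.
  + by move=> t at_ tb; exact: strip_lt (h3 t at_ tb).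
- by move=> B mB; exact: beta_mart.
- exact: exit_expectation.
Qed.

End inner_barrier.
End exit.

(** * Two-point laws *)

Section laws.
Context {R : realType} {n : nat}.
Implicit Types (p q : 'rV[R]_n -> R) (D : set 'rV[R]_n).

Lemma indic_norm_mul (X : Type) (A : set X) x (y : R) : `|\1_A x * y| <= `|y|.
Proof. by rewrite normrM ler_piMl// indic_norm_le1. Qed.

Lemma law_integral d1 d2 d3 (T1 : measurableType d1) (T2 : measurableType d2) (Y : measurableType d3)
    (P1 : probability T1 R) (P2 : probability T2 R)
    (U1 : T1 -> Y) (U2 : T2 -> Y) (f : Y -> R) :
  measurable_fun setT U1 -> measurable_fun setT U2 ->
  (forall B, measurable B -> P1 (U1 @^-1` B) = P2 (U2 @^-1` B)) ->
  measurable_fun setT f -> (forall z, 0 <= f z) ->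
  (\int[P1]_w (f (U1 w))%:E = \int[P2]_w (f (U2 w))%:E)%E.
Proof.
move=> m1 m2 H mf f0.
have := @weight_ext _ _ _ _ _ _ R P1 P2 U1 U2 (fun=> 1) (fun=> 1) m1 m2
  (@measurable_cst _ _ _ _ _ _) (@measurable_cst _ _ _ _ _ _) (fun=> ler01) (fun=> ler01) _ (EFin \o f).
move=> E; transitivity (\int[P1]_x ((EFin \o f) (U1 x) * 1%:E))%E.
  by apply: eq_integral => x _; rewrite mule1.
rewrite E; first by apply: eq_integral => x _; rewrite mule1.
- move=> A mA; have I d (T : measurableType d) (P : probability T R) (U : T -> Y) :
      measurable_fun setT U -> (\int[P]_x (\1_A (U x) * 1)%:E)%E = P (U @^-1` A).
    move=> mU'; have mUA : measurable (U @^-1` A) by rewrite -[X in measurable X]setTI; exact: mU'.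
    transitivity (\int[P]_x (\1_(U @^-1` A) x)%:E)%E; last by rewrite integral_indic// setIT.
    by apply: eq_integral => x _; rewrite mulr1.
  by rewrite !I// H.
- exact/measurable_EFinP.
- by move=> x; rewrite lee_fin.
Qed.

Lemma eq_law_Ex {d1 d2} {T1 : measurableType d1} {T2 : measurableType d2}
    (P1 : probability T1 R) (P2 : probability T2 R) (U1 : T1 -> 'rV[R]_n) (U2 : T2 -> 'rV[R]_n)
    (h : 'rV[R]_n -> R) :
  measurable_fun setT U1 -> measurable_fun setT U2 ->
  (forall B, measurable B -> P1 (U1 @^-1` B) = P2 (U2 @^-1` B)) ->
  measurable_fun setT h -> (forall z, 0 <= h z) ->
  Ex P1 (fun w => h (U1 w)) = Ex P2 (fun w => h (U2 w)).
Proof. by move=> m1 m2 H mh h0; rewrite /Ex /Rintegral; congr fine; exact: law_integral. Qed.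

(** The weight of q z that makes the mean of the choice equal to |z|, when p z <= |z| <= q z. If p z
    = q z the two points coincide, and 0 is a convention. *)
Definition upper_weight p q z : R := if p z < q z then (enorm z - p z) / (q z - p z) else 0.

(* The law of a mean-preserving choice between p z and q z on the ray of z. *)
Definition two_point p q D z : R :=
  upper_weight p q z * \1_D (q z *: angle z) +
  (1 - upper_weight p q z) * \1_D (p z *: angle z).

Section choice.
Context {d : measure_display} {T : measurableType d} (P : probability T R).
Variables (p q : 'rV[R]_n -> R) (U V : T -> 'rV[R]_n).
Hypotheses (mp : measurable_fun setT p) (mq : measurable_fun setT q).
Hypotheses (p0 : forall z, 0 <= p z) (pz : forall z, p z <= enorm z) (qz : forall z, enorm z <= q z).

Lemma upper_weight01 z : 0 <= upper_weight p q z <= 1.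
Proof.
rewrite /upper_weight; case: ifP => pq; last by rewrite lexx ler01.
rewrite divr_ge0 ?subr_ge0 ?(ltW pq)//= ler_pdivrMr ?subr_gt0// mul1r lerD2r; exact: qz.
Qed.

Lemma two_point01 D z : 0 <= two_point p q D z <= 1.
Proof.
have /andP[h1 h2] := upper_weight01 z; rewrite /two_point !indicE.
by case: (_ \in D); case: (_ \in D); rewrite ?mulr1 ?mulr0 ?addr0 ?add0r; lra.
Qed.

Lemma measurable_lt : measurable [set z | p z < q z].
Proof.
rewrite (_ : [set z | _] = (fun z => q z - p z) @^-1` `]0, +oo[).
  rewrite -[X in measurable X]setTI; apply: (measurable_funB mq mp) => //.
by apply/seteqP; split => z /=; rewrite in_itv/= andbT subr_gt0.
Qed.

Lemma measurable_if_lt (f : 'rV[R]_n -> R) : measurable_fun setT f ->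
  measurable_fun setT (fun z => if p z < q z then f z else 0).
Proof.
move=> mf; apply: measurable_fun_ifT => //.
apply: (@measurable_fun_bool _ _ _ _ true); rewrite setTI.
rewrite (_ : _ @^-1` _ = [set z | p z < q z]); first exact: measurable_lt.
by apply/seteqP; split.
Qed.

Lemma measurable_upper_weight : measurable_fun setT (upper_weight p q).
Proof.
apply: measurable_if_lt; apply: measurable_funM.
  by apply: measurable_funB => //; exact: measurable_enorm.
by apply: measurableT_comp; [exact: measurable_inv_R|exact: measurable_funB].
Qed.

Lemma measurable_point (r : 'rV[R]_n -> R) D : measurable_fun setT r -> measurable D ->
  measurable_fun setT (fun z => \1_D (r z *: angle z) : R).
Proof.
move=> mr mD; apply: (measurableT_comp (measurable_indic mD)).
by apply: measurable_scale => //; exact: measurable_angle.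
Qed.

Lemma measurable_two_point D : measurable D -> measurable_fun setT (two_point p q D).
Proof.
move=> mD; have mw := measurable_upper_weight.
by apply: measurable_funD; apply: measurable_funM; [|exact: measurable_point|
  exact: measurable_funB|exact: measurable_point].
Qed.

Hypotheses (mU : measurable_fun setT U) (mV : measurable_fun setT V).
Hypotheses (lU : L1 P (fun w => enorm (U w))) (lV : L1 P (fun w => enorm (V w))).
Hypothesis choice : {ae P, forall w, (enorm (V w) = p (U w) \/ enorm (V w) = q (U w)) /\
  V w = enorm (V w) *: angle (U w)}.
Hypothesis mart : forall B, measurable B ->
  Ex P (fun w => \1_B (U w) * enorm (V w)) = Ex P (fun w => \1_B (U w) * enorm (U w)).

Let E := [set w | p (U w) < q (U w) /\ enorm (V w) = q (U w)].

Let mrV : measurable_fun setT (fun w => enorm (V w)).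
Proof. by apply: measurableT_comp => //; exact: measurable_enorm. Qed.

Let mqU : measurable_fun setT (fun w => q (U w)). Proof. exact: measurableT_comp. Qed.
Let mpU : measurable_fun setT (fun w => p (U w)). Proof. exact: measurableT_comp. Qed.

Let mE : measurable E.
Proof.
apply: (@measurableI _ _ [set w | p (U w) < q (U w)] [set w | enorm (V w) = q (U w)]).
  by rewrite -[X in measurable X]setTI; apply: (mU measurableT measurable_lt).
rewrite (_ : [set w | _] = (fun w => enorm (V w) - q (U w)) @^-1` [set 0]).
  rewrite -[X in measurable X]setTI.
  exact: (measurable_funB mrV mqU measurableT (measurable_set1 0)).
by apply/seteqP; split => w /= => [->|/eqP]; [rewrite subrr|rewrite subr_eq0 => /eqP].
Qed.

(** Where p < q, the variable |V| - p(U) is q(U) - p(U) on [E] and 0 elsewhere, and by [mart] it has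
    the same conditional mean given U as |U| - p(U). Dividing by q - p gives the conditional
    probability of [E]. The quotient may be unbounded, hence the use of [weight_ext] on nonnegative
    functions. *)
Let upper_expectation (g : 'rV[R]_n -> R) : measurable_fun setT g -> (forall z, 0 <= g z <= 1) ->
  Ex P (fun w => \1_E w * g (U w)) = Ex P (fun w => upper_weight p q (U w) * g (U w)).
Proof.
(* The difference is nonnegative only almost everywhere, while [weight_ext] takes weights that are
   nonnegative everywhere. *)
move=> mg g01; pose r1 w := Num.max 0 (enorm (V w) - p (U w)).
pose r2 w := enorm (U w) - p (U w).
have mr1 : measurable_fun setT r1 by apply: measurable_maxr => //; exact: measurable_funB.
have lpU : L1 P (fun w => p (U w)) by apply: (L1_le mpU lU) => w; rewrite ger0_norm.
have mr2 : measurable_fun setT r2 by apply: measurable_funB => //; exact: L1_meas lU.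
have r1E : {ae P, forall w, r1 w = enorm (V w) - p (U w)}.
  apply: filterS choice => w [h _]; rewrite /r1 max_r// subr_ge0.
  by case: h => ->; [exact: lexx|exact: le_trans (pz _) (qz _)].
have g0 z : 0 <= g z by have /andP[] := g01 z.
pose f z := if p z < q z then g z / (q z - p z) else 0.
have mf : measurable_fun setT f.
  apply: measurable_if_lt; apply: measurable_funM => //.
  by apply: measurableT_comp; [exact: measurable_inv_R|exact: measurable_funB].
have f0 z : (0 <= (EFin \o f) z)%E.
  by rewrite lee_fin /f; case: ifP => // pq; rewrite divr_ge0// subr_ge0 ltW.
have Hr A : measurable A -> (\int[P]_x (\1_A (U x) * r1 x)%:E = \int[P]_x (\1_A (U x) * r2 x)%:E)%E.
  move=> mA; have mAU : measurable_fun setT (fun w => \1_A (U w) : R).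
    by apply: measurableT_comp => //; exact: measurable_indic.
  have lA (h : T -> R) : L1 P h -> L1 P (fun w => \1_A (U w) * h w).
    move=> lh; apply: (L1_le _ (L1_norm lh)); first by apply: measurable_funM => //; exact: L1_meas lh.
    by move=> w; exact: indic_norm_mul.
  transitivity (\int[P]_x (\1_A (U x) * (enorm (V x) - p (U x)))%:E)%E.
    apply: ae_eq_integral => //.
    - by apply/measurable_EFinP; exact: measurable_funM.
    - by apply/measurable_EFinP; apply: measurable_funM => //; exact: measurable_funB.
    - by apply: filterS r1E => w /= ->.
  rewrite !Ex_int; [|exact: lA (L1B lU lpU)|exact: lA (L1B lV lpU)]; congr (_%:E).
  under eq_fun do rewrite mulrBr.
  under [in RHS]eq_fun do rewrite mulrBr.
  by rewrite !ExB ?mart//; exact: lA.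
have := weight_ext mU mU mr1 mr2 (fun w => ltac:(by rewrite /r1 le_max lexx))
  (fun w => ltac:(by rewrite /r2 subr_ge0)) Hr ((measurable_EFinP _ _).2 mf) f0.
move=> K; apply: EFin_inj.
have w01 w := upper_weight01 (U w).
have mgU : measurable_fun setT (fun w => g (U w)) by exact: measurableT_comp.
rewrite -!Ex_int; last 2 first.
- apply: (@L1_bounded _ _ _ _ _ 1).
    by apply: measurable_funM => //; apply: measurableT_comp => //; exact: measurable_upper_weight.
  move=> w; have /andP[h1 h2] := w01 w; have /andP[h3 h4] := g01 (U w).
  by rewrite ger0_norm ?mulr_ge0// -[leRHS]mul1r ler_pM.
- apply: L1_indic => //; apply: (@L1_bounded _ _ _ _ _ 1) => // w.
  by have /andP[h3 h4] := g01 (U w); rewrite ger0_norm.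
rewrite [RHS](_ : _ = \int[P]_x ((EFin \o f) (U x) * (r2 x)%:E))%E; last first.
  apply: eq_integral => w _; rewrite /= -EFinM; congr (_%:E).
  rewrite /upper_weight /f /r2; case: ifP => _; last by rewrite !mul0r.
  by rewrite mulrAC [RHS]mulrAC [g _ * _]mulrC.
rewrite -K; apply: ae_eq_integral => //.
- by apply/measurable_EFinP; apply: measurable_funM => //; exact: measurable_indic.
- apply: emeasurable_funM; last exact/measurable_EFinP.
  by apply/measurable_EFinP; exact: measurableT_comp.
- apply: filterS2 choice r1E => w [Vpq _] r1w _; rewrite /= -EFinM; congr (_%:E).
  rewrite r1w /f indicE; case: ifPn => pq; last first.
    by rewrite memNset ?mul0r// => -[h _]; rewrite h in pq.
  have qp0 : q (U w) - p (U w) != 0 by rewrite gt_eqF// subr_gt0.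
  case: Vpq => h; rewrite h.
    rewrite memNset; last by move=> [_]; rewrite h => h'; move: pq; rewrite h' ltxx.
    by rewrite mul0r subrr mulr0.
  by rewrite (mem_set (conj pq h : E w)) mul1r divfK.
Qed.

(** The law of V is a function of the law of U. Applied to Z at two successive times and to two
    successive barycenters, this carries the equality of laws from one level to the next. *)
Lemma two_pointE D : measurable D -> fine (P (V @^-1` D)) = Ex P (fun w => two_point p q D (U w)).
Proof.
move=> mD; have mVD : measurable (V @^-1` D) by rewrite -[X in measurable X]setTI; exact: mV.
pose gq z : R := \1_D (q z *: angle z); pose gp z : R := \1_D (p z *: angle z).
have mgq : measurable_fun setT gq by exact: measurable_point.
have mgp : measurable_fun setT gp by exact: measurable_point.
have g01 z : (0 <= gq z <= 1) * (0 <= gp z <= 1) by split; exact: indic01.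
have lg (h : T -> R) (g : 'rV[R]_n -> R) : measurable_fun setT h -> (forall w, 0 <= h w <= 1) -> measurable_fun setT g ->
    (forall z, 0 <= g z <= 1) -> L1 P (fun w => h w * g (U w)).
  move=> mh h01 mg gg; apply: (@L1_bounded _ _ _ _ _ 1).
    by apply: measurable_funM => //; exact: measurableT_comp.
  move=> w; have /andP[h1 h2] := h01 w; have /andP[h3 h4] := gg (U w).
  by rewrite ger0_norm ?mulr_ge0// -[leRHS]mul1r ler_pM.
have mi : measurable_fun setT (\1_E : T -> R) by exact: measurable_indic.
have i01 w : 0 <= (\1_E w : R) <= 1 by exact: indic01.
have mw : measurable_fun setT (fun w => upper_weight p q (U w)).
  by apply: measurableT_comp => //; exact: measurable_upper_weight.
have w01 w : 0 <= upper_weight p q (U w) <= 1 by exact: upper_weight01.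
have lgp : L1 P (fun w => gp (U w)).
  apply: (@L1_bounded _ _ _ _ _ 1); first exact: measurableT_comp.
  by move=> w; have [_ /andP[h3 h4]] := g01 (U w); rewrite ger0_norm.
have D1 (h : T -> R) : measurable_fun setT h -> (forall w, 0 <= h w <= 1) ->
    Ex P (fun w => h w * gq (U w) + (1 - h w) * gp (U w)) =
    Ex P (fun w => h w * gq (U w)) + (Ex P (fun w => gp (U w)) - Ex P (fun w => h w * gp (U w))).
  move=> mh h01; have l1 := lg h gq mh h01 mgq (fun z => (g01 z).1).
  have l2 := lg h gp mh h01 mgp (fun z => (g01 z).2).
  rewrite -ExB// -ExD//; last exact: L1B.
  by apply: eq_Ex => w; rewrite mulrBl mul1r.
rewrite (D1 _ mw w01) -(upper_expectation mgq (fun z => (g01 z).1)).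
rewrite -(upper_expectation mgp (fun z => (g01 z).2)) -(D1 _ mi i01) -Ex_indic//.
apply: Ex_ae.
- exact: measurable_indic.
- apply: measurable_funD; apply: measurable_funM => //.
  + exact: measurableT_comp.
  + exact: measurable_funB.
  + exact: measurableT_comp.
- apply: filterS choice => w [Vpq Vr].
  have -> : \1_(V @^-1` D) w = \1_D (V w) :> R by [].
  rewrite Vr [\1_E w]indicE; case: (boolP (w \in E)) => [/set_mem[_ ->]|].
    by rewrite mul1r subrr mul0r addr0.
  rewrite notin_setE => nE; rewrite mul0r add0r subr0 mul1r /gp.
  suff -> : enorm (V w) = p (U w) by [].
  case: Vpq => // h; rewrite h; apply: contrapT => pq; apply: nE; split => //.
  by rewrite lt_neqAle (le_trans (pz _) (qz _)) andbT eq_sym; apply/eqP.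
Qed.

End choice.
End laws.

(** * The polar measure *)

Section kernel_fubini.
Context {d1 d2 : measure_display} {X : measurableType d1} {Y : measurableType d2} {R : realType}.
Variables (lam : probability X R) (k : R.-pker X ~> Y).

Lemma pair_measurable (x : X) : measurable_fun setT (pair x : Y -> X * Y).
Proof. by apply/measurable_fun_pairP; split => /=; [exact: measurable_cst|exact: measurable_id]. Qed.

(** The law of (x, y) with y drawn from [k x]. The argument of type [unit] is there to fit the
    composition of kernels, with [lam] viewed as a kernel from a point. *)
Definition pair_law (u : unit * X) : {measure set (X * Y) -> \bar R} :=
  measure_function_pushforward__canonical__measure_function_Measure (k u.2) (pair_measurable u.2).

Let pair_law_measurable A : measurable A -> measurable_fun setT (pair_law ^~ A).
Proof.
move=> mA; have h : measurable_fun setT (fun x => k x (xsection A x)).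
  have [_ H] : A \in measurable /\ True by rewrite inE.
  by apply: measurable_fun_xsection_finite_kernel; rewrite inE.
rewrite (_ : pair_law ^~ A = (fun x => k x (xsection A x)) \o snd).
  exact: measurableT_comp.
by apply/funext => -[u x] /=; rewrite /pushforward xsectionE.
Qed.

HB.instance Definition _ := isKernel.Build _ _ _ _ R pair_law pair_law_measurable.

Let pair_law_prob u : pair_law u setT = 1%E.
Proof. by rewrite /pair_law/= /pushforward preimage_setT prob_kernel. Qed.

HB.instance Definition _ := Kernel_isProbability.Build _ _ _ _ R pair_law pair_law_prob.

Let base : R.-pker unit ~> X :=
  kprobability (measurable_cst (lam : pprobability X R) : measurable_fun [set: unit] (fun=> lam : pprobability X R)).

(** [Q] agrees on rectangles, hence everywhere, with the composition of [lam] and [pair_law], for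
    which iterated integration is known. *)
Lemma kernel_fubini (Q : {measure set (X * Y) -> \bar R}) : 
  (forall A B, measurable A -> measurable B -> Q (A `*` B) = \int[lam]_(x in A) k x B)%E ->
  forall f : X * Y -> \bar R, measurable_fun setT f -> (forall z, 0 <= f z)%E ->
  (\int[Q]_z f z = \int[lam]_x \int[k x]_y f (x, y))%E.
Proof.
move=> HQ f mf f0; pose M := mkcomp base pair_law tt.
have QM A : measurable A -> Q A = M A.
  apply: (measure_unique [set A `*` B | A in measurable & B in measurable] (fun=> setT)).
  - exact: measurable_prod_measurableType.
  - move=> _ _ [A1 mA1 [B1 mB1 <-]] [A2 mA2 [B2 mB2 <-]].
    by exists (A1 `&` A2); [exact: measurableI|exists (B1 `&` B2); [exact: measurableI|rewrite setXI]].
  - by move=> _; exists setT => //; exists setT => //; rewrite setXTT.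
  - by rewrite bigcup_const.
  - move=> _ [A1 mA1 [B1 mB1 <-]]; rewrite HQ// /M/= /mkcomp /kcomp /=.
    rewrite integral_mkcond; apply: eq_integral => x _; rewrite patchE /pushforward.
    case: ifPn => [/set_mem xA|]; last rewrite notin_setE => xA.
      by congr (k x _); apply/seteqP; split => y //= [].
    by rewrite (_ : _ @^-1` _ = set0) ?measure0//; apply/seteqP; split => y // [].
  - by move=> _; rewrite -setXTT HQ//; under eq_integral do rewrite prob_kernel; rewrite integral_cst// mul1e -ge0_fin_numE// fin_num_measure.
have -> : (\int[Q]_z f z = \int[M]_z f z)%E by apply: eq_measure_integral => A mA _; exact: QM.
rewrite /M /mkcomp integral_kcomp//=; apply: eq_integral => x _.
rewrite ge0_integral_pushforward//=; exact: pair_measurable.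
Qed.

End kernel_fubini.

Section polar.
Context {R : realType} {n : nat} (mu : probability 'rV[R]_n R).
Hypothesis mu0 : (mu [set (0%R : 'rV[R]_n)] < 1)%E.
Notation k := (fine (mu [set (0%R : 'rV[R]_n)])).

Let k0 : 0 <= k. Proof. exact: fine_ge0. Qed.
Let k1 : k < 1. Proof. by rewrite -lte_fin fineK// fin_num_measure//; exact: measurable_set1_rV. Qed.

Let nz : set 'rV[R]_n := [set z | z != 0].
Let m0 : measurable [set (0 : 'rV[R]_n)]. Proof. exact: measurable_set1_rV. Qed.
Let nzE : nz = ~` [set 0].
Proof. by apply/seteqP; split => z /=; [move/eqP|move=> h; apply/eqP]. Qed.
Let mnz : measurable nz. Proof. by rewrite nzE; exact: measurableC. Qed.

Let fp (z : 'rV[R]_n) : 'rV[R]_n * R := (angle z, enorm z).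
Let f0 (z : 'rV[R]_n) : 'rV[R]_n * R := (angle z, 0).
Let mfp : measurable_fun setT fp.
Proof. by apply/measurable_fun_pairP; split; [exact: measurable_angle|exact: measurable_enorm]. Qed.
Let mf0 : measurable_fun setT f0.
Proof. by apply/measurable_fun_pairP; split; [exact: measurable_angle|exact: measurable_cst]. Qed.

Let c : {nonneg R} := NngNum (divr_ge0 k0 (ltW (etrans (subr_gt0 _ _) k1))).

(** The polar measure written as a sum of images of the restriction of mu off the origin, which
    makes it a measure by construction. *)
Let M : {measure set ('rV[R]_n * R) -> \bar R} :=
  measure_add
    (measure_function_pushforward__canonical__measure_function_Measure (mrestr mu mnz) mfp)
    (mscale c (measure_function_pushforward__canonical__measure_function_Measure (mrestr mu mnz) mf0)).

Let ME B : M B = polar_measure mu B.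
Proof.
have -> : M B = (mrestr mu mnz (fp @^-1` B) + (c%:num)%:E * mrestr mu mnz (f0 @^-1` B))%E.
  exact: measure_addE.
rewrite /mrestr /polar_measure.
by congr (_ + _ * _)%E; congr (mu _); apply/seteqP; split => z [].
Qed.

Let M1 : M setT = 1%E.
Proof.
rewrite ME /polar_measure.
have -> : [set z : 'rV[R]_n | z != 0 /\ [set: 'rV[R]_n * R] (angle z, enorm z)] = nz by apply/seteqP; split => z // [].
have -> : mu nz = (1 - k)%:E by rewrite nzE probability_setC// -[mu [set _]]fineK ?fin_num_measure.
rewrite -EFinM -EFinD; congr (_%:E); field.
by rewrite subr_eq0 gt_eqF.
Qed.

Lemma polar_probability : exists Q : probability ('rV[R]_n * R)%type R, forall B, Q B = polar_measure mu B.
Proof.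
pose Q : probability ('rV[R]_n * R)%type R := HB.pack (Measure.sort M) (Measure_isProbability.Build _ _ _ M M1).
exists Q => B; exact: ME.
Qed.

Lemma angular_probability : exists lam : probability 'rV[R]_n R, (lam : set _ -> \bar R) = angular_marginal mu.
Proof.
have [Q QE] := polar_probability.
have mfst : measurable_fun setT (fst : 'rV[R]_n * R -> 'rV[R]_n) by exact: measurable_fst.
pose L : {measure set 'rV[R]_n -> \bar R} := measure_function_pushforward__canonical__measure_function_Measure Q mfst.
have L1 : L setT = 1%E by rewrite /L/= /pushforward preimage_setT probability_setT.
pose lam : probability 'rV[R]_n R := HB.pack (Measure.sort L) (Measure_isProbability.Build _ _ _ L L1).
exists lam; apply/funext => A; rewrite /lam/= /pushforward QE /angular_marginal; congr (polar_measure mu _).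
by apply/seteqP; split => -[x y]; [split|case].
Qed.

End polar.

(** * The tree of barycenters *)

(* The cells of the refined partitions are indexed by binary words; the last
   refinement is the head of the word, and [true] stands for the upper half. *)
Section tree_def.
Context {R : realType}.
Implicit Types (nu : set R -> \bar R) (u : seq bool).

Fixpoint cell nu u : \bar R * \bar R :=
  if u is b :: u' then
    let c := cell nu u' in let m := barycenter nu c.1 c.2 in
    if b then (m, c.2) else (c.1, m)
  else (0%E, +oo%E).

Definition bar nu u : \bar R := barycenter nu (cell nu u).1 (cell nu u).2.

Definition cell_set nu u : set R := [set r | ((cell nu u).1 <= r%:E < (cell nu u).2)%E].

Fixpoint word nu (r : R) (l : nat) : seq bool :=
  if l is l'.+1 then let u := word nu r l' in (bar nu u <= r%:E)%E :: u else [::].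

Fixpoint consec (a : \bar R) (s : seq (\bar R)) : seq (\bar R * \bar R) :=
  if s is b :: s' then (a, b) :: consec b s' else [::].

Lemma pairmap_consec (f : \bar R -> \bar R -> \bar R) a s :
  pairmap f a s = [seq f c.1 c.2 | c <- consec a s].
Proof. by elim: s a => //= b s IH a; rewrite IH. Qed.

Lemma refine_consec nu a s c : c \in consec a (refine_from nu a s) <->
  exists2 c0, c0 \in consec a s & exists b : bool, c = if b then (barycenter nu c0.1 c0.2, c0.2) else (c0.1, barycenter nu c0.1 c0.2).
Proof.
elim: s a c => [|b s IH] a c /=; first by split => // -[].
rewrite !inE; split.
  move=> /orP[/eqP ->|/orP[/eqP ->|/IH[c0 c0s [b' ->]]]].
  - by exists (a, b); [rewrite inE eqxx|exists false].
  - by exists (a, b); [rewrite inE eqxx|exists true].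
  - by exists c0; [rewrite inE c0s orbT|exists b'].
move=> [c0]; rewrite inE => /orP[/eqP ->|c0s] [b' ->].
  by case: b'; rewrite eqxx ?orbT.
by apply/orP; right; apply/orP; right; apply/(IH b); exists c0 => //; exists b'.
Qed.

Lemma mem_cells nu l c : c \in consec 0%E (bary_tail nu l) <-> exists2 u, size u = l & c = cell nu u.
Proof.
elim: l c => [|l IH] c.
  rewrite /bary_tail/= inE; split; first by move=> /eqP ->; exists [::].
  by move=> [[]//= _ ->].
rewrite /bary_tail iterS refine_consec; split.
  by move=> [c0 /IH[u ul ->] [b ->]]; exists (b :: u); [rewrite /= ul|case: b].
move=> [[//|b u] /= [ul] ->]; exists (cell nu u); first by apply/IH; exists u.
by exists b; case: b.
Qed.

(** The lists may repeat points and hide the tree; the words of length l name the same points by the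
    cell of which each is the barycenter. *)
Lemma mem_inserted nu l x : x \in inserted nu l <-> exists2 u, size u = l & x = bar nu u.
Proof.
rewrite /inserted pairmap_consec; split.
  by move=> /mapP[c /mem_cells[u ul ->] ->]; exists u.
by move=> [u ul ->]; apply/mapP; exists (cell nu u) => //; apply/mem_cells; exists u.
Qed.

Lemma size_word nu r l : size (word nu r l) = l.
Proof. by elim: l => //= l ->. Qed.

End tree_def.

Section tree.
Context {R : realType}.
Variable nu : {measure set R -> \bar R}.
Hypothesis nuT : nu setT = 1%E.
Hypothesis nu_mean : (mean nu < +oo)%E.
Implicit Types (u : seq bool) (A : set R).
Local Open Scope ereal_scope.

Lemma measurable_cell (a b : \bar R) : measurable [set r : R | a <= r%:E < b].
Proof.
have mE : measurable_fun setT (@EFin R) by apply: (measurable_EFinP _ _).2; exact: measurable_id.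
rewrite (_ : [set r | _] = EFin @^-1` [set x | a <= x] `&` EFin @^-1` [set x | x < b]).
  apply: measurableI; rewrite -[X in measurable X]setTI.
    rewrite (_ : [set x | _] = `[a, +oo]%classic); last by apply/seteqP; split => x /=; rewrite in_itv/= leey andbT.
    by apply: mE => //; exact: emeasurable_itv.
  rewrite (_ : [set x | _] = `[-oo, b[%classic); last by apply/seteqP; split => x /=; rewrite in_itv/= leNye.
  by apply: mE => //; exact: emeasurable_itv.
by apply/seteqP; split => r /= /andP.
Qed.

Lemma mass_fin A : measurable A -> nu A \is a fin_num.
Proof.
move=> mA; rewrite ge0_fin_numE//; apply: (@le_lt_trans _ _ 1); last by rewrite ltry.
by rewrite -nuT; apply: le_measure; rewrite ?inE.
Qed.

Definition mass u : R := fine (nu (cell_set nu u)).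
Definition moment u : R := fine (\int[nu]_(r in cell_set nu u) r%:E).

Lemma mass_ge0 u : (0 <= mass u)%R. Proof. exact: fine_ge0. Qed.

Section finite_cell.
Variable u : seq bool.
Hypothesis lo0 : 0 <= (cell nu u).1.

Let mC : measurable (cell_set nu u). Proof. exact: measurable_cell. Qed.

Let pos r : cell_set nu u r -> (0 <= r)%R.
Proof. by move=> /= /andP[h _]; rewrite -lee_fin; exact: le_trans h. Qed.

Lemma massE : nu (cell_set nu u) = (mass u)%:E.
Proof. by rewrite fineK// mass_fin. Qed.

Lemma momentE : \int[nu]_(r in cell_set nu u) r%:E = (moment u)%:E.
Proof.
rewrite fineK// ge0_fin_numE; last by apply: integral_ge0 => r /pos; rewrite lee_fin.
apply: le_lt_trans nu_mean; apply: ge0_subset_integral => //.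
- by move=> r /=; rewrite in_itv/= andbT.
- by move=> r /pos h; rewrite /= in_itv/= h.
Qed.

Lemma moment_ge (a : R) : (forall r, cell_set nu u r -> a <= r)%R -> (0 <= a)%R -> (a * mass u <= moment u)%R.
Proof.
move=> ar a0; rewrite -lee_fin EFinM -massE -momentE -integral_cst//.
by apply: ge0_le_integral.
Qed.

Lemma moment_le (b : R) : (forall r, cell_set nu u r -> r <= b)%R -> (0 <= b)%R -> (moment u <= b * mass u)%R.
Proof.
move=> rb b0; rewrite -lee_fin EFinM -massE -momentE -integral_cst//.
by apply: ge0_le_integral.
Qed.

Lemma barE : bar nu u = if (0 < mass u)%R then (moment u / mass u)%:E else (cell nu u).1.
Proof.
rewrite /bar /barycenter -/(cell_set nu u) massE momentE lte_fin; case: ifP => // m0.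
by rewrite inver gt_eqF// -EFinM.
Qed.

End finite_cell.

(** The invariants support each other: in an ordered cell with finite lower end, the two moment
    bounds place a finite barycenter between the ends, which makes both halves ordered. Only an
    upper end can be +oo. *)
Lemma cell_ok u : [/\ 0 <= (cell nu u).1, (cell nu u).1 \is a fin_num,
  (cell nu u).1 <= bar nu u, bar nu u <= (cell nu u).2 & bar nu u \is a fin_num].
Proof.
suff H v : [/\ 0 <= (cell nu v).1, (cell nu v).1 \is a fin_num & (cell nu v).1 <= (cell nu v).2] ->
   [/\ (cell nu v).1 <= bar nu v, bar nu v <= (cell nu v).2 & bar nu v \is a fin_num].
  suff K : [/\ 0 <= (cell nu u).1, (cell nu u).1 \is a fin_num & (cell nu u).1 <= (cell nu u).2].
    by have [h1 h2 h3] := H u K; have [k1 k2 k3] := K.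
  elim: u => [|b u IH] /=; first by rewrite lexx leey.
  have [k1 k2 k3] := IH; have [h1 h2 h3] := H u IH.
  rewrite -/(bar nu u); case: b => /=; split => //; exact: le_trans h1.
move=> [k1 k2 k3]; rewrite barE//; case: ifPn => [m0|_]; last by split.
split => //.
  rewrite -[X in X <= _]fineK// lee_fin ler_pdivlMr//; apply: moment_ge => //; last exact: fine_ge0.
  by move=> r /andP[h _]; rewrite -lee_fin fineK.
case E : (cell nu v).2 => [h| |]; last 2 first.
- by rewrite leey.
- by move: k3; rewrite E leeNy_eq => /eqP h; rewrite h in k2.
rewrite lee_fin ler_pdivrMr//; apply: moment_le => //.
- by move=> r; rewrite /cell_set/= E => /andP[_ /ltW]; rewrite lee_fin.
- by move: k3; rewrite E => k3; rewrite -lee_fin; exact: le_trans k3.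
Qed.

Let lo0 u : 0 <= (cell nu u).1. Proof. by have [] := cell_ok u. Qed.

Definition rbar u : R := fine (bar nu u).

Lemma rbarE u : bar nu u = (rbar u)%:E.
Proof. by rewrite fineK//; have [] := cell_ok u. Qed.

Lemma rbar_ge0 u : (0 <= rbar u)%R.
Proof. by have [h1 _ h2 _ _] := cell_ok u; rewrite -lee_fin -rbarE; exact: le_trans h2. Qed.

(** On a null cell both sides are 0, so the identity holds without a case distinction on the
    mass. *)
Lemma rbar_mass u : (rbar u * mass u = moment u)%R.
Proof.
have mE : measurable_fun (cell_set nu u) (@EFin R).
  by apply: measurable_funTS; apply: (measurable_EFinP _ _).2; exact: measurable_id.
have m0 := mass_ge0 u; rewrite /rbar barE//; case: ifPn => [h|]; first by rewrite /= divfK// gt_eqF.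
rewrite -leNgt => h; have mu0 : mass u = 0%R by apply/eqP; rewrite eq_le h m0.
rewrite mu0 mulr0; apply/esym; rewrite /moment.
have nu0 : nu (cell_set nu u) = 0 by rewrite massE// mu0.
by rewrite (null_set_integral (measurable_cell _ _) mE nu0).
Qed.

Lemma bar_false u : bar nu (false :: u) <= bar nu u.
Proof. by have [_ _ _ h _] := cell_ok (false :: u). Qed.

Lemma bar_true u : bar nu u <= bar nu (true :: u).
Proof. by have [_ _ h _ _] := cell_ok (true :: u). Qed.

Lemma cell_order u v : size u = size v -> u != v ->
  (cell nu u).2 <= (cell nu v).1 \/ (cell nu v).2 <= (cell nu u).1.
Proof.
elim: u v => [|b u IH] [|c v] //= [suv] buv.
have [h1 h2 h3 h4 h5] := cell_ok u; have [g1 g2 g3 g4 g5] := cell_ok v.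
have [uv|uv] := eqVneq u v.
  rewrite uv in buv *; case: b c buv => [] [] //=; rewrite ?eqxx//; by [right|left].
case: (IH v suv uv) => h.
  left; apply: (@le_trans _ _ (cell nu u).2); first by case: b {buv}.
  by apply: le_trans h _; case: c {buv}.
right; apply: (@le_trans _ _ (cell nu v).2); first by case: c {buv}.
by apply: le_trans h _; case: b {buv}.
Qed.

Lemma cell_sub b u : cell_set nu (b :: u) `<=` cell_set nu u.
Proof.
have [h1 h2 h3 h4 h5] := cell_ok u; rewrite /cell_set; case: b => r /= /andP[r1 r2]; apply/andP; split => //.
  exact: le_trans r1.
exact: lt_le_trans h4.
Qed.

Lemma cell_split u : cell_set nu u = cell_set nu (false :: u) `|` cell_set nu (true :: u).
Proof.
apply/seteqP; split => [r /= /andP[r1 r2]|r []]; last 2 first.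
- exact: cell_sub.
- exact: cell_sub.
by have [h|h] := leP (bar nu u) r%:E; [right|left]; rewrite /cell_set/= -/(bar nu u) ?h ?r1 ?r2.
Qed.

Lemma cell_disj u : cell_set nu (false :: u) `&` cell_set nu (true :: u) = set0.
Proof.
apply/seteqP; split => // r [/= /andP[_ h1] /andP[h2 _]].
by move: (lt_le_trans h1 h2); rewrite ltxx.
Qed.

Lemma word_cell (r : R) l : (0 <= r)%R -> cell_set nu (word nu r l) r.
Proof.
move=> r0; elim: l => [|l IH] /=; first by rewrite /cell_set/= lee_fin r0 ltry.
move: IH; rewrite /cell_set/= => /andP[h1 h2]; rewrite -/(bar nu _).
by have [h|h] := leP (bar nu (word nu r l)) r%:E; rewrite /= ?h ?h1 ?h2.
Qed.

Lemma cell_word u (r : R) : cell_set nu u r -> word nu r (size u) = u.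
Proof.
elim: u => //= b u IH bur; rewrite (IH (cell_sub bur)); congr (_ :: _).
move: bur; rewrite /cell_set/=; case: b => /andP[h1 h2]; first by rewrite h1.
by apply/negbTE; rewrite -ltNge.
Qed.

Lemma mass_split u : mass u = (mass (false :: u) + mass (true :: u))%R.
Proof.
apply: EFin_inj; rewrite EFinD -!massE cell_split; apply: measureU; [exact: measurable_cell..|exact: cell_disj].
Qed.

Lemma moment_split u : moment u = (moment (false :: u) + moment (true :: u))%R.
Proof.
apply: EFin_inj; rewrite EFinD -!momentE// cell_split; apply: ge0_integral_setU; [exact: measurable_cell..| | |].
- by apply/measurable_EFinP.
- move=> r [] /= /andP[h _]; apply: le_trans h; exact: (lo0 (_ :: u)).
- by apply/disj_setPS => r h; rewrite -(cell_disj u).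
Qed.

(** Mass and moment are additive over the two halves, so that a half whose barycenter is that of the
    whole leaves the same barycenter, or no mass, to the other half. *)
Lemma half_null b u : rbar (b :: u) = rbar u -> mass (~~ b :: u) = 0%R \/ rbar (~~ b :: u) = rbar u.
Proof.
move=> e; have := rbar_mass u; rewrite moment_split mass_split -!rbar_mass => H.
have [m0|m0] := eqVneq (mass (~~ b :: u)) 0%R; [by left|right].
by apply: (mulIf m0); case: b e m0 H => /= e m0; rewrite e; lra.
Qed.

(** Cells of one level are ordered, so any other cell lies entirely beyond an end of the cell of
    [u], and so do the barycenters of its halves; within the cell the two halves give the extreme
    points of the gap. *)
Lemma next_level_gap u v : size v = (size u).+1 ->
  [\/ rbar v <= rbar (false :: u) | rbar (true :: u) <= rbar v]%R.
Proof.
case: v => // c v /= [sv].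
have le_rbar x y : bar nu x <= bar nu y -> (rbar x <= rbar y)%R by rewrite !rbarE lee_fin.
have [<-|uv] := eqVneq v u; first by case: c; [right|left].
have [h1 h2 h3 h4 h5] := cell_ok (c :: v).
have [f1 f2 f3 f4 f5] := cell_ok (false :: u); have [t1 t2 t3 t4 t5] := cell_ok (true :: u).
have [k1 k2 k3 k4 k5] := cell_ok v.
case: (cell_order sv uv) => h.
  left; apply: le_rbar; apply: le_trans h4 _; apply: le_trans f3.
  by apply: le_trans h => /=; case: c {h1 h2 h3 h5}.
right; apply: le_rbar; apply: le_trans h3; apply: le_trans t4 _.
by apply: le_trans h _ => /=; case: c {h1 h2 h4 h5}.
Qed.

End tree.

Section barycenter_measurability.
Context {R : realType} {d : measure_display} {X : measurableType d} (k : R.-pker X ~> R).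
Local Open Scope ereal_scope.

Lemma measurable_between (a b : X -> \bar R) : measurable_fun setT a -> measurable_fun setT b ->
  measurable [set z : X * R | a z.1 <= z.2%:E < b z.1].
Proof.
move=> ma mb.
have m2 : measurable_fun setT (fun z : X * R => z.2%:E) by apply/measurable_EFinP; exact: measurable_snd.
have m1 (f : X -> \bar R) : measurable_fun setT f -> measurable_fun setT (fun z : X * R => f z.1).
  by move=> mf; apply: measurableT_comp => //; exact: measurable_fst.
rewrite (_ : [set z | _] = [set z | a z.1 <= z.2%:E] `&` [set z | z.2%:E < b z.1]); last first.
  by apply/seteqP; split => z /=; [move/andP|move=> [h1 h2]; apply/andP].
apply: measurableI.
  have := measurable_lee measurableT (m1 _ ma) m2; by rewrite setTI.
by have := measurable_lte measurableT m2 (m1 _ mb); rewrite setTI.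
Qed.

Lemma measurable_barycenter (a b : X -> \bar R) : measurable_fun setT a -> measurable_fun setT b ->
  (forall x, 0 <= a x) -> measurable_fun setT (fun x => barycenter (k x) (a x) (b x)).
Proof.
move=> ma mb a0.
pose S : set (X * R) := [set z | a z.1 <= z.2%:E < b z.1].
have mS : measurable S by exact: measurable_between.
have mI : measurable_fun setT (fun z : X * R => (\1_S z : R)%:E) by apply/measurable_EFinP; exact: measurable_indic.
have Sx x : [set r : R | a x <= r%:E < b x] = xsection S x by rewrite xsectionE.
have mSx x : measurable [set r : R | a x <= r%:E < b x] by rewrite Sx; exact: measurable_xsection.
have pos x r : a x <= r%:E < b x -> (0 <= r)%R.
  by move=> /andP[h _]; rewrite -lee_fin; exact: le_trans h.
have mN : measurable_fun setT (fun x => k x [set r | a x <= r%:E < b x]).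
  have := measurable_fun_integral_finite_kernel (fun z : X * R => (\1_S z : R)%:E) k _ mI.
  rewrite (_ : (fun x => \int[k x]_y _) = (fun x => k x [set r | a x <= r%:E < b x])).
    by apply => z; rewrite lee_fin.
  apply/funext => x; rewrite Sx; transitivity (\int[k x]_(r in setT) (\1_(xsection S x) r : R)%:E).
    by apply: eq_integral => r _; rewrite !indicE mem_xsection.
  by rewrite integral_indic ?setIT// -Sx.
have mM : measurable_fun setT (fun x => \int[k x]_(r in [set r | a x <= r%:E < b x]) r%:E).
  (* The factor max(0, r) agrees with r on [S], where the radius is nonnegative, and makes the
     integrand nonnegative everywhere, as measurability of kernel integrals requires here. *)
  have mf : measurable_fun setT (fun z : X * R => ((\1_S z : R) * Num.max 0 z.2)%:E).
    apply/measurable_EFinP; apply: measurable_funM; first exact: measurable_indic.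
    by apply: measurable_maxr => //; exact: measurable_snd.
  have := measurable_fun_integral_finite_kernel (fun z : X * R => ((\1_S z : R) * Num.max 0 z.2)%:E) k _ mf.
  rewrite (_ : (fun x => \int[k x]_y _) = (fun x => \int[k x]_(r in [set r | a x <= r%:E < b x]) r%:E)).
    by apply => z; rewrite lee_fin mulr_ge0// le_max lexx.
  apply/funext => x; rewrite [RHS]integral_mkcond; apply: eq_integral => r _.
  rewrite patchE indicE; have [h|h] := pselect (a x <= r%:E < b x).
    by rewrite !mem_set// mul1r max_r//; exact: pos h.
  by rewrite !memNset// mul0r.
have N1 x : k x [set r | a x <= r%:E < b x] <= 1.
  by rewrite -(prob_kernel (s := k) x); apply: le_measure; rewrite ?inE.
have Nf x : k x [set r | a x <= r%:E < b x] \is a fin_num.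
  by rewrite ge0_fin_numE//; apply: le_lt_trans (N1 x) _; rewrite ltry.
have -> : (fun x => barycenter (k x) (a x) (b x)) = (fun x => if 0 < k x (xsection S x) then
   \int[k x]_(r in xsection S x) r%:E * ((fine (k x (xsection S x)))^-1)%:E else a x).
  apply/funext => x; rewrite /barycenter Sx; case: ifP => // N0; congr (_ * _).
  rewrite -[X in X^-1]fineK -?Sx// inver gt_eqF// fine_gt0// Sx N0 -Sx (le_lt_trans (N1 x)) ?ltry//.
have mN' : measurable_fun setT (fun x => k x (xsection S x)).
  by apply: eq_measurable_fun mN => x _; rewrite Sx.
have mM' : measurable_fun setT (fun x => \int[k x]_(r in xsection S x) r%:E).
  by apply: eq_measurable_fun mM => x _; rewrite Sx.
apply: measurable_fun_ifT => //.
  by apply: measurable_fun_lte.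
apply: emeasurable_funM => //; apply/measurable_EFinP; apply: measurableT_comp; first exact: measurable_inv_R.
by apply: measurableT_comp.
Qed.

Lemma barycenter_ge0 (nu : {measure set R -> \bar R}) (a b : \bar R) : 0 <= a -> 0 <= barycenter nu a b.
Proof.
move=> a0; rewrite /barycenter; case: ifP => // N0; apply: mule_ge0.
  by apply: integral_ge0 => r /andP[h _]; exact: le_trans h.
by rewrite inve_ge0.
Qed.

Lemma measurable_tree u : [/\ measurable_fun setT (fun x => (cell (k x) u).1),
  measurable_fun setT (fun x => (cell (k x) u).2) & forall x, 0 <= (cell (k x) u).1].
Proof.
elim: u => [|b u [m1 m2 p]] /=; first by split => //; exact: measurable_cst.
by case: b => /=; split => //; [exact: measurable_barycenter|move=> x; exact: barycenter_ge0|exact: measurable_barycenter].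
Qed.

Lemma measurable_bar u : measurable_fun setT (fun x => bar (k x) u).
Proof. by have [m1 m2 p] := measurable_tree u; exact: measurable_barycenter. Qed.

Lemma measurable_rbar u : measurable_fun setT (fun x => rbar (k x) u).
Proof. by apply: measurableT_comp => //; exact: measurable_bar. Qed.

End barycenter_measurability.

(** * Neighbouring barycenters on a ray *)

Section neighbours.
Context {R : realType} {n : nat} (mug : R.-pker 'rV[R]_n ~> R) (g0 : 'rV[R]_n).
Hypothesis g0S : sphere R n g0.
Hypothesis mug_fin : forall g, sphere R n g -> (mean (mug g) < +oo)%E.

(** The kernel is controlled on the sphere only; sending all other directions to [g0] makes the
    functions of the direction total and keeps them measurable. *)
Definition to_sphere (g : 'rV[R]_n) : 'rV[R]_n := if g \in sphere R n then g else g0.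

Lemma to_sphere_in g : sphere R n (to_sphere g).
Proof. by rewrite /to_sphere; case: ifPn => // /set_mem. Qed.

Lemma to_sphere_id g : sphere R n g -> to_sphere g = g.
Proof. by move=> gS; rewrite /to_sphere mem_set. Qed.

Lemma measurable_to_sphere : measurable_fun setT to_sphere.
Proof.
apply: measurable_fun_ifT => //; apply: (@measurable_fun_bool _ _ _ _ true); rewrite setTI.
rewrite (_ : _ @^-1` _ = sphere R n); first exact: measurable_sphere.
by apply/seteqP; split => g /=; [move=> /set_mem|move=> /mem_set].
Qed.

Definition ray_bar u g : R := rbar (mug (to_sphere g)) u.

Lemma measurable_ray_bar u : measurable_fun setT (ray_bar u).
Proof. by apply: (measurableT_comp (measurable_rbar mug u)); exact: measurable_to_sphere. Qed.

Let mT g : mug g setT = 1%E. Proof. exact: prob_kernel. Qed.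
Let mF g : (mean (mug (to_sphere g)) < +oo)%E. Proof. by apply: mug_fin; exact: to_sphere_in. Qed.

Lemma ray_bar_ge0 u g : 0 <= ray_bar u g. Proof. exact: rbar_ge0. Qed.

(** The greatest barycenter of words of length k, on the ray of z, that is at most |z|, or 0 if
    there is none. *)
Definition lower k z : R := \big[Num.max/0]_(u : k.-tuple bool)
  (if ray_bar u (angle z) <= enorm z then ray_bar u (angle z) else 0).

Definition top k z : R := enorm z + \sum_(u : k.-tuple bool) ray_bar u (angle z).

(** The least such barycenter that is at least |z|; [top], which dominates all the candidates,
    serves as neutral value. At the origin the ray is not determined, and the value 0 makes the
    interval degenerate. *)
Definition upper k z : R := if z == 0 then 0 else \big[Num.min/top k z]_(u : k.-tuple bool)
  (if enorm z <= ray_bar u (angle z) then ray_bar u (angle z) else top k z).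

Lemma top_ge k z : enorm z <= top k z.
Proof. by rewrite lerDl sumr_ge0// => u _; exact: ray_bar_ge0. Qed.

Lemma lower_ge0 k z : 0 <= lower k z.
Proof. exact: bigmax_ge_id. Qed.

Lemma lower_le k z : lower k z <= enorm z.
Proof. by apply: bigmax_le => [|u _]; [exact: enorm_ge0|case: ifP => // _; exact: enorm_ge0]. Qed.

Lemma upper_ge k z : enorm z <= upper k z.
Proof.
rewrite /upper; case: eqP => [->|_]; first by rewrite enorm0.
by apply: le_bigmin => [|u _]; [exact: top_ge|case: ifP => // _; exact: top_ge].
Qed.

Lemma upper0 k : upper k 0 = 0. Proof. by rewrite /upper eqxx. Qed.

Lemma lower_eq k z (v : seq bool) : size v = k -> ray_bar v (angle z) <= enorm z ->
  (forall u, size u = k -> ray_bar u (angle z) <= enorm z -> ray_bar u (angle z) <= ray_bar v (angle z)) ->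
  lower k z = ray_bar v (angle z).
Proof.
move=> vk vz h; apply/eqP; rewrite eq_le; apply/andP; split.
  apply: bigmax_le => [|u _]; first exact: ray_bar_ge0.
  by case: ifP => [uz|_]; [apply: h => //; exact: size_tuple|exact: ray_bar_ge0].
pose v' : k.-tuple bool := tcast vk (in_tuple v).
have v'E : v' = v :> seq bool by rewrite /v' val_tcast.
have := le_bigmax 0 (fun u : k.-tuple bool => if ray_bar u (angle z) <= enorm z then ray_bar u (angle z) else 0) v'.
by rewrite v'E vz.
Qed.

Lemma upper_eq k z (v : seq bool) : z != 0 -> size v = k -> enorm z <= ray_bar v (angle z) ->
  (forall u, size u = k -> enorm z <= ray_bar u (angle z) -> ray_bar v (angle z) <= ray_bar u (angle z)) ->
  upper k z = ray_bar v (angle z).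
Proof.
move=> z0 vk vz h; rewrite /upper (negbTE z0).
pose v' : k.-tuple bool := tcast vk (in_tuple v).
have v'E : v' = v :> seq bool by rewrite /v' val_tcast.
have vt : ray_bar v (angle z) <= top k z.
  rewrite /top (bigD1 v')//= v'E addrCA lerDl addr_ge0 ?enorm_ge0// sumr_ge0// => u _; exact: ray_bar_ge0.
apply/eqP; rewrite eq_le; apply/andP; split; last first.
  by apply: le_bigmin => // u _; case: ifP => // uz; apply: h => //; exact: size_tuple.
have := bigmin_le (top k z) v' (fun u : k.-tuple bool => if enorm z <= ray_bar u (angle z) then ray_bar u (angle z) else top k z).
by rewrite v'E vz.
Qed.

Lemma measurable_bigmax (I : Type) (s : seq I) (f : I -> 'rV[R]_n -> R) (x : 'rV[R]_n -> R) :
  measurable_fun setT x -> (forall i, measurable_fun setT (f i)) ->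
  measurable_fun setT (fun z => \big[Num.max/x z]_(i <- s) f i z) /\
  measurable_fun setT (fun z => \big[Num.min/x z]_(i <- s) f i z).
Proof.
move=> mx mf; elim: s => [|i s [IH1 IH2]].
  by split; under eq_fun do rewrite big_nil.
by split; under eq_fun do rewrite big_cons; [exact: measurable_maxr|exact: measurable_minr].
Qed.

Let mrb u : measurable_fun setT (fun z => ray_bar u (angle z)).
Proof. by apply: (measurableT_comp (measurable_ray_bar u)); exact: measurable_angle. Qed.

Lemma measurable_lower k : measurable_fun setT (lower k).
Proof.
apply: (@measurable_bigmax _ _ _ (fun=> 0) _ _).1 => // u; apply: measurable_fun_ifT => //.
by apply: measurable_fun_ler => //; exact: measurable_enorm.
Qed.

Lemma measurable_upper k : measurable_fun setT (upper k).
Proof.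
have mt : measurable_fun setT (top k).
  by apply: measurable_funD; [exact: measurable_enorm|exact: measurable_sum].
apply: measurable_fun_ifT => //.
  apply: (@measurable_fun_bool _ _ _ _ true); rewrite setTI.
  rewrite (_ : _ @^-1` _ = [set 0]); first exact: measurable_set1_rV.
  by apply/seteqP; split => z /= /eqP.
apply: (@measurable_bigmax _ _ _ (top k) mt _).2 => u; apply: measurable_fun_ifT => //.
by apply: measurable_fun_ler => //; exact: measurable_enorm.
Qed.

Lemma ray_bar_scale u g v : sphere R n g -> ray_bar u g *: g != 0 -> ray_bar v (angle (ray_bar u g *: g)) = ray_bar v g.
Proof.
move=> gS; rewrite scaler_eq0 negb_or => /andP[b0 _]; congr (ray_bar v _).
by apply: angleZ => //; rewrite lt_neqAle eq_sym b0 ray_bar_ge0.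
Qed.

Lemma enorm_ray_bar u g : sphere R n g -> enorm (ray_bar u g *: g) = ray_bar u g.
Proof. by move=> gS; rewrite enormZ_sphere//; exact: ray_bar_ge0. Qed.

Lemma ray_bar_false u g : ray_bar (false :: u) g <= ray_bar u g.
Proof. by rewrite -lee_fin -!rbarE//; exact: bar_false. Qed.

Lemma ray_bar_true u g : ray_bar u g <= ray_bar (true :: u) g.
Proof. by rewrite -lee_fin -!rbarE//; exact: bar_true. Qed.

(** Either the barycenters of the two halves enclose the point strictly and, by [next_level_gap],
    are its neighbours; or one of them coincides with the point, which then already belongs to the
    next level, and the interval shrinks to it. *)
Lemma neighbours u g : sphere R n g -> let z := ray_bar u g *: g in
  let p := lower (size u).+1 z in let q := upper (size u).+1 z in
  (ray_bar (false :: u) g < ray_bar u g < ray_bar (true :: u) g /\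
     p = ray_bar (false :: u) g /\ q = ray_bar (true :: u) g) \/
  ((exists b, ray_bar (b :: u) g = ray_bar u g) /\ p = ray_bar u g /\ q = ray_bar u g).
Proof.
move=> gS z p q; have h1 := ray_bar_false u g; have h2 := ray_bar_true u g.
have zE : enorm z = ray_bar u g by exact: enorm_ray_bar.
have [e1|e1] := eqVneq (ray_bar (false :: u) g) (ray_bar u g);
  [right|have [e2|e2] := eqVneq (ray_bar (true :: u) g) (ray_bar u g); [right|left]].
- split; first by exists false.
  have [z0|z0] := eqVneq z 0.
    have b0 : ray_bar u g = 0 by rewrite -zE z0 enorm0.
    rewrite /p /q z0 upper0 b0; split => //; apply/eqP.
    by rewrite eq_le lower_ge0 andbT -[leRHS](@enorm0 R n) lower_le.
  have E v : ray_bar v (angle z) = ray_bar v g by exact: ray_bar_scale.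
  split.
    by rewrite /p (@lower_eq _ _ (false :: u)) ?E ?e1 ?zE// => v _; rewrite E.
  by rewrite /q (@upper_eq _ _ (false :: u)) ?E ?e1 ?zE// => v _; rewrite E.
- split; first by exists true.
  have [z0|z0] := eqVneq z 0.
    have b0 : ray_bar u g = 0 by rewrite -zE z0 enorm0.
    rewrite /p /q z0 upper0 b0; split => //; apply/eqP.
    by rewrite eq_le lower_ge0 andbT -[leRHS](@enorm0 R n) lower_le.
  have E v : ray_bar v (angle z) = ray_bar v g by exact: ray_bar_scale.
  split.
    by rewrite /p (@lower_eq _ _ (true :: u)) ?E ?e2 ?zE// => v _; rewrite E.
  by rewrite /q (@upper_eq _ _ (true :: u)) ?E ?e2 ?zE// => v _; rewrite E.
- have l1 : ray_bar (false :: u) g < ray_bar u g by rewrite lt_neqAle e1.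
  have l2 : ray_bar u g < ray_bar (true :: u) g by rewrite lt_neqAle eq_sym e2.
  have z0 : z != 0 by rewrite -enorm_gt0 zE; apply: le_lt_trans l1; exact: ray_bar_ge0.
  have E v : ray_bar v (angle z) = ray_bar v g by exact: ray_bar_scale.
  have gap v : size v = (size u).+1 -> ray_bar v g <= ray_bar (false :: u) g \/ ray_bar (true :: u) g <= ray_bar v g.
    by move=> sv; case: (next_level_gap (mT _) (mF g) sv) => h; [left|right].
  split; first by rewrite l1.
  split.
    rewrite /p (@lower_eq _ _ (false :: u)) ?E ?zE// => v sv; rewrite E => vb.
    by case: (gap v sv) => // h; move: (lt_le_trans l2 (le_trans h vb)); rewrite ltxx.
  rewrite /q (@upper_eq _ _ (true :: u)) ?E ?zE// => v sv; rewrite E => vb.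
  by case: (gap v sv) => // h; move: (le_lt_trans (le_trans vb h) l1); rewrite ltxx.
Qed.

Lemma neighbours_gap u v g t : sphere R n g -> size v = (size u).+1 ->
  lower (size u).+1 (ray_bar u g *: g) < t < upper (size u).+1 (ray_bar u g *: g) -> ray_bar v g != t.
Proof.
move=> gS sv /andP[tl tu]; case: (neighbours u gS) => [[_ [pE qE]]|[_ [pE qE]]]; rewrite pE in tl; rewrite qE in tu.
  case: (next_level_gap (mT _) (mF g) sv) => h; apply/eqP => e.
    by have := le_lt_trans h tl; rewrite -/(ray_bar v g) e ltxx.
  by have := lt_le_trans tu h; rewrite -/(ray_bar v g) e ltxx.
by have := lt_trans tl tu; rewrite ltxx.
Qed.

Lemma neighbours_attained u g : sphere R n g ->
  (exists2 v, size v = (size u).+1 & lower (size u).+1 (ray_bar u g *: g) = ray_bar v g) /\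
  (exists2 v, size v = (size u).+1 & upper (size u).+1 (ray_bar u g *: g) = ray_bar v g).
Proof.
move=> gS; case: (neighbours u gS) => [[_ [-> ->]]|[[b e] [-> ->]]].
  by split; [exists (false :: u)|exists (true :: u)].
by split; exists (b :: u).
Qed.

(** In the degenerate case one half repeats the point, and by [half_null] the other half does so too
    unless it is null. *)
Lemma neighbours_choice b u g : sphere R n g ->
  [\/ mass (mug g) (b :: u) = 0, ray_bar (b :: u) g = lower (size u).+1 (ray_bar u g *: g) |
   ray_bar (b :: u) g = upper (size u).+1 (ray_bar u g *: g)].
Proof.
move=> gS; case: (neighbours u gS) => [[_ [-> ->]]|[[c e] [-> ->]]].
  by case: b; [apply: Or33|apply: Or32].
have [bc|bc] := eqVneq b c; first by apply: Or32; rewrite bc.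
have -> : b = ~~ c by case: b c bc {e} => [] [].
have e' : rbar (mug (to_sphere g)) (c :: u) = rbar (mug (to_sphere g)) u by exact: e.
case: (half_null (mT _) (mF g) e'); first by rewrite to_sphere_id//; exact: Or31.
by move=> h; apply: Or32.
Qed.

End neighbours.

(** * The martingale of barycenters *)

Section chain.
Context {R : realType} {n : nat} (mug : R.-pker 'rV[R]_n ~> R) (g0 : 'rV[R]_n).
Hypothesis g0S : sphere R n g0.
Hypothesis mug_fin : forall g, sphere R n g -> (mean (mug g) < +oo)%E.
Hypothesis mug_supp : forall g, sphere R n g -> mug g `[0, +oo[%classic = 1%E.
Variables (lam : probability 'rV[R]_n R) (Q : probability ('rV[R]_n * R)%type R).
Hypothesis lamS : lam (sphere R n) = 1%E.
Hypothesis QE : forall A B, measurable A -> measurable B -> Q (A `*` B) = (\int[lam]_(g in A) mug g B)%E.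

Local Notation to_sphere := (to_sphere g0).
Local Notation ray_bar := (ray_bar mug g0).
Local Notation lower := (lower mug g0).
Local Notation upper := (upper mug g0).

Let mT g : mug g setT = 1%E. Proof. exact: prob_kernel. Qed.
Let mF g : (mean (mug (to_sphere g)) < +oo)%E. Proof. by apply: mug_fin; exact: to_sphere_in. Qed.

Definition polar_domain : set ('rV[R]_n * R) := [set w | sphere R n w.1 /\ 0 <= w.2].

Definition polar_cell u : set ('rV[R]_n * R) := [set w | sphere R n w.1 /\ cell_set (mug w.1) u w.2].

Definition modulus (w : 'rV[R]_n * R) : R := if w \in polar_domain then w.2 else 0.

Definition address k (w : 'rV[R]_n * R) : seq bool := word (mug w.1) w.2 k.

Definition bary_chain k (w : 'rV[R]_n * R) : R :=
  if w \in polar_domain then ray_bar (address k w) w.1 else 0.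

Definition direction (w : 'rV[R]_n * R) : 'rV[R]_n := to_sphere w.1.

Let fst_meas (f : 'rV[R]_n -> R) : measurable_fun setT f -> measurable_fun setT (fun w : 'rV[R]_n * R => f w.1).
Proof. by move=> mf; apply: measurableT_comp => //; exact: measurable_fst. Qed.

Lemma measurable_polar_cell u : measurable (polar_cell u).
Proof.
have [m1 m2 _] := measurable_tree mug u.
rewrite (_ : polar_cell u = (fst @^-1` sphere R n) `&` [set w | ((cell (mug w.1) u).1 <= w.2%:E < (cell (mug w.1) u).2)%E]); last by [].
apply: measurableI; last exact: (measurable_between m1 m2).
rewrite -[X in measurable X]setTI; apply: measurable_fst => //; exact: measurable_sphere.
Qed.

Lemma polar_domainE : polar_domain = polar_cell [::].
Proof.
apply/seteqP; split => w [h1 h2]; split => //; first by rewrite /cell_set/= lee_fin h2 ltry.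
by move: h2; rewrite /cell_set/= lee_fin => /andP[].
Qed.

Lemma measurable_polar_domain : measurable polar_domain.
Proof. by rewrite polar_domainE; exact: measurable_polar_cell. Qed.

Lemma polar_cell_address u w : polar_cell u w -> address (size u) w = u.
Proof. by move=> [h1 h2]; exact: (cell_word (mT _) (mug_fin h1) h2). Qed.

Lemma address_cell k w : polar_domain w -> polar_cell (address k w) w.
Proof. by move=> [h1 h2]; split => //; exact: word_cell. Qed.

Lemma polar_cell_domain u w : polar_cell u w -> polar_domain w.
Proof.
move=> [h1 /andP[h2 _]]; split => //.
by have [lo0 _ _ _ _] := cell_ok (mT w.1) (mug_fin h1) u; rewrite -lee_fin; exact: le_trans h2.
Qed.

(** The cells of level k partition the domain, so that a function of the address is a finite sum
    over words: measurability and integrals are treated cell by cell. *)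
Lemma sum_address k (f : seq bool -> R) w : polar_domain w ->
  \sum_(u : k.-tuple bool) \1_(polar_cell u) w * f u = f (address k w).
Proof.
move=> wd; pose v : k.-tuple bool := tcast (size_word _ _ _) (in_tuple (address k w)).
have vE : v = address k w :> seq bool by rewrite /v val_tcast.
rewrite (bigD1 v)//= vE indicE mem_set ?mul1r; last exact: address_cell.
rewrite big1 ?addr0// => u uv; rewrite indicE memNset ?mul0r// => /polar_cell_address.
by rewrite size_tuple => e; move: uv; rewrite -val_eqE/= vE e eqxx.
Qed.

Lemma sum_address_out k (f : seq bool -> R) w : ~ polar_domain w ->
  \sum_(u : k.-tuple bool) \1_(polar_cell u) w * f u = 0.
Proof.
move=> wd; rewrite big1// => u _; rewrite indicE memNset ?mul0r// => /polar_cell_domain.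
exact: wd.
Qed.

Lemma chain_sum k h w : h (address k w) w.1 * bary_chain k w =
  \sum_(u : k.-tuple bool) \1_(polar_cell u) w * (h u w.1 * ray_bar u w.1).
Proof.
have [wd|wd] := pselect (polar_domain w).
  by rewrite (sum_address _ (fun u => h u w.1 * ray_bar u w.1))// /bary_chain mem_set.
by rewrite (sum_address_out _ (fun u => h u w.1 * ray_bar u w.1))// /bary_chain memNset// mulr0.
Qed.

Lemma modulus_sum k h w : h (address k w) w.1 * modulus w =
  \sum_(u : k.-tuple bool) \1_(polar_cell u) w * (h u w.1 * w.2).
Proof.
have [wd|wd] := pselect (polar_domain w).
  by rewrite (sum_address _ (fun u => h u w.1 * w.2))// /modulus mem_set.
by rewrite (sum_address_out _ (fun u => h u w.1 * w.2))// /modulus memNset// mulr0.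
Qed.

Lemma chain_ge0 k w : 0 <= bary_chain k w.
Proof. by rewrite /bary_chain; case: ifP => // _; exact: ray_bar_ge0. Qed.

Lemma modulus_ge0 w : 0 <= modulus w.
Proof. by rewrite /modulus; case: ifPn => // /set_mem[]. Qed.

Lemma measurable_modulus : measurable_fun setT modulus.
Proof.
apply: measurable_fun_ifT; [|exact: measurable_snd|exact: measurable_cst].
apply: (@measurable_fun_bool _ _ _ _ true); rewrite setTI.
rewrite (_ : _ @^-1` _ = polar_domain); first exact: measurable_polar_domain.
by apply/seteqP; split => w /=; [move/set_mem|move/mem_set].
Qed.

Lemma measurable_address_mul k (h : seq bool -> 'rV[R]_n -> R) (f : 'rV[R]_n * R -> R) : (forall u, measurable_fun setT (h u)) ->
  measurable_fun setT f -> (forall w, ~ polar_domain w -> f w = 0) ->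
  measurable_fun setT (fun w => h (address k w) w.1 * f w).
Proof.
move=> mh mf f0.
rewrite (_ : (fun w => _) = (fun w => \sum_(u : k.-tuple bool) \1_(polar_cell u) w * (h u w.1 * f w))).
  apply: measurable_sum => u; apply: measurable_funM; first by apply: measurable_indic; exact: measurable_polar_cell.
  by apply: measurable_funM => //; exact: fst_meas.
apply/funext => w; have [wd|wd] := pselect (polar_domain w).
  by rewrite (sum_address _ (fun u => h u w.1 * f w)).
by rewrite (sum_address_out _ (fun u => h u w.1 * f w))// f0// mulr0.
Qed.

Lemma measurable_chain k : measurable_fun setT (bary_chain k).
Proof.
rewrite (_ : bary_chain k = (fun w => \sum_(u : k.-tuple bool) \1_(polar_cell u) w * (1 * ray_bar u w.1))).
  apply: measurable_sum => u; apply: measurable_funM; first by apply: measurable_indic; exact: measurable_polar_cell.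
  by apply: measurable_funM => //; apply: fst_meas => //; exact: measurable_ray_bar.
by apply/funext => w; rewrite -(chain_sum k (fun _ _ => 1)) mul1r.
Qed.

Lemma measurable_ray : measurable_fun setT direction.
Proof. by apply: (measurableT_comp (measurable_to_sphere g0)); exact: measurable_fst. Qed.

(** On each ray of the disintegration, the moment of a cell is its barycenter times its mass. *)
Lemma cell_fubini u (h : 'rV[R]_n -> R) : measurable_fun setT h -> (forall g, 0 <= h g) ->
  (\int[Q]_w (\1_(polar_cell u) w * (h w.1 * w.2))%:E =
   \int[Q]_w (\1_(polar_cell u) w * (h w.1 * ray_bar u w.1))%:E)%E.
Proof.
move=> mh h0; have mc := measurable_polar_cell u.
rewrite !(kernel_fubini QE); last 4 first.
- apply/measurable_EFinP; apply: measurable_funM; first exact: measurable_indic.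
  by apply: measurable_funM; apply: fst_meas => //; exact: measurable_ray_bar.
- by move=> w; rewrite lee_fin mulr_ge0// mulr_ge0// ray_bar_ge0.
- apply/measurable_EFinP; apply: measurable_funM; first exact: measurable_indic.
  by apply: measurable_funM; [exact: fst_meas|exact: measurable_snd].
- move=> w; rewrite lee_fin indicE; case: (boolP (w \in _)) => [/set_mem/polar_cell_domain[_ w0]|_].
    by rewrite mul1r mulr_ge0.
  by rewrite mul0r.
apply: eq_integral => x _; have [xS|xS] := pselect (sphere R n x); last first.
  by apply: eq_integral => y _; rewrite !indicE memNset ?mul0r// => -[].
have mcell : measurable (cell_set (mug x) u) by exact: measurable_cell.
have lo0 : (0 <= (cell (mug x) u).1)%E by have [] := cell_ok (mT x) (mug_fin xS) u.
transitivity (\int[mug x]_(y in cell_set (mug x) u) ((h x)%:E * y%:E))%E.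
  rewrite [RHS]integral_mkcond; apply: eq_integral => y _; rewrite patchE indicE.
  have [yc|yc] := pselect (cell_set (mug x) u y); first by rewrite !mem_set// mul1r.
  by rewrite !memNset ?mul0r// => -[].
rewrite (_ : (\int[mug x]_(y in _) _)%E = ((h x)%:E * \int[mug x]_(y in cell_set (mug x) u) y%:E)%E); last first.
  apply: ge0_integralZl; [exact: mcell| | |by rewrite lee_fin].
    by apply: measurable_funTS; apply: (measurable_EFinP _ _).2; exact: measurable_id.
  by move=> y /andP[h1 _]; exact: le_trans h1.
transitivity (\int[mug x]_(y in cell_set (mug x) u) (h x * ray_bar u x)%:E)%E; last first.
  rewrite [LHS]integral_mkcond; apply: eq_integral => y _; rewrite patchE indicE.
  have [yc|yc] := pselect (cell_set (mug x) u y); first by rewrite !mem_set// mul1r.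
  by rewrite !memNset ?mul0r// => -[].
rewrite integral_cst// momentE//; last exact: mug_fin.
rewrite massE// -!EFinM -(rbar_mass (mT x) (mug_fin xS)) /ray_bar to_sphere_id//.
by rewrite mulrA.
Qed.

Lemma polar_domain_full : Q polar_domain = 1%E.
Proof.
rewrite (_ : polar_domain = sphere R n `*` `[0, +oo[%classic); last first.
  by apply/seteqP; split => w [h1 /=]; rewrite ?in_itv/= ?andbT => h2; split; rewrite //= ?in_itv/= ?andbT.
rewrite QE//; last exact: measurable_sphere.
rewrite (eq_integral (fun=> 1%E)); last by move=> g /set_mem gS; rewrite mug_supp.
transitivity (1 * lam (sphere R n))%E; last by rewrite lamS mule1.
by apply: integral_cst; exact: measurable_sphere.
Qed.

Lemma ae_polar_domain : {ae Q, forall w, polar_domain w}.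
Proof.
exists (~` polar_domain); split; [by apply: measurableC; exact: measurable_polar_domain| |by []].
by rewrite probability_setC ?polar_domain_full ?subee//; exact: measurable_polar_domain.
Qed.

(** Discards the first alternative of [neighbours_choice]: almost surely the radius does not fall in
    a null cell of its ray. *)
Lemma null_cells u : {ae Q, forall w, polar_cell u w -> mass (mug w.1) u != 0}.
Proof.
pose N := [set w : 'rV[R]_n * R | polar_cell u w /\ mass (mug w.1) u = 0].
have mm : measurable_fun setT (fun w : 'rV[R]_n * R => mass (mug w.1) u).
  apply: (fst_meas (f := fun g => mass (mug g) u)); apply: measurableT_comp => //.
  have [m1 m2 _] := measurable_tree mug u.
  have := measurable_fun_xsection_finite_kernel mug (A := [set w | ((cell (mug w.1) u).1 <= w.2%:E < (cell (mug w.1) u).2)%E]).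
  rewrite inE => /(_ (measurable_between m1 m2)).
  apply: eq_measurable_fun => x _; congr (mug x _); apply/seteqP; split => y /=.
    by rewrite /xsection/= => /set_mem.
  by move=> yc; rewrite /xsection/=; exact: mem_set.
have mN : measurable N.
  rewrite (_ : N = polar_cell u `&` ((fun w => mass (mug w.1) u) @^-1` [set 0])); last by [].
  apply: measurableI; first exact: measurable_polar_cell.
  by rewrite -[X in measurable X]setTI; apply: mm.
exists N; split => //; last first.
  move=> w /= /not_implyP[wc /negP]; rewrite negbK => /eqP wm; by split.
rewrite -[N]setIT -integral_indic//.
have := kernel_fubini QE (f := fun w => (\1_N w : R)%:E) => ->; last 2 first.
- by apply/measurable_EFinP; exact: measurable_indic.
- by move=> w; rewrite lee_fin.
rewrite integral0_eq// => x _; have [[xS x0]|xm] := pselect (sphere R n x /\ mass (mug x) u = 0).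
  transitivity (\int[mug x]_(y in setT) (\1_(cell_set (mug x) u) y : R)%:E)%E.
    apply: eq_integral => y _; rewrite !indicE; congr (_%:R%:E); congr nat_of_bool.
    by apply/idP/idP => /set_mem h; apply: mem_set; [case: h => -[]|split => //; split].
  by rewrite integral_indic ?setIT ?massE ?x0//; exact: measurable_cell.
rewrite integral0_eq// => y _; rewrite indicE memNset// => -[[h1 h2] h3]; exact: xm.
Qed.

Lemma chainS k w : polar_domain w ->
  address k.+1 w = (bary_chain k w <= w.2) :: address k w.
Proof.
move=> wd; rewrite /address/= /bary_chain mem_set// /ray_bar to_sphere_id; last by case: wd.
by rewrite rbarE ?lee_fin//; apply: mug_fin; case: wd.
Qed.

Lemma enorm_chain k w : enorm (bary_chain k w *: direction w) = bary_chain k w.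
Proof. by rewrite enormZ_sphere//; [exact: chain_ge0|exact: to_sphere_in]. Qed.

(** The counterpart for the barycenters of the exit of Z from an interval of its ray, in the form
    that [two_pointE] expects. *)
Lemma chain_choice k : {ae Q, forall w,
  (bary_chain k.+1 w = lower k.+1 (bary_chain k w *: direction w) \/ bary_chain k.+1 w = upper k.+1 (bary_chain k w *: direction w)) /\
  bary_chain k.+1 w *: direction w = bary_chain k.+1 w *: angle (bary_chain k w *: direction w)}.
Proof.
have : {ae Q, forall w, forall u : k.+1.-tuple bool, polar_cell u w -> mass (mug w.1) u != 0}.
  by apply: filter_forall => u; exact: null_cells.
apply: filterS => w H.
have H1 : bary_chain k.+1 w = lower k.+1 (bary_chain k w *: direction w) \/ bary_chain k.+1 w = upper k.+1 (bary_chain k w *: direction w).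
  have [wd|wd] := pselect (polar_domain w); last first.
    by right; rewrite /bary_chain !memNset// scale0r upper0.
  have wS : sphere R n w.1 by case: wd.
  have E j : bary_chain j w = ray_bar (address j w) w.1 by rewrite /bary_chain mem_set.
  have := neighbours_choice g0S mug_fin (bary_chain k w <= w.2) (address k w) wS.
  rewrite -chainS// /direction to_sphere_id// !E size_word; case; [|by left|by right].
  pose v : k.+1.-tuple bool := tcast (size_word _ _ _) (in_tuple (address k.+1 w)).
  have vE : v = address k.+1 w :> seq bool by rewrite /v val_tcast.
  by move=> h; have := H v; rewrite vE => /(_ (address_cell _ wd)); rewrite h eqxx.
split => //; have [c0|c0] := eqVneq (bary_chain k w) 0.
  have -> : bary_chain k.+1 w = 0; last by rewrite !scale0r.
  move: H1; rewrite c0 scale0r upper0; case => // ->.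
  by apply/eqP; rewrite eq_le lower_ge0 andbT -[leRHS](@enorm0 R n) lower_le.
congr (_ *: _); rewrite angleZ//; [by rewrite lt_neqAle eq_sym c0 chain_ge0|exact: to_sphere_in].
Qed.

Section square_integrable.
Hypothesis rad2 : L1 Q (fun w => modulus w ^+ 2).

Lemma L1_modulus : L1 Q modulus.
Proof. exact: L1_sqr measurable_modulus rad2. Qed.

(** [bary_chain k] is the conditional expectation of the modulus given the direction and the address
    of length k; [h] runs over the nonnegative bounded functions of these two. Each cell is settled
    by [cell_fubini]. *)
Lemma chain_mart k (h : seq bool -> 'rV[R]_n -> R) (C : R) :
  (forall u, measurable_fun setT (h u)) -> (forall u g, 0 <= h u g <= C) ->
  [/\ L1 Q (fun w => h (address k w) w.1 * bary_chain k w),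
      L1 Q (fun w => h (address k w) w.1 * modulus w) &
   Ex Q (fun w => h (address k w) w.1 * bary_chain k w) = Ex Q (fun w => h (address k w) w.1 * modulus w)].
Proof.
move=> mh hC; have h0 u g : 0 <= h u g by have /andP[] := hC u g.
have C0 : 0 <= C by have /andP[a b] := hC [::] g0; exact: le_trans b.
have mc u := measurable_polar_cell u.
have lr u : L1 Q (fun w => \1_(polar_cell u) w * (h u w.1 * w.2)).
  apply: (L1_le _ (L1Z C L1_modulus)).
    apply: measurable_funM; first exact: measurable_indic.
    by apply: measurable_funM; [exact: fst_meas|exact: measurable_snd].
  move=> w; rewrite indicE; case: (boolP (w \in _)) => [/set_mem/polar_cell_domain wd|_]; last first.
    by rewrite mul0r normr0 mulr_ge0// modulus_ge0.
  rewrite mul1r /modulus mem_set//; case: wd => _ w0; rewrite ger0_norm ?mulr_ge0//.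
  by apply: ler_wpM2r => //; have /andP[] := hC u w.1.
have lc u : L1 Q (fun w => \1_(polar_cell u) w * (h u w.1 * ray_bar u w.1)).
  have m1 : measurable_fun setT (fun w : 'rV[R]_n * R => \1_(polar_cell u) w * (h u w.1 * ray_bar u w.1)).
    apply: measurable_funM; first exact: measurable_indic.
    by apply: measurable_funM; apply: fst_meas => //; exact: measurable_ray_bar.
  apply/integrableP; split; first exact/measurable_EFinP.
  rewrite (_ : (\int[Q]_x _)%E = \int[Q]_w (\1_(polar_cell u) w * (h u w.1 * ray_bar u w.1))%:E)%E.
    by rewrite -cell_fubini// Ex_int// ltry.
  by apply: eq_integral => w _ /=; rewrite ger0_norm// mulr_ge0// mulr_ge0// ray_bar_ge0.
split.
- by apply: (eq_L1 (fun w => esym (chain_sum k h w))); exact: L1_sum.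
- by apply: (eq_L1 (fun w => esym (modulus_sum k h w))); exact: L1_sum.
- rewrite (eq_Ex _ (chain_sum k h)) (eq_Ex _ (modulus_sum k h)) !Ex_sum//.
  apply: eq_bigr => u _; apply: EFin_inj; rewrite -!Ex_int//; apply/esym; exact: cell_fubini.
Qed.

Lemma chain_mart_next k (h : seq bool -> 'rV[R]_n -> R) (C : R) :
  (forall u, measurable_fun setT (h u)) -> (forall u g, 0 <= h u g <= C) ->
  L1 Q (fun w => h (address k w) w.1 * bary_chain k.+1 w) /\
  Ex Q (fun w => h (address k w) w.1 * bary_chain k.+1 w) = Ex Q (fun w => h (address k w) w.1 * bary_chain k w).
Proof.
move=> mh hC; have [_ _ E1] := chain_mart k mh hC.
(* A function of the address of length k is one of the address of length k + 1, by forgetting its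
   head, the last refinement. *)
have [l2 _ E2] := chain_mart k.+1 (h := fun u => h (behead u)) (fun u => mh _) (fun u g => hC _ g).
by split; [exact: l2|rewrite E1; exact: E2].
Qed.

Lemma L1_chain k : L1 Q (bary_chain k).
Proof.
have [l _ _] := chain_mart k (h := fun _ _ => 1) (fun=> measurable_cst _) (C := 1) (fun _ _ => ltac:(by rewrite ler01 lexx)).
by apply: eq_L1 l => w; rewrite mul1r.
Qed.

Lemma Ex_chain k : Ex Q (bary_chain k) = Ex Q modulus.
Proof.
have [_ _ E] := chain_mart k (h := fun _ _ => 1) (fun=> measurable_cst _) (C := 1) (fun _ _ => ltac:(by rewrite ler01 lexx)).
by rewrite -(eq_Ex Q (fun w => mul1r (bary_chain k w))) E; apply: eq_Ex => w; rewrite mul1r.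
Qed.

Let trunc (N : nat) u g : R := Num.min N%:R (ray_bar u g).
Let mtrunc N u : measurable_fun setT (trunc N u).
Proof. by apply: measurable_minr => //; exact: measurable_ray_bar. Qed.
Let trunc_bd N u g : 0 <= trunc N u g <= N%:R.
Proof. by rewrite /trunc; apply/andP; split; [rewrite le_min ler0n; exact: ray_bar_ge0|rewrite ge_min lexx]. Qed.
Let cut (N : nat) (x : R) := Num.min N%:R x.
Let cut_cvg (x : R) : 0 <= x -> cut ^~ x @ \oo --> x.
Proof.
move=> x0; apply: cvg_near_cst; near=> N; rewrite /cut min_r//.
by near: N; exact: nbhs_infty_ger.
Unshelve. all: by end_near. Qed.
Let truncE N k w : polar_domain w -> trunc N (address k w) w.1 = cut N (bary_chain k w).
Proof. by move=> wd; rewrite /bary_chain mem_set. Qed.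

(** Jensen's inequality with a truncation, as squares are not yet known to be integrable. With c =
    min(N, X_k), E c^2 <= E c X_k = E c r <= (E c^2 + E r^2) / 2, and E c^2 is finite, so that E c^2
    <= E r^2; then N grows. *)
Lemma L1_chain_sqr k : L1 Q (fun w => bary_chain k w ^+ 2) /\ Ex Q (fun w => bary_chain k w ^+ 2) <= Ex Q (fun w => modulus w ^+ 2).
Proof.
have mcut N : measurable_fun setT (fun w => cut N (bary_chain k w)).
  by apply: measurable_minr => //; exact: measurable_chain.
have cut01 N w : 0 <= cut N (bary_chain k w) <= N%:R by rewrite /cut le_min ler0n chain_ge0 ge_min lexx.
have l2 N : L1 Q (fun w => cut N (bary_chain k w) ^+ 2).
  apply: (@L1_bounded _ _ _ _ _ (N%:R ^+ 2)); first exact: measurable_funX.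
  by move=> w; have /andP[h1 h2] := cut01 N w; rewrite ger0_norm ?exprn_ge0// lerXn2r// nnegrE.
apply: (@Ex_fatou _ _ _ Q (fun N w => cut N (bary_chain k w) ^+ 2)) => //.
- by move=> N w; exact: sqr_ge0.
- move=> N; have [l3 l4 E] := chain_mart k (mtrunc N) (trunc_bd N).
  have h1 : Ex Q (fun w => cut N (bary_chain k w) ^+ 2) <= Ex Q (fun w => trunc N (address k w) w.1 * bary_chain k w).
    apply: le_Ex => // w; have [wd|wd] := pselect (polar_domain w).
      rewrite truncE// expr2; apply: ler_wpM2l; first by have /andP[] := cut01 N w.
      by rewrite /cut ge_min lexx orbT.
    by rewrite /cut /bary_chain memNset// mulr0 min_r// expr0n.
  have h2 : Ex Q (fun w => trunc N (address k w) w.1 * modulus w) <=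
      Ex Q (fun w => 2^-1 * cut N (bary_chain k w) ^+ 2 + 2^-1 * modulus w ^+ 2).
    apply: le_Ex => //; first by apply: L1D; exact: L1Z.
    move=> w; have [wd|wd] := pselect (polar_domain w).
      rewrite truncE//; have := sqr_ge0 (cut N (bary_chain k w) - modulus w); rewrite sqrrB => h.
      rewrite -mulrDr ler_pdivlMl//; lra.
    by rewrite /modulus memNset// mulr0 expr0n mulr0 addr0 mulr_ge0 ?sqr_ge0.
  move: h2; rewrite ExD; [|exact: L1Z..]; rewrite !ExZ//; move: h1; rewrite E; lra.
- move=> w; apply: (@continuous_cvg _ _ _ _ _ _ (fun x : R => x ^+ 2)); first exact: exprn_continuous.
  by apply: cut_cvg; exact: chain_ge0.
Qed.

Lemma L1_chain_mul k : L1 Q (fun w => bary_chain k w * bary_chain k.+1 w).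
Proof.
have [l1 _] := L1_chain_sqr k; have [l2 _] := L1_chain_sqr k.+1.
apply: (L1_le _ (L1D l1 l2)); first by apply: measurable_funM; exact: measurable_chain.
move=> w; have h1 := chain_ge0 k w; have h2 := chain_ge0 k.+1 w.
rewrite ger0_norm ?mulr_ge0//; nra.
Qed.

Lemma chain_orthogonal k : Ex Q (fun w => bary_chain k w * bary_chain k.+1 w) = Ex Q (fun w => bary_chain k w ^+ 2).
Proof.
have lm := L1_chain_mul k; have [l2 _] := L1_chain_sqr k.
have cutle N w : cut N (bary_chain k w) <= bary_chain k w by rewrite /cut ge_min lexx orbT.
have cut0 N w : 0 <= cut N (bary_chain k w) by rewrite /cut le_min ler0n chain_ge0.
have mcut N : measurable_fun setT (fun w => cut N (bary_chain k w)).
  by apply: measurable_minr => //; exact: measurable_chain.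
have [_ D1] := @Ex_dct _ _ _ Q (fun N w => cut N (bary_chain k w) * bary_chain k.+1 w) (fun w => bary_chain k w * bary_chain k.+1 w) _
   (fun N => measurable_funM (mcut N) (measurable_chain k.+1)) lm
   (fun N w => ltac:(rewrite ger0_norm ?mulr_ge0 ?chain_ge0//; apply: ler_wpM2r; [exact: chain_ge0|exact: cutle]))
   (fun w => ltac:(apply: cvgM; [apply: cut_cvg; exact: chain_ge0|exact: cvg_cst])).
have [_ D2] := @Ex_dct _ _ _ Q (fun N w => cut N (bary_chain k w) * bary_chain k w) (fun w => bary_chain k w ^+ 2) _
   (fun N => measurable_funM (mcut N) (measurable_chain k)) l2
   (fun N w => ltac:(rewrite ger0_norm ?mulr_ge0 ?chain_ge0//= expr2; apply: ler_wpM2r; [exact: chain_ge0|exact: cutle]))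
   (fun w => ltac:(rewrite /= expr2; apply: cvgM; [apply: cut_cvg; exact: chain_ge0|exact: cvg_cst])).
have E N : Ex Q (fun w => cut N (bary_chain k w) * bary_chain k.+1 w) = Ex Q (fun w => cut N (bary_chain k w) * bary_chain k w).
  have [_ E] := chain_mart_next k (mtrunc N) (trunc_bd N).
  transitivity (Ex Q (fun w => trunc N (address k w) w.1 * bary_chain k.+1 w)).
    apply: eq_Ex => w; have [wd|wd] := pselect (polar_domain w); first by rewrite truncE.
    by rewrite /bary_chain memNset// !mulr0.
  rewrite E; apply: eq_Ex => w; have [wd|wd] := pselect (polar_domain w); first by rewrite truncE.
  by rewrite /bary_chain memNset// !mulr0.
apply: (@cvg_unique R (@norm_hausdorff R R) (fmap (fun N => Ex Q (fun w => cut N (bary_chain k w) * bary_chain k.+1 w)) \oo)) => //.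
rewrite /= (_ : (fun N => Ex Q (fun w => cut N (bary_chain k w) * bary_chain k.+1 w)) = (fun N => Ex Q (fun w => cut N (bary_chain k w) * bary_chain k w))); last exact/funext.
exact: D2.
Qed.

Lemma chain_step_sqr k : L1 Q (fun w => (bary_chain k.+1 w - bary_chain k w) ^+ 2) /\
  Ex Q (fun w => (bary_chain k.+1 w - bary_chain k w) ^+ 2) = Ex Q (fun w => bary_chain k.+1 w ^+ 2) - Ex Q (fun w => bary_chain k w ^+ 2).
Proof.
have [l1 _] := L1_chain_sqr k; have [l2 _] := L1_chain_sqr k.+1; have lm := L1_chain_mul k.
have e w : (bary_chain k.+1 w ^+ 2 - 2 * (bary_chain k w * bary_chain k.+1 w)) + bary_chain k w ^+ 2 = (bary_chain k.+1 w - bary_chain k w) ^+ 2 by ring.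
have l3 := L1B l2 (L1Z 2 lm).
split; first exact: (eq_L1 e (L1D l3 l1)).
rewrite -(eq_Ex Q e) ExD// ExB//; last exact: L1Z.
rewrite ExZ// chain_orthogonal; ring.
Qed.

(** Both r and X_(k+1) lie on the same side of X_k, and this side is the head of the address of
    length k + 1. With H its indicator, |x - X_k| = (2H - 1)(x - X_k) for x = r and for x = X_(k+1),
    and X_(k+1) is the conditional expectation of r given an address that determines H. *)
Lemma chain_error k : L1 Q (fun w => `|modulus w - bary_chain k w|) /\
  Ex Q (fun w => `|modulus w - bary_chain k w|) = Ex Q (fun w => `|bary_chain k.+1 w - bary_chain k w|).
Proof.
have lr := L1_modulus; have lc := L1_chain k; have lc1 := L1_chain k.+1.
split; first exact: L1_norm (L1B lr lc).
pose h (u : seq bool) (g : 'rV[R]_n) : R := (head false u)%:R.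
have h01 u g : 0 <= h u g <= 1 by rewrite /h; case: (head _ _); rewrite /= ?lexx ler01.
have mh u : measurable_fun setT (h u) by exact: measurable_cst.
have [l1 l2 E] := chain_mart k.+1 mh h01.
pose H w := h (address k.+1 w) w.1.
have lH : L1 Q (fun w => H w * bary_chain k w).
  apply: (L1_le _ lc).
    apply: measurable_address_mul => //; first exact: measurable_chain.
    by move=> w wd; rewrite /bary_chain memNset.
  move=> w; have /andP[g1 g2] := h01 (address k.+1 w) w.1; rewrite ger0_norm ?mulr_ge0 ?chain_ge0//.
  by rewrite ler_piMl// chain_ge0.
have eq1 w : `|modulus w - bary_chain k w| = 2 * (H w * modulus w - H w * bary_chain k w) - (modulus w - bary_chain k w).
  have [wd|wd] := pselect (polar_domain w); last first.
    by rewrite /modulus /bary_chain !memNset// !mulr0 subrr normr0 mulr0 subrr.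
  rewrite /H chainS// /h/= /modulus mem_set//; have [g|g] := leP (bary_chain k w) w.2.
    by rewrite ger0_norm ?subr_ge0// !mul1r; ring.
  by rewrite ltr0_norm ?subr_lt0// !mul0r; ring.
have eq2 w : `|bary_chain k.+1 w - bary_chain k w| = 2 * (H w * bary_chain k.+1 w - H w * bary_chain k w) - (bary_chain k.+1 w - bary_chain k w).
  have [wd|wd] := pselect (polar_domain w); last first.
    by rewrite /bary_chain !memNset// !mulr0 subrr normr0 mulr0 subrr.
  have Ek j : bary_chain j w = ray_bar (address j w) w.1 by rewrite /bary_chain mem_set.
  rewrite /H [bary_chain k.+1 w]Ek chainS// /h/=; have [g|g] := leP (bary_chain k w) w.2.
    rewrite ger0_norm ?subr_ge0; last by rewrite Ek; exact: ray_bar_true.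
    by rewrite !mul1r; ring.
  rewrite ler0_norm ?subr_le0; last by rewrite Ek; exact: ray_bar_false.
  by rewrite !mul0r; ring.
rewrite (eq_Ex Q eq1) (eq_Ex Q eq2) !ExB//; [|exact: L1B..|exact: L1Z (L1B _ _)|exact: L1B|exact: L1Z (L1B _ _)|exact: L1B].
rewrite !ExZ ?ExB//; [|exact: L1B..].
by rewrite E !Ex_chain.
Qed.

Lemma chain_cvg : (fun k => Ex Q (fun w => `|modulus w - bary_chain k w|)) @ \oo --> 0.
Proof.
pose a k := Ex Q (fun w => bary_chain k w ^+ 2).
have step k : Ex Q (fun w => (bary_chain k.+1 w - bary_chain k w) ^+ 2) = a k.+1 - a k by have [] := chain_step_sqr k.
have a_inc : nondecreasing_seq a.
  apply/nondecreasing_seqP => k; rewrite -subr_ge0 -step; apply: Ex_ge0 => w; exact: sqr_ge0.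
have a_ub : has_ubound (range a).
  by exists (Ex Q (fun w => modulus w ^+ 2)) => _ [k _ <-]; have [] := L1_chain_sqr k.
have a_cvg := nondecreasing_is_cvgn a_inc a_ub.
have d_cvg : (fun k => a k.+1 - a k) @ \oo --> 0.
  rewrite -(subrr (limn a)); apply: cvgB => //.
  by rewrite (cvg_shiftS a).
apply/cvgrPdist_le => e e0.
move/cvgrPdist_le : d_cvg => /(_ (e ^+ 2)); rewrite exprn_gt0// => /(_ isT).
apply: filterS => k; rewrite !sub0r !normrN => d.
have [_ ->] := chain_error k; have [ls _] := chain_step_sqr k.
have ld := L1B (L1_chain k.+1) (L1_chain k).
rewrite ger0_norm; last by apply: Ex_ge0 => w.
have d' : Ex Q (fun w => (bary_chain k.+1 w - bary_chain k w) ^+ 2) <= e ^+ 2 by rewrite step; exact: le_trans (ler_norm _) d.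
(* The inequality |y| <= y^2 / (2e) + e/2 takes the place of Cauchy-Schwarz; with E y^2 <= e^2 it
   yields E |y| <= e. *)
have : Ex Q (fun w => `|bary_chain k.+1 w - bary_chain k w|) <= Ex Q (fun w => (2 * e)^-1 * (bary_chain k.+1 w - bary_chain k w) ^+ 2 + e / 2).
  apply: le_Ex; [exact: L1_norm|apply: L1D; [exact: L1Z|exact: L1_cst]|move=> w].
  set y := bary_chain k.+1 w - bary_chain k w.
  have y2 : y ^+ 2 = `|y| ^+ 2 by rewrite real_normK// num_real.
  rewrite y2; have := sqr_ge0 (`|y| - e) => h.
  have -> : (2 * e)^-1 * `|y| ^+ 2 + e / 2 = (2 * e)^-1 * (`|y| ^+ 2 + e ^+ 2) by field; rewrite gt_eqF.
  rewrite ler_pdivlMl ?mulr_gt0//; lra.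
rewrite ExD; [|exact: L1Z|exact: L1_cst]; rewrite ExZ// Ex_cst => /le_trans; apply.
have : (2 * e)^-1 * Ex Q (fun w => (bary_chain k.+1 w - bary_chain k w) ^+ 2) <= (2 * e)^-1 * e ^+ 2.
  by apply: ler_wpM2l => //; rewrite invr_ge0 mulr_ge0// ltW.
have -> : (2 * e)^-1 * e ^+ 2 = e / 2 by field; rewrite gt_eqF.
lra.
Qed.

End square_integrable.

End chain.

(** * Lipschitz bounds for the bumps along a ray *)

Section bump_lipschitz.
Context {R : realType} {n : nat}.

Lemma prod_lip (I : Type) (s : seq I) (f g : I -> R) :
  (forall i, 0 <= f i <= 1) -> (forall i, 0 <= g i <= 1) ->
  `|\prod_(i <- s) f i - \prod_(i <- s) g i| <= \sum_(i <- s) `|f i - g i|.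
Proof.
move=> f01 g01; elim: s => [|i s IH]; first by rewrite !big_nil subrr normr0.
rewrite !big_cons; set x := \prod_(j <- s) f j in IH *; set y := \prod_(j <- s) g j in IH *.
have x01 : 0 <= x <= 1.
  apply/andP; split; first by apply: prodr_ge0 => j _; have /andP[] := f01 j.
  rewrite /x; elim: s {IH x y} => [|j s IH]; first by rewrite big_nil.
  by rewrite big_cons; have /andP[h1 h2] := f01 j; apply: mulr_ile1 => //; apply: prodr_ge0 => l _; have /andP[] := f01 l.
have -> : f i * x - g i * y = (f i - g i) * x + g i * (x - y) by ring.
apply: le_trans (ler_normD _ _) _; rewrite !normrM; apply: lerD.
  by have /andP[h1 h2] := x01; rewrite ler_piMr// ger0_norm.
apply: le_trans IH; have /andP[h1 h2] := g01 i; by rewrite ler_piMl// ger0_norm.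
Qed.

Lemma clamp_lip (k s t a b : R) : 0 <= k ->
  `|Num.min 1 (k * Num.max 0 (Num.min (s - a) (b - s))) - Num.min 1 (k * Num.max 0 (Num.min (t - a) (b - t)))| <= k * `|s - t|.
Proof.
move=> k0; suff H x y : Num.min 1 (k * Num.max 0 (Num.min (x - a) (b - x))) <=
    Num.min 1 (k * Num.max 0 (Num.min (y - a) (b - y))) + k * `|x - y|.
  by rewrite ler_norml; apply/andP; split; [have := H t s; rewrite distrC; lra|have := H s t; lra].
have h1 := ler_norm (x - y); have h2 := ler_norm (y - x); rewrite distrC in h2.
have h3 : Num.max 0 (Num.min (x - a) (b - x)) <= Num.max 0 (Num.min (y - a) (b - y)) + `|x - y|.
  rewrite ge_max addr_ge0 ?le_max ?lexx//=.
  rewrite -lerBlDr le_max le_min; apply/orP; right; apply/andP; split; rewrite lerBlDr ge_min; apply/orP; [left|right]; lra.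
have h4 := ler_wpM2l k0 h3; rewrite mulrDr in h4.
rewrite -lerBlDr le_min; apply/andP; split; rewrite lerBlDr ge_min; apply/orP; [left|right] => //.
by rewrite lerDl mulr_ge0.
Qed.

(** Each of the n factors is Lipschitz with constant k and a coordinate of a unit vector is at most
    1 in absolute value. Convergence of the moduli in L^1 thus passes to the expectations of the
    bumps. *)
Lemma box_bump_lip (a b : 'rV[R]_n) k (r s : R) (g : 'rV[R]_n) : enorm g = 1 ->
  `|box_bump a b k (r *: g) - box_bump a b k (s *: g)| <= n%:R * (k%:R * `|r - s|).
Proof.
move=> g1; rewrite /box_bump.
have c01 (x : R) : 0 <= Num.min 1 (k%:R * Num.max 0 x) <= 1.
  by rewrite le_min ler01 mulr_ge0 ?le_max ?lexx//= ge_min lexx.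
apply: (le_trans (prod_lip _ (fun i => c01 _) (fun i => c01 _))).
apply: (@le_trans _ _ (\sum_(i < n) k%:R * `|r - s|)); last by rewrite sumr_const card_ord [leRHS]mulr_natl.
apply: ler_sum => i _; apply: le_trans (clamp_lip _ _ _ _ (ler0n _ _)) _.
apply: ler_wpM2l => //; rewrite !mxE -mulrBl normrM ler_piMr//.
rewrite -[leRHS]g1 /enorm -sqrtr_sqr ler_sqrt.
  by rewrite (bigD1 i)//= lerDl sumr_ge0// => j _; exact: sqr_ge0.
exact: sum_sqr_ge0.
Qed.

End bump_lipschitz.

Lemma prob_ae_eq {R : realType} {d} {T : measurableType d} (P : probability T R) (A B : set T) :
  measurable A -> measurable B -> {ae P, forall w, A w <-> B w} -> P A = P B.
Proof.
move=> mA mB AB; rewrite -[LHS]fineK ?fin_num_measure// -[RHS]fineK ?fin_num_measure//; congr (_%:E).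
rewrite -!Ex_indic//; apply: Ex_ae => //; apply: filterS AB => w h; rewrite !indicE; congr (_%:R); congr nat_of_bool.
by apply/idP/idP => /set_mem/h/mem_set.
Qed.

(** * The polar measure recovers mu, and the density of kappa *)

Section polar_law.
Context {R : realType} {n : nat} (mu : probability 'rV[R]_n R) (mug : R.-pker 'rV[R]_n ~> R) (g0 : 'rV[R]_n).
Hypothesis mu0 : (mu [set 0%R] < 1)%E.
Hypothesis mugE : disintegration mu mug.
Hypothesis mug_mean : forall g, sphere R n g -> (0 < mean (mug g) < +oo)%E.
Hypothesis g0S : sphere R n g0.
Hypothesis mu2 : (\int[mu]_z ((enorm z) ^+ 2)%:E < +oo)%E.
Variables (Q : probability ('rV[R]_n * R)%type R) (lam : probability 'rV[R]_n R).
Hypothesis QP : forall B, Q B = polar_measure mu B.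
Hypothesis lamE : (lam : set _ -> \bar R) = angular_marginal mu.

Let mug_fin g : sphere R n g -> (mean (mug g) < +oo)%E. Proof. by move=> /mug_mean/andP[]. Qed.
Let mug_supp g : sphere R n g -> mug g `[0, +oo[%classic = 1%E. Proof. exact: mugE.1. Qed.

Local Notation ray := (direction g0).
Local Notation mm := (ray_bar mug g0 [::]).
Local Notation mbar := (Ex mu (@enorm R n)).

Lemma polar_disintegration A B : measurable A -> measurable B -> Q (A `*` B) = (\int[lam]_(g in A) mug g B)%E.
Proof. by move=> mA mB; rewrite QP mugE.2// -lamE. Qed.

Lemma angular_sphere : lam (sphere R n) = 1%E.
Proof.
rewrite lamE /angular_marginal -(@probability_setT _ _ _ Q) QP /polar_measure.
by congr (mu _ + _ * mu _)%E; apply/seteqP; split => z [z0 _]; split => //; split => //; exact: angle_sphere.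
Qed.

Let full : {ae Q, forall w, polar_domain w} := ae_polar_domain mug_supp angular_sphere polar_disintegration.

Lemma angular_law B : measurable B -> Q (ray @^-1` B) = lam B.
Proof.
move=> mB; have mr : measurable (ray @^-1` B) by rewrite -[X in measurable X]setTI; exact: measurable_ray.
transitivity (Q (B `*` setT)); last first.
  have := congr1 (fun f : set 'rV[R]_n -> \bar R => f B) lamE; rewrite /= => ->.
  by rewrite QP.
apply: prob_ae_eq => //.
  exact: measurableX.
by apply: filterS full => w [wS _]; rewrite /direction /= /ray to_sphere_id//; split => // -[].
Qed.

(** The part of the polar measure at radius 0 has total mass k/(1-k) times 1 - k, that is k, which
    is the mass of mu at the origin. *)
Lemma polar_law B : measurable B -> Q ((fun w => modulus w *: ray w) @^-1` B) = mu B.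
Proof.
move=> mB; set U := fun w : 'rV[R]_n * R => _.
have m0 := @measurable_set1_rV R n 0.
have nz : [set z : 'rV[R]_n | z != 0] = ~` [set 0].
  by apply/seteqP; split => z /=; [move/eqP|move=> h; apply/eqP].
have mnz : measurable [set z : 'rV[R]_n | z != 0] by rewrite nz; exact: measurableC.
have k1 : fine (mu [set 0]) < 1 by rewrite -lte_fin fineK// fin_num_measure.
set k := fine (mu [set 0]) in k1.
rewrite QP; have -> : polar_measure mu (U @^-1` B) = (mu [set z | z != 0%R /\ (U @^-1` B) (angle z, enorm z)] +
   (k / (1 - k))%:E * mu [set z | z != 0%R /\ (U @^-1` B) (angle z, 0%R)])%E by [].
have E1 : [set z : 'rV[R]_n | z != 0 /\ (U @^-1` B) (angle z, enorm z)] = B `\` [set 0].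
  have E z : z != 0 -> U (angle z, enorm z) = z.
    move=> z0; have zS := angle_sphere z0.
    rewrite /U /modulus mem_set/=; last by split => //=; exact: enorm_ge0.
    by rewrite /direction/= to_sphere_id// enorm_angle.
  apply/seteqP; split => z /=; first by move=> [z0]; rewrite E//; move/eqP : z0.
  by move=> [Bz /eqP z0]; rewrite E.
have E2 : [set z : 'rV[R]_n | z != 0 /\ (U @^-1` B) (angle z, 0)] = if 0 \in B then [set z | z != 0] else set0.
  have E z : U (angle z, 0) = 0.
    by rewrite /U /modulus; case: ifP => _; rewrite scale0r.
  case: ifPn => [/set_mem B0|/negP B0]; apply/seteqP; split => z //=; rewrite E; [by case|by split|].
  by move=> [_ h]; apply: B0; exact: mem_set.
rewrite E1 E2.
have kE : mu [set 0] = k%:E by rewrite fineK// fin_num_measure.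
transitivity (mu (B `\` [set 0%R]) + mu (B `&` [set 0%R]))%E; last by apply/esym; exact: measureDI.
congr (_ + _)%E.
case: ifPn => [/set_mem B0|/negP B0].
  rewrite nz probability_setC// kE setIidr; last by move=> z ->.
  rewrite kE -EFinM; congr (_%:E); field; by rewrite subr_eq0 gt_eqF.
rewrite measure0 mule0 (_ : B `&` [set 0] = set0) ?measure0//.
by apply/seteqP; split => // z [Bz z0]; apply: B0; apply: mem_set; rewrite -z0.
Qed.

Let mU : measurable_fun setT (fun w : 'rV[R]_n * R => modulus w *: ray w).
Proof. by apply: measurable_scale; [exact: (measurable_modulus mug)|exact: measurable_ray]. Qed.

Lemma L1_ge0 d1 (T1 : measurableType d1) (P1 : probability T1 R) (f : T1 -> R) : measurable_fun setT f ->
  (forall w, 0 <= f w) -> (\int[P1]_w (f w)%:E < +oo)%E -> L1 P1 f.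
Proof.
move=> mf f0 h; apply/integrableP; split; first exact/measurable_EFinP.
rewrite (eq_integral (fun w => (f w)%:E))// => w _ /=; by rewrite ger0_norm.
Qed.

Lemma L1_enorm2 : L1 mu (fun z => enorm z ^+ 2).
Proof. by apply: L1_ge0 => [|z|//]; [apply: measurable_funX; exact: measurable_enorm|exact: sqr_ge0]. Qed.

Lemma L1_enorm : L1 mu (@enorm R n).
Proof. apply: L1_sqr; [exact: measurable_enorm|exact: L1_enorm2]. Qed.

Lemma L1_modulus2 : L1 Q (fun w => modulus w ^+ 2).
Proof.
apply: L1_ge0 => [|w|]; [apply: measurable_funX; exact: (measurable_modulus mug)|exact: sqr_ge0|].
have := @law_integral _ _ _ _ _ _ _ Q mu (fun w => modulus w *: ray w) id (fun z => enorm z ^+ 2) mU (@measurable_id _ _ _) polar_law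
  (measurable_funX _ (@measurable_enorm R n)) (fun z => sqr_ge0 _).
move=> E; move: mu2; rewrite -E; congr (_ < _)%E; apply: eq_integral => w _; congr ((_ ^+ 2)%:E).
by rewrite enormZ_sphere//; [exact: modulus_ge0|exact: to_sphere_in].
Qed.

Lemma mbar_gt0 : 0 < mbar.
Proof.
rewrite lt_neqAle eq_sym Ex_ge0 ?andbT; last by move=> z; exact: enorm_ge0.
apply/eqP => e.
have me : measurable_fun setT (fun z : 'rV[R]_n => (enorm z)%:E) by apply/measurable_EFinP; exact: measurable_enorm.
have /(ae_eq_integral_abs mu measurableT me) H : (\int[mu]_z `|(enorm z)%:E| = 0)%E.
  transitivity (\int[mu]_z (enorm z)%:E)%E; last by rewrite Ex_int ?e//; exact: L1_enorm.
  by apply: eq_integral => z _; rewrite /= ger0_norm// enorm_ge0.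
have : mu [set 0] = mu setT.
  apply: prob_ae_eq => //; first exact: measurable_set1_rV.
  apply: filterS H => z /(_ I) [z0]; split => // _ /=; apply/eqP; by rewrite -enorm_eq0 z0.
by move=> h; move: mu0; rewrite h probability_setT ltxx.
Qed.

Lemma mean_ray_bar g : sphere R n g -> mean (mug g) = (mm g)%:E.
Proof.
move=> gS; have gT : mug g setT = 1%E by exact: prob_kernel.
have lo0 : (0 <= (cell (mug g) [::]).1)%E by [].
have cE : cell_set (mug g) [::] = `[0, +oo[%classic.
  apply/seteqP; split => r /=; rewrite /cell_set/= in_itv/= lee_fin andbT; first by case/andP.
  by move=> ->; rewrite ltry.
have m1 : mass (mug g) [::] = 1 by rewrite /mass cE mug_supp.
have := rbar_mass gT (mug_fin gS) [::]; rewrite m1 mulr1 /ray_bar to_sphere_id// => ->.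
by rewrite -momentE// ?cE//; exact: mug_fin.
Qed.

Lemma mm_gt0 g : 0 < mm g.
Proof.
have gS := to_sphere_in g0S g; have := mean_ray_bar gS.
rewrite /ray_bar (to_sphere_id g0 gS) => E; rewrite -lte_fin -E; by have /andP[] := mug_mean gS.
Qed.

Let mmm : measurable_fun setT mm. Proof. exact: (measurable_ray_bar mug g0). Qed.

Section spinning.
Variable kappa : probability 'rV[R]_n R.
Hypothesis kappaS : kappa (sphere R n) = 1%E.
Hypothesis kappaE : let m := (\int[mu]_z (enorm z)%:E)%E in
  forall A, measurable A -> kappa A = (\int[angular_marginal mu]_(g in A) (mean (mug g) / m))%E.

(** The mean of the kernel is known to be [mm] on the sphere only; the complement is null for both
    measures. *)
Lemma spin_density A : measurable A -> kappa A = (\int[lam]_g (\1_A g * (mm g / mbar))%:E)%E.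
Proof.
move=> mA; have mS := @measurable_sphere R n.
have mAS : measurable (A `&` sphere R n) by exact: measurableI.
have mf : measurable_fun setT (fun g => (mm g / mbar)%:E) by apply/measurable_EFinP; exact: measurable_funM.
have f0 g : (0 <= (mm g / mbar)%:E)%E by rewrite lee_fin divr_ge0// ltW// ?mm_gt0 ?mbar_gt0.
have lam0 : lam (~` sphere R n) = 0%E by rewrite probability_setC// angular_sphere subee.
have -> : kappa A = kappa (A `&` sphere R n).
  transitivity (kappa (A `\` sphere R n) + kappa (A `&` sphere R n))%E; first exact: measureDI.
  rewrite (_ : kappa (A `\` _) = 0%E) ?add0e//.
  apply/eqP; rewrite eq_le measure_ge0 andbT.
  have <- : kappa (~` sphere R n) = 0%E by rewrite probability_setC// kappaS subee.
  apply: le_measure; rewrite ?inE//; [exact: measurableD|exact: measurableC].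
rewrite kappaE// -lamE.
transitivity (\int[lam]_(g in A `&` sphere R n) (mm g / mbar)%:E)%E.
  apply: eq_integral => g /set_mem[_ gS]; rewrite mean_ray_bar// Ex_int; last exact: L1_enorm.
  by rewrite inver gt_eqF ?mbar_gt0// -EFinM.
transitivity (\int[lam]_(g in A) (mm g / mbar)%:E)%E.
  have := @ge0_negligible_integral _ _ _ lam A (~` sphere R n) (fun g => (mm g / mbar)%:E) (measurableC mS) mA
    (measurable_funTS mf) (fun g _ => f0 g) lam0.
  by rewrite setDE setCK.
rewrite integral_mkcond; apply: eq_integral => g _; rewrite patchE indicE.
by case: (g \in A); rewrite ?mul1r ?mul0r.
Qed.

Lemma L1_angular_mean : L1 lam mm.
Proof.
have h : L1 lam (fun g => mm g / mbar).
  apply: L1_ge0 => [|g|]; [exact: measurable_funM|by rewrite divr_ge0// ltW// ?mm_gt0 ?mbar_gt0|].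
  have -> : (\int[lam]_g (mm g / mbar)%:E)%E = kappa setT; last by rewrite probability_setT ltry.
  by rewrite spin_density//; apply: eq_integral => g _; rewrite indicE mem_set// mul1r.
by apply: eq_L1 (L1Z mbar h) => g /=; rewrite mulrC divfK// gt_eqF// mbar_gt0.
Qed.

Lemma spin_mean B : measurable B -> fine (kappa B) * mbar = Ex lam (fun x => \1_B x * mm x).
Proof.
move=> mB; have lB := L1_indic mB L1_angular_mean.
rewrite spin_density// (eq_integral (fun g => (mbar^-1 * (\1_B g * mm g))%:E)); last first.
  by move=> g _; congr (_%:E); ring.
rewrite Ex_int; last exact: L1Z.
by rewrite /= ExZ// mulrAC mulVf ?mul1r// gt_eqF// mbar_gt0.
Qed.

(** The mean of m_g under kappa is that of m_g^2 / mbar under [lam], and m_g is the barycenter X_0,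
    whose square is integrable along with r^2. The second moment of mu thus makes the first
    threshold time integrable. *)
Lemma L1_spin_mean : L1 kappa mm.
Proof.
have mr0 g : 0 <= mm g by exact: ltW (mm_gt0 g).
apply: L1_ge0 => //.
have := @weight_ext _ _ _ _ _ _ R kappa lam id id (fun=> 1) (fun g => mm g / mbar) (@measurable_id _ _ _) (@measurable_id _ _ _)
  (@measurable_cst _ _ _ _ _ _) _ (fun=> ler01) _ _ (fun g => (mm g)%:E).
have -> : (\int[kappa]_w (mm w)%:E = \int[kappa]_w ((mm w)%:E * 1%:E))%E.
  by apply: eq_integral => x _; rewrite mule1.
move=> ->; last 5 first.
- exact: measurable_funM.
- by move=> g; rewrite divr_ge0// ltW// mbar_gt0.
- move=> A mA; rewrite -spin_density//.
  transitivity (\int[kappa]_x (\1_A x : R)%:E)%E; last by rewrite integral_indic// setIT.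
  by apply: eq_integral => x _; rewrite mulr1.
- exact/measurable_EFinP.
- by move=> g; rewrite lee_fin.
pose f g := mm g * (mm g / mbar).
have f0 g : 0 <= f g by rewrite mulr_ge0// divr_ge0// ltW// mbar_gt0.
have mf : measurable_fun setT f by apply: measurable_funM => //; exact: measurable_funM.
rewrite (eq_integral (fun g => (f g)%:E)); last by move=> g _; rewrite -EFinM.
have <- := @law_integral _ _ _ _ _ _ _ Q lam ray id f (measurable_ray g0) (@measurable_id _ _ _) angular_law mf f0.
have [l2 _] := L1_chain_sqr g0S mug_fin polar_disintegration L1_modulus2 0.
have l3 := L1Z mbar^-1 l2.
rewrite (ae_eq_integral (fun w => (mbar^-1 * bary_chain mug g0 0 w ^+ 2)%:E))//.
- by rewrite Ex_int// ltry.
- by apply/measurable_EFinP; apply: (measurableT_comp mf); exact: measurable_ray.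
- by apply/measurable_EFinP; exact: L1_meas l3.
apply: filterS full => w wd _; congr (_%:E); rewrite /f /bary_chain mem_set//= /direction/=.
by rewrite /ray_bar (to_sphere_id g0 (to_sphere_in g0S _)); ring.
Qed.

End spinning.
End polar_law.

(** * The embedding *)

Section hitting.
Context {R : realType} {n : nat} (mug : R.-pker 'rV[R]_n ~> R) (g0 : 'rV[R]_n).
Hypothesis g0S : sphere R n g0.
Hypothesis mug_fin : forall g, sphere R n g -> (mean (mug g) < +oo)%E.

Local Notation ray_bar := (ray_bar mug g0).
Local Notation lower := (lower mug g0).
Local Notation upper := (upper mug g0).

Lemma barrierP l z : barrier mug l.+1 z <->
  exists g u, [/\ sphere R n g, size u = l & z = ray_bar u g *: g].
Proof.
have E u g : sphere R n g -> bar (mug g) u = (ray_bar u g)%:E.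
  move=> gS; rewrite /ray_bar to_sphere_id// rbarE//; [exact: prob_kernel|exact: mug_fin].
split; last first.
  move=> [g [u [gS su ->]]]; exists g, (ray_bar u g); split => //; apply/mem_inserted.
  by exists u => //; rewrite E.
move=> [g [r [gS /mem_inserted[u su re] ->]]]; exists g, u; split => //.
by congr (_ *: _); apply: EFin_inj; rewrite re E.
Qed.

Section paths.
Context {d : measure_display} {T : measurableType d} (Z : R -> T -> 'rV[R]_n).

Lemma tau_hit l w t0 : (tau_ mug Z l w <= t0%:E)%E -> barrier mug l.+1 (Z t0 w) ->
  (forall t, (tau_ mug Z l w <= t%:E)%E -> t < t0 -> ~ barrier mug l.+1 (Z t w)) ->
  tau_ mug Z l.+1 w = t0%:E.
Proof.
move=> h1 h2 h3 /=; apply/eqP; rewrite eq_le; apply/andP; split.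
  by apply: ereal_inf_lbound; exists t0.
apply: le_ereal_inf_tmp => _ [t [t1 t2] <-]; rewrite lee_fin leNgt; apply/negP => tt.
exact: h3 t1 tt t2.
Qed.

Lemma tau_ge0 l w : (0 <= tau_ mug Z l w)%E.
Proof.
elim: l => //= l IH; apply: le_ereal_inf_tmp => _ [t [t1 _] <-]; exact: le_trans t1.
Qed.

Lemma tau_nondecreasing w : {homo tau_ mug Z ^~ w : i j / (i <= j)%N >-> (i <= j)%E}.
Proof.
apply: homo_leq => [x|y x z|l] //; first exact: le_trans.
by apply: le_ereal_inf_tmp => _ [t [t1 _] <-].
Qed.

Variables (P : probability T R) (kappa : probability 'rV[R]_n R) (F : R -> set_system T).
Hypothesis sp : spider P kappa F Z.

(** Before b the radius is positive and strictly between two neighbours, so Z stays on the ray of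
    its starting point and a point of the barrier met there would be a barycenter inside the gap. *)
Lemma next_hit w a b u g : sphere R n g -> Z a w = ray_bar u g *: g ->
  Z b w = enorm (Z b w) *: angle (Z a w) ->
  enorm (Z b w) = lower (size u).+1 (Z a w) \/ enorm (Z b w) = upper (size u).+1 (Z a w) ->
  (forall t, a <= t -> t < b -> lower (size u).+1 (Z a w) < enorm (Z t w) < upper (size u).+1 (Z a w)) ->
  barrier mug (size u).+2 (Z b w) /\ forall t, a <= t -> t < b -> ~ barrier mug (size u).+2 (Z t w).
Proof.
move=> gS Za Zb Eb between.
have [v sv Ev] : exists2 v, size v = (size u).+1 & enorm (Z b w) = ray_bar v g.
  have [[v1 s1 e1] [v2 s2 e2]] := neighbours_attained g0S mug_fin u gS.
  by rewrite Za in Eb; case: Eb => ->; [exists v1|exists v2].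
split; last first.
  move=> t at_ tb /barrierP[g' [v' [g'S sv' Zt]]]; have /andP[tl tu] := between t at_ tb.
  have Zne s : a <= s -> s < b -> Z s w != 0.
    move=> as_ sb; have /andP[h _] := between s as_ sb; rewrite -enorm_gt0; apply: le_lt_trans h; exact: lower_ge0.
  have aE : angle (Z t w) = angle (Z a w).
    by apply/esym/(sp_ang_eq sp) => // s /andP[s1 s2]; apply: Zne => //; exact: le_lt_trans tb.
  have ga : angle (Z a w) = g.
    have Za0 := Zne a (lexx _) (le_lt_trans at_ tb); rewrite Za in Za0 *; rewrite angleZ// lt_neqAle ray_bar_ge0// andbT eq_sym.
    by apply: contra Za0 => /eqP ->; rewrite scale0r.
  have rt : enorm (Z t w) = ray_bar v' g' by rewrite Zt enorm_ray_bar.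
  have gg : g' = g.
    rewrite -ga -aE Zt angleZ// -rt; apply: le_lt_trans tl; exact: lower_ge0.
  have := neighbours_gap g0S mug_fin (v := v') (t := enorm (Z t w)) gS sv'.
  by rewrite -Za tl tu => /(_ isT); rewrite rt gg eqxx.
(* At the origin the direction g cannot be read off Z. There the barycenter of [u] is 0, hence so is
   that of its lower half, and the origin belongs to the next barrier. *)
apply/barrierP; have [z0|z0] := eqVneq (Z a w) 0.
  have Zb0 : Z b w = 0 by rewrite Zb z0 angle0 scaler0.
  exists g, (false :: u); split => //; rewrite Zb0.
  have r0 : ray_bar u g = 0 by rewrite -(enorm_ray_bar g0S mug_fin u gS) -Za z0 enorm0.
  have -> : ray_bar (false :: u) g = 0; last by rewrite scale0r.
  by apply/eqP; rewrite eq_le ray_bar_ge0// andbT -r0 ray_bar_false.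
exists g, v; split => //; rewrite -Ev {1}Zb; congr (_ *: _); rewrite Za in z0 *.
rewrite angleZ// lt_neqAle ray_bar_ge0// andbT eq_sym; by apply: contra z0 => /eqP ->; rewrite scale0r.
Qed.

End paths.

Lemma tau_ext d (T : measurableType d) (Z Z' : R -> T -> 'rV[R]_n) w l :
  (forall s, 0 <= s -> Z' s w = Z s w) -> tau_ mug Z' l w = tau_ mug Z l w.
Proof.
move=> ZZ; elim: l => //= l ->; congr ereal_inf; congr image; apply/seteqP.
by split => t [t1 t2]; split => //; [rewrite -ZZ|rewrite ZZ] => //; rewrite -lee_fin; exact: le_trans (tau_ge0 _ _ _) t1.
Qed.

End hitting.

Section embedding.
Context {R : realType} {n : nat} {d : measure_display} {T : measurableType d}.
Variables (mu : probability 'rV[R]_n R) (mug : R.-pker 'rV[R]_n ~> R) (g0 : 'rV[R]_n).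
Hypothesis mu0 : (mu [set 0%R] < 1)%E.
Hypothesis mugE : disintegration mu mug.
Hypothesis mug_mean : forall g, sphere R n g -> (0 < mean (mug g) < +oo)%E.
Hypothesis g0S : sphere R n g0.
Hypothesis mu2 : (\int[mu]_z ((enorm z) ^+ 2)%:E < +oo)%E.
Variables (Q : probability ('rV[R]_n * R)%type R) (lam : probability 'rV[R]_n R).
Hypothesis QP : forall B, Q B = polar_measure mu B.
Hypothesis lamE : (lam : set _ -> \bar R) = angular_marginal mu.
Variable kappa : probability 'rV[R]_n R.
Hypothesis kappaS : kappa (sphere R n) = 1%E.
Hypothesis kappaE : let m := (\int[mu]_z (enorm z)%:E)%E in
  forall A, measurable A -> kappa A = (\int[angular_marginal mu]_(g in A) (mean (mug g) / m))%E.
Variables (P : probability T R) (F : R -> set_system T) (Z : R -> T -> 'rV[R]_n).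
Hypothesis sp : spider P kappa F Z.

Let mug_fin g : sphere R n g -> (mean (mug g) < +oo)%E. Proof. by move=> /mug_mean/andP[]. Qed.
Let mug_supp g : sphere R n g -> mug g `[0, +oo[%classic = 1%E. Proof. exact: mugE.1. Qed.
Let lamS := angular_sphere QP lamE.
Let QE := polar_disintegration mugE QP lamE.
Let rad2 := L1_modulus2 mug mu0 g0S mu2 QP.

Local Notation ray_bar := (ray_bar mug g0).
Local Notation lower := (lower mug g0).
Local Notation upper := (upper mug g0).
Local Notation ray := (direction g0).
Local Notation chain := (bary_chain mug g0).
Local Notation rad t w := (enorm (Z t w)).
Local Notation ang t w := (angle (Z t w)).

Let Y k w := chain k w *: ray w.

Let mY k : measurable_fun setT (Y k).
Proof. by apply: measurable_scale; [exact: measurable_chain|exact: measurable_ray]. Qed.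

Let mZ a : stop F a -> measurable_fun setT (fun w => Z (a w) w).
Proof. exact: (stop_Z_measurable sp). Qed.

Let enormY k w : enorm (Y k w) = chain k w. Proof. exact: enorm_chain. Qed.

(** The induction hypothesis on the time that will be tau_(k+1): the index is shifted by one because
    X_0, the mean on the ray, is the only point of S_1. *)
Definition stage k (a : T -> R) : Prop := [/\ stop F a, L1 P a,
  forall B, measurable B -> P ((fun w => Z (a w) w) @^-1` B) = Q (Y k @^-1` B) &
  {ae P, forall w, barrier mug k.+1 (Z (a w) w)}].

Let v : R := gauss_var.

Lemma stage_rad2 k a : stage k a -> L1 P (fun w => rad (a w) w ^+ 2) /\
  Ex P (fun w => rad (a w) w ^+ 2) = Ex Q (fun w => chain k w ^+ 2).
Proof.
move=> [sa la law _]; have msq : measurable_fun setT (fun z : 'rV[R]_n => enorm z ^+ 2).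
  by apply: measurable_funX; exact: measurable_enorm.
have E := @law_integral _ _ _ _ _ _ _ P Q (fun w => Z (a w) w) (Y k) (fun z => enorm z ^+ 2) (mZ sa) (mY k) law msq (fun z => sqr_ge0 _).
have [l2 _] := L1_chain_sqr g0S mug_fin QE rad2 k.
have E2 : (\int[Q]_w (enorm (Y k w) ^+ 2)%:E = \int[Q]_w (chain k w ^+ 2)%:E)%E.
  by apply: eq_integral => w _; rewrite enormY.
split.
  apply: L1_ge0 => [|w|]; [exact: (measurableT_comp msq (mZ sa))|exact: sqr_ge0|].
  by rewrite E E2 Ex_int// ltry.
by rewrite /Ex /Rintegral E E2.
Qed.

Lemma first_stage : exists2 a, stage 0 a & {ae P, forall w, tau_ mug Z 1 w = (a w)%:E}.
Proof.
have [a [sa la ae lawA]] := first_time sp (mm_gt0 mugE mug_mean g0S) (measurable_ray_bar mug g0 [::])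
  (L1_spin_mean mu0 mugE mug_mean g0S mu2 QP lamE kappaS kappaE)
  (L1_angular_mean mu0 mugE mug_mean g0S mu2 QP lamE kappaS kappaE) (mbar_gt0 mu0 mu2)
  (spin_mean mu0 mugE mug_mean g0S mu2 QP lamE kappaS kappaE).
have a0 w : 0 <= a w by have [] := sa.
have ma : measurable_fun setT (fun w => ang (a w) w).
  by apply: (measurableT_comp (@measurable_angle R n)); exact: mZ.
have aeS : {ae P, forall w, sphere R n (ang (a w) w)}.
  have mS : measurable [set w | sphere R n (ang (a w) w)].
    by rewrite -[X in measurable X]setTI; apply: ma => //; exact: measurable_sphere.
  apply: (ae_of_null mS); rewrite probability_setC// (lawA _ (@measurable_sphere R n)) lamS subee//.
have hit : {ae P, forall w, barrier mug 1 (Z (a w) w) /\ forall t, 0 <= t -> t < a w -> ~ barrier mug 1 (Z t w)}.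
  apply: filterS2 ae aeS => w [r1 r2] wS; split.
    apply/(barrierP g0 mug_fin); exists (ang (a w) w), [::]; split => //.
    by rewrite -r1 enorm_angle.
  move=> t t0 ta /(barrierP g0 mug_fin)[g [u [gS /size0nil -> Zt]]]; have := r2 t t0 ta.
  rewrite Zt enorm_ray_bar// angleZ ?eqxx//; exact: (mm_gt0 mugE mug_mean g0S).
exists a; last first.
  by apply: filterS hit => w [h1 h2]; apply: tau_hit => //=; rewrite lee_fin.
split => //; last by apply: filterS hit => w [].
move=> B mB; pose G g := ray_bar [::] g *: g.
have mG : measurable_fun setT G by apply: measurable_scale; [exact: measurable_ray_bar|exact: measurable_id].
have mGB : measurable (G @^-1` B) by rewrite -[X in measurable X]setTI; exact: mG.
transitivity (P [set w | (G @^-1` B) (ang (a w) w)]).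
  apply: prob_ae_eq.
  - by rewrite -[X in measurable X]setTI; exact: mZ.
  - by rewrite -[X in measurable X]setTI; exact: ma.
  by apply: filterS ae => w [r1 _]; rewrite /= /G -r1 enorm_angle.
rewrite lawA// -(angular_law g0 mugE QP lamE mGB).
apply: prob_ae_eq.
- by rewrite -[X in measurable X]setTI; apply: measurable_ray.
- by rewrite -[X in measurable X]setTI; exact: mY.
apply: filterS (ae_polar_domain mug_supp lamS QE) => w wd.
by rewrite /= /G /Y /chain mem_set// /ray_bar (to_sphere_id g0 (to_sphere_in g0S _)).
Qed.

(** The last clause says that v E a_k - E X_k^2 does not increase with k. As E X_k^2 is at most E
    r^2, the expectations of all the times are bounded together. *)
Lemma next_stage k a : stage k a -> {ae P, forall w, tau_ mug Z k.+1 w = (a w)%:E} ->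
  exists b, [/\ stage k.+1 b, forall w, a w <= b w,
    {ae P, forall w, tau_ mug Z k.+2 w = (b w)%:E} &
    v * Ex P b - Ex Q (fun w => chain k.+1 w ^+ 2) <= v * Ex P a - Ex Q (fun w => chain k w ^+ 2)].
Proof.
move=> st ta; have [sa la law bar_a] := st; have [l2 e2] := stage_rad2 st.
have [b [sb ab ae mart last_b]] := exit_stage sp sa la l2
  (measurable_upper mug g0 k.+1) (upper_ge g0S mug_fin k.+1) (measurable_lower mug g0 k.+1) (lower_ge0 mug g0 k.+1) (lower_le mug g0 k.+1).
have lV : L1 P (fun w => rad (b w) w).
  have [l _] := mart setT measurableT; apply: eq_L1 l => w; by rewrite indicE mem_set// mul1r.
have lU : L1 P (fun w => rad (a w) w).
  apply: L1_sqr l2; apply: (measurableT_comp (@measurable_enorm R n)); exact: mZ.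
have lawb B : measurable B -> P ((fun w => Z (b w) w) @^-1` B) = Q (Y k.+1 @^-1` B).
  move=> mB; have mPB : measurable ((fun w => Z (b w) w) @^-1` B) by rewrite -[X in measurable X]setTI; exact: mZ.
  have mQB : measurable (Y k.+1 @^-1` B) by rewrite -[X in measurable X]setTI; exact: mY.
  rewrite -[LHS]fineK ?fin_num_measure// -[RHS]fineK ?fin_num_measure//; congr (_%:E).
  have E1 := two_pointE (measurable_lower mug g0 k.+1) (measurable_upper mug g0 k.+1)
     (lower_ge0 mug g0 k.+1) (lower_le mug g0 k.+1) (upper_ge g0S mug_fin k.+1) (mZ sa) (mZ sb) lU lV.
  rewrite E1; last 3 first.
  - by apply: filterS ae => w [h1 h2 _].
  - by move=> D mD; have [] := mart D mD.
  - exact: mB.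
  have lc j : L1 Q (fun w => enorm (Y j w)).
    apply: eq_L1 (L1_chain g0S mug_fin QE rad2 j) => w; by rewrite enormY.
  have E2 := two_pointE (measurable_lower mug g0 k.+1) (measurable_upper mug g0 k.+1)
     (lower_ge0 mug g0 k.+1) (lower_le mug g0 k.+1) (upper_ge g0S mug_fin k.+1) (mY k) (mY k.+1) (lc k) (lc k.+1).
  rewrite E2; last 3 first.
  - by apply: filterS (chain_choice g0S mug_fin QE k) => w [h1 h2]; rewrite enormY.
  - move=> D mD; pose h u g : R := \1_D (ray_bar u g *: to_sphere g0 g).
    have mh u : measurable_fun setT (h u).
      apply: (measurableT_comp (measurable_indic mD)); apply: measurable_scale; first exact: measurable_ray_bar.
      exact: measurable_to_sphere.
    have h01 u g : 0 <= h u g <= 1 by rewrite /h indicE; case: (_ \in _); rewrite /= ?lexx ler01.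
    have [_ E] := chain_mart_next g0S mug_fin QE rad2 k mh h01.
    have H w j : \1_D (Y k w) * enorm (Y j w) = h (address mug k w) w.1 * chain j w.
      rewrite enormY /h /Y; have [wd|wd] := pselect (polar_domain w).
        by congr (\1_D (_ *: _) * _); rewrite /bary_chain mem_set.
      by rewrite [chain j w]/bary_chain memNset// !mulr0.
    by rewrite (eq_Ex Q (fun w => H w k.+1)) (eq_Ex Q (fun w => H w k)).
  - exact: mB.
  apply: eq_law_Ex => //; [exact: mZ|apply: measurable_two_point => //; [exact: measurable_lower|exact: measurable_upper]|].
  move=> z; by have /andP[] := two_point01 (lower_le mug g0 k.+1) (upper_ge g0S mug_fin k.+1) B z.
have hit : {ae P, forall w, barrier mug k.+2 (Z (b w) w) /\ forall t, a w <= t -> t < b w -> ~ barrier mug k.+2 (Z t w)}.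
  apply: filterS2 bar_a ae => w /(barrierP g0 mug_fin)[g [u [gS su Za]]] [h1 h2 h3].
  have := @next_hit _ _ _ _ g0S mug_fin _ _ _ _ _ _ sp w (a w) (b w) u g gS Za h2.
  by rewrite su => /(_ h1 h3).
have st' : stage k.+1 b.
  split => //; last by apply: filterS hit => w [].
  (* Integrability of b rests on that of |Z_b|^2, which is read off the law just found, that of
     X_(k+1). *)
  apply: (last_b _).1.
  have msq : measurable_fun setT (fun z : 'rV[R]_n => enorm z ^+ 2).
    by apply: measurable_funX; exact: measurable_enorm.
  have E := @law_integral _ _ _ _ _ _ _ P Q (fun w => Z (b w) w) (Y k.+1) (fun z => enorm z ^+ 2) (mZ sb) (mY k.+1) lawb msq (fun z => sqr_ge0 _).
  have [l3 _] := L1_chain_sqr g0S mug_fin QE rad2 k.+1.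
  apply: L1_ge0 => [|w|]; [exact: (measurableT_comp msq (mZ sb))|exact: sqr_ge0|].
  have E2 : (\int[Q]_w (enorm (Y k.+1 w) ^+ 2)%:E = \int[Q]_w (chain k.+1 w ^+ 2)%:E)%E.
    by apply: eq_integral => w _; rewrite enormY.
  by rewrite E E2 Ex_int// ltry.
exists b; split => //.
  apply: filterS2 ta hit => w tw [h1 h2]; apply: tau_hit => //; first by rewrite tw lee_fin.
  by move=> t; rewrite tw lee_fin; exact: h2.
have [l3 e3] := stage_rad2 st'; have [_ h] := last_b l3; rewrite e2 e3 -/v in h; lra.
Qed.

Lemma stages : exists a : nat -> T -> R, [/\ forall k, stage k (a k), forall k w, a k w <= a k.+1 w,
  {ae P, forall w, forall k, tau_ mug Z k.+1 w = (a k w)%:E} &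
  exists C, forall k, Ex P (a k) <= C].
Proof.
have [a0 st0 ta0] := first_stage.
pose good k a := stage k a /\ {ae P, forall w, tau_ mug Z k.+1 w = (a w)%:E}.
(* Dependent choice: the step function is made total by returning its argument when the stage is not
   good, and is then iterated. *)
have /choice[f fP] : forall x : nat * (T -> R), exists b, good x.1 x.2 ->
   [/\ good x.1.+1 b, forall w, x.2 w <= b w &
    v * Ex P b - Ex Q (fun w => chain x.1.+1 w ^+ 2) <= v * Ex P x.2 - Ex Q (fun w => chain x.1 w ^+ 2)].
  move=> [k a]; have [[st ta]|ng] := pselect (good k a); last by exists a.
  by have [b [h1 h2 h3 h4]] := next_stage st ta; exists b.
pose a := fix a k := if k is k'.+1 then f (k', a k') else a0.
have ga k : good k (a k) by elim: k => [|k IH] //=; have [] := fP (k, a k) IH.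
have step k := fP (k, a k) (ga k).
have e0 : 0 < v := gauss_var_gt0.
exists a; split.
- by move=> k; have [] := ga k.
- by move=> k w; have [_ h _] := step k; exact: h.
- by apply: ae_foralln => k; have [] := ga k.
exists (v^-1 * (v * Ex P a0 + Ex Q (fun w => modulus w ^+ 2))) => k.
have H : v * Ex P (a k) - Ex Q (fun w => chain k w ^+ 2) <= v * Ex P a0.
  elim: k => [|k IH].
    by rewrite gerBl; apply: Ex_ge0 => w; exact: sqr_ge0.
  by have [_ _ h] := step k; exact: le_trans h IH.
rewrite ler_pdivlMl//; have [_ h] := L1_chain_sqr g0S mug_fin QE rad2 k; lra.
Qed.

End embedding.

(* The monotonicity of the integral in the library is for measurable functions;
   [tau] is measurable only up to a null set. *)
Lemma le_integral_ae {R : realType} {d} {T : measurableType d} (P : probability T R) (f g : T -> \bar R) :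
  (forall w, 0 <= f w)%E -> measurable_fun setT g -> (forall w, 0 <= g w)%E ->
  {ae P, forall w, f w = g w} -> (\int[P]_w f w <= \int[P]_w g w)%E.
Proof.
move=> f0 mg g0 [N [mN PN sN]]; pose h w := if w \in N then +oo%E else g w.
have h0 w : (0 <= h w)%E by rewrite /h; case: ifP.
have fh w : (f w <= h w)%E.
  rewrite /h; case: ifPn => [_|/negP wN]; first exact: leey.
  suff -> : f w = g w by [].
  by apply: contrapT => fg; apply: wN; apply: mem_set; exact: sN.
have mh : measurable_fun setT h.
  apply: measurable_fun_ifT => //; apply: (@measurable_fun_bool _ _ _ _ true); rewrite setTI.
  by rewrite (_ : _ @^-1` _ = N)//; apply/seteqP; split => w /=; [move/set_mem|move/mem_set].
have <- : (\int[P]_w h w = \int[P]_w g w)%E.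
  apply: ae_eq_integral => //; exists N; split => // w /= hw; apply: contrapT => wN.
  by apply: hw => _; rewrite /h memNset.
rewrite !ge0_integralTE//; apply: ereal_sup_le => _ [u /= uf <-]; exists u => //= w.
exact: le_trans (uf w) (fh w).
Qed.

(** * Passage to the limit in the stages *)

Section limit.
Context {R : realType} {n : nat} {d : measure_display} {T : measurableType d}.
Variables (mu : probability 'rV[R]_n R) (mug : R.-pker 'rV[R]_n ~> R) (g0 : 'rV[R]_n).
Hypothesis mu0 : (mu [set 0%R] < 1)%E.
Hypothesis mugE : disintegration mu mug.
Hypothesis mug_mean : forall g, sphere R n g -> (0 < mean (mug g) < +oo)%E.
Hypothesis g0S : sphere R n g0.
Hypothesis mu2 : (\int[mu]_z ((enorm z) ^+ 2)%:E < +oo)%E.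
Variables (Q : probability ('rV[R]_n * R)%type R) (lam : probability 'rV[R]_n R).
Hypothesis QP : forall B, Q B = polar_measure mu B.
Hypothesis lamE : (lam : set _ -> \bar R) = angular_marginal mu.
Variable kappa : probability 'rV[R]_n R.
Hypothesis kappaS : kappa (sphere R n) = 1%E.
Hypothesis kappaE : let m := (\int[mu]_z (enorm z)%:E)%E in
  forall A, measurable A -> kappa A = (\int[angular_marginal mu]_(g in A) (mean (mug g) / m))%E.
Variables (P : probability T R) (F : R -> set_system T) (Z : R -> T -> 'rV[R]_n).
Hypothesis sp : spider P kappa F Z.

Let mug_fin g : sphere R n g -> (mean (mug g) < +oo)%E. Proof. by move=> /mug_mean/andP[]. Qed.
Let QE := polar_disintegration mugE QP lamE.
Let rad2 := L1_modulus2 mug mu0 g0S mu2 QP.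

Variable a : nat -> T -> R.
Hypothesis st : forall k, stage mug g0 Q P F Z k (a k).
Hypothesis inc : forall k w, a k w <= a k.+1 w.
Hypothesis ta : {ae P, forall w, forall k, tau_ mug Z k.+1 w = (a k w)%:E}.
Variable C : R.
Hypothesis aC : forall k, Ex P (a k) <= C.

Let sa k : stop F (a k). Proof. by have [] := st k. Qed.
Let a0 k w : 0 <= a k w. Proof. by have [] := sa k. Qed.
Let ma k : measurable_fun setT (a k). Proof. exact: (stop_measurable (sp_sigma sp) (sp_meas sp) (sa k)). Qed.

Let X w : \bar R := limn (fun k => (a k w)%:E).

Let mono w : {homo (fun k => (a k w)%:E) : i j / (i <= j)%N >-> (i <= j)%E}.
Proof.
have h : nondecreasing_seq (a ^~ w) by apply/nondecreasing_seqP => k; exact: inc.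
by move=> i j ij; rewrite lee_fin; exact: h.
Qed.

Let X_cvg w : (fun k => (a k w)%:E) @ \oo --> X w.
Proof. by apply: ereal_nondecreasing_is_cvgn; exact: mono. Qed.

Let mX : measurable_fun setT X.
Proof. by apply: (emeasurable_fun_cvg (fun k w => (a k w)%:E)) => [k|w _]; [apply/measurable_EFinP|exact: X_cvg]. Qed.

Let aX k w : ((a k w)%:E <= X w)%E.
Proof.
rewrite /X (cvg_lim _ (ereal_nondecreasing_cvgn (mono w)))//.
by apply: ereal_sup_ubound; exists k.
Qed.

Let X0 w : (0 <= X w)%E. Proof. by apply: le_trans (aX 0 w); rewrite lee_fin. Qed.

Lemma limit_time_integral : (\int[P]_w X w <= C%:E)%E.
Proof.
rewrite monotone_convergence//; last 2 first.
- by move=> k; apply/measurable_EFinP.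
- by move=> k w _; rewrite lee_fin.
apply: lime_le.
  apply: ereal_nondecreasing_is_cvgn => i j ij; apply: ge0_le_integral => //.
  - by move=> w _; rewrite lee_fin.
  - exact/measurable_EFinP.
  - exact/measurable_EFinP.
  - by move=> w _; exact: mono.
apply: nearW => k; have [_ la _ _] := st k; by rewrite Ex_int// lee_fin.
Qed.

Let G := [set w | (X w < +oo)%E].

Let mG : measurable G.
Proof. by have := emeasurable_fun_infty_o measurableT mX +oo%E; rewrite setTI. Qed.

Let aeG : {ae P, forall w, G w}.
Proof.
have iX : P.-integrable setT X.
  apply/integrableP; split => //; apply: le_lt_trans (ltry C); rewrite (eq_integral X).
    exact: limit_time_integral.
  by move=> w _; rewrite gee0_abs.
apply: filterS (integrable_ae measurableT iX) => w /(_ I) h; by rewrite /G/= -ge0_fin_numE.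
Qed.

Let S w : R := fine (X w).

Let S_cvg w : G w -> (fun k => a k w) @ \oo --> S w.
Proof.
move=> Gw; have Xf : X w = (S w)%:E by rewrite fineK// ge0_fin_numE.
have /fine_cvgP[_] : (fun k => (a k w)%:E) @ \oo --> (S w)%:E by rewrite -Xf; exact: X_cvg.
by [].
Qed.

(** The limit is at most s exactly when all the times are. Off [G] the limit is infinite and its
    real part is 0 by default, which adds a null event, known to the filtration. *)
Let S_stop : stop F S.
Proof.
have PG : P (~` G) = 0%E by apply/(negligibleP _ _).1 => //; exact: measurableC.
split=> [w|s]; first exact: fine_ge0.
have fN : F s (~` G) by apply: (sp_null sp) => //; exact: measurableC.
have [s0|s0] := leP 0 s; last first.
  rewrite (_ : [set w | _] = set0); first exact: (filt0 (sp_sigma sp)).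
  by apply/seteqP; split => // w /= h; have := le_lt_trans h s0; rewrite ltNge fine_ge0.
rewrite (_ : [set w | _] = (\bigcap_k [set w | a k w <= s]) `|` ~` G).
  apply: (filtU (sp_sigma sp)) => //; apply: (filt_bigcap (sp_sigma sp)) => k; by have [_] := sa k.
apply/seteqP; split => w.
  move=> /= ws; have [Gw|nG] := pselect (G w); [left|by right].
  move=> k _ /=; apply: le_trans ws; rewrite -lee_fin fineK ?aX// ge0_fin_numE//.
move=> [h|nG] /=; last first.
  have -> : S w = 0; last by [].
  rewrite /S; have : X w = +oo%E; last by move=> ->.
  by apply/eqP; rewrite -leye_eq leNgt; apply/negP.
have Xs : (X w <= s%:E)%E.
  apply: lime_le; first by apply: ereal_nondecreasing_is_cvgn; exact: mono.
  by apply: nearW => k; rewrite lee_fin; exact: h.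
by rewrite -lee_fin fineK// ge0_fin_numE//; apply: le_lt_trans Xs (ltry _).
Qed.

Let V w := Z (S w) w.

Let mV : measurable_fun setT V. Proof. exact: (stop_Z_measurable sp). Qed.

Let V_cvg w : G w -> (fun k => Z (a k w) w) @ \oo --> V w.
Proof.
move=> Gw; apply: (@continuous_cvg _ _ _ _ _ _ (fun t => Z t w)); last exact: S_cvg.
exact: (sp_cont sp).
Qed.

Let Y k w := bary_chain mug g0 k w *: direction g0 w.
Let U w := modulus w *: direction g0 w.

Let mY k : measurable_fun setT (Y k).
Proof. by apply: measurable_scale; [exact: measurable_chain|exact: measurable_ray]. Qed.

Let mU : measurable_fun setT U.
Proof. by apply: measurable_scale; [exact: (measurable_modulus mug)|exact: measurable_ray]. Qed.

Let mb lo hi j : measurable_fun setT (@box_bump R n lo hi j).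
Proof. by apply: continuous_measurable_rV; exact: box_bump_cont. Qed.

Let b0 lo hi j z : 0 <= @box_bump R n lo hi j z. Proof. by have /andP[] := box_bump01 lo hi j z. Qed.
Let b1 lo hi j z : `|@box_bump R n lo hi j z| <= 1.
Proof. by have /andP[h1 h2] := box_bump01 lo hi j z; rewrite ger0_norm. Qed.

(** The expectations of a bump at Z_(a_k) and at X_k g agree for every k. As k grows, the former
    converge by continuity of the paths, the latter by [box_bump_lip] and the convergence of X_k in
    L^1, and the limit law is mu by [polar_law]. *)
Lemma limit_bump lo hi j : Ex P (fun w => \1_G w * box_bump lo hi j (V w)) = Ex mu (box_bump lo hi j).
Proof.
pose f k w := \1_G w * box_bump lo hi j (Z (a k w) w).
have mf k : measurable_fun setT (f k).
  apply: measurable_funM; first exact: measurable_indic.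
  by apply: (measurableT_comp (mb lo hi j)); exact: (stop_Z_measurable sp).
have f1 k w : `|f k w| <= 1.
  by rewrite /f normrM mulr_ile1// ?b1// indic_norm_le1.
have fc w : f ^~ w @ \oo --> \1_G w * box_bump lo hi j (V w).
  rewrite /f indicE; have [Gw|nG] := pselect (G w).
    rewrite mem_set//; apply: cvgM; first exact: cvg_cst.
    apply: continuous_cvg; [exact: box_bump_cont|exact: V_cvg].
  rewrite memNset// mul0r; under eq_fun do rewrite mul0r; exact: cvg_cst.
have [_ D1] := Ex_dct mf (L1_cst P 1) f1 fc.
have fY k : Ex P (f k) = Ex Q (fun w => box_bump lo hi j (Y k w)).
  have [_ _ law _] := st k.
  rewrite (Ex_full mG aeG); last by apply: (measurableT_comp (mb lo hi j)); exact: (stop_Z_measurable sp).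
  by apply: eq_law_Ex => //; exact: (stop_Z_measurable sp).
have lb (W : 'rV[R]_n * R -> 'rV[R]_n) : measurable_fun setT W -> L1 Q (fun w => box_bump lo hi j (W w)).
  by move=> mW; apply: (@L1_bounded _ _ _ _ _ 1) => //; exact: (measurableT_comp (mb lo hi j)).
have D2 : (fun k => Ex Q (fun w => box_bump lo hi j (Y k w))) @ \oo --> Ex Q (fun w => box_bump lo hi j (U w)).
  have D3 : (fun k => n%:R * (j%:R * Ex Q (fun w => `|modulus w - bary_chain mug g0 k w|))) @ \oo --> (0 : R).
    rewrite -(mulr0 n%:R) -(mulr0 j%:R); apply: cvgM; first exact: cvg_cst.
    apply: cvgM; [exact: cvg_cst|exact: (chain_cvg g0S mug_fin QE rad2)].
  apply/cvgrPdist_le => e e0; move/cvgrPdist_le : D3 => /(_ e e0); apply: filterS => k.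
  rewrite sub0r normrN => h; apply: le_trans (le_trans (ler_norm _) h).
  rewrite -ExB; [|exact: lb|exact: lb]; apply: le_trans (le_norm_Ex (L1B (lb _ mU) (lb _ (mY k)))) _.
  have [le _] := chain_error g0S mug_fin QE rad2 k.
  rewrite -!ExZ//; last exact: L1Z.
  apply: le_Ex; [exact: L1_norm (L1B (lb _ mU) (lb _ (mY k)))|by apply: L1Z; exact: L1Z|].
  by move=> w; apply: box_bump_lip; exact: to_sphere_in.
transitivity (Ex Q (fun w => box_bump lo hi j (U w))).
  apply: (@cvg_unique R (@norm_hausdorff R R) (fmap (Ex P \o f) \oo)) => //.
  rewrite (_ : Ex P \o f = (fun k => Ex Q (fun w => box_bump lo hi j (Y k w))))//.
  by apply/funext => k; rewrite /= fY.
apply: (eq_law_Ex (U2 := id)) => //; exact: (polar_law g0 mu0 QP).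
Qed.

(** Bumps increase the information from continuous functions to boxes by dominated convergence; both
    laws are probabilities that agree on boxes. *)
Lemma limit_law A : measurable A -> P (V @^-1` A) = mu A.
Proof.
have mVA B : measurable B -> measurable (V @^-1` B) by move=> mB; rewrite -[X in measurable X]setTI; exact: mV.
move: A; apply: (@dynkin_rV _ _ (fun A => P (V @^-1` A) = mu A)).
- by rewrite preimage_setT !probability_setT.
- move=> lo hi.
  have mbox : measurable (box lo hi).
    by rewrite measurable_rV_boxE; apply: sub_gen_smallest; exists lo, hi.
  rewrite -[LHS]fineK ?fin_num_measure//; last exact: mVA.
  rewrite -[RHS]fineK ?fin_num_measure//; congr (_%:E).
  rewrite -!Ex_indic//; last exact: mVA.
  rewrite -(Ex_full mG aeG); last by apply: measurable_indic; exact: mVA.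
  have [_ D1] := @Ex_dct _ _ _ P (fun j w => \1_G w * box_bump lo hi j (V w)) (fun w => \1_G w * \1_(V @^-1` box lo hi) w) (cst 1)
    (fun j => measurable_funM (measurable_indic mG) (measurableT_comp (mb lo hi j) mV)) (L1_cst P 1)
    (fun j w => ltac:(by rewrite normrM mulr_ile1// ?b1// indic_norm_le1))
    (fun w => ltac:(apply: cvgM; [exact: cvg_cst|exact: box_bump_cvg])).
  have [_ D2] := @Ex_dct _ _ _ mu (fun j => box_bump lo hi j) (\1_(box lo hi)) (cst 1)
    (mb lo hi) (L1_cst mu 1) (b1 lo hi) (@box_bump_cvg R n lo hi).
  apply: (@cvg_unique R (@norm_hausdorff R R) (fmap (Ex mu \o box_bump lo hi) \oo)) => //.
  rewrite (_ : Ex mu \o _ = (fun j => Ex P (fun w => \1_G w * box_bump lo hi j (V w))))//.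
  by apply/funext => j; rewrite /= limit_bump.
- by move=> B mB h; rewrite preimage_setC !probability_setC ?h//; exact: mVA.
- move=> B mB tB h; rewrite preimage_bigcup !measure_bigcup//.
  + by apply: eq_eseriesr => k _; exact: h.
  + by move=> k _; exact: mVA.
  + by move=> i j _ _ [w [w1 w2]]; apply: tB => //; exists (V w).
Qed.

Lemma limit_tau : {ae P, forall w, tau mug Z w = X w}.
Proof.
apply: filterS ta => w h; rewrite /tau; apply: cvg_lim; first exact: ereal_hausdorff.
rewrite -(cvg_shiftS (fun l => tau_ mug Z l w)).
rewrite (_ : [sequence _]_n = (fun k => (a k w)%:E)); first exact: X_cvg.
by apply/funext => k; exact: h.
Qed.

Lemma tau_pos (Z1 : R -> T -> 'rV[R]_n) w : (0 <= tau mug Z1 w)%E.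
Proof.
apply: lime_ge; first by apply: ereal_nondecreasing_is_cvgn; exact: tau_nondecreasing.
by apply: nearW => l; exact: tau_ge0.
Qed.

Lemma limit_embedding (Z1 : R -> T -> 'rV[R]_n) :
  {ae P, forall w, forall s, 0 <= s -> Z s w = Z1 s w} ->
  [/\ ae_measurable P (tau mug Z1), (\int[P]_w tau mug Z1 w < +oo)%E,
  {ae P, forall w, (tau mug Z1 w < +oo)%E} & ae_has_law P (fun w => Z1 (fine (tau mug Z1 w)) w) mu].
Proof.
move=> ZZ; have tauX : {ae P, forall w, tau mug Z1 w = X w}.
  apply: filterS2 ZZ limit_tau => w h <-; rewrite /tau; congr (limn _); apply/funext => l.
  by apply/esym; exact: tau_ext.
split.
- by exists X.
- apply: le_lt_trans (ltry C); apply: le_trans limit_time_integral; apply: le_integral_ae => //; exact: tau_pos.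
- by apply: filterS2 tauX aeG => w ->.
- exists (mfun_Sub (mem_set mV)); last exact: limit_law.
  by apply: filterS2 ZZ tauX => w h ->; rewrite -h//; exact: fine_ge0.
Qed.

End limit.

Local Open Scope ereal_scope.

Theorem theorem4p1 (R : realType) (n : nat) (hn : (0 < n)%N)
  (mu : probability 'rV[R]_n R) (mu0 : mu [set 0%R] < 1)
  (kappa : probability 'rV[R]_n R) (kappaS : kappa (sphere R n) = 1)
  (mug : R.-pker 'rV[R]_n ~> R) (mugE : disintegration mu mug)
  (mug_mean : forall g, sphere R n g -> 0 < mean (mug g) < +oo)
  (kappaE : let m := \int[mu]_z (enorm z)%:E in
     forall A, measurable A ->
       kappa A = \int[angular_marginal mu]_(g in A) (mean (mug g) / m))
  (mu2 : \int[mu]_z ((enorm z) ^+ 2)%:E < +oo)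
  (d : measure_display) (T : measurableType d) (P : probability T R)
  (Z : R -> T -> 'rV[R]_n) (wbmZ : walsh_brownian_motion P kappa Z)
  (Z0 : {ae P, forall w, Z 0%R w = 0%R}) :
  [/\ ae_measurable P (tau mug Z),
      \int[P]_w tau mug Z w < +oo,
      {ae P, forall w, tau mug Z w < +oo} &
      ae_has_law P (fun w => Z (fine (tau mug Z w)) w) mu].
Proof.
(* The default direction: the sphere has mass 1 under [kappa] and is therefore nonempty. *)
have [g0 g0S] : exists g0, sphere R n g0.
  apply: contrapT => /forallNP h; move: kappaS; rewrite (_ : sphere R n = set0).
    by rewrite measure0 => /eqP; rewrite eq_sym onee_eq0.
  by apply/seteqP; split => // g /h.
have [Q QP] := polar_probability mu0.
have [lam lamE] := angular_probability mu0.
have [F [Z' [sp ZZ]]] := regular_spider kappaS wbmZ Z0.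
have [a [st inc ta [C aC]]] := stages mu0 mugE mug_mean g0S mu2 QP lamE kappaS kappaE sp.
exact: (limit_embedding mu0 mugE mug_mean g0S mu2 QP lamE sp st inc ta aC ZZ).
Qed.
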